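(* Let $T\in AP$. Then $T=0$ if and only if the monodromy matrices $M_1,M_2$ of $\mathcal{L}(T)$ satisfy $M_k=\varepsilon_k I_{2\times 2}$ with $\varepsilon_k\in\{\pm1\}$, $k=1,2$.
   Context: Let $\tau\in\mathbb{C}$ with $\mathrm{Im}\,\tau>0$, $\Lambda_\tau=\mathbb{Z}+\mathbb{Z}\tau$, $E_\tau=\mathbb{C}/\Lambda_\tau$; $\wp(z)=\wp(z;\tau)$ and $\zeta(z)=\zeta(z;\tau)$ are the Weierstrass functions of $\Lambda_\tau$ ($\zeta'=-\wp$, $\zeta$ odd). Put $\omega_0=0,\omega_1=1,\omega_2=\tau,\omega_3=1+\tau$, $\eta_0=0$, and $\eta_i=\zeta(z+\omega_i)-\zeta(z)$ for $i=1,2,3$. For $(\mathbb{T},B)=(T_0,T_1,T_2,T_3,B)\in\mathbb{C}^5$ with $\sum_{k=0}^3T_k=0$, $\mathcal{L}(\mathbb{T},B)$ is the equation $y''(z)=q(z;\mathbb{T},B)y(z)$, $z\in\mathbb{C}$, with $$q(z;\mathbb{T},B)=\tfrac34\sum_{k=0}^3\wp(z-\tfrac{\omega_k}{2})+\sum_{k=0}^3T_k\zeta(z-\tfrac{\omega_k}{2})+B.$$ $AP$ is the set of all such $(\mathbb{T},B)$ that are apparent, i.e. such that all solutions are free of logarithmic singularities at every $\omega_k/2$. One has $AP=V_1\cup V_2\cup V_3$ where, with $\varepsilon^{(\ell)}_0=\varepsilon^{(\ell)}_\ell=1$ and $\varepsilon^{(\ell)}_j=-1$ for $j\in\{1,2,3\}\setminus\{\ell\}$,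 $$V_\ell=\{(\varepsilon_0^{(\ell)}T,\varepsilon_1^{(\ell)}T,\varepsilon_2^{(\ell)}T,\varepsilon_3^{(\ell)}T,\,T^2-\eta_{3-\ell}T)\mid T\in\mathbb{C}\}.$$ Each $V_\ell$ is identified with $\mathbb{C}$ via $T$; an element of $AP$ is denoted by $T$ and the equation by $\mathcal{L}(T)$; $T=0$ means $(\mathbb{T},B)=(0,0,0,0,0)$. Monodromy matrices: fix $z_0\in\mathbb{C}$ such that $z_0+\mathbb{R}$ and $z_0+\tau\mathbb{R}$ contain no singularities of $q$, and let $y_1,y_2$ be linearly independent solutions near $z_0$. Then $M_1,M_2$ are the $2\times2$ matrices with $(y_1,y_2)^t(z+1)=M_1(y_1,y_2)^t(z)$ near $z_0+\mathbb{R}$ and $(y_1,y_2)^t(z+\tau)=M_2(y_1,y_2)^t(z)$ near $z_0+\tau\mathbb{R}$ (analytic continuation along these lines); they are defined up to a common conjugation. *)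

(* Defs.v *)
From Stdlib Require Import Reals ZArith.
From Coquelicot Require Import Coquelicot.
Open Scope C_scope.

(** * Weierstrass functions of the lattice Z + Z tau *)

Definition lattice_point (tau : C) (m n : Z) : C :=
  RtoC (IZR m) + RtoC (IZR n) * tau.

(* Componentwise limit: the limit of [u] in C whenever [u] converges, and a
   junk value otherwise. *)
Definition Clim_seq (u : nat -> C) : C :=
  (real (Lim_seq (fun n => Re (u n))), real (Lim_seq (fun n => Im (u n)))).

Definition sum_sym (N : nat) (f : Z -> C) : C :=
  sum_n (fun k => f (Z.of_nat k - Z.of_nat N)%Z) (2 * N).

(* The sum of [f w] over all nonzero lattice points w, as the limit over the
   squares |m|, |n| <= N. The two series below converge absolutely, so the
   order of summation is immaterial. *)
Definition lattice_sum (tau : C) (f : C -> C) : C :=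
  Clim_seq (fun N =>
    sum_sym N (fun m => sum_sym N (fun n =>
      if (Z.eqb m 0 && Z.eqb n 0)%bool then RtoC 0
      else f (lattice_point tau m n)))).

Definition wp (tau z : C) : C :=
  / (z * z) + lattice_sum tau (fun w => / ((z - w) * (z - w)) - / (w * w)).

Definition wzeta (tau z : C) : C :=
  / z + lattice_sum tau (fun w => / (z - w) + / w + z / (w * w)).

(** * The equation y'' = q y *)

Definition omega (tau : C) (k : nat) : C :=
  match k with
  | 0%nat => RtoC 0
  | 1%nat => RtoC 1
  | 2%nat => tau
  | _ => 1 + tau
  end.

Record params := Params { T0 : C; T1 : C; T2 : C; T3 : C; B : C }.

Definition Tcoef (p : params) (k : nat) : C :=
  match k with
  | 0%nat => T0 p
  | 1%nat => T1 p
  | 2%nat => T2 p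
  | _ => T3 p
  end.

Definition params0 : params :=
  Params (RtoC 0) (RtoC 0) (RtoC 0) (RtoC 0) (RtoC 0).

(* [sum_n a 3] has the four terms k = 0, 1, 2, 3. *)
Definition q (tau : C) (p : params) (z : C) : C :=
  RtoC (3 / 4) * sum_n (fun k => wp tau (z - omega tau k / 2)) 3
  + sum_n (fun k => Tcoef p k * wzeta tau (z - omega tau k / 2)) 3
  + B p.

(* The singularities of [q] are exactly the half-lattice points: at each of
   them q has the polar part (3/4) (z - c)^-2 + T_k (z - c)^-1. *)
Definition singular (tau z : C) : Prop :=
  exists m n : Z, z = lattice_point tau m n / 2.

(* Complex differentiation throughout: [is_derive] is taken over C. *)
Definition solution_on (tau : C) (p : params) (D : C -> Prop) (y : C -> C) :
    Prop :=
  exists dy : C -> C, forall z : C, D z ->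
    is_derive y z (dy z) /\ is_derive dy z (q tau p z * y z).

(** * Apparent equations *)

Definition disc (c : C) (r : R) (z : C) : Prop := (Cmod (z - c) < r)%R.

(* The disc cut along the ray c + (-oo, 0]. *)
Definition slit_disc (c : C) (r : R) (z : C) : Prop :=
  disc c r z /\ ((0 < Re (z - c))%R \/ Im (z - c) <> 0%R).

(* The principal square root, on the complement of (-oo, 0]. *)
Definition Csqrt (z : C) : C :=
  let a := sqrt ((Cmod z + Re z) / 2) in (a, (Im z / (2 * a))%R).

(* The local exponents at a singularity c are the roots -1/2 and 3/2 of
   s (s - 1) = 3/4. They differ by an integer, so by Frobenius every solution
   near c is (z - c)^(-1/2) times h(z) + k(z) log (z - c) with h, k holomorphic
   at c; it is free of a logarithmic singularity when k = 0. As solutions are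
   multivalued around c, they are considered on a slit disc. *)
Definition log_free (tau : C) (p : params) (c : C) : Prop :=
  forall (r : R) (y : C -> C),
    (0 < r)%R ->
    (forall z, disc c r z -> z <> c -> ~ singular tau z) ->
    solution_on tau p (slit_disc c r) y ->
    exists h : C -> C,
      (forall z, disc c r z -> ex_derive h z) /\
      (forall z, slit_disc c r z -> y z = h z / Csqrt (z - c)).

Definition AP (tau : C) (p : params) : Prop :=
  T0 p + T1 p + T2 p + T3 p = 0 /\
  forall k : nat, (k <= 3)%nat -> log_free tau p (omega tau k / 2).

(** * Monodromy *)

Definition line (z0 w : C) (t : R) : C := z0 + RtoC t * w.

Definition regular_base_point (tau z0 : C) : Prop :=
  forall t : R,
    ~ singular tau (line z0 1 t) /\ ~ singular tau (line z0 tau t).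

Definition local_basis (tau : C) (p : params) (z0 : C) (y1 y2 : C -> C) :
    Prop :=
  (exists D : C -> Prop, open D /\ D z0 /\
    solution_on tau p D y1 /\ solution_on tau p D y2) /\
  (forall a b : C,
    locally z0 (fun z => a * y1 z + b * y2 z = 0) -> a = 0 /\ b = 0).

Definition col2 (a b : C) : @matrix C 2 1 :=
  mk_matrix 2 1 (fun i _ => match i with 0%nat => a | _ => b end).

(* [u1], [u2] are the analytic continuations of [y1], [y2] along z0 + w R, and
   (u1, u2)^t (z + w) = M (u1, u2)^t (z) near that line. *)
Definition is_monodromy (tau : C) (p : params) (z0 w : C) (y1 y2 : C -> C)
    (M : @matrix C 2 2) : Prop :=
  exists (D : C -> Prop) (u1 u2 : C -> C),
    open D /\ (forall t : R, D (line z0 w t)) /\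
    solution_on tau p D u1 /\ solution_on tau p D u2 /\
    locally z0 (fun z => u1 z = y1 z /\ u2 z = y2 z) /\
    forall t : R, locally (line z0 w t) (fun z =>
      col2 (u1 (z + w)) (u2 (z + w)) = Mmult M (col2 (u1 z) (u2 z))).

Definition scalar_mat2 (e : C) : @matrix C 2 2 :=
  mk_matrix 2 2 (fun i j => if Nat.eqb i j then e else RtoC 0).

(* Main.v *)
Require Import Defs.
From Stdlib Require Import Reals ZArith Lra Lia ClassicalEpsilon.
From Coquelicot Require Import Coquelicot.
Open Scope C_scope.

(** Why the statement holds.

    Write Q(y) for a quadratic form in a basis of solutions, and S for the set of
    half-lattice points. If both monodromy matrices are scalar with entries +-1, all
    products of two solutions are invariant under the two translations. An apparent
    singularity has exponents -1/2 and 3/2, so a solution is h(x) / sqrt x with h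
    holomorphic, and products of solutions are single-valued around every point of S,
    with at most a simple pole there. Hence each Q(y) is the germ of an elliptic function Y
    ([sym2_globalize], [form_exists]). The equation forces h'(0) = - T_k h(0)
    ([apparent_derivative]), so near omega_k / 2
      Y = g_k / x - 2 T_k g_k + o(1).
    The elliptic functions with simple poles on S are spanned by 1 and
    phi_l = zeta-combinations with residues eps^l_k, l = 1, 2, 3, normalized to have no
    constant term at any half-period; there is no elliptic function with a single simple
    pole ([legendre_weak]). By Liouville's theorem Y = b_1 phi_1 + b_2 phi_2 + b_3 phi_3 + K,
    and comparing constant terms K = - 2 T_k g_k for every k ([form_phi]).

    Now count dimensions. The forms Q make up a space of dimension three and Q is
    determined by Y. If some T_i is nonzero, so is another T_j, as they add up to zero; a
    nonzero Q with g_i = 0 and one more residue equal to zero has K = 0, hence g_j = 0, hence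
    all residues vanish, so Y = 0: a contradiction ([no_two_residues]). Thus all T_k
    vanish, K = 0, and Y is a combination of the phi_l. The latter satisfy the third-order
    equation of products of solutions for B = 0, so B Y' = 0 for all Q, and B = 0
    ([accessory_vanishes]).

    Conversely, for the zero parameters q = (phi_1^2 + phi_2^2 + phi_3^2) / 4, while
    phi_1' = - phi_2 phi_3 and cyclically. These relations make three explicit bilinear
    expressions in u, u', v, v' constant for any two solutions u, v
    ([invariant_Cder]). Their coefficients are elliptic, and as the phi_l^2 differ by nonzero
    constants the three invariants determine uv, uv' + u'v and u'v'
    ([invariants_injective]). So these return to their values after a period, and a matrix
    acting trivially on the symmetric square of C^2 is +-1 ([sym_square_trivial]).

    Extending Q(y) to Y needs no path-lifting. The complement of S is covered by the open
    strips between neighbouring lines of half-lattice points, in both directions. Strips are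
    convex, so a quadratic form in solutions extends uniquely from a cell to the strips
    through it, and the extensions on three cells around a point of S agree with the fourth
    because the local forms are single-valued there ([corner]). *)

(** * The modulus *)

Lemma Cmod_minus_sym (a b : C) : Cmod (a - b) = Cmod (b - a).
Proof. replace (a - b) with (- (b - a)) by ring. apply Cmod_opp. Qed.

Lemma Cmod_triangle_minus (a b : C) : (Cmod (a - b) <= Cmod a + Cmod b)%R.
Proof.
  replace (a - b) with (a + - b) by ring.
  rewrite <- (Cmod_opp b). apply Cmod_triangle.
Qed.

Lemma Cmod_triangle_inv (a b : C) : (Cmod a - Cmod b <= Cmod (a - b))%R.
Proof.
  assert (H := Cmod_triangle (a - b) b).
  replace (a - b + b) with a in H by ring. lra.
Qed.

Lemma Cmod_chain (a b c : C) : (Cmod (a - c) <= Cmod (a - b) + Cmod (b - c))%R.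
Proof.
  replace (a - c) with ((a - b) + (b - c)) by ring. apply Cmod_triangle.
Qed.

Lemma Cmod_scal_R (r : R) (z : C) : (0 <= r)%R -> Cmod (RtoC r * z) = (r * Cmod z)%R.
Proof. intros Hr. rewrite Cmod_mult, Cmod_R, Rabs_pos_eq; auto. Qed.

Lemma Cminus_neq_0 (a b : C) : a <> b -> a - b <> 0.
Proof.
  intros H H0. apply H. replace a with (a - b + b) by ring. rewrite H0. ring.
Qed.

Lemma Cmod_eps_eq (a b : C) :
  (forall eps, (0 < eps)%R -> (Cmod (a - b) <= eps)%R) -> a = b.
Proof.
  intros H. destruct (Req_dec (Cmod (a - b)) 0) as [E|E].
  - apply Cmod_eq_0 in E. replace a with (a - b + b) by ring. rewrite E. ring.
  - assert (P := Cmod_ge_0 (a - b)).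
    specialize (H (Cmod (a - b) / 2)%R). lra.
Qed.

Lemma im_le_Cmod (z : C) : (Rabs (Im z) <= Cmod z)%R.
Proof.
  eapply Rle_trans; [|apply Rmax_Cmod]. apply Rmax_r.
Qed.

Lemma re_le_Cmod' (z : C) : (Re z <= Cmod z)%R.
Proof. eapply Rle_trans; [apply Rle_abs|apply re_le_Cmod]. Qed.

Lemma Cmod_le_re_im (z : C) : (Cmod z <= Rabs (Re z) + Rabs (Im z))%R.
Proof.
  destruct z as [x y]. unfold Re, Im. simpl.
  replace (x, y) with (RtoC x + Ci * RtoC y).
  2:{ unfold RtoC, Ci, Cplus, Cmult; simpl; f_equal; ring. }
  eapply Rle_trans; [apply Cmod_triangle|].
  rewrite Cmod_mult, Cmod_Ci, !Cmod_R. lra.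
Qed.

(** * Derivatives *)

(** The definition of the derivative with explicit moduli, which is how derivatives
    are estimated below. *)
Definition Cder (f : C -> C) (z l : C) : Prop :=
  forall eps, (0 < eps)%R -> exists d, (0 < d)%R /\ forall w,
    (Cmod (w - z) < d)%R ->
    (Cmod (f w - f z - (w - z) * l) <= eps * Cmod (w - z))%R.

Definition ccont (f : C -> C) (z : C) : Prop :=
  forall eps, (0 < eps)%R -> exists d, (0 < d)%R /\ forall w,
    (Cmod (w - z) < d)%R -> (Cmod (f w - f z) < eps)%R.

Lemma locally_C_iff (z : C) (P : C -> Prop) :
  locally z P <-> exists d, (0 < d)%R /\ forall w, (Cmod (w - z) < d)%R -> P w.
Proof.
  split.
  - intros [d Hd]. exists d. split; [apply cond_pos|]. intros w Hw. apply Hd.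
    apply C_NormedModule_mixin_compat1. exact Hw.
  - intros [d [Hd H]].
    assert (H2 : (0 < sqrt 2)%R) by (apply sqrt_lt_R0; lra).
    assert (Hd' : (0 < d / sqrt 2)%R) by (apply Rdiv_lt_0_compat; auto).
    exists (mkposreal _ Hd'). intros w Hw. apply H.
    apply C_NormedModule_mixin_compat2 in Hw. simpl in Hw.
    replace d with (sqrt 2 * (d / sqrt 2))%R by (field; lra). exact Hw.
Qed.

Lemma open_C_iff (D : C -> Prop) :
  open D <-> forall z, D z ->
    exists d, (0 < d)%R /\ forall w, (Cmod (w - z) < d)%R -> D w.
Proof.
  split; intros H z Hz; apply locally_C_iff; auto.
Qed.

(** C as a module over itself and C as a normed space have different but
    equivalent uniform structures; the algebraic rules for derivatives are stated for the
    former. *)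
Lemma Cder_alg_iff (f : C -> C) (z l : C) :
  is_derive (K := C_AbsRing) (V := AbsRing_NormedModule C_AbsRing) f z l <-> Cder f z l.
Proof.
  split.
  - intros [_ H] eps Heps.
    destruct (H z (fun P HP => HP) (mkposreal _ Heps)) as [d Hd].
    exists d. split; [apply cond_pos|]. exact Hd.
  - intros H. split; [apply is_linear_scal_l|].
    intros x Hx.
    assert (E : z = x).
    { apply (is_filter_lim_locally_unique (K := C_AbsRing)
        (V := AbsRing_NormedModule C_AbsRing)). exact Hx. }
    subst x. intros eps. destruct (H eps (cond_pos eps)) as [d [Hd Hw]].
    exists (mkposreal d Hd). exact Hw.
Qed.

Lemma Cder_iff (f : C -> C) (z l : C) : is_derive f z l <-> Cder f z l.
Proof.
  rewrite <- Cder_alg_iff. split; intros [L H]; split; try apply is_linear_scal_l; exact H.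
Qed.

Lemma ccont_iff (f : C -> C) (z : C) :
  @continuous (AbsRing_UniformSpace C_AbsRing) (AbsRing_UniformSpace C_AbsRing) f z <-> ccont f z.
Proof.
  split.
  - intros H eps Heps. destruct (proj1 (filterlim_locally _ _) H (mkposreal eps Heps)) as [d Hd].
    exists d. split; [apply cond_pos|]. exact Hd.
  - intros H. apply filterlim_locally. intros eps.
    destruct (H eps (cond_pos eps)) as [d [Hd Hw]]. exists (mkposreal d Hd). exact Hw.
Qed.

Lemma Cder_locally_ext (f g : C -> C) (z l r : _) :
  (0 < r)%R -> (forall w, (Cmod (w - z) < r)%R -> f w = g w) ->
  Cder f z l -> Cder g z l.
Proof.
  intros Hr E H eps Heps. destruct (H eps Heps) as [d [Hd Hw]].
  exists (Rmin d r). split; [apply Rmin_pos; auto|].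
  intros w Hwd. assert (A := Rmin_l d r). assert (B := Rmin_r d r).
  rewrite <- (E w), <- (E z).
  - apply Hw. lra.
  - replace (z - z) with (RtoC 0) by ring. rewrite Cmod_0. lra.
  - lra.
Qed.

Lemma Cder_ext (f g : C -> C) (z l : C) :
  (forall w, f w = g w) -> Cder f z l -> Cder g z l.
Proof. intros E. apply (Cder_locally_ext f g z l 1); auto. lra. Qed.

Lemma Cder_eq (f : C -> C) (z l l' : C) : Cder f z l -> l = l' -> Cder f z l'.
Proof. intros; subst; auto. Qed.

Lemma Cder_const (a z : C) : Cder (fun _ => a) z 0.
Proof. apply Cder_alg_iff. exact (is_derive_const (K := C_AbsRing) (V := AbsRing_NormedModule C_AbsRing) a z). Qed.

Lemma Cder_id (z : C) : Cder (fun w => w) z 1.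
Proof. apply Cder_alg_iff. exact (is_derive_id z). Qed.

Lemma Cder_ccont (f : C -> C) (z l : C) : Cder f z l -> ccont f z.
Proof. rewrite <- Cder_alg_iff, <- ccont_iff. intros H. apply (ex_derive_continuous (K := C_AbsRing) (V := AbsRing_NormedModule C_AbsRing)). exists l. exact H. Qed.

Lemma Cder_plus (f g : C -> C) (z l m : C) :
  Cder f z l -> Cder g z m -> Cder (fun w => f w + g w) z (l + m).
Proof. rewrite <- !Cder_iff. intros H K. exact (is_derive_plus f g z l m H K). Qed.

Lemma Cder_opp (f : C -> C) (z l : C) :
  Cder f z l -> Cder (fun w => - f w) z (- l).
Proof. rewrite <- !Cder_iff. intros H. exact (is_derive_opp f z l H). Qed.

Lemma Cder_minus (f g : C -> C) (z l m : C) :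
  Cder f z l -> Cder g z m -> Cder (fun w => f w - g w) z (l - m).
Proof. intros H K. apply (Cder_plus f (fun w => - g w)); auto. apply Cder_opp; auto. Qed.

Lemma Cder_mult (f g : C -> C) (z l m : C) :
  Cder f z l -> Cder g z m -> Cder (fun w => f w * g w) z (l * g z + f z * m).
Proof.
  rewrite <- !Cder_alg_iff. intros H K.
  exact (is_derive_mult f g z l m H K Cmult_comm).
Qed.

Lemma Cder_comp (f g : C -> C) (z l m : C) :
  Cder f (g z) l -> Cder g z m -> Cder (fun w => f (g w)) z (m * l).
Proof. rewrite <- !Cder_alg_iff. exact (is_derive_comp (K := C_AbsRing) (V := AbsRing_NormedModule C_AbsRing) f g z l m). Qed.

Lemma Cder_scal (a : C) (f : C -> C) (z l : C) :
  Cder f z l -> Cder (fun w => a * f w) z (a * l).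
Proof.
  intros H. apply (Cder_eq _ _ (0 * f z + a * l)).
  - apply (Cder_mult (fun _ => a)); auto. apply Cder_const.
  - ring.
Qed.

Lemma Cder_shift (f : C -> C) (z c l : C) :
  Cder f (z + c) l -> Cder (fun w => f (w + c)) z l.
Proof.
  intros H. apply (Cder_eq _ _ (1 * l)); [|ring].
  apply (Cder_comp f (fun w => w + c)); auto.
  apply (Cder_eq _ _ (1 + 0)); [|ring].
  apply Cder_plus; [apply Cder_id|apply Cder_const].
Qed.

Lemma ccont_locally_ext (f g : C -> C) (z : C) (r : R) :
  (0 < r)%R -> (forall w, (Cmod (w - z) < r)%R -> f w = g w) ->
  ccont f z -> ccont g z.
Proof.
  intros Hr E H eps Heps. destruct (H eps Heps) as [d [Hd Hw]].
  exists (Rmin d r). split; [apply Rmin_pos; auto|].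
  intros w Hwd. assert (A := Rmin_l d r). assert (B := Rmin_r d r).
  rewrite <- (E w), <- (E z).
  - apply Hw. lra.
  - replace (z - z) with (RtoC 0) by ring. rewrite Cmod_0. lra.
  - lra.
Qed.

Lemma ccont_const (a z : C) : ccont (fun _ => a) z.
Proof. apply (Cder_ccont _ _ _ (Cder_const a z)). Qed.

Lemma ccont_id (z : C) : ccont (fun w => w) z.
Proof. apply (Cder_ccont _ _ _ (Cder_id z)). Qed.

Lemma ccont_plus (f g : C -> C) (z : C) :
  ccont f z -> ccont g z -> ccont (fun w => f w + g w) z.
Proof. rewrite <- !ccont_iff. exact (continuous_plus (U := AbsRing_UniformSpace C_AbsRing) (K := C_AbsRing) (V := AbsRing_NormedModule C_AbsRing) f g z). Qed.

Lemma ccont_mult (f g : C -> C) (z : C) :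
  ccont f z -> ccont g z -> ccont (fun w => f w * g w) z.
Proof. rewrite <- !ccont_iff. exact (continuous_mult (U := AbsRing_UniformSpace C_AbsRing) (K := C_AbsRing) f g z). Qed.

Lemma ccont_opp (f : C -> C) (z : C) : ccont f z -> ccont (fun w => - f w) z.
Proof. rewrite <- !ccont_iff. exact (continuous_opp (U := AbsRing_UniformSpace C_AbsRing) (K := C_AbsRing) (V := AbsRing_NormedModule C_AbsRing) f z). Qed.

Lemma ccont_minus (f g : C -> C) (z : C) :
  ccont f z -> ccont g z -> ccont (fun w => f w - g w) z.
Proof. intros. apply (ccont_plus f (fun w => - g w)); auto. apply ccont_opp; auto. Qed.

Lemma ccont_shift (f : C -> C) (z c : C) :
  ccont f (z + c) -> ccont (fun w => f (w + c)) z.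
Proof.
  intros H eps Heps. destruct (H eps Heps) as [d [Hd Hw]]. exists d. split; auto.
  intros w Hwd. apply Hw. replace (w + c - (z + c)) with (w - z) by ring. auto.
Qed.

Lemma Cder_inv_id (z : C) : z <> 0 -> Cder (fun w => / w) z (- / (z * z)).
Proof.
  intros Hz eps Heps. assert (Pz := proj1 (Cmod_gt_0 z) Hz).
  set (m := Cmod z) in *.
  exists (Rmin (m / 2) (eps * m * m * m / 2)). split.
  { apply Rmin_pos; [lra|]. assert (0 < m * m * m)%R by (apply Rmult_lt_0_compat; nra).
    nra. }
  intros w Hw. assert (A := Rmin_l (m / 2) (eps * m * m * m / 2)).
  assert (B := Rmin_r (m / 2) (eps * m * m * m / 2)).
  assert (Hwm : (m / 2 < Cmod w)%R).
  { assert (T := Cmod_triangle_inv z w). rewrite Cmod_minus_sym in T.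
    fold m in T. lra. }
  assert (Hw0 : w <> 0) by (apply Cmod_gt_0; lra).
  replace (/ w - / z - (w - z) * - / (z * z)) with
    ((w - z) * (w - z) * / (w * (z * z))) by (field; auto).
  assert (Hn : w * (z * z) <> 0) by (apply Cmult_neq_0; [|apply Cmult_neq_0]; auto).
  rewrite Cmod_mult, Cmod_inv by auto. rewrite !Cmod_mult. fold m.
  set (t := Cmod (w - z)) in *. assert (Ht : (0 <= t)%R) by apply Cmod_ge_0.
  set (v := Cmod w) in *.
  assert (P : (0 < v * (m * m))%R) by (apply Rmult_lt_0_compat; nra).
  apply (Rmult_le_reg_r (v * (m * m))); auto.
  rewrite Rmult_assoc, Rinv_l, Rmult_1_r by lra.
  replace (eps * t * (v * (m * m)))%R with (t * (eps * (v * (m * m))))%R by ring.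
  apply Rmult_le_compat_l; auto.
  apply Rle_trans with (eps * m * m * m / 2)%R; [lra|].
  replace (eps * m * m * m / 2)%R with ((eps * m * m) * (m / 2))%R by field.
  replace (eps * (v * (m * m)))%R with ((eps * m * m) * v)%R by ring.
  apply Rmult_le_compat_l; [|lra]. apply Rmult_le_pos; [|lra]. nra.
Qed.

Lemma Cder_inv (f : C -> C) (z l : C) :
  Cder f z l -> f z <> 0 -> Cder (fun w => / f w) z (- (l * / (f z * f z))).
Proof.
  intros H Hz. apply (Cder_eq _ _ (l * - / (f z * f z))); [|ring].
  apply (Cder_comp (fun w => / w) f); auto. apply Cder_inv_id; auto.
Qed.

Lemma ccont_neq_0 (f : C -> C) (z : C) : ccont f z -> f z <> 0 ->
  exists d, (0 < d)%R /\ forall w, (Cmod (w - z) < d)%R -> f w <> 0.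
Proof.
  intros H Hz. apply Cmod_gt_0 in Hz. destruct (H _ Hz) as [d [Hd Hw]].
  exists d. split; auto. intros w Hwd E. specialize (Hw w Hwd).
  rewrite E in Hw. replace (0 - f z) with (- f z) in Hw by ring.
  rewrite Cmod_opp in Hw. lra.
Qed.

Lemma Cder_unique (f : C -> C) (z l m : C) : Cder f z l -> Cder f z m -> l = m.
Proof.
  intros H K. apply Cmod_eps_eq. intros eps Heps.
  destruct (H (eps / 2)%R) as [d [Hd Hw]]; [lra|].
  destruct (K (eps / 2)%R) as [d' [Hd' Hw']]; [lra|].
  set (t := (Rmin d d' / 2)%R).
  assert (Ht : (0 < t)%R) by (unfold t; assert (X := Rmin_pos d d' Hd Hd'); lra).
  assert (B1 := Rmin_l d d'). assert (B2 := Rmin_r d d').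
  assert (Et : Cmod (z + RtoC t - z) = t).
  { replace (z + RtoC t - z) with (RtoC t) by ring. rewrite Cmod_R.
    apply Rabs_pos_eq; lra. }
  specialize (Hw (z + RtoC t)). specialize (Hw' (z + RtoC t)).
  rewrite Et in Hw, Hw'. unfold t in Hw at 1, Hw' at 1.
  specialize (Hw ltac:(unfold t in Ht; lra)).
  specialize (Hw' ltac:(unfold t in Ht; lra)).
  assert (T := Cmod_triangle_minus (f (z + RtoC t) - f z - (z + RtoC t - z) * m)
    (f (z + RtoC t) - f z - (z + RtoC t - z) * l)).
  replace (f (z + RtoC t) - f z - (z + RtoC t - z) * m -
    (f (z + RtoC t) - f z - (z + RtoC t - z) * l)) with (RtoC t * (l - m)) in T by ring.
  rewrite Cmod_scal_R in T by lra.
  apply (Rmult_le_reg_l t); auto. lra.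
Qed.

(** * Complex functions of a real variable *)

(** Componentwise, so that the real mean value theorem and real integrals apply. *)
Definition Rder (g : R -> C) (t : R) (l : C) : Prop :=
  is_derive (fun s => Re (g s)) t (Re l) /\ is_derive (fun s => Im (g s)) t (Im l).

Lemma is_derive_R_eps (f : R -> R) (t l : R) :
  (forall eps, (0 < eps)%R -> exists d, (0 < d)%R /\ forall h, (Rabs h < d)%R ->
     (Rabs (f (t + h)%R - f t - h * l) <= eps * Rabs h)%R) ->
  is_derive f t l.
Proof.
  intros H. apply is_derive_Reals. intros eps Heps.
  destruct (H (eps / 2)%R) as [d [Hd Hw]]; [lra|].
  exists (mkposreal d Hd). intros h Hh Hhd. simpl in Hhd.
  specialize (Hw h Hhd).
  replace ((f (t + h) - f t) / h - l)%R with ((f (t + h) - f t - h * l) / h)%R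
    by (field; auto).
  assert (P := Rabs_pos_lt h Hh).
  unfold Rdiv. rewrite Rabs_mult, Rabs_inv.
  apply (Rmult_lt_reg_r (Rabs h)); auto.
  rewrite Rmult_assoc, Rinv_l by lra. nra.
Qed.

(** A complex derivative restricts to every real line; this reduces complex
    estimates to real ones. *)
Lemma Cder_slice (f : C -> C) (a b l : C) (t : R) :
  Cder f (a + RtoC t * b) l -> Rder (fun s => f (a + RtoC s * b)) t (l * b).
Proof.
  intros H.
  assert (X : forall eps, (0 < eps)%R -> exists d, (0 < d)%R /\ forall h,
    (Rabs h < d)%R -> (Cmod (f (a + RtoC (t + h)%R * b) - f (a + RtoC t * b)
      - RtoC h * (l * b))%C <= eps * Rabs h)%R).
  { intros eps Heps. assert (Pb := Cmod_ge_0 b).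
    destruct (H (eps / (1 + Cmod b))%R) as [d [Hd Hw]].
    { apply Rdiv_lt_0_compat; lra. }
    exists (d / (1 + Cmod b))%R. split; [apply Rdiv_lt_0_compat; lra|].
    intros h Hh. specialize (Hw (a + RtoC (t + h)%R * b)).
    replace (a + RtoC (t + h)%R * b - (a + RtoC t * b)) with (RtoC h * b) in Hw
      by (rewrite RtoC_plus; ring).
    rewrite Cmod_mult, Cmod_R in Hw.
    assert (Q := Rabs_pos h).
    replace (RtoC h * (l * b)) with (RtoC h * b * l) by ring.
    apply (Rmult_lt_compat_r (1 + Cmod b)) in Hh; [|lra].
    replace (d / (1 + Cmod b) * (1 + Cmod b))%R with d in Hh by (field; lra).
    eapply Rle_trans; [apply Hw; nra|].
    apply (Rmult_le_reg_r (1 + Cmod b)); [lra|].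
    replace (eps / (1 + Cmod b) * (Rabs h * Cmod b) * (1 + Cmod b))%R with
      (eps * (Rabs h * Cmod b))%R by (field; lra). nra. }
  split; apply is_derive_R_eps; intros eps Heps;
    destruct (X eps Heps) as [d [Hd Hw]]; exists d; split; auto;
    intros h Hh; eapply Rle_trans; [|apply (Hw h Hh)| |apply (Hw h Hh)].
  - eapply Rle_trans; [|apply re_le_Cmod]. apply Req_le. f_equal.
    unfold Re, Im, RtoC, Cplus, Cminus, Copp, Cmult; simpl. ring.
  - eapply Rle_trans; [|apply im_le_Cmod]. apply Req_le. f_equal.
    unfold Re, Im, RtoC, Cplus, Cminus, Copp, Cmult; simpl. ring.
Qed.

Lemma Rder_minus (f g : R -> C) (t : R) (l m : C) :
  Rder f t l -> Rder g t m -> Rder (fun s => f s - g s) t (l - m).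
Proof.
  intros [A B] [A' B']. split.
  - exact (is_derive_minus _ _ _ _ _ A A').
  - exact (is_derive_minus _ _ _ _ _ B B').
Qed.

Lemma Rder_lin (a b : C) (t : R) : Rder (fun s => a + RtoC s * b) t b.
Proof.
  assert (H := Cder_slice (fun z => z) a b 1 t (Cder_id _)).
  rewrite Cmult_1_l in H. exact H.
Qed.

Lemma MVT_le (h h' : R -> R) (a b : R) : (a <= b)%R ->
  (forall t, (a <= t <= b)%R -> is_derive h t (h' t)) ->
  (forall t, (a <= t <= b)%R -> (h' t <= 0)%R) -> (h b <= h a)%R.
Proof.
  intros Hab H Hn.
  destruct (MVT_gen h a b h') as [c [Hc E]].
  - intros x Hx. rewrite Rmin_left, Rmax_right in Hx by lra. apply H. lra.
  - intros x Hx. rewrite Rmin_left, Rmax_right in Hx by lra.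
    apply derivable_continuous_pt. exists (h' x). apply is_derive_Reals. apply H. lra.
  - rewrite Rmin_left, Rmax_right in Hc by lra.
    specialize (Hn c Hc). nra.
Qed.

(** The primitive of a complex function moves no faster than the primitive of a
   bound of its modulus: project on the direction of the displacement. *)
Lemma Rder_compare (g g' : R -> C) (b b' : R -> R) (t0 t1 : R) : (t0 <= t1)%R ->
  (forall t, (t0 <= t <= t1)%R -> Rder g t (g' t)) ->
  (forall t, (t0 <= t <= t1)%R -> is_derive b t (b' t)) ->
  (forall t, (t0 <= t <= t1)%R -> (Cmod (g' t) <= b' t)%R) ->
  (Cmod (g t1 - g t0) <= b t1 - b t0)%R.
Proof.
  intros Ht Hg Hb Hle.
  set (u := g t1 - g t0).
  assert (Hb0 : (- b t1 <= - b t0)%R).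
  { apply (MVT_le (fun t => - b t)%R (fun t => - b' t)%R); auto.
    - intros t Hi. exact (is_derive_opp b t _ (Hb t Hi)).
    - intros t Hi. specialize (Hle t Hi). assert (P := Cmod_ge_0 (g' t)). lra. }
  destruct (Req_dec (Cmod u) 0) as [E|E]; [lra|].
  assert (P : (0 < Cmod u)%R) by (assert (X := Cmod_ge_0 u); lra).
  set (h := fun t => (Re u * Re (g t) + Im u * Im (g t) - Cmod u * b t)%R).
  assert (Hd : forall t, (t0 <= t <= t1)%R ->
    is_derive h t (Re u * Re (g' t) + Im u * Im (g' t) - Cmod u * b' t)%R).
  { intros t Hi. destruct (Hg t Hi) as [A B]. specialize (Hb t Hi).
    unfold h. apply (is_derive_minus (fun t => Re u * Re (g t) + Im u * Im (g t))%R
      (fun t => Cmod u * b t)%R).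
    - apply (is_derive_plus (fun t => Re u * Re (g t))%R (fun t => Im u * Im (g t))%R).
      + exact (is_derive_scal _ t (Re u) _ A).
      + exact (is_derive_scal _ t (Im u) _ B).
    - exact (is_derive_scal _ t (Cmod u) _ Hb). }
  assert (Hm : (h t1 <= h t0)%R).
  { apply (MVT_le h _ t0 t1 Ht Hd). intros t Hi. specialize (Hle t Hi).
    assert (Q : (Re u * Re (g' t) + Im u * Im (g' t) <= Cmod u * Cmod (g' t))%R).
    { eapply Rle_trans; [|rewrite <- (Cmod_conj u), <- Cmod_mult; apply re_le_Cmod'].
      apply Req_le. unfold Re, Im, Cconj, Cmult; simpl. ring. }
    assert (X : (Cmod u * Cmod (g' t) <= Cmod u * b' t)%R)
      by (apply Rmult_le_compat_l; lra). lra. }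
  unfold h in Hm.
  assert (S : (Cmod u * Cmod u = Re u * (Re (g t1) - Re (g t0)) +
     Im u * (Im (g t1) - Im (g t0)))%R).
  { assert (S := Cmod2_alt u). simpl in S. rewrite !Rmult_1_r in S. rewrite S.
    unfold u, Re, Im, Cminus, Cplus, Copp; simpl. ring. }
  apply (Rmult_le_reg_l (Cmod u)); auto. lra.
Qed.

Definition seg (a b : C) (t : R) : C := a + RtoC t * (b - a).

Lemma seg_0 (a b : C) : seg a b 0 = a.
Proof. unfold seg. ring. Qed.

Lemma seg_1 (a b : C) : seg a b 1 = b.
Proof. unfold seg. ring. Qed.

(** The mean value inequality, from [Rder_compare] along the segment. *)
Lemma Cder_mvi (f f' : C -> C) (a b : C) (K : R) :
  (forall t, (0 <= t <= 1)%R ->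
     Cder f (seg a b t) (f' (seg a b t)) /\ (Cmod (f' (seg a b t)) <= K)%R) ->
  (Cmod (f b - f a) <= K * Cmod (b - a))%R.
Proof.
  intros H.
  assert (X := Rder_compare (fun t => f (seg a b t))
    (fun t => f' (seg a b t) * (b - a)) (fun t => K * Cmod (b - a) * t)%R
    (fun t => K * Cmod (b - a))%R 0 1 ltac:(lra)).
  cbv beta in X. rewrite seg_0, seg_1 in X.
  assert (Y : (Cmod (f b - f a) <= K * Cmod (b - a) * 1 - K * Cmod (b - a) * 0)%R); [|lra].
  apply X.
  - intros t Ht. apply Cder_slice. apply H; auto.
  - intros t Ht. auto_derive; auto. ring.
  - intros t Ht. rewrite Cmod_mult. apply Rmult_le_compat_r; [apply Cmod_ge_0|].
    apply H; auto.
Qed.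

Lemma Cder_zero_const (f : C -> C) (a b : C) :
  (forall t, (0 <= t <= 1)%R -> Cder f (seg a b t) 0) -> f b = f a.
Proof.
  intros H. apply Cmod_eps_eq. intros eps Heps.
  assert (X := Cder_mvi f (fun _ => 0) a b 0).
  assert (Y : (Cmod (f b - f a) <= 0 * Cmod (b - a))%R).
  { apply X. intros t Ht. rewrite Cmod_0. split; [auto|lra]. }
  lra.
Qed.

(** * Limits of sequences and termwise differentiation *)

Definition Climit (u : nat -> C) (l : C) : Prop :=
  forall eps, (0 < eps)%R -> exists N, forall n, (N <= n)%nat ->
    (Cmod (u n - l) < eps)%R.

Lemma Climit_Clim_seq (u : nat -> C) (l : C) : Climit u l -> Clim_seq u = l.
Proof.
  intros H.
  assert (A : is_lim_seq (fun n => Re (u n)) (Re l)).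
  { apply is_lim_seq_spec. intros eps. destruct (H eps (cond_pos eps)) as [N HN].
    exists N. intros n Hn. eapply Rle_lt_trans; [|apply (HN n Hn)].
    eapply Rle_trans; [|apply re_le_Cmod]. apply Req_le. f_equal. }
  assert (B : is_lim_seq (fun n => Im (u n)) (Im l)).
  { apply is_lim_seq_spec. intros eps. destruct (H eps (cond_pos eps)) as [N HN].
    exists N. intros n Hn. eapply Rle_lt_trans; [|apply (HN n Hn)].
    eapply Rle_trans; [|apply im_le_Cmod]. apply Req_le. f_equal. }
  unfold Clim_seq. rewrite (is_lim_seq_unique _ _ A), (is_lim_seq_unique _ _ B).
  destruct l; reflexivity.
Qed.

Lemma Climit_cauchy (u : nat -> C) :
  (forall eps, (0 < eps)%R -> exists N, forall n m, (N <= n)%nat -> (N <= m)%nat ->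
    (Cmod (u n - u m) < eps)%R) -> exists l, Climit u l.
Proof.
  intros H.
  assert (A : ex_finite_lim_seq (fun n => Re (u n))).
  { apply ex_lim_seq_cauchy_corr. intros eps. destruct (H eps (cond_pos eps)) as [N HN].
    exists N. intros n m Hn Hm. eapply Rle_lt_trans; [|apply (HN n m Hn Hm)].
    eapply Rle_trans; [|apply re_le_Cmod]. apply Req_le. f_equal. }
  assert (B : ex_finite_lim_seq (fun n => Im (u n))).
  { apply ex_lim_seq_cauchy_corr. intros eps. destruct (H eps (cond_pos eps)) as [N HN].
    exists N. intros n m Hn Hm. eapply Rle_lt_trans; [|apply (HN n m Hn Hm)].
    eapply Rle_trans; [|apply im_le_Cmod]. apply Req_le. f_equal. }
  destruct A as [a Ha]. destruct B as [b Hb].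
  exists (a, b). intros eps Heps.
  apply is_lim_seq_spec in Ha. apply is_lim_seq_spec in Hb.
  assert (He : (0 < eps / 2)%R) by lra.
  destruct (Ha (mkposreal _ He)) as [N1 H1]. destruct (Hb (mkposreal _ He)) as [N2 H2].
  exists (max N1 N2). intros n Hn. simpl in H1, H2.
  specialize (H1 n ltac:(lia)). specialize (H2 n ltac:(lia)).
  eapply Rle_lt_trans; [apply Cmod_le_re_im|].
  unfold Re, Im, Cminus, Cplus, Copp in *. simpl in *. unfold Rminus in *. lra.
Qed.

Lemma Climit_unique (u : nat -> C) (l m : C) : Climit u l -> Climit u m -> l = m.
Proof.
  intros H K. apply Climit_Clim_seq in H. apply Climit_Clim_seq in K. congruence.
Qed.

Lemma Climit_ext (u v : nat -> C) (l : C) (N0 : nat) :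
  (forall n, (N0 <= n)%nat -> u n = v n) -> Climit u l -> Climit v l.
Proof.
  intros E H eps Heps. destruct (H eps Heps) as [N HN]. exists (max N N0).
  intros n Hn. rewrite <- E by lia. apply HN. lia.
Qed.

Lemma Climit_plus (u v : nat -> C) (l m : C) :
  Climit u l -> Climit v m -> Climit (fun n => u n + v n) (l + m).
Proof.
  intros Hu Hv eps Heps.
  destruct (Hu (eps / 2)%R) as [N HN]; [lra|].
  destruct (Hv (eps / 2)%R) as [M HM]; [lra|].
  exists (max N M). intros n Hn.
  replace (u n + v n - (l + m)) with ((u n - l) + (v n - m)) by ring.
  eapply Rle_lt_trans; [apply Cmod_triangle|].
  specialize (HN n ltac:(lia)). specialize (HM n ltac:(lia)). lra.
Qed.

Lemma Climit_const (a : C) : Climit (fun _ => a) a.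
Proof.
  intros eps Heps. exists 0%nat. intros n _. replace (a - a) with (RtoC 0) by ring.
  rewrite Cmod_0. auto.
Qed.

Lemma Climit_opp (u : nat -> C) (l : C) : Climit u l -> Climit (fun n => - u n) (- l).
Proof.
  intros H eps Heps. destruct (H eps Heps) as [N HN]. exists N. intros n Hn.
  replace (- u n - - l) with (- (u n - l)) by ring. rewrite Cmod_opp. auto.
Qed.

Lemma Climit_le (u : nat -> C) (l : C) (K : R) (N0 : nat) :
  (forall n, (N0 <= n)%nat -> (Cmod (u n) <= K)%R) -> Climit u l -> (Cmod l <= K)%R.
Proof.
  intros H Hu. apply Rnot_lt_le. intros Hlt.
  destruct (Hu (Cmod l - K)%R) as [N HN]; [lra|].
  specialize (HN (max N N0) ltac:(lia)). specialize (H (max N N0) ltac:(lia)).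
  rewrite Cmod_minus_sym in HN.
  assert (T := Cmod_triangle_inv l (u (max N N0))). lra.
Qed.

(** Locally uniform convergence of the derivatives suffices: by the mean value
    inequality the difference quotients of F_n - F_m are small uniformly in m. *)
Lemma Cder_termwise (F G : nat -> C -> C) (f g : C -> C) (z : C) (r : R) :
  (0 < r)%R ->
  (forall n w, (Cmod (w - z) < r)%R -> Cder (F n) w (G n w)) ->
  (forall w, (Cmod (w - z) < r)%R -> Climit (fun n => F n w) (f w)) ->
  Climit (fun n => G n z) (g z) ->
  (forall eps, (0 < eps)%R -> exists N, forall n m w, (N <= n)%nat -> (N <= m)%nat ->
     (Cmod (w - z) < r)%R -> (Cmod (G n w - G m w) <= eps)%R) ->
  Cder f z (g z).
Proof.
  intros Hr HF Hf Hg HC eps Heps.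
  destruct (HC (eps / 4)%R) as [N HN]; [lra|].
  destruct (Hg (eps / 4)%R) as [N1 HN1]; [lra|].
  set (n := max N N1).
  assert (Hz : (Cmod (z - z) < r)%R).
  { replace (z - z) with (RtoC 0) by ring. rewrite Cmod_0. auto. }
  destruct (HF n z Hz (eps / 4)%R) as [d [Hd Hw]]; [lra|].
  exists (Rmin d r). split; [apply Rmin_pos; auto|]. intros w Hwd.
  assert (B1 := Rmin_l d r). assert (B2 := Rmin_r d r).
  specialize (Hw w ltac:(lra)).
  assert (Hwr : (Cmod (w - z) < r)%R) by lra.
  assert (X : (Cmod ((f w - F n w) - (f z - F n z)) <= eps / 4 * Cmod (w - z))%R).
  { apply (Climit_le (fun m => (F m w - F n w) - (F m z - F n z)) _ _ N).
    - intros m Hm.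
      assert (Y := Cder_mvi (fun x => F m x - F n x) (fun x => G m x - G n x) z w (eps / 4)).
      replace (F m w - F n w - (F m z - F n z)) with
        ((fun x => F m x - F n x) w - (fun x => F m x - F n x) z) by reflexivity.
      apply Y. intros t Ht.
      assert (Hs : (Cmod (seg z w t - z) < r)%R).
      { unfold seg. replace (z + RtoC t * (w - z) - z) with (RtoC t * (w - z)) by ring.
        rewrite Cmod_scal_R by lra. assert (Q := Cmod_ge_0 (w - z)). nra. }
      split.
      + apply (Cder_minus (F m) (F n)); auto.
      + apply HN; auto. unfold n. lia.
    - apply (Climit_plus (fun m => F m w - F n w) (fun m => - (F m z - F n z))).
      + apply (Climit_plus (fun m => F m w) (fun m => - F n w)); auto. apply Climit_const.
      + apply (Climit_opp (fun m => F m z - F n z)).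
        apply (Climit_plus (fun m => F m z) (fun m => - F n z)); auto. apply Climit_const. }
  specialize (HN1 n ltac:(unfold n; lia)).
  replace (f w - f z - (w - z) * g z) with
    (((f w - F n w) - (f z - F n z)) + ((F n w - F n z - (w - z) * G n z)
      + (w - z) * (G n z - g z))) by ring.
  eapply Rle_trans; [apply Cmod_triangle|].
  eapply Rle_trans; [apply Rplus_le_compat_l; apply Cmod_triangle|].
  rewrite (Cmod_mult (w - z)).
  assert (Q := Cmod_ge_0 (w - z)). assert (Q2 := Cmod_ge_0 (G n z - g z)). nra.
Qed.

(** * Primitives on star-shaped domains *)

(** Joint continuity, as required for differentiation under the integral sign. *)
Definition cont2 (G : R -> R -> C) (s t : R) : Prop :=
  forall eps, (0 < eps)%R -> exists d, (0 < d)%R /\ forall u v,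
    (Rabs (u - s) < d)%R -> (Rabs (v - t) < d)%R -> (Cmod (G u v - G s t) < eps)%R.

Lemma cont2_continuity_2d (G : R -> R -> C) (s t : R) : cont2 G s t ->
  continuity_2d_pt (fun u v => Re (G u v)) s t.
Proof.
  intros H eps. destruct (H eps (cond_pos eps)) as [d [Hd Hw]].
  exists (mkposreal d Hd). intros u v Hu Hv. simpl in *.
  eapply Rle_lt_trans; [|apply (Hw u v Hu Hv)].
  eapply Rle_trans; [|apply re_le_Cmod]. apply Req_le. f_equal.
Qed.

Lemma cont2_const (a : C) s t : cont2 (fun _ _ => a) s t.
Proof.
  intros eps Heps. exists 1%R. split; [lra|]. intros.
  replace (a - a) with (RtoC 0) by ring. rewrite Cmod_0. auto.
Qed.

Lemma cont2_fst (f : R -> R) s t : continuity_pt f s -> cont2 (fun u _ => RtoC (f u)) s t.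
Proof.
  intros H eps Heps. destruct (H eps Heps) as [d [Hd Hw]]. exists d. split; auto.
  intros u v Hu Hv. rewrite <- RtoC_minus, Cmod_R.
  destruct (Req_dec u s) as [->|E].
  - rewrite Rminus_diag, Rabs_R0. auto.
  - apply Hw. split; [split; [exact I|auto]|exact Hu].
Qed.

Lemma cont2_snd (f : R -> R) s t : continuity_pt f t -> cont2 (fun _ v => RtoC (f v)) s t.
Proof.
  intros H eps Heps. destruct (H eps Heps) as [d [Hd Hw]]. exists d. split; auto.
  intros u v Hu Hv. rewrite <- RtoC_minus, Cmod_R.
  destruct (Req_dec v t) as [->|E].
  - rewrite Rminus_diag, Rabs_R0. auto.
  - apply Hw. split; [split; [exact I|auto]|exact Hv].
Qed.

Lemma cont2_comp (f : C -> C) (G : R -> R -> C) s t :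
  ccont f (G s t) -> cont2 G s t -> cont2 (fun u v => f (G u v)) s t.
Proof.
  intros Hf HG eps Heps. destruct (Hf eps Heps) as [d [Hd Hw]].
  destruct (HG d Hd) as [d' [Hd' Hw']]. exists d'. split; auto.
Qed.

Lemma cont2_plus (G H : R -> R -> C) s t :
  cont2 G s t -> cont2 H s t -> cont2 (fun u v => G u v + H u v) s t.
Proof.
  intros Hf Hg eps Heps.
  destruct (Hf (eps / 2)%R) as [d [Hd Hw]]; [lra|].
  destruct (Hg (eps / 2)%R) as [d' [Hd' Hw']]; [lra|].
  exists (Rmin d d'). split; [apply Rmin_pos; auto|].
  intros u v Hu Hv. assert (A := Rmin_l d d'). assert (B := Rmin_r d d').
  replace (G u v + H u v - (G s t + H s t)) with ((G u v - G s t) + (H u v - H s t)) by ring.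
  eapply Rle_lt_trans; [apply Cmod_triangle|].
  specialize (Hw u v ltac:(lra) ltac:(lra)). specialize (Hw' u v ltac:(lra) ltac:(lra)). lra.
Qed.

Lemma cont2_mult (G H : R -> R -> C) s t :
  cont2 G s t -> cont2 H s t -> cont2 (fun u v => G u v * H u v) s t.
Proof.
  intros Hf Hg eps Heps.
  assert (P1 := Cmod_ge_0 (G s t)). assert (P2 := Cmod_ge_0 (H s t)).
  set (A := (1 + Cmod (G s t) + Cmod (H s t))%R).
  assert (HA : (0 < A)%R) by (unfold A; lra).
  set (e := Rmin 1 (eps / (2 * A))).
  assert (He : (0 < e)%R).
  { apply Rmin_pos; [lra|]. apply Rdiv_lt_0_compat; lra. }
  destruct (Hf e He) as [d [Hd Hw]].
  destruct (Hg e He) as [d' [Hd' Hw']].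
  exists (Rmin d d'). split; [apply Rmin_pos; auto|].
  intros u v Hu Hv. assert (B1 := Rmin_l d d'). assert (B2 := Rmin_r d d').
  specialize (Hw u v ltac:(lra) ltac:(lra)). specialize (Hw' u v ltac:(lra) ltac:(lra)).
  replace (G u v * H u v - G s t * H s t) with
    ((G u v - G s t) * (H u v - H s t) +
     (G s t * (H u v - H s t) + (G u v - G s t) * H s t)) by ring.
  eapply Rle_lt_trans; [apply Cmod_triangle|].
  eapply Rle_lt_trans; [apply Rplus_le_compat_l; apply Cmod_triangle|].
  rewrite !Cmod_mult.
  assert (E1 : (e <= 1)%R) by apply Rmin_l.
  assert (E2 : (e * (2 * A) <= eps)%R).
  { assert (X : (e <= eps / (2 * A))%R) by apply Rmin_r.
    apply (Rmult_le_compat_r (2 * A)) in X; [|lra].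
    replace (eps / (2 * A) * (2 * A))%R with eps in X by (field; lra). exact X. }
  assert (Q1 := Cmod_ge_0 (G u v - G s t)). assert (Q2 := Cmod_ge_0 (H u v - H s t)).
  unfold A in E2. nra.
Qed.

Lemma cont2_continuous_snd (G : R -> R -> C) (s t : R) : cont2 G s t ->
  continuous (fun v => Re (G s v)) t.
Proof.
  intros H.
  apply filterlim_locally. intros eps.
  destruct (H eps (cond_pos eps)) as [d [Hd Hw]].
  exists (mkposreal d Hd). intros v Hv.
  specialize (Hw s v). rewrite Rminus_diag, Rabs_R0 in Hw.
  specialize (Hw Hd Hv).
  eapply Rle_lt_trans; [|apply Hw].
  eapply Rle_trans; [|apply re_le_Cmod]. apply Req_le. reflexivity.
Qed.

(** The integral of f along the segment from x0 to z. On a star-shaped domain it is a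
    primitive, without any appeal to Cauchy's theorem, when f is continuously
    differentiable. *)
Definition Prim (x0 : C) (f : C -> C) (z : C) : C :=
  (RInt (fun t => Re ((z - x0) * f (seg x0 z t))) 0 1,
   RInt (fun t => Im ((z - x0) * f (seg x0 z t))) 0 1).

Definition star (x0 : C) (D : C -> Prop) : Prop :=
  forall z t, D z -> (0 <= t <= 1)%R -> D (seg x0 z t).

(** Differentiation under the integral sign along the segment [z, w]: the
   derivative of the integrand (y - x0) f (x0 + t (y - x0)) in y is the
   t-derivative of t f (x0 + t (y - x0)). *)
Lemma Prim_slice_Re (D : C -> Prop) (x0 : C) (f f' : C -> C) (z v : C) (s : R) :
  open D -> star x0 D -> (forall y, D y -> Cder f y (f' y) /\ ccont f' y) ->
  D (z + RtoC s * v) ->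
  is_derive (fun s => RInt (fun t => Re ((z + RtoC s * v - x0)
     * f (seg x0 (z + RtoC s * v) t))) 0 1) s (Re (v * f (z + RtoC s * v))).
Proof.
  intros HD Hst Hf Hs. rewrite open_C_iff in HD.
  set (P := fun s => z + RtoC s * v).
  set (pt := fun s t => seg x0 (P s) t).
  set (k := fun s t => Re ((P s - x0) * f (pt s t))).
  set (k1 := fun s t => v * f (pt s t) + RtoC t * (P s - x0) * (v * f' (pt s t))).
  assert (Cpt : forall s t, cont2 pt s t).
  { intros s1 t1. unfold pt, seg, P. apply cont2_plus; [apply cont2_const|].
    apply cont2_mult; [apply (cont2_snd (fun t => t)), continuity_pt_id|].
    apply (cont2_plus _ (fun _ _ => - x0)); [|apply cont2_const].
    apply cont2_plus; [apply cont2_const|].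
    apply cont2_mult; [apply (cont2_fst (fun t => t)), continuity_pt_id|apply cont2_const]. }
  assert (CP : forall s t, cont2 (fun u _ => P u - x0) s t).
  { intros s1 t1. unfold P.
    apply (cont2_plus _ (fun _ _ => - x0)); [|apply cont2_const].
    apply cont2_plus; [apply cont2_const|].
    apply cont2_mult; [apply (cont2_fst (fun t => t)), continuity_pt_id|apply cont2_const]. }
  assert (Dk : forall s t, D (pt s t) -> is_derive (fun u => k u t) s (Re (k1 s t))).
  { intros s1 t1 H1. destruct (Hf _ H1) as [A B].
    assert (X : Cder (fun y => (y - x0) * f (seg x0 y t1)) (z + RtoC s1 * v)
      (f (pt s1 t1) + RtoC t1 * (P s1 - x0) * f' (pt s1 t1))).
    { eapply Cder_eq.
      - apply (Cder_mult (fun y => y - x0) (fun y => f (seg x0 y t1))).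
        + apply Cder_minus; [apply Cder_id|apply Cder_const].
        + apply (Cder_comp f (fun y => seg x0 y t1)); [exact A|].
          unfold seg. apply Cder_plus; [apply Cder_const|].
          apply Cder_scal. apply Cder_minus; [apply Cder_id|apply Cder_const].
      - unfold pt, P. ring. }
    destruct (Cder_slice _ z v _ s1 X) as [Y _].
    replace (k1 s1 t1) with ((f (pt s1 t1) + RtoC t1 * (P s1 - x0) * f' (pt s1 t1)) * v).
    { exact Y. }
    unfold k1. ring. }
  assert (Dopen : forall s t, D (pt s t) -> exists d, (0 < d)%R /\ forall u w,
    (Rabs (u - s) < d)%R -> (Rabs (w - t) < d)%R -> D (pt u w)).
  { intros s1 t1 H1. destruct (HD _ H1) as [d [Hd Hw]].
    destruct (Cpt s1 t1 d Hd) as [d' [Hd' Hw']]. exists d'. split; auto. }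
  assert (Ck1 : forall s t, D (pt s t) -> cont2 k1 s t).
  { intros s1 t1 H1. destruct (Hf _ H1) as [A B]. unfold k1. apply cont2_plus.
    - apply cont2_mult; [apply cont2_const|]. apply cont2_comp; auto.
      apply (Cder_ccont _ _ _ A).
    - apply cont2_mult.
      + apply cont2_mult; [apply (cont2_snd (fun t => t)), continuity_pt_id|apply CP].
      + apply cont2_mult; [apply cont2_const|]. apply cont2_comp; auto. }
  destruct (HD _ Hs) as [d0 [Hd0 Hw0]].
  assert (Hloc : exists d, (0 < d)%R /\ forall u, (Rabs (u - s) < d)%R -> D (P u)).
  { exists (d0 / (1 + Cmod v))%R. assert (Q := Cmod_ge_0 v).
    split; [apply Rdiv_lt_0_compat; lra|]. intros u Hu. apply Hw0. unfold P.
    replace (z + RtoC u * v - (z + RtoC s * v)) with (RtoC (u - s) * v)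
      by (rewrite RtoC_minus; ring).
    rewrite Cmod_mult, Cmod_R.
    apply (Rmult_lt_compat_r (1 + Cmod v)) in Hu; [|lra].
    replace (d0 / (1 + Cmod v) * (1 + Cmod v))%R with d0 in Hu by (field; lra).
    assert (Q2 := Rabs_pos (u - s)). nra. }
  destruct Hloc as [d [Hd Hloc]].
  assert (E : Re (v * f (P s)) = RInt (fun t => Derive (fun u => k u t) s) 0 1).
  { symmetry. apply is_RInt_unique.
    apply (is_RInt_ext (fun t => Re (k1 s t))).
    { intros t Ht. rewrite Rmin_left, Rmax_right in Ht by lra.
      symmetry. apply is_derive_unique. apply Dk. apply Hst; [exact Hs|lra]. }
    replace (Re (v * f (P s))) with (minus ((fun t => Re (RtoC t * (v * f (pt s t)))) 1%R)
      ((fun t => Re (RtoC t * (v * f (pt s t)))) 0%R)).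
    2:{ unfold pt. rewrite seg_0, seg_1. unfold minus, plus, opp, Re, RtoC, Cmult; simpl. ring. }
    apply (is_RInt_derive (fun t => Re (RtoC t * (v * f (pt s t))))
      (fun t => Re (k1 s t)) 0 1).
    - intros t Ht. rewrite Rmin_left, Rmax_right in Ht by lra.
      assert (H1 : D (pt s t)) by (apply Hst; [exact Hs|lra]).
      destruct (Hf _ H1) as [A B].
      assert (X := Cder_slice f x0 (P s - x0) _ t A). destruct X as [X1 X2].
      assert (Y := Rder_lin 0 v t).
      set (F := fun t => f (x0 + RtoC t * (P s - x0))) in *.
      assert (G1 : is_derive (fun t => (t * (Re v * Re (F t) - Im v * Im (F t)))%R) t
        (Re (k1 s t))).
      { evar_last.
        - apply (is_derive_mult (fun t : R => t) (fun t => (Re v * Re (F t) - Im v * Im (F t)))%R t).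
          + apply is_derive_id.
          + apply (is_derive_minus (fun t => (Re v * Re (F t))%R) (fun t => (Im v * Im (F t))%R)).
            * apply is_derive_scal. exact X1.
            * apply is_derive_scal. exact X2.
          + intros n m. apply Rmult_comm.
        - unfold k1. change (f (pt s t)) with (F t).
          change (seg x0 (P s) t) with (pt s t).
          generalize (F t) (f' (pt s t)) (P s - x0). intros [a1 a2] [b1 b2] [c1 c2].
          unfold plus, mult, minus, opp, one, scal, Re, Im, RtoC, Cmult, Cplus; simpl.
          unfold mult, plus; simpl. ring. }
      eapply is_derive_ext; [|exact G1]. intros u. unfold F, pt, seg, Re, Im, RtoC, Cmult; simpl. ring.
    - intros t Ht. rewrite Rmin_left, Rmax_right in Ht by lra.
      apply cont2_continuous_snd. apply Ck1. apply Hst; [exact Hs|lra]. }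
  change (is_derive (fun s => RInt (fun t => k s t) 0 1) s (Re (v * f (P s)))).
  rewrite E. apply is_derive_RInt_param.
  - exists (mkposreal d Hd). intros u Hu t Ht.
    rewrite Rmin_left, Rmax_right in Ht by lra.
    exists (Re (k1 u t)). apply Dk. apply Hst; [apply Hloc; exact Hu|exact Ht].
  - intros t Ht. rewrite Rmin_left, Rmax_right in Ht by lra.
    assert (H1 : D (pt s t)) by (apply Hst; [exact Hs|lra]).
    apply (continuity_2d_pt_ext_loc (fun u w => Re (k1 u w))).
    + destruct (Dopen s t H1) as [d1 [Hd1 Hw1]].
      exists (mkposreal d1 Hd1). intros u w Hu Hw. symmetry. apply is_derive_unique.
      apply Dk. apply Hw1; auto.
    + apply cont2_continuity_2d. apply Ck1. exact H1.
  - exists (mkposreal d Hd). intros u Hu.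
    apply (ex_RInt_continuous (V := R_CompleteNormedModule)). intros t Ht.
    rewrite Rmin_left, Rmax_right in Ht by lra.
    apply (cont2_continuous_snd (fun u t => (P u - x0) * f (pt u t))).
    apply cont2_mult; [apply CP|]. apply cont2_comp; [|apply Cpt].
    assert (H1 : D (pt u t)) by (apply Hst; [apply Hloc; exact Hu|lra]).
    destruct (Hf _ H1) as [A B]. apply (Cder_ccont _ _ _ A).
Qed.

Lemma Prim_slice (D : C -> Prop) (x0 : C) (f f' : C -> C) (z v : C) (s : R) :
  open D -> star x0 D -> (forall y, D y -> Cder f y (f' y) /\ ccont f' y) ->
  D (z + RtoC s * v) ->
  Rder (fun s => Prim x0 f (z + RtoC s * v)) s (v * f (z + RtoC s * v)).
Proof.
  intros HD Hst Hf Hs. split.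
  - apply (Prim_slice_Re D x0 f f' z v s); auto.
  - assert (X := Prim_slice_Re D x0 (fun y => - Ci * f y) (fun y => - Ci * f' y) z v s HD Hst).
    assert (E : forall a b, Re (a * (- Ci * b)) = Im (a * b)).
    { intros a b. unfold Re, Im, Ci, Cmult, Copp; simpl. ring. }
    cbv beta in X. rewrite E in X.
    eapply is_derive_ext; [|apply X; auto].
    + intros u. change (Im (Prim x0 f (z + RtoC u * v))) with (RInt (fun t =>
        Im ((z + RtoC u * v - x0) * f (seg x0 (z + RtoC u * v) t))) 0 1).
      apply RInt_ext. intros t _. apply E.
    + intros y Hy. destruct (Hf y Hy) as [A B]. split.
      * apply Cder_scal; auto.
      * apply ccont_mult; auto. apply ccont_const.
Qed.

(** The segment from z to a nearby w lies in D, so [Prim_slice] gives the increment of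
    the primitive over it. *)
Lemma Prim_der (D : C -> Prop) (x0 : C) (f f' : C -> C) (z : C) :
  open D -> star x0 D -> (forall y, D y -> Cder f y (f' y) /\ ccont f' y) ->
  D z -> Cder (Prim x0 f) z (f z).
Proof.
  intros HD Hst Hf Hz eps Heps.
  destruct (proj1 (open_C_iff D) HD z Hz) as [d [Hd Hw]].
  destruct (Hf z Hz) as [A _].
  destruct (Cder_ccont _ _ _ A eps Heps) as [d' [Hd' Hw']].
  exists (Rmin d d'). split; [apply Rmin_pos; auto|]. intros w Hwd.
  assert (B1 := Rmin_l d d'). assert (B2 := Rmin_r d d').
  assert (Hs : forall s, (0 <= s <= 1)%R ->
    (Cmod (z + RtoC s * (w - z) - z) < Rmin d d')%R).
  { intros s Hs. replace (z + RtoC s * (w - z) - z) with (RtoC s * (w - z)) by ring.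
    rewrite Cmod_scal_R by lra. assert (Q := Cmod_ge_0 (w - z)). nra. }
  assert (X := Rder_compare
    (fun s => Prim x0 f (z + RtoC s * (w - z)) - (0 + RtoC s * ((w - z) * f z)))
    (fun s => (w - z) * f (z + RtoC s * (w - z)) - (w - z) * f z)
    (fun s => eps * Cmod (w - z) * s)%R (fun _ => eps * Cmod (w - z))%R 0 1 ltac:(lra)).
  cbv beta in X.
  replace (z + 1 * (w - z)) with w in X by ring.
  replace (z + 0 * (w - z)) with z in X by ring.
  replace (Prim x0 f w - (0 + 1 * ((w - z) * f z)) -
    (Prim x0 f z - (0 + 0 * ((w - z) * f z)))) with
    (Prim x0 f w - Prim x0 f z - (w - z) * f z) in X by ring.
  eapply Rle_trans; [apply X|lra].
  - intros s Hsi. apply Rder_minus.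
    + apply (Prim_slice D x0 f f'); auto. apply Hw. specialize (Hs s Hsi). lra.
    + apply Rder_lin.
  - intros s Hsi. auto_derive; auto. ring.
  - intros s Hsi. replace ((w - z) * f (z + RtoC s * (w - z)) - (w - z) * f z) with
      ((f (z + RtoC s * (w - z)) - f z) * (w - z)) by ring.
    rewrite Cmod_mult. apply Rmult_le_compat_r; [apply Cmod_ge_0|].
    specialize (Hs s Hsi). apply Rlt_le. apply Hw'. lra.
Qed.

Lemma Prim_base (x0 : C) (f : C -> C) : Prim x0 f x0 = 0.
Proof.
  unfold Prim.
  rewrite (RInt_ext _ (fun _ => 0%R)), (RInt_ext (fun t => Im _) (fun _ => 0%R)).
  - rewrite RInt_const. unfold scal; simpl. unfold mult; simpl.
    unfold RtoC. f_equal; ring.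
  - intros. replace (x0 - x0) with (RtoC 0) by ring. rewrite Cmult_0_l. reflexivity.
  - intros. replace (x0 - x0) with (RtoC 0) by ring. rewrite Cmult_0_l. reflexivity.
Qed.

(** The exponential weight turns the Volterra iteration into a contraction. *)
Lemma Prim_bound (D : C -> Prop) (x0 : C) (f f' : C -> C) (z : C) (K lam : R) :
  open D -> star x0 D -> (forall y, D y -> Cder f y (f' y) /\ ccont f' y) ->
  D z -> (0 < lam)%R ->
  (forall t, (0 <= t <= 1)%R -> (Cmod (f (seg x0 z t)) <= K * exp (lam * t))%R) ->
  forall t, (0 <= t <= 1)%R ->
  (Cmod (Prim x0 f (seg x0 z t)) <= K * Cmod (z - x0) / lam * exp (lam * t))%R.
Proof.
  intros HD Hst Hf Hz Hlam Hb t Ht.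
  assert (HK : (0 <= K)%R).
  { specialize (Hb 0%R ltac:(lra)). rewrite Rmult_0_r, exp_0 in Hb.
    assert (Q := Cmod_ge_0 (f (seg x0 z 0))). lra. }
  assert (X := Rder_compare (fun s => Prim x0 f (seg x0 z s))
    (fun s => (z - x0) * f (seg x0 z s))
    (fun s => K * Cmod (z - x0) / lam * exp (lam * s))%R
    (fun s => Cmod (z - x0) * (K * exp (lam * s)))%R 0 t ltac:(lra)).
  cbv beta in X. rewrite seg_0, Prim_base in X.
  replace (Prim x0 f (seg x0 z t) - 0) with (Prim x0 f (seg x0 z t)) in X by ring.
  eapply Rle_trans; [apply X|].
  - intros s Hs. apply (Prim_slice D x0 f f'); auto. apply Hst; auto. lra.
  - intros s Hs. auto_derive; auto. field. lra.
  - intros s Hs. rewrite Cmod_mult. apply Rmult_le_compat_l; [apply Cmod_ge_0|].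
    apply Hb. lra.
  - assert (0 <= K * Cmod (z - x0) / lam * exp (lam * 0))%R; [|lra].
    apply Rmult_le_pos; [|left; apply exp_pos]. unfold Rdiv.
    apply Rmult_le_pos; [apply Rmult_le_pos; [auto|apply Cmod_ge_0]|].
    left. apply Rinv_0_lt_compat. auto.
Qed.

(** * Sums over squares of the lattice *)

Lemma sum_sym_0 (f : Z -> C) : sum_sym 0 f = f 0%Z.
Proof. unfold sum_sym. simpl. rewrite sum_O. reflexivity. Qed.

Lemma sum_sym_S (N : nat) (f : Z -> C) :
  sum_sym (S N) f = sum_sym N f + (f (Z.of_nat (S N)) + f (- Z.of_nat (S N))%Z).
Proof.
  unfold sum_sym. replace (2 * S N)%nat with (S (S (2 * N))) by lia.
  rewrite sum_Sn. unfold sum_n at 1. rewrite sum_Sn_m by lia.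
  assert (E : sum_n_m (fun k => f (Z.of_nat k - Z.of_nat (S N))%Z) 1 (S (2 * N)) =
    sum_n_m (fun k => f (Z.of_nat k - Z.of_nat N)%Z) 0 (2 * N)).
  { rewrite <- (sum_n_m_S (fun k => f (Z.of_nat k - Z.of_nat (S N))%Z) 0 (2 * N)).
    apply sum_n_m_ext. intros k. f_equal. lia. }
  rewrite E. unfold sum_n.
  replace (Z.of_nat 0 - Z.of_nat (S N))%Z with (- Z.of_nat (S N))%Z by lia.
  replace (Z.of_nat (S (S (2 * N))) - Z.of_nat (S N))%Z with (Z.of_nat (S N)) by lia.
  generalize (sum_n_m (fun k => f (Z.of_nat k - Z.of_nat N)%Z) 0 (2 * N)) as s.
  intros s. change (f (- Z.of_nat (S N))%Z + s + f (Z.of_nat (S N)) =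
    s + (f (Z.of_nat (S N)) + f (- Z.of_nat (S N))%Z)). ring.
Qed.

Lemma sum_sym_ext (N : nat) (f g : Z -> C) :
  (forall m, f m = g m) -> sum_sym N f = sum_sym N g.
Proof.
  intros E. induction N as [|N IH]; [rewrite !sum_sym_0; auto|].
  rewrite !sum_sym_S, IH, !E. reflexivity.
Qed.

Lemma sum_sym_plus (N : nat) (f g : Z -> C) :
  sum_sym N (fun m => f m + g m) = sum_sym N f + sum_sym N g.
Proof.
  induction N as [|N IH]; [rewrite !sum_sym_0; auto|].
  rewrite !sum_sym_S, IH. ring.
Qed.

Lemma sum_sym_scal (N : nat) (a : C) (f : Z -> C) :
  sum_sym N (fun m => a * f m) = a * sum_sym N f.
Proof.
  induction N as [|N IH]; [rewrite !sum_sym_0; auto|].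
  rewrite !sum_sym_S, IH. ring.
Qed.

Lemma sum_sym_0fun (N : nat) : sum_sym N (fun _ => RtoC 0) = 0.
Proof.
  induction N as [|N IH]; [rewrite !sum_sym_0; auto|].
  rewrite !sum_sym_S, IH. ring.
Qed.

Lemma sum_sym_neg (N : nat) (f : Z -> C) :
  sum_sym N (fun m => f (- m)%Z) = sum_sym N f.
Proof.
  induction N as [|N IH]; [rewrite !sum_sym_0; auto|].
  rewrite !sum_sym_S, IH. rewrite Z.opp_involutive. ring.
Qed.

(** The sum telescopes: only the two ends of the range survive a translation. *)
Lemma sum_sym_shift (N : nat) (f : Z -> C) :
  sum_sym N (fun m => f (m - 1)%Z) - sum_sym N f = f (- Z.of_nat (S N))%Z - f (Z.of_nat N).
Proof.
  induction N as [|N IH]; [rewrite !sum_sym_0; simpl; ring|].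
  rewrite !sum_sym_S.
  replace (Z.of_nat (S N) - 1)%Z with (Z.of_nat N) by lia.
  replace (- Z.of_nat (S N) - 1)%Z with (- Z.of_nat (S (S N)))%Z by lia.
  replace (sum_sym N (fun m => f (m - 1)%Z) + (f (Z.of_nat N) + f (- Z.of_nat (S (S N)))%Z)
    - (sum_sym N f + (f (Z.of_nat (S N)) + f (- Z.of_nat (S N))%Z))) with
    ((sum_sym N (fun m => f (m - 1)%Z) - sum_sym N f) + f (Z.of_nat N)
     + f (- Z.of_nat (S (S N)))%Z - f (Z.of_nat (S N)) - f (- Z.of_nat (S N))%Z) by ring.
  rewrite IH. ring.
Qed.

Lemma sum_sym_bound (N : nat) (f : Z -> C) (b : R) :
  (forall m, (Z.abs m <= Z.of_nat N)%Z -> (Cmod (f m) <= b)%R) ->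
  (Cmod (sum_sym N f) <= (2 * INR N + 1) * b)%R.
Proof.
  induction N as [|N IH]; intros H.
  - rewrite sum_sym_0. simpl. assert (X := H 0%Z ltac:(simpl; lia)). lra.
  - rewrite sum_sym_S, S_INR.
    eapply Rle_trans; [apply Cmod_triangle|].
    assert (X1 := H (Z.of_nat (S N)) ltac:(lia)).
    assert (X2 := H (- Z.of_nat (S N))%Z ltac:(lia)).
    assert (X3 := Cmod_triangle (f (Z.of_nat (S N))) (f (- Z.of_nat (S N))%Z)).
    specialize (IH ltac:(intros; apply H; lia)). lra.
Qed.

Definition sq (N : nat) (g : Z -> Z -> C) : C :=
  sum_sym N (fun m => sum_sym N (fun n => g m n)).

Lemma sq_ext N g h : (forall m n, g m n = h m n) -> sq N g = sq N h.
Proof. intros E. apply sum_sym_ext. intros m. apply sum_sym_ext. auto. Qed.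

Lemma sq_plus N g h : sq N (fun m n => g m n + h m n) = sq N g + sq N h.
Proof.
  unfold sq. rewrite <- sum_sym_plus. apply sum_sym_ext. intros m. apply sum_sym_plus.
Qed.

Lemma sq_scal N a g : sq N (fun m n => a * g m n) = a * sq N g.
Proof.
  unfold sq. rewrite <- sum_sym_scal. apply sum_sym_ext. intros m. apply sum_sym_scal.
Qed.

Lemma sq_neg N g : sq N (fun m n => g (- m)%Z (- n)%Z) = sq N g.
Proof.
  unfold sq. rewrite <- (sum_sym_neg N (fun m => sum_sym N (fun n => g m n))).
  apply sum_sym_ext. intros m. apply (sum_sym_neg N (fun n => g (- m)%Z n)).
Qed.

Lemma sq_S N g : sq (S N) g - sq N g =
  sum_sym N (fun m => g m (Z.of_nat (S N)) + g m (- Z.of_nat (S N))%Z) +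
  (sum_sym (S N) (fun n => g (Z.of_nat (S N)) n) +
   sum_sym (S N) (fun n => g (- Z.of_nat (S N))%Z n)).
Proof.
  unfold sq. rewrite sum_sym_S.
  rewrite (sum_sym_ext N (fun m => sum_sym (S N) (fun n => g m n))
    (fun m => sum_sym N (fun n => g m n) +
      (g m (Z.of_nat (S N)) + g m (- Z.of_nat (S N))%Z))).
  2:{ intros m. apply sum_sym_S. }
  rewrite (sum_sym_plus N (fun m => sum_sym N (fun n => g m n))). ring.
Qed.

Definition shell (m n : Z) : Z := Z.max (Z.abs m) (Z.abs n).

(** A shell of the square lattice of radius N + 1 has 8 (N + 1) points. *)
Lemma sq_shell_bound (N : nat) (g : Z -> Z -> C) (b : R) :
  (forall m n, shell m n = Z.of_nat (S N) -> (Cmod (g m n) <= b)%R) ->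
  (Cmod (sq (S N) g - sq N g) <= 8 * INR (S N) * b)%R.
Proof.
  intros H. rewrite sq_S.
  eapply Rle_trans; [apply Cmod_triangle|].
  eapply Rle_trans; [apply Rplus_le_compat_l, Cmod_triangle|].
  assert (X1 := sum_sym_bound N
    (fun m => g m (Z.of_nat (S N)) + g m (- Z.of_nat (S N))%Z) (2 * b)).
  assert (X2 := sum_sym_bound (S N) (fun n => g (Z.of_nat (S N)) n) b).
  assert (X3 := sum_sym_bound (S N) (fun n => g (- Z.of_nat (S N))%Z n) b).
  specialize (X2 ltac:(intros; apply H; unfold shell; lia)).
  specialize (X3 ltac:(intros; apply H; unfold shell; lia)).
  assert (X1' : (Cmod (sum_sym N (fun m => g m (Z.of_nat (S N)) +
     g m (- Z.of_nat (S N))%Z))%C <= (2 * INR N + 1) * (2 * b))%R).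
  { apply X1. intros m Hm. eapply Rle_trans; [apply Cmod_triangle|].
    assert (Y1 := H m (Z.of_nat (S N)) ltac:(unfold shell; lia)).
    assert (Y2 := H m (- Z.of_nat (S N))%Z ltac:(unfold shell; lia)). lra. }
  rewrite S_INR in *.
  lra.
Qed.

(** The shells contribute O(N) terms of size O(N^-3), and the sum of N^-2 is dominated by
    a telescoping one. *)
Lemma sq_tail (g : Z -> Z -> C) (K : R) (N0 N M : nat) : (0 <= K)%R ->
  (forall m n, (Z.of_nat N0 < shell m n)%Z ->
     (Cmod (g m n) <= K / (IZR (shell m n) * IZR (shell m n) * IZR (shell m n)))%R) ->
  (0 < N)%nat -> (N0 <= N)%nat -> (N <= M)%nat ->
  (Cmod (sq M g - sq N g) <= 8 * K / INR N)%R.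
Proof.
  intros HK H HN HN0 HM.
  assert (X : (Cmod (sq M g - sq N g) <= 8 * K * (/ INR N - / INR M))%R).
  { induction HM as [|M HM IH].
    - replace (sq N g - sq N g) with (RtoC 0) by ring. rewrite Cmod_0. lra.
    - eapply Rle_trans; [apply (Cmod_chain _ (sq M g))|].
      assert (PM : (0 < INR M)%R) by (apply lt_0_INR; lia).
      assert (PM1 : (0 < INR (S M))%R) by (apply lt_0_INR; lia).
      assert (Y := sq_shell_bound M g (K / (INR (S M) * INR (S M) * INR (S M)))).
      specialize (Y ltac:(intros m n Hmn; assert (Z := H m n ltac:(lia));
        rewrite Hmn, <- INR_IZR_INZ in Z; exact Z)).
      assert (E : (8 * INR (S M) * (K / (INR (S M) * INR (S M) * INR (S M))) =
        8 * K * / (INR (S M) * INR (S M)))%R) by (field; lra).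
      rewrite E in Y.
      assert (F : (/ (INR (S M) * INR (S M)) <= / INR M - / INR (S M))%R).
      { replace (/ INR M - / INR (S M))%R with (/ (INR M * INR (S M)))%R.
        - apply Rinv_le_contravar; [nra|]. rewrite S_INR. nra.
        - rewrite S_INR in *. field. lra. }
      assert (G : (8 * K * / (INR (S M) * INR (S M)) <=
        8 * K * (/ INR M - / INR (S M)))%R) by (apply Rmult_le_compat_l; lra).
      lra. }
  assert (PM : (0 < / INR M)%R) by (apply Rinv_0_lt_compat, lt_0_INR; lia).
  unfold Rdiv. nra.
Qed.

Lemma INR_div_small (K eps : R) : (0 < eps)%R ->
  exists N, (0 < N)%nat /\ forall n, (N <= n)%nat -> (K / INR n < eps)%R.
Proof.
  intros Heps. destruct (INR_unbounded (Rabs K / eps)) as [N HN].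
  exists (S N). split; [lia|]. intros n Hn.
  assert (P : (0 < INR n)%R) by (apply lt_0_INR; lia).
  assert (Q : (INR N < INR n)%R) by (apply lt_INR; lia).
  apply (Rmult_lt_reg_r (INR n)); auto. unfold Rdiv.
  rewrite Rmult_assoc, Rinv_l, Rmult_1_r by lra.
  assert (A := Rle_abs K).
  apply Rle_lt_trans with (Rabs K); auto.
  apply (Rmult_lt_reg_r (/ eps)); [apply Rinv_0_lt_compat; auto|].
  replace (eps * INR n * / eps)%R with (INR n) by (field; lra). unfold Rdiv in HN. lra.
Qed.

Lemma sq_converges (g : Z -> Z -> C) (K : R) (N0 : nat) : (0 <= K)%R ->
  (forall m n, (Z.of_nat N0 < shell m n)%Z ->
     (Cmod (g m n) <= K / (IZR (shell m n) * IZR (shell m n) * IZR (shell m n)))%R) ->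
  Climit (fun N => sq N g) (Clim_seq (fun N => sq N g)).
Proof.
  intros HK H.
  destruct (Climit_cauchy (fun N => sq N g)) as [l Hl].
  - intros eps Heps. destruct (INR_div_small (8 * K) (eps / 2) ltac:(lra)) as [N1 [P HN1]].
    exists (max N0 N1). intros n m Hn Hm.
    set (N := max N0 N1) in *.
    assert (A := sq_tail g K N0 N n HK H ltac:(lia) ltac:(lia) Hn).
    assert (B := sq_tail g K N0 N m HK H ltac:(lia) ltac:(lia) Hm).
    specialize (HN1 N ltac:(lia)).
    eapply Rle_lt_trans; [apply (Cmod_chain _ (sq N g))|].
    rewrite (Cmod_minus_sym (sq N g)). lra.
  - rewrite (Climit_Clim_seq _ _ Hl). exact Hl.
Qed.

(** * Geometry of the lattice *)

Section Lattice.
Variable tau : C.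
Hypothesis Htau : (0 < Im tau)%R.

(** The real coordinates of z in the basis (1, tau). *)
Definition ct (z : C) : R := (Im z / Im tau)%R.
Definition cs (z : C) : R := (Re z - ct z * Re tau)%R.

Lemma coords (z : C) : z = RtoC (cs z) + RtoC (ct z) * tau.
Proof.
  unfold cs, ct. destruct z as [x y], tau as [a b]. unfold Re, Im in *. simpl in *.
  unfold RtoC, Cplus, Cmult; simpl. f_equal; field; lra.
Qed.

Lemma ct_coords (s t : R) : ct (RtoC s + RtoC t * tau) = t.
Proof.
  unfold ct. destruct tau as [a b]. unfold Re, Im in *; simpl in *. field. lra.
Qed.

Lemma cs_coords (s t : R) : cs (RtoC s + RtoC t * tau) = s.
Proof.
  unfold cs. rewrite ct_coords. destruct tau as [a b]. unfold Re, Im in *; simpl in *. ring.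
Qed.

(** A bound for the coordinates in the basis (1, tau) in terms of the modulus. *)
Definition Kt : R := (1 + (1 + Cmod tau) / Im tau)%R.

Lemma Kt_ge_1 : (1 <= Kt)%R.
Proof.
  unfold Kt. assert (P := Cmod_ge_0 tau).
  assert (0 <= (1 + Cmod tau) / Im tau)%R; [|lra].
  apply Rmult_le_pos; [lra|]. left. apply Rinv_0_lt_compat; auto.
Qed.

Lemma ct_bound (z : C) : (Rabs (ct z) <= Kt * Cmod z)%R.
Proof.
  unfold ct. unfold Rdiv. rewrite Rabs_mult, (Rabs_pos_eq (/ Im tau))
    by (left; apply Rinv_0_lt_compat; auto).
  assert (A := im_le_Cmod z). assert (P := Cmod_ge_0 z). assert (Q := Cmod_ge_0 tau).
  assert (I : (0 < / Im tau)%R) by (apply Rinv_0_lt_compat; auto).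
  unfold Kt. unfold Rdiv.
  assert (X : (Rabs (Im z) * / Im tau <= Cmod z * / Im tau)%R)
    by (apply Rmult_le_compat_r; lra).
  assert (Y : (0 <= Cmod tau * / Im tau * Cmod z)%R).
  { apply Rmult_le_pos; [apply Rmult_le_pos|]; lra. }
  lra.
Qed.

Lemma cs_bound (z : C) : (Rabs (cs z) <= Kt * Cmod z)%R.
Proof.
  unfold cs. assert (A := re_le_Cmod z). assert (B := re_le_Cmod tau).
  assert (P := Cmod_ge_0 z). assert (Q := Cmod_ge_0 tau).
  assert (I : (0 < / Im tau)%R) by (apply Rinv_0_lt_compat; auto).
  eapply Rle_trans; [apply Rabs_triang|]. rewrite Rabs_Ropp, Rabs_mult.
  assert (C0 : (Rabs (ct z) <= Cmod z * / Im tau)%R).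
  { unfold ct, Rdiv. rewrite Rabs_mult, (Rabs_pos_eq (/ Im tau)) by lra.
    apply Rmult_le_compat_r; [lra|apply im_le_Cmod]. }
  assert (X : (Rabs (ct z) * Rabs (Re tau) <= Cmod z * / Im tau * Cmod tau)%R).
  { apply Rmult_le_compat; auto; apply Rabs_pos. }
  assert (Y : (0 <= / Im tau * Cmod z)%R) by (apply Rmult_le_pos; lra).
  unfold Kt, Rdiv. lra.
Qed.

Lemma lp_coords (m n : Z) :
  cs (lattice_point tau m n) = IZR m /\ ct (lattice_point tau m n) = IZR n.
Proof. unfold lattice_point. rewrite cs_coords, ct_coords. auto. Qed.

Lemma lp_bound (m n : Z) : (IZR (shell m n) <= Kt * Cmod (lattice_point tau m n))%R.
Proof.
  destruct (lp_coords m n) as [A B].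
  assert (X := cs_bound (lattice_point tau m n)). assert (Y := ct_bound (lattice_point tau m n)).
  rewrite A in X. rewrite B in Y. rewrite <- abs_IZR in X, Y.
  unfold shell. destruct (Z.max_spec (Z.abs m) (Z.abs n)) as [[_ ->]|[_ ->]]; auto.
Qed.

Lemma lp_neq_0 (m n : Z) : (Z.eqb m 0 && Z.eqb n 0)%bool = false ->
  lattice_point tau m n <> 0.
Proof.
  intros H E. assert (X := lp_bound m n). rewrite E, Cmod_0, Rmult_0_r in X.
  apply le_IZR in X. unfold shell in X.
  assert (m = 0%Z /\ n = 0%Z) as [-> ->] by lia. discriminate.
Qed.

Lemma lp_plus (m n m' n' : Z) :
  lattice_point tau (m + m') (n + n') = lattice_point tau m n + lattice_point tau m' n'.
Proof. unfold lattice_point. rewrite !plus_IZR, !RtoC_plus. ring. Qed.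

Lemma lp_opp (m n : Z) : lattice_point tau (- m) (- n) = - lattice_point tau m n.
Proof. unfold lattice_point. rewrite !opp_IZR, !RtoC_opp. ring. Qed.

Lemma lp_minus (m n m' n' : Z) :
  lattice_point tau (m - m') (n - n') = lattice_point tau m n - lattice_point tau m' n'.
Proof. unfold Z.sub. rewrite lp_plus, lp_opp. ring. Qed.

(** Two half-lattice points differ by half a nonzero lattice vector. *)
Lemma singular_dist (z w : C) : singular tau z -> singular tau w -> z <> w ->
  (/ (2 * Kt) <= Cmod (z - w))%R.
Proof.
  intros [m [n ->]] [m' [n' ->]] H.
  assert (K1 := Kt_ge_1).
  assert (E : lattice_point tau m n / 2 - lattice_point tau m' n' / 2 =
    RtoC (/ 2) * lattice_point tau (m - m') (n - n')).
  { rewrite lp_minus. rewrite RtoC_inv by lra. field. }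
  rewrite E, Cmod_scal_R by lra.
  assert (X := lp_bound (m - m') (n - n')).
  assert (Y : (1 <= shell (m - m') (n - n'))%Z).
  { unfold shell. destruct (Z.eq_dec m m'), (Z.eq_dec n n'); subst; try lia. exfalso; apply H; reflexivity. }
  apply IZR_le in Y.
  apply (Rmult_le_reg_l (2 * Kt)); [lra|].
  rewrite Rinv_r by lra. lra.
Qed.

(** Every point has a disc around it containing no singular point but possibly
   its centre. *)
Lemma singular_isolated (z : C) : exists r, (0 < r)%R /\
  forall w, singular tau w -> w <> z -> (r <= Cmod (z - w))%R.
Proof.
  assert (K1 := Kt_ge_1).
  assert (P : (0 < / (4 * Kt))%R) by (apply Rinv_0_lt_compat; lra).
  assert (E : (/ (2 * Kt) = 2 * / (4 * Kt))%R) by (field; lra).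
  destruct (classic (exists c, singular tau c /\ c <> z /\ (Cmod (z - c) < / (4 * Kt))%R))
    as [[c [Hc [Hn Hd]]]|H].
  - assert (Pc : (0 < Cmod (z - c))%R).
    { apply Cmod_gt_0. apply Cminus_neq_0. auto. }
    exists (Cmod (z - c)). split; auto. intros w Hw Hwz.
    destruct (classic (w = c)) as [->|Hne]; [lra|].
    assert (X := singular_dist w c Hw Hc Hne).
    assert (T := Cmod_chain w z c). rewrite (Cmod_minus_sym w z) in T. lra.
  - exists (/ (4 * Kt))%R. split; auto. intros w Hw Hwz.
    apply Rnot_lt_le. intros Hl. apply H. exists w. auto.
Qed.

Lemma lattice_singular (m n : Z) : singular tau (lattice_point tau m n).
Proof.
  exists (m + m)%Z, (n + n)%Z. rewrite lp_plus. field.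
Qed.

(** * Termwise differentiation of lattice sums *)

Definition mask (f : C -> C) (m n : Z) : C :=
  if (Z.eqb m 0 && Z.eqb n 0)%bool then RtoC 0 else f (lattice_point tau m n).

(** Terms of order |w|^-3 at the lattice point w make a lattice sum converge
    absolutely. The threshold [rho] and the constant are separated from f so that the
    bound can be uniform in a parameter. *)
Definition cubic_decay (rho K : R) (f : C -> C) : Prop :=
  forall w, (rho <= Cmod w)%R -> (Cmod (f w) <= K / (Cmod w * Cmod w * Cmod w))%R.

Lemma mask_bound (rho K : R) : (0 <= K)%R -> exists N0, forall f, cubic_decay rho K f ->
  forall m n, (Z.of_nat N0 < shell m n)%Z -> (Cmod (mask f m n) <=
    K * (Kt * Kt * Kt) / (IZR (shell m n) * IZR (shell m n) * IZR (shell m n)))%R.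
Proof.
  intros HK. assert (K1 := Kt_ge_1).
  destruct (INR_unbounded (Kt * Rabs rho)) as [N0 HN0]. exists N0.
  intros f Hf m n Hmn.
  assert (B := lp_bound m n).
  assert (S1 : (INR N0 < IZR (shell m n))%R) by (rewrite INR_IZR_INZ; apply IZR_lt; auto).
  assert (S0 : (0 < IZR (shell m n))%R) by (assert (X := pos_INR N0); lra).
  set (s := IZR (shell m n)) in *.
  unfold mask. destruct (Z.eqb m 0 && Z.eqb n 0)%bool eqn:E.
  { rewrite Cmod_0. apply Rmult_le_pos; [repeat apply Rmult_le_pos; lra|].
    left. apply Rinv_0_lt_compat. repeat apply Rmult_lt_0_compat; lra. }
  set (w := lattice_point tau m n) in *.
  assert (Q : (Rabs rho < Cmod w)%R) by (apply (Rmult_lt_reg_l Kt); lra).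
  assert (Q1 := Rle_abs rho). assert (Q2 := Rabs_pos rho).
  eapply Rle_trans; [apply Hf; lra|].
  set (v := Cmod w) in *.
  assert (P1 : (0 < v * v * v)%R) by (repeat apply Rmult_lt_0_compat; lra).
  assert (P2 : (0 < s * s * s)%R) by (repeat apply Rmult_lt_0_compat; lra).
  replace (K * (Kt * Kt * Kt) / (s * s * s))%R with
    (K * ((Kt * Kt * Kt) * / (s * s * s)))%R by (field; lra).
  unfold Rdiv. apply Rmult_le_compat_l; auto.
  apply (Rmult_le_reg_l (v * v * v)); auto. rewrite Rinv_r by lra.
  apply (Rmult_le_reg_r (s * s * s)); auto.
  replace (v * v * v * (Kt * Kt * Kt * / (s * s * s)) * (s * s * s))%R with
    ((Kt * v) * (Kt * v) * (Kt * v))%R by (field; lra).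
  rewrite Rmult_1_l.
  apply Rmult_le_compat; try nra.
Qed.

Lemma lattice_sum_conv (rho K : R) (f : C -> C) : (0 <= K)%R -> cubic_decay rho K f ->
  Climit (fun N => sq N (mask f)) (lattice_sum tau f).
Proof.
  intros HK Hf. destruct (mask_bound rho K HK) as [N0 HN0].
  apply (sq_converges (mask f) (K * (Kt * Kt * Kt)) N0).
  - assert (K1 := Kt_ge_1). repeat apply Rmult_le_pos; lra.
  - apply HN0. exact Hf.
Qed.

Lemma sum_sym_Cder (N : nat) (f f' : Z -> C -> C) (z : C) :
  (forall m, Cder (f m) z (f' m z)) ->
  Cder (fun y => sum_sym N (fun m => f m y)) z (sum_sym N (fun m => f' m z)).
Proof.
  intros H. induction N as [|N IH].
  - rewrite sum_sym_0. eapply Cder_ext; [|apply (H 0%Z)]. intros w.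
    rewrite sum_sym_0. reflexivity.
  - rewrite sum_sym_S. eapply Cder_ext.
    + intros w. symmetry. apply (sum_sym_S N (fun m => f m w)).
    + apply Cder_plus; [exact IH|]. apply Cder_plus; apply H.
Qed.

(** Uniform cubic decay of the terms and of their derivatives makes the sums over
    squares converge uniformly on the disc. *)
Lemma lattice_sum_Cder (f f' : C -> C -> C) (z : C) (r rho K : R) :
  (0 < r)%R -> (0 <= K)%R ->
  (forall m n y, (Z.eqb m 0 && Z.eqb n 0)%bool = false -> (Cmod (y - z) < r)%R ->
     Cder (f (lattice_point tau m n)) y (f' (lattice_point tau m n) y)) ->
  (forall y, (Cmod (y - z) < r)%R -> cubic_decay rho K (fun w => f w y)) ->
  (forall y, (Cmod (y - z) < r)%R -> cubic_decay rho K (fun w => f' w y)) ->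
  Cder (fun y => lattice_sum tau (fun w => f w y)) z (lattice_sum tau (fun w => f' w z)).
Proof.
  intros Hr HK Hd Hf Hf'. assert (K1 := Kt_ge_1).
  destruct (mask_bound rho K HK) as [N0 HN0].
  assert (HK' : (0 <= K * (Kt * Kt * Kt))%R) by (repeat apply Rmult_le_pos; lra).
  assert (Hz : (Cmod (z - z) < r)%R).
  { replace (z - z) with (RtoC 0) by ring. rewrite Cmod_0. auto. }
  apply (Cder_termwise (fun N y => sq N (mask (fun w => f w y)))
    (fun N y => sq N (mask (fun w => f' w y)))
    (fun y => lattice_sum tau (fun w => f w y))
    (fun y => lattice_sum tau (fun w => f' w y)) z r Hr).
  - intros N y Hy. unfold sq.
    apply (sum_sym_Cder N (fun m y => sum_sym N (fun n => mask (fun w => f w y) m n))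
      (fun m y => sum_sym N (fun n => mask (fun w => f' w y) m n))).
    intros m.
    apply (sum_sym_Cder N (fun n y => mask (fun w => f w y) m n)
      (fun n y => mask (fun w => f' w y) m n)).
    intros n. unfold mask. destruct (Z.eqb m 0 && Z.eqb n 0)%bool eqn:E.
    + apply Cder_const.
    + apply Hd; auto.
  - intros y Hy. apply (lattice_sum_conv rho K); auto.
  - apply (lattice_sum_conv rho K); auto.
  - intros eps Heps.
    destruct (INR_div_small (8 * (K * (Kt * Kt * Kt))) (eps / 2) ltac:(lra)) as [N1 [P HN1]].
    exists (max N0 N1). intros n m y Hn Hm Hy.
    set (N := max N0 N1) in *.
    assert (A := sq_tail _ _ N0 N n HK' (HN0 _ (Hf' y Hy)) ltac:(lia) ltac:(lia) Hn).
    assert (B := sq_tail _ _ N0 N m HK' (HN0 _ (Hf' y Hy)) ltac:(lia) ltac:(lia) Hm).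
    specialize (HN1 N ltac:(lia)).
    eapply Rle_trans; [apply (Cmod_chain _ (sq N (mask (fun w => f' w y))))|].
    rewrite (Cmod_minus_sym (sq N _)). lra.
Qed.

Definition in_lattice (z : C) : Prop := exists m n, z = lattice_point tau m n.

Lemma in_lattice_singular (z : C) : in_lattice z -> singular tau z.
Proof. intros [m [n ->]]. apply lattice_singular. Qed.

Lemma in_lattice_0 : in_lattice 0.
Proof. exists 0%Z, 0%Z. unfold lattice_point. ring. Qed.

(** The regular parts of the Weierstrass functions at 0 are defined at 0 too, where
    only the terms of nonzero lattice points occur. *)
Definition off_star (z : C) : Prop := ~ in_lattice z \/ z = 0.

Lemma off_star_disc (z : C) : off_star z -> exists r : R, (0 < r <= 1)%R /\
  forall y m n, (Cmod (y - z) < r)%R -> (Z.eqb m 0 && Z.eqb n 0)%bool = false ->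
    y - lattice_point tau m n <> 0.
Proof.
  intros Hz. destruct (singular_isolated z) as [r [Hr H]].
  exists (Rmin r 1). split; [split; [apply Rmin_pos; lra|apply Rmin_r]|].
  intros y m n Hy Hmn E.
  assert (E' : y = lattice_point tau m n)
    by (replace y with (y - lattice_point tau m n + lattice_point tau m n) by ring; rewrite E; ring).
  assert (Hne : lattice_point tau m n <> z).
  { intros E2. destruct Hz as [Hz|Hz].
    - apply Hz. exists m, n. auto.
    - apply (lp_neq_0 m n Hmn). congruence. }
  assert (X := H _ (lattice_singular m n) Hne). rewrite <- E', Cmod_minus_sym in X.
  assert (B := Rmin_l r 1). lra.
Qed.

(** The regular part of zeta at 0; [pr], [pr1] and [pr2] are its successive derivatives
    up to sign. *)
Definition zr (z : C) : C := lattice_sum tau (fun w => / (z - w) + / w + z / (w * w)).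
Definition pr (z : C) : C := lattice_sum tau (fun w => / ((z - w) * (z - w)) - / (w * w)).
Definition pr1 (z : C) : C :=
  lattice_sum tau (fun w => - (2) * / ((z - w) * (z - w) * (z - w))).
Definition pr2 (z : C) : C :=
  lattice_sum tau (fun w => 6 * / ((z - w) * (z - w) * ((z - w) * (z - w)))).

Lemma decay_aux (rho : R) (y w : C) : (1 <= rho)%R -> (Cmod y <= rho)%R ->
  (2 * rho <= Cmod w)%R ->
  w <> 0 /\ y - w <> 0 /\ (Cmod (/ w) = / Cmod w)%R /\
  (Cmod (/ (y - w)) <= 2 * / Cmod w)%R /\ (0 < / Cmod w <= / 2)%R.
Proof.
  intros H1 Hy Hw. assert (T := Cmod_triangle_inv w y). rewrite Cmod_minus_sym in T.
  assert (X : (Cmod w / 2 <= Cmod (y - w))%R) by lra.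
  assert (N1 : w <> 0) by (apply Cmod_gt_0; lra).
  assert (N2 : y - w <> 0) by (apply Cmod_gt_0; lra).
  repeat split; auto.
  - apply Cmod_inv; auto.
  - rewrite Cmod_inv by auto. replace (2 * / Cmod w)%R with (/ (Cmod w / 2))%R by (field; lra).
    apply Rinv_le_contravar; lra.
  - apply Rinv_0_lt_compat; lra.
  - apply Rinv_le_contravar; lra.
Qed.

(** One constant large enough for the four series. *)
Definition decay_const (rho : R) : R := (96 * (rho * rho))%R.

Lemma decay_from_inv (K : R) (f : C -> C) (w : C) : w <> 0 ->
  (Cmod (f w) <= K * (/ Cmod w * / Cmod w * / Cmod w))%R ->
  (Cmod (f w) <= K / (Cmod w * Cmod w * Cmod w))%R.
Proof.
  intros Hw H. apply Cmod_gt_0 in Hw. eapply Rle_trans; [exact H|].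
  apply Req_le. field. lra.
Qed.

Lemma zeta_term_decay (rho : R) (y : C) : (1 <= rho)%R -> (Cmod y <= rho)%R ->
  cubic_decay (2 * rho) (decay_const rho) (fun w => / (y - w) + / w + y / (w * w)).
Proof.
  intros H1 Hy w Hw. destruct (decay_aux rho y w H1 Hy Hw) as [N1 [N2 [A [B [D E]]]]].
  apply (decay_from_inv _ (fun w => / (y - w) + / w + y / (w * w))); auto.
  replace (/ (y - w) + / w + y / (w * w)) with (y * y * (/ w * / w * / (y - w)))
    by (field; auto).
  rewrite !Cmod_mult, A. unfold decay_const.
  set (a := Cmod y) in *. set (i := (/ Cmod w)%R) in *. set (u := Cmod (/ (y - w))) in *.
  assert (Pa : (0 <= a)%R) by apply Cmod_ge_0. assert (Pu : (0 <= u)%R) by apply Cmod_ge_0.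
  replace (96 * (rho * rho) * (i * i * i))%R with ((rho * rho) * (i * i * (96 * i)))%R by ring.
  apply Rmult_le_compat; try nra.
Qed.

Lemma zeta_term_decay' (rho : R) (y : C) : (1 <= rho)%R -> (Cmod y <= rho)%R ->
  cubic_decay (2 * rho) (decay_const rho)
    (fun w => - (/ ((y - w) * (y - w)) - / (w * w))).
Proof.
  intros H1 Hy w Hw. destruct (decay_aux rho y w H1 Hy Hw) as [N1 [N2 [A [B [D E]]]]].
  apply (decay_from_inv _ (fun w => - (/ ((y - w) * (y - w)) - / (w * w)))); auto.
  replace (- (/ ((y - w) * (y - w)) - / (w * w))) with
    (y * (/ w * / w * / (y - w) * (1 - w * / (y - w)))) by (field; auto).
  rewrite !Cmod_mult, A. unfold decay_const.
  assert (F : (Cmod (1 - w * / (y - w)) <= 3)%R).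
  { eapply Rle_trans; [apply Cmod_triangle_minus|]. rewrite Cmod_1, Cmod_mult.
    assert (X : (Cmod w * Cmod (/ (y - w)) <= Cmod w * (2 * / Cmod w))%R)
      by (apply Rmult_le_compat_l; [apply Cmod_ge_0|auto]).
    assert (Q := proj1 (Cmod_gt_0 w) N1).
    replace (Cmod w * (2 * / Cmod w))%R with 2%R in X by (field; lra). lra. }
  set (a := Cmod y) in *. set (i := (/ Cmod w)%R) in *. set (u := Cmod (/ (y - w))) in *.
  set (v := Cmod (1 - w * / (y - w))) in *.
  assert (Pa : (0 <= a)%R) by apply Cmod_ge_0. assert (Pu : (0 <= u)%R) by apply Cmod_ge_0.
  assert (Pv : (0 <= v)%R) by apply Cmod_ge_0.
  replace (96 * (rho * rho) * (i * i * i))%R with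
    ((rho * rho) * ((i * i * (32 * i)) * 3))%R by ring.
  assert (Q0 : (0 <= i * i)%R) by nra.
  apply Rmult_le_compat; try nra.
  - apply Rmult_le_pos; nra.
  - apply Rmult_le_compat; try nra.
Qed.

Lemma pr_term_decay (rho : R) (y : C) : (1 <= rho)%R -> (Cmod y <= rho)%R ->
  cubic_decay (2 * rho) (decay_const rho)
    (fun w => / ((y - w) * (y - w)) - / (w * w)).
Proof.
  intros H1 Hy w Hw. rewrite <- Cmod_opp.
  apply (zeta_term_decay' rho y H1 Hy w Hw).
Qed.

Lemma pr1_term_decay (rho : R) (y : C) : (1 <= rho)%R -> (Cmod y <= rho)%R ->
  cubic_decay (2 * rho) (decay_const rho)
    (fun w => - (2) * / ((y - w) * (y - w) * (y - w))).
Proof.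
  intros H1 Hy w Hw. destruct (decay_aux rho y w H1 Hy Hw) as [N1 [N2 [A [B [D E]]]]].
  apply (decay_from_inv _ (fun w => - (2) * / ((y - w) * (y - w) * (y - w)))); auto.
  replace (- (2) * / ((y - w) * (y - w) * (y - w))) with
    (- (2) * (/ (y - w) * / (y - w) * / (y - w))) by (field; auto).
  rewrite !Cmod_mult, Cmod_opp, Cmod_R, (Rabs_pos_eq 2) by lra. unfold decay_const.
  set (i := (/ Cmod w)%R) in *. set (u := Cmod (/ (y - w))) in *.
  assert (Pu : (0 <= u)%R) by apply Cmod_ge_0.
  apply Rle_trans with (2 * (2 * i * (2 * i) * (2 * i)))%R.
  - apply Rmult_le_compat_l; [lra|]. apply Rmult_le_compat; auto.
    + nra.
    + apply Rmult_le_compat; auto.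
  - assert (Q : (0 <= i * i * i)%R) by (apply Rmult_le_pos; nra).
    assert (Q3 : (0 <= (rho * rho - 1) * (i * i * i))%R) by (apply Rmult_le_pos; nra). nra.
Qed.

Lemma pr2_term_decay (rho : R) (y : C) : (1 <= rho)%R -> (Cmod y <= rho)%R ->
  cubic_decay (2 * rho) (decay_const rho)
    (fun w => 6 * / ((y - w) * (y - w) * ((y - w) * (y - w)))).
Proof.
  intros H1 Hy w Hw. destruct (decay_aux rho y w H1 Hy Hw) as [N1 [N2 [A [B [D E]]]]].
  apply (decay_from_inv _ (fun w => 6 * / ((y - w) * (y - w) * ((y - w) * (y - w))))); auto.
  replace (6 * / ((y - w) * (y - w) * ((y - w) * (y - w)))) with
    (6 * (/ (y - w) * / (y - w) * (/ (y - w) * / (y - w)))) by (field; auto).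
  rewrite !Cmod_mult, Cmod_R, (Rabs_pos_eq 6) by lra. unfold decay_const.
  set (i := (/ Cmod w)%R) in *. set (u := Cmod (/ (y - w))) in *.
  assert (Pu : (0 <= u)%R) by apply Cmod_ge_0.
  apply Rle_trans with (6 * (2 * i * (2 * i) * (2 * i * (2 * i))))%R.
  - apply Rmult_le_compat_l; [lra|]. apply Rmult_le_compat; try nra.
  - assert (Q : (0 <= i * i * i)%R) by (apply Rmult_le_pos; nra).
    assert (Q3 : (0 <= (rho * rho - 1) * (i * i * i))%R) by (apply Rmult_le_pos; nra).
    assert (Q2 : (i * (i * i * i) <= / 2 * (i * i * i))%R) by (apply Rmult_le_compat_r; lra).
    nra.
Qed.

Lemma decay_const_pos (rho : R) : (0 <= decay_const rho)%R.
Proof. unfold decay_const. nra. Qed.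

Lemma disc_norm_le (z y : C) (r : R) : (r <= 1)%R -> (Cmod (y - z) < r)%R ->
  (1 <= 2 + Cmod z)%R /\ (Cmod y <= 2 + Cmod z)%R.
Proof.
  intros Hr Hy. assert (P := Cmod_ge_0 z). assert (T := Cmod_triangle_inv y z). lra.
Qed.

Lemma zr_Cder (z : C) : off_star z -> Cder zr z (- pr z).
Proof.
  intros Hz. destruct (off_star_disc z Hz) as [r [[Hr Hr1] Hd]].
  assert (X := lattice_sum_Cder (fun w y => / (y - w) + / w + y / (w * w))
    (fun w y => - (/ ((y - w) * (y - w)) - / (w * w))) z r (2 * (2 + Cmod z))
    (decay_const (2 + Cmod z)) Hr (decay_const_pos _)).
  assert (E : lattice_sum tau (fun w => - (/ ((z - w) * (z - w)) - / (w * w))) = - pr z).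
  { apply Climit_Clim_seq. apply (Climit_ext (fun N => - sq N (mask (fun w =>
      / ((z - w) * (z - w)) - / (w * w)))) _ _ 0%nat).
    - intros N _. transitivity (- (1) * sq N (mask (fun w => / ((z - w) * (z - w)) - / (w * w)))).
      ring. rewrite <- sq_scal. apply sq_ext. intros m n. unfold mask.
      destruct (Z.eqb m 0 && Z.eqb n 0)%bool; ring.
    - apply Climit_opp. destruct (disc_norm_le z z r Hr1) as [Y1 Y2].
      { replace (z - z) with (RtoC 0) by ring. rewrite Cmod_0. auto. }
      apply (lattice_sum_conv _ _ _ (decay_const_pos _)
        (pr_term_decay (2 + Cmod z) z Y1 Y2)). }
  cbv beta in X. rewrite E in X. apply X.
  - intros m n y E1 Hy. specialize (Hd y m n Hy E1).
    assert (Hl := lp_neq_0 m n E1). set (w := lattice_point tau m n) in *.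
    eapply Cder_eq.
    + apply (Cder_plus (fun y => / (y - w) + / w) (fun y => y / (w * w))).
      * apply (Cder_plus (fun y => / (y - w)) (fun _ => / w)); [|apply Cder_const].
        apply (Cder_inv (fun y => y - w)); auto.
        apply Cder_minus; [apply Cder_id|apply Cder_const].
      * apply (Cder_mult (fun y => y) (fun _ => / (w * w))); [apply Cder_id|apply Cder_const].
    + cbv beta. field. auto.
  - intros y Hy. destruct (disc_norm_le z y r Hr1 Hy). apply zeta_term_decay; auto.
  - intros y Hy. destruct (disc_norm_le z y r Hr1 Hy). apply zeta_term_decay'; auto.
Qed.

Lemma pr_Cder (z : C) : off_star z -> Cder pr z (pr1 z).
Proof.
  intros Hz. destruct (off_star_disc z Hz) as [r [[Hr Hr1] Hd]].
  apply (lattice_sum_Cder (fun w y => / ((y - w) * (y - w)) - / (w * w))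
    (fun w y => - (2) * / ((y - w) * (y - w) * (y - w))) z r (2 * (2 + Cmod z))
    (decay_const (2 + Cmod z)) Hr (decay_const_pos _)).
  - intros m n y E1 Hy. specialize (Hd y m n Hy E1). set (w := lattice_point tau m n) in *.
    assert (Hy2 : Cder (fun y => y - w) y 1).
    { eapply Cder_eq; [apply Cder_minus; [apply Cder_id|apply Cder_const]|]. ring. }
    eapply Cder_eq.
    + apply (Cder_minus (fun y => / ((y - w) * (y - w))) (fun _ => / (w * w)));
        [|apply Cder_const].
      apply (Cder_inv (fun y => (y - w) * (y - w))).
      * apply (Cder_mult (fun y => y - w) (fun y => y - w)); exact Hy2.
      * apply Cmult_neq_0; auto.
    + cbv beta. field. auto.
  - intros y Hy. destruct (disc_norm_le z y r Hr1 Hy). apply pr_term_decay; auto.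
  - intros y Hy. destruct (disc_norm_le z y r Hr1 Hy). apply pr1_term_decay; auto.
Qed.

Lemma pr1_Cder (z : C) : off_star z -> Cder pr1 z (pr2 z).
Proof.
  intros Hz. destruct (off_star_disc z Hz) as [r [[Hr Hr1] Hd]].
  apply (lattice_sum_Cder (fun w y => - (2) * / ((y - w) * (y - w) * (y - w)))
    (fun w y => 6 * / ((y - w) * (y - w) * ((y - w) * (y - w)))) z r (2 * (2 + Cmod z))
    (decay_const (2 + Cmod z)) Hr (decay_const_pos _)).
  - intros m n y E1 Hy. specialize (Hd y m n Hy E1). set (w := lattice_point tau m n) in *.
    assert (Hy2 : Cder (fun y => y - w) y 1).
    { eapply Cder_eq; [apply Cder_minus; [apply Cder_id|apply Cder_const]|]. ring. }
    eapply Cder_eq.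
    + apply (Cder_scal (- (2)) (fun y => / ((y - w) * (y - w) * (y - w)))).
      apply (Cder_inv (fun y => (y - w) * (y - w) * (y - w))).
      * apply (Cder_mult (fun y => (y - w) * (y - w)) (fun y => y - w)); [|exact Hy2].
        apply (Cder_mult (fun y => y - w) (fun y => y - w)); exact Hy2.
      * repeat apply Cmult_neq_0; auto.
    + cbv beta. field. auto.
  - intros y Hy. destruct (disc_norm_le z y r Hr1 Hy). apply pr1_term_decay; auto.
  - intros y Hy. destruct (disc_norm_le z y r Hr1 Hy). apply pr2_term_decay; auto.
Qed.

Lemma lattice_sum_null (f : C -> C) : (forall m n, mask f m n = 0) -> lattice_sum tau f = 0.
Proof.
  intros H. apply Climit_Clim_seq. apply (Climit_ext (fun _ => RtoC 0) _ _ 0%nat).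
  - intros N _. change (RtoC 0 = sq N (mask f)).
    rewrite (sq_ext N _ (fun _ _ => RtoC 0) H). unfold sq.
    rewrite (sum_sym_ext N _ (fun _ => RtoC 0)).
    + rewrite sum_sym_0fun. reflexivity.
    + intros m. apply sum_sym_0fun.
  - apply Climit_const.
Qed.

Lemma zr_0 : zr 0 = 0.
Proof.
  apply lattice_sum_null. intros m n. unfold mask.
  destruct (Z.eqb m 0 && Z.eqb n 0)%bool eqn:E; auto.
  assert (H := lp_neq_0 m n E). field. auto.
Qed.

Lemma pr_0 : pr 0 = 0.
Proof.
  apply lattice_sum_null. intros m n. unfold mask.
  destruct (Z.eqb m 0 && Z.eqb n 0)%bool eqn:E; auto.
  assert (H := lp_neq_0 m n E). field. auto.
Qed.

(** Reversing the sign of the lattice point permutes the terms. *)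
Lemma zr_odd (z : C) : off_star z -> zr (- z) = - zr z.
Proof.
  intros Hz. apply Climit_Clim_seq.
  destruct (off_star_disc z Hz) as [r [[Hr Hr1] Hd]].
  assert (Hzz : (Cmod (z - z) < r)%R).
  { replace (z - z) with (RtoC 0) by ring. rewrite Cmod_0. auto. }
  apply (Climit_ext (fun N => - sq N (mask (fun w => / (z - w) + / w + z / (w * w)))) _ _ 0%nat).
  - intros N _.
    change (- sq N (mask (fun w => / (z - w) + / w + z / (w * w))) =
      sq N (mask (fun w => / (- z - w) + / w + - z / (w * w)))).
    rewrite <- (sq_neg N (mask (fun w => / (- z - w) + / w + - z / (w * w)))).
    transitivity (- (1) * sq N (mask (fun w => / (z - w) + / w + z / (w * w)))); [ring|].
    rewrite <- sq_scal. apply sq_ext. intros m n. unfold mask.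
    replace (Z.eqb (- m) 0) with (Z.eqb m 0) by (apply Bool.eq_true_iff_eq; rewrite !Z.eqb_eq; lia).
    replace (Z.eqb (- n) 0) with (Z.eqb n 0) by (apply Bool.eq_true_iff_eq; rewrite !Z.eqb_eq; lia).
    destruct (Z.eqb m 0 && Z.eqb n 0)%bool eqn:E; [ring|].
    rewrite lp_opp. assert (H := lp_neq_0 m n E). assert (H2 := Hd z m n Hzz E).
    set (w := lattice_point tau m n) in *. field. repeat split; auto.
    intros E2. apply H2. replace (z - w) with (- (- z - - w)) by ring. rewrite E2. ring.
  - apply Climit_opp. destruct (disc_norm_le z z r Hr1 Hzz) as [Y1 Y2].
    apply (lattice_sum_conv _ _ _ (decay_const_pos _) (zeta_term_decay (2 + Cmod z) z Y1 Y2)).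
Qed.

Lemma wzeta_zr (z : C) : wzeta tau z = / z + zr z.
Proof. reflexivity. Qed.

Lemma wp_pr (z : C) : wp tau z = / (z * z) + pr z.
Proof. reflexivity. Qed.

Definition wp1 (z : C) : C := - (2) * / (z * z * z) + pr1 z.

Lemma not_lattice_neq_0 (z : C) : ~ in_lattice z -> z <> 0.
Proof. intros H E. apply H. rewrite E. apply in_lattice_0. Qed.

Lemma wzeta_Cder (z : C) : ~ in_lattice z -> Cder (wzeta tau) z (- wp tau z).
Proof.
  intros H. assert (H0 := not_lattice_neq_0 z H). rewrite wp_pr.
  eapply Cder_eq.
  - apply (Cder_plus (fun z => / z) zr); [apply Cder_inv_id; auto|].
    apply zr_Cder. left; auto.
  - ring.
Qed.

Lemma wp_Cder (z : C) : ~ in_lattice z -> Cder (wp tau) z (wp1 z).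
Proof.
  intros H. assert (H0 := not_lattice_neq_0 z H). unfold wp1.
  eapply Cder_eq.
  - apply (Cder_plus (fun z => / (z * z)) pr).
    + apply (Cder_inv (fun z => z * z)).
      * apply (Cder_mult (fun z => z) (fun z => z)); apply Cder_id.
      * apply Cmult_neq_0; auto.
    + apply pr_Cder. left; auto.
  - cbv beta. field. auto.
Qed.

Lemma wp1_Cder (z : C) : ~ in_lattice z -> exists l, Cder wp1 z l.
Proof.
  intros H. assert (H0 := not_lattice_neq_0 z H). eexists.
  apply (Cder_plus (fun z => - (2) * / (z * z * z)) pr1).
  - apply Cder_scal. apply (Cder_inv (fun z => z * z * z)).
    + apply (Cder_mult (fun z => z * z) (fun z => z)); [|apply Cder_id].
      apply (Cder_mult (fun z => z) (fun z => z)); apply Cder_id.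
    + repeat apply Cmult_neq_0; auto.
  - apply pr1_Cder. left; auto.
Qed.

Lemma in_lattice_plus (z : C) (m n : Z) :
  in_lattice (z + lattice_point tau m n) -> in_lattice z.
Proof.
  intros [a [b E]]. exists (a - m)%Z, (b - n)%Z. rewrite lp_minus, <- E. ring.
Qed.

Lemma in_lattice_opp (z : C) : in_lattice (- z) -> in_lattice z.
Proof.
  intros [a [b E]]. exists (- a)%Z, (- b)%Z. rewrite lp_opp, <- E. ring.
Qed.

Lemma wzeta_odd (z : C) : ~ in_lattice z -> wzeta tau (- z) = - wzeta tau z.
Proof.
  intros H. rewrite !wzeta_zr, zr_odd by (left; auto).
  assert (H0 := not_lattice_neq_0 z H). field. auto.
Qed.

(** * Quasi-periods of zeta *)

Definition czero (m n : Z) : bool := (Z.eqb m 0 && Z.eqb n 0)%bool.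

(** The term of the zeta series at a lattice point, the term 1/z being put at the
    origin. *)
Definition zterm (z : C) (m n : Z) : C :=
  / (z - lattice_point tau m n) + (if czero m n then RtoC 0
    else / lattice_point tau m n + z / (lattice_point tau m n * lattice_point tau m n)).

Lemma sq_delta (N : nat) (a : C) :
  sq N (fun m n => if czero m n then a else RtoC 0) = a.
Proof.
  induction N as [|N IH].
  - unfold sq. rewrite !sum_sym_0. reflexivity.
  - transitivity (sq N (fun m n => if czero m n then a else RtoC 0)); [|exact IH].
    apply Cmod_eps_eq. intros eps Heps.
    eapply Rle_trans; [apply (sq_shell_bound N _ 0)|lra].
    intros m n H. unfold czero. destruct (Z.eqb_spec m 0), (Z.eqb_spec n 0); simpl;
      rewrite ?Cmod_0; try lra. subst. unfold shell in H. simpl in H. lia.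
Qed.

Lemma lp_00 : lattice_point tau 0 0 = 0.
Proof. unfold lattice_point. ring. Qed.

Lemma zterm_limit (z : C) : off_star z -> Climit (fun N => sq N (zterm z)) (wzeta tau z).
Proof.
  intros Hz.
  destruct (off_star_disc z Hz) as [r [[Hr Hr1] _]].
  destruct (disc_norm_le z z r Hr1) as [Y1 Y2].
  { replace (z - z) with (RtoC 0) by ring. rewrite Cmod_0. auto. }
  assert (X := lattice_sum_conv _ _ _ (decay_const_pos _) (zeta_term_decay (2 + Cmod z) z Y1 Y2)).
  rewrite wzeta_zr.
  apply (Climit_ext (fun N => / z + sq N (mask (fun w => / (z - w) + / w + z / (w * w)))) _ _ 0%nat).
  - intros N _. rewrite <- (sq_delta N (/ z)) at 1. rewrite <- sq_plus.
    apply sq_ext. intros m n. unfold zterm, mask. fold (czero m n).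
    destruct (czero m n) eqn:E; [|ring].
    unfold czero in E. apply andb_prop in E. destruct E as [E1 E2].
    apply Z.eqb_eq in E1. apply Z.eqb_eq in E2. subst. rewrite lp_00.
    replace (z - 0) with z by ring. ring.
  - apply (Climit_plus (fun _ => / z)); [apply Climit_const|exact X].
Qed.

(** An edge of the square of radius N has O(N) points, at which 1/(z - w) - 1/(z' - w) is
    O(N^-2). *)
Lemma edge_diff (z z' : C) : exists K N0, (0 <= K)%R /\ forall N, (N0 <= N)%nat -> (0 < N)%nat ->
  forall f g : Z -> Z, (forall k, (Z.abs k <= Z.of_nat N)%Z -> (Z.of_nat N <= shell (f k) (g k))%Z) ->
  (Cmod (sum_sym N (fun k => / (z - lattice_point tau (f k) (g k))
     - / (z' - lattice_point tau (f k) (g k))))%C <= K / INR N)%R.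
Proof.
  assert (K1 := Kt_ge_1). assert (P1 := Cmod_ge_0 z). assert (P2 := Cmod_ge_0 z').
  assert (P3 := Cmod_ge_0 (z - z')).
  set (rho := (1 + Cmod z + Cmod z')%R).
  destruct (INR_unbounded (Kt * (2 * rho))) as [N0 HN0].
  exists (12 * (Kt * Kt) * Cmod (z - z'))%R, N0. split; [repeat apply Rmult_le_pos; lra|].
  intros N HN HN1 f g Hfg.
  assert (PN : (1 <= INR N)%R) by (apply (le_INR 1); lia).
  assert (QN : (INR N0 <= INR N)%R) by (apply le_INR; auto).
  assert (B : forall k, (Z.abs k <= Z.of_nat N)%Z ->
    (Cmod (/ (z - lattice_point tau (f k) (g k)) - / (z' - lattice_point tau (f k) (g k)))%C
      <= 4 * (Kt * Kt) * Cmod (z - z') * / (INR N * INR N))%R).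
  { intros k Hk. specialize (Hfg k Hk). apply IZR_le in Hfg. rewrite <- INR_IZR_INZ in Hfg.
    assert (X := lp_bound (f k) (g k)). set (w := lattice_point tau (f k) (g k)) in *.
    assert (Hw : (2 * rho < Cmod w)%R) by (apply (Rmult_lt_reg_l Kt); lra).
    destruct (decay_aux rho z w ltac:(unfold rho; lra) ltac:(unfold rho; lra) ltac:(lra))
      as [A1 [A2 [A3 [A4 A5]]]].
    destruct (decay_aux rho z' w ltac:(unfold rho; lra) ltac:(unfold rho; lra) ltac:(lra))
      as [_ [B2 [_ [B4 _]]]].
    replace (/ (z - w) - / (z' - w)) with (- (z - z') * (/ (z - w) * / (z' - w)))
      by (field; auto).
    rewrite !Cmod_mult, Cmod_opp.
    assert (I : (/ Cmod w <= Kt * / INR N)%R).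
    { replace (Kt * / INR N)%R with (/ (INR N * / Kt))%R by (field; lra).
      assert (Q : (0 < / Kt)%R) by (apply Rinv_0_lt_compat; lra).
      apply Rinv_le_contravar; [apply Rmult_lt_0_compat; lra|].
      apply (Rmult_le_reg_l Kt); [lra|]. replace (Kt * (INR N * / Kt))%R with (INR N) by (field; lra).
      lra. }
    assert (U : (Cmod (/ (z - w)) * Cmod (/ (z' - w)) <=
      (2 * (Kt * / INR N)) * (2 * (Kt * / INR N)))%R).
    { apply Rmult_le_compat; try apply Cmod_ge_0; lra. }
    replace (4 * (Kt * Kt) * Cmod (z - z') * / (INR N * INR N))%R with
      (Cmod (z - z') * ((2 * (Kt * / INR N)) * (2 * (Kt * / INR N))))%R by (field; lra).
    apply Rmult_le_compat_l; auto. }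
  eapply Rle_trans; [apply (sum_sym_bound N _ _ B)|].
  apply Rle_trans with ((3 * INR N) * (4 * (Kt * Kt) * Cmod (z - z') * / (INR N * INR N)))%R.
  - apply Rmult_le_compat_r; [|lra]. repeat apply Rmult_le_pos; try lra.
    left. apply Rinv_0_lt_compat. nra.
  - apply Req_le. field. lra.
Qed.

Lemma sq_split_const (N : nat) (z : C) : forall w,
  sq N (zterm (z + w)) - sq N (zterm z) =
  (sq N (fun m n => / (z + w - lattice_point tau m n)) -
   sq N (fun m n => / (z - lattice_point tau m n))) +
  w * sq N (fun m n => if czero m n then RtoC 0
     else / (lattice_point tau m n * lattice_point tau m n)).
Proof.
  intros w. rewrite <- sq_scal.
  replace (sq N (zterm (z + w)) - sq N (zterm z)) with
    (sq N (zterm (z + w)) + - (1) * sq N (zterm z)) by ring.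
  replace (sq N (fun m n => / (z + w - lattice_point tau m n)) -
   sq N (fun m n => / (z - lattice_point tau m n))) with
   (sq N (fun m n => / (z + w - lattice_point tau m n)) +
   - (1) * sq N (fun m n => / (z - lattice_point tau m n))) by ring.
  rewrite <- !sq_scal, <- !sq_plus. apply sq_ext. intros m n. unfold zterm.
  destruct (czero m n) eqn:E; [ring|].
  generalize (/ (z + w - lattice_point tau m n)), (/ (z - lattice_point tau m n)).
  intros a b. field. apply (lp_neq_0 m n E).
Qed.

(** Translating z by a period moves the square of summation by one step, so
    zeta(z + w) - zeta(z) is a sum over two opposite edges up to a term that does not
    depend on z; by [edge_diff] the edges contribute a constant in the limit. *)
Lemma quasi_period_aux (w z z' : C) (f1 g1 f2 g2 : nat -> Z -> Z) :
  ~ in_lattice z -> ~ in_lattice (z + w) -> ~ in_lattice z' -> ~ in_lattice (z' + w) ->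
  (forall N k, (Z.abs k <= Z.of_nat N)%Z -> (Z.of_nat N <= shell (f1 N k) (g1 N k))%Z) ->
  (forall N k, (Z.abs k <= Z.of_nat N)%Z -> (Z.of_nat N <= shell (f2 N k) (g2 N k))%Z) ->
  (forall N z, sq N (fun m n => / (z + w - lattice_point tau m n)) -
   sq N (fun m n => / (z - lattice_point tau m n)) =
   sum_sym N (fun k => / (z - lattice_point tau (f1 N k) (g1 N k))) -
   sum_sym N (fun k => / (z - lattice_point tau (f2 N k) (g2 N k)))) ->
  wzeta tau (z + w) - wzeta tau z = wzeta tau (z' + w) - wzeta tau z'.
Proof.
  intros H1 H2 H3 H4 Hf1 Hf2 Ht.
  assert (L := fun x (Hx : ~ in_lattice x) => zterm_limit x (or_introl Hx)).
  assert (L1 : Climit (fun N => (sq N (zterm (z + w)) + - sq N (zterm z)) +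
    - (sq N (zterm (z' + w)) + - sq N (zterm z')))
    ((wzeta tau (z + w) + - wzeta tau z) + - (wzeta tau (z' + w) + - wzeta tau z'))).
  { apply (Climit_plus (fun N => sq N (zterm (z + w)) + - sq N (zterm z))
      (fun N => - (sq N (zterm (z' + w)) + - sq N (zterm z')))).
    - apply (Climit_plus (fun N => sq N (zterm (z + w)))); auto.
      apply (Climit_opp (fun N => sq N (zterm z))); auto.
    - apply Climit_opp. apply (Climit_plus (fun N => sq N (zterm (z' + w)))); auto.
      apply (Climit_opp (fun N => sq N (zterm z'))); auto. }
  destruct (edge_diff z z') as [K [N0 [HK HE]]].
  assert (L2 : Climit (fun N => (sq N (zterm (z + w)) + - sq N (zterm z)) +
    - (sq N (zterm (z' + w)) + - sq N (zterm z'))) 0).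
  { intros eps Heps. destruct (INR_div_small (2 * K) eps Heps) as [N1 [PN1 HN1]].
    exists (max N0 N1). intros N HN.
    assert (A := HE N ltac:(lia) ltac:(lia) (f1 N) (g1 N) (Hf1 N)).
    assert (B := HE N ltac:(lia) ltac:(lia) (f2 N) (g2 N) (Hf2 N)).
    specialize (HN1 N ltac:(lia)).
    assert (E : forall y, sq N (zterm (y + w)) + - sq N (zterm y) =
      sum_sym N (fun k => / (y - lattice_point tau (f1 N k) (g1 N k))) -
      sum_sym N (fun k => / (y - lattice_point tau (f2 N k) (g2 N k))) +
      w * sq N (fun m n => if czero m n then RtoC 0
     else / (lattice_point tau m n * lattice_point tau m n))).
    { intros y. rewrite <- Ht, <- sq_split_const. ring. }
    rewrite !E.
    assert (F : forall f g, sum_sym N (fun k => / (z - lattice_point tau (f k) (g k))) -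
      sum_sym N (fun k => / (z' - lattice_point tau (f k) (g k))) =
      sum_sym N (fun k => / (z - lattice_point tau (f k) (g k)) -
        / (z' - lattice_point tau (f k) (g k)))).
    { intros f g. transitivity (sum_sym N (fun k => / (z - lattice_point tau (f k) (g k))) +
        - (1) * sum_sym N (fun k => / (z' - lattice_point tau (f k) (g k)))); [ring|].
      rewrite <- sum_sym_scal, <- sum_sym_plus. apply sum_sym_ext. intros; ring. }
    match goal with |- (Cmod ?x < _)%R => replace x with
      ((sum_sym N (fun k => / (z - lattice_point tau (f1 N k) (g1 N k))) -
      sum_sym N (fun k => / (z' - lattice_point tau (f1 N k) (g1 N k)))) -
      (sum_sym N (fun k => / (z - lattice_point tau (f2 N k) (g2 N k))) -
      sum_sym N (fun k => / (z' - lattice_point tau (f2 N k) (g2 N k))))) by ring end.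
    rewrite !F. eapply Rle_lt_trans; [apply Cmod_triangle_minus|].
    unfold Rdiv in *. lra. }
  assert (E := Climit_unique _ _ _ L1 L2).
  replace (wzeta tau (z + w) - wzeta tau z) with
    (wzeta tau (z + w) + - wzeta tau z + - (wzeta tau (z' + w) + - wzeta tau z')
     + (wzeta tau (z' + w) - wzeta tau z')) by ring.
  rewrite E. ring.
Qed.

Lemma lattice_shift_not (z : C) (m n : Z) : ~ in_lattice z ->
  ~ in_lattice (z + lattice_point tau m n).
Proof. intros H K. apply H. eapply in_lattice_plus; eauto. Qed.

Lemma lp_10 : lattice_point tau 1 0 = 1.
Proof. unfold lattice_point. ring. Qed.

Lemma lp_01 : lattice_point tau 0 1 = tau.
Proof. unfold lattice_point. ring. Qed.

Lemma wzeta_shift_1_indep (z z' : C) : ~ in_lattice z -> ~ in_lattice z' ->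
  wzeta tau (z + 1) - wzeta tau z = wzeta tau (z' + 1) - wzeta tau z'.
Proof.
  intros H H'.
  apply (quasi_period_aux 1 z z' (fun N _ => - Z.of_nat (S N))%Z (fun _ k => k)
    (fun N _ => Z.of_nat N) (fun _ k => k)); auto.
  - rewrite <- lp_10. apply lattice_shift_not; auto.
  - rewrite <- lp_10. apply lattice_shift_not; auto.
  - intros; unfold shell; lia.
  - intros; unfold shell; lia.
  - intros N y. unfold sq.
    rewrite <- (sum_sym_shift N (fun m => sum_sym N (fun n => / (y - lattice_point tau m n)))).
    f_equal. apply sum_sym_ext. intros m. apply sum_sym_ext. intros n. f_equal.
    replace n with (n - 0)%Z at 2 by lia. rewrite lp_minus, lp_10. ring.
Qed.

Lemma wzeta_shift_tau_indep (z z' : C) : ~ in_lattice z -> ~ in_lattice z' ->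
  wzeta tau (z + tau) - wzeta tau z = wzeta tau (z' + tau) - wzeta tau z'.
Proof.
  intros H H'.
  apply (quasi_period_aux tau z z' (fun _ k => k) (fun N _ => - Z.of_nat (S N))%Z
    (fun _ k => k) (fun N _ => Z.of_nat N)); auto.
  - rewrite <- lp_01 at 1. apply lattice_shift_not; auto.
  - rewrite <- lp_01 at 1. apply lattice_shift_not; auto.
  - intros; unfold shell; lia.
  - intros; unfold shell; lia.
  - intros N y. unfold sq.
    assert (M : forall f g : Z -> C, sum_sym N f - sum_sym N g = sum_sym N (fun m => f m - g m)).
    { intros f g. transitivity (sum_sym N f + - (1) * sum_sym N g); [ring|].
      rewrite <- sum_sym_scal, <- sum_sym_plus. apply sum_sym_ext. intros; ring. }
    rewrite !M. apply sum_sym_ext. intros m.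
    rewrite <- (sum_sym_shift N (fun n => / (y - lattice_point tau m n))).
    f_equal. apply sum_sym_ext. intros n. f_equal.
    replace m with (m - 0)%Z at 2 by lia. rewrite lp_minus, lp_01. ring.
Qed.

End Lattice.

(** * The mean value property *)

Definition cis (t : R) : C := (cos t, sin t).

Lemma Cmod_cis (t : R) : Cmod (cis t) = 1%R.
Proof.
  unfold cis, Cmod. simpl. replace (cos t * (cos t * 1) + sin t * (sin t * 1))%R with 1%R.
  - apply sqrt_1.
  - assert (H := sin2_cos2 t). unfold Rsqr in H. lra.
Qed.

Lemma cis_eq (t : R) : cis t = RtoC (cos t) + Ci * RtoC (sin t).
Proof. unfold cis, RtoC, Ci, Cplus, Cmult; simpl. f_equal; ring. Qed.

Lemma polar (z : C) : exists t, z = RtoC (Cmod z) * cis t.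
Proof.
  destruct (classic (z = 0)) as [->|H].
  { exists 0%R. rewrite Cmod_0. ring. }
  apply Cmod_gt_0 in H. set (r := Cmod z) in *.
  assert (E2 := Cmod2_alt z). fold r in E2.
  assert (Hx : (-1 <= Re z / r <= 1)%R).
  { assert (A := re_le_Cmod z). fold r in A. apply Rabs_le_between in A.
    split; apply (Rmult_le_reg_r r); auto; unfold Rdiv;
      rewrite Rmult_assoc, Rinv_l by lra; lra. }
  assert (S : (1 - Rsqr (Re z / r) = Rsqr (Im z / r))%R).
  { unfold Rsqr. field_simplify_eq; [|lra]. simpl in E2. lra. }
  assert (S1 : sin (acos (Re z / r)) = Rabs (Im z / r)).
  { rewrite sin_acos by auto. rewrite S. apply sqrt_Rsqr_abs. }
  destruct (Rle_dec 0 (Im z / r)) as [Hi|Hi].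
  - exists (acos (Re z / r)). unfold cis. rewrite cos_acos, S1, Rabs_pos_eq by auto.
    destruct z as [x y]. unfold Re, Im, RtoC, Cmult; simpl. f_equal; field; lra.
  - exists (- acos (Re z / r))%R. unfold cis. rewrite cos_neg, sin_neg, cos_acos, S1 by auto.
    rewrite Rabs_left by lra.
    destruct z as [x y]. unfold Re, Im, RtoC, Cmult; simpl. f_equal; field; lra.
Qed.

Lemma cont2_cis s t : cont2 (fun _ v => cis v) s t.
Proof.
  assert (H : cont2 (fun _ v => RtoC (cos v) + Ci * RtoC (sin v)) s t).
  { apply cont2_plus.
    - apply (cont2_snd cos). apply continuity_cos.
    - apply cont2_mult; [apply cont2_const|]. apply (cont2_snd sin). apply continuity_sin. }
  intros eps Heps. destruct (H eps Heps) as [d [Hd Hw]]. exists d. split; auto.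
  intros u v Hu Hv. rewrite !cis_eq. apply (Hw u v); auto.
Qed.

Definition Rd_eps (g : R -> C) (t : R) (l : C) : Prop :=
  forall eps, (0 < eps)%R -> exists d, (0 < d)%R /\ forall h, (Rabs h < d)%R ->
    (Cmod (g (t + h)%R - g t - RtoC h * l) <= eps * Rabs h)%R.

Lemma is_derive_R_eps_inv (f : R -> R) (t l : R) : is_derive f t l ->
  forall eps, (0 < eps)%R -> exists d, (0 < d)%R /\ forall h, (Rabs h < d)%R ->
     (Rabs (f (t + h)%R - f t - h * l) <= eps * Rabs h)%R.
Proof.
  intros H eps Heps. apply is_derive_Reals in H. destruct (H eps Heps) as [d Hd].
  exists d. split; [apply cond_pos|]. intros h Hh.
  destruct (Req_dec h 0) as [->|Hn].
  - rewrite Rplus_0_r, Rminus_diag, Rmult_0_l, Rminus_0_r, Rabs_R0. lra.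
  - specialize (Hd h Hn Hh).
    replace (f (t + h) - f t - h * l)%R with (((f (t + h) - f t) / h - l) * h)%R by (field; auto).
    rewrite Rabs_mult. apply Rmult_le_compat_r; [apply Rabs_pos|lra].
Qed.

Lemma Rder_eps (g : R -> C) (t : R) (l : C) : Rder g t l <-> Rd_eps g t l.
Proof.
  split.
  - intros [A B] eps Heps.
    destruct (is_derive_R_eps_inv _ _ _ A (eps / 2) ltac:(lra)) as [d [Hd Hw]].
    destruct (is_derive_R_eps_inv _ _ _ B (eps / 2) ltac:(lra)) as [d' [Hd' Hw']].
    exists (Rmin d d'). split; [apply Rmin_pos; auto|]. intros h Hh.
    assert (X := Rmin_l d d'). assert (Y := Rmin_r d d').
    specialize (Hw h ltac:(lra)). specialize (Hw' h ltac:(lra)).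
    eapply Rle_trans; [apply Cmod_le_re_im|].
    replace (Re (g (t + h)%R - g t - RtoC h * l)) with
      (Re (g (t + h)%R) - Re (g t) - h * Re l)%R
      by (unfold Re, RtoC, Cminus, Cplus, Copp, Cmult; simpl; ring).
    replace (Im (g (t + h)%R - g t - RtoC h * l)) with
      (Im (g (t + h)%R) - Im (g t) - h * Im l)%R
      by (unfold Im, RtoC, Cminus, Cplus, Copp, Cmult; simpl; ring).
    lra.
  - intros H. split; apply is_derive_R_eps; intros eps Heps;
      destruct (H eps Heps) as [d [Hd Hw]]; exists d; split; auto;
      intros h Hh; eapply Rle_trans; [|apply (Hw h Hh)| |apply (Hw h Hh)].
    + eapply Rle_trans; [|apply re_le_Cmod]. apply Req_le. f_equal.
      unfold Re, Im, RtoC, Cplus, Cminus, Copp, Cmult; simpl. ring.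
    + eapply Rle_trans; [|apply im_le_Cmod]. apply Req_le. f_equal.
      unfold Re, Im, RtoC, Cplus, Cminus, Copp, Cmult; simpl. ring.
Qed.

(** The chain rule along a differentiable curve. *)
Lemma Cder_curve (f : C -> C) (g : R -> C) (t : R) (l v : C) :
  Cder f (g t) l -> Rder g t v -> Rder (fun s => f (g s)) t (l * v).
Proof.
  intros Hf Hg. apply Rder_eps. apply (proj1 (Rder_eps _ _ _)) in Hg. intros eps Heps.
  assert (P1 := Cmod_ge_0 l). assert (P2 := Cmod_ge_0 v).
  set (A := (1 + Cmod l + Cmod v)%R).
  assert (HA : (1 <= A)%R) by (unfold A; lra).
  set (e := Rmin 1 (eps / (2 * A))).
  assert (He : (0 < e)%R).
  { apply Rmin_pos; [lra|]. apply Rdiv_lt_0_compat; lra. }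
  assert (E1 : (e <= 1)%R) by apply Rmin_l.
  assert (E2 : (e * (2 * A) <= eps)%R).
  { assert (X : (e <= eps / (2 * A))%R) by apply Rmin_r.
    apply (Rmult_le_compat_r (2 * A)) in X; [|lra].
    replace (eps / (2 * A) * (2 * A))%R with eps in X by (field; lra). exact X. }
  destruct (Hf e He) as [d [Hd Hw]]. destruct (Hg e He) as [d' [Hd' Hw']].
  assert (Hq : (0 < d / A)%R) by (apply Rdiv_lt_0_compat; lra).
  exists (Rmin d' (d / A)). split; [apply Rmin_pos; auto|].
  intros h Hh. assert (B1 := Rmin_l d' (d / A)). assert (B2 := Rmin_r d' (d / A)).
  specialize (Hw' h ltac:(lra)).
  assert (Ht := Rabs_pos h).
  assert (T := Cmod_triangle (g (t + h)%R - g t - RtoC h * v) (RtoC h * v)).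
  replace (g (t + h)%R - g t - RtoC h * v + RtoC h * v) with (g (t + h)%R - g t) in T by ring.
  rewrite Cmod_mult, Cmod_R in T.
  assert (T2 : (Cmod (g (t + h)%R - g t) <= A * Rabs h)%R) by (unfold A; nra).
  assert (T3 : (A * Rabs h < d)%R).
  { assert (X : (Rabs h < d / A)%R) by lra.
    apply (Rmult_lt_compat_l A) in X; [|lra].
    replace (A * (d / A))%R with d in X by (field; lra). exact X. }
  specialize (Hw (g (t + h)%R) ltac:(lra)).
  replace (f (g (t + h)%R) - f (g t) - RtoC h * (l * v)) with
    ((f (g (t + h)%R) - f (g t) - (g (t + h)%R - g t) * l) +
     (g (t + h)%R - g t - RtoC h * v) * l) by ring.
  eapply Rle_trans; [apply Cmod_triangle|]. rewrite Cmod_mult.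
  assert (X1 : (e * Cmod (g (t + h)%R - g t) <= e * (A * Rabs h))%R)
    by (apply Rmult_le_compat_l; lra).
  assert (X2 : (Cmod (g (t + h)%R - g t - RtoC h * v) * Cmod l <= (e * Rabs h) * A)%R).
  { apply Rmult_le_compat; try apply Cmod_ge_0; unfold A; lra. }
  assert (X4 : (e * (2 * A) * Rabs h <= eps * Rabs h)%R) by (apply Rmult_le_compat_r; auto).
  lra.
Qed.

Lemma Rder_circle (c : C) (r t : R) :
  Rder (fun s => c + RtoC r * cis s) t (RtoC r * (Ci * cis t)).
Proof.
  split.
  - apply (is_derive_ext (fun s => Re c + r * cos s)%R).
    { intros s. unfold Re, cis, RtoC, Cplus, Cmult; simpl. ring. }
    auto_derive; auto. unfold Re, cis, RtoC, Ci, Cplus, Cmult; simpl. ring.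
  - apply (is_derive_ext (fun s => Im c + r * sin s)%R).
    { intros s. unfold Im, cis, RtoC, Cplus, Cmult; simpl. ring. }
    auto_derive; auto. unfold Im, cis, RtoC, Ci, Cplus, Cmult; simpl. ring.
Qed.

Section Mean.
Variables (g g' : C -> C) (c : C) (R0 : R).
Hypothesis Hg : forall z, (0 < Cmod (z - c) < R0)%R -> Cder g z (g' z) /\ ccont g' z.
Hypothesis Hc : ccont g c.

Let P (r t : R) : C := c + RtoC r * cis t.

Lemma circle_dist (r t : R) : (0 <= r)%R -> Cmod (P r t - c) = r.
Proof.
  intros Hr. unfold P. replace (c + RtoC r * cis t - c) with (RtoC r * cis t) by ring.
  rewrite Cmod_scal_R, Cmod_cis by auto. ring.
Qed.

Lemma circle_reg (r t : R) : (0 < r < R0)%R -> Cder g (P r t) (g' (P r t)) /\ ccont g' (P r t).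
Proof. intros Hr. apply Hg. rewrite circle_dist; lra. Qed.

Lemma cont2_P (r t : R) : cont2 P r t.
Proof.
  unfold P. apply cont2_plus; [apply cont2_const|].
  apply cont2_mult; [apply (cont2_fst (fun x => x)), continuity_pt_id|apply cont2_cis].
Qed.

Lemma circle_continuous (r t : R) : (0 < r < R0)%R ->
  continuous (fun s => Re (g (P r s))) t.
Proof.
  intros Hr. apply (cont2_continuous_snd (fun r s => g (P r s))).
  apply cont2_comp; [|apply cont2_P]. apply (Cder_ccont _ _ (g' (P r t))).
  apply circle_reg; auto.
Qed.

Lemma circle_ex_RInt (r a b : R) : (0 < r < R0)%R ->
  ex_RInt (fun s => Re (g (P r s))) a b.
Proof.
  intros Hr. apply (ex_RInt_continuous (V := R_CompleteNormedModule)). intros t _.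
  apply circle_continuous; auto.
Qed.

(** d/dr of the mean over the circle of radius r is the integral of the angular
   derivative of Im g / r, which vanishes by periodicity. *)
Lemma circle_mean_derive (r : R) : (0 < r < R0)%R ->
  is_derive (fun r => RInt (fun s => Re (g (P r s))) 0 (2 * PI)) r 0%R.
Proof.
  intros Hr. assert (Pi := PI_RGT_0).
  assert (Dr : forall r t, (0 < r < R0)%R ->
    is_derive (fun u => Re (g (P u t))) r (Re (g' (P r t) * cis t))).
  { intros r1 t Hr1. destruct (circle_reg r1 t Hr1) as [A _].
    destruct (Cder_slice g c (cis t) _ r1 A) as [X _]. exact X. }
  assert (E : RInt (fun t => Derive (fun u => Re (g (P u t))) r) 0 (2 * PI) = 0%R).
  { apply is_RInt_unique.
    apply (is_RInt_ext (fun t => Re (g' (P r t) * cis t))).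
    { intros t _. symmetry. apply is_derive_unique. apply Dr; auto. }
    replace 0%R with (minus ((fun t => / r * Im (g (P r t)))%R (2 * PI)%R)
      ((fun t => / r * Im (g (P r t)))%R 0%R)) at 2.
    2:{ replace (P r (2 * PI)) with (P r 0).
        - unfold minus, plus, opp; simpl. ring.
        - unfold P, cis. rewrite cos_2PI, sin_2PI, cos_0, sin_0. reflexivity. }
    apply (is_RInt_derive (fun t => / r * Im (g (P r t)))%R).
    - intros t _. destruct (circle_reg r t Hr) as [A _].
      destruct (Cder_curve g (fun s => P r s) t _ _ A (Rder_circle c r t)) as [_ X].
      apply (is_derive_scal _ t (/ r)%R) in X.
      replace (Re (g' (P r t) * cis t)) with
        (/ r * Im (g' (P r t) * (RtoC r * (Ci * cis t))))%R; [exact X|].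
      generalize (g' (P r t)). intros [a b].
      unfold Re, Im, RtoC, Ci, cis, Cmult; simpl. field. lra.
    - intros t _. apply (cont2_continuous_snd (fun r t => g' (P r t) * cis t)).
      apply cont2_mult; [|apply cont2_cis]. apply cont2_comp; [|apply cont2_P].
      apply circle_reg; auto. }
  set (d := Rmin r (R0 - r)).
  assert (Hd : (0 < d)%R) by (apply Rmin_pos; lra).
  assert (Hloc : forall u, (Rabs (u - r) < d)%R -> (0 < u < R0)%R).
  { intros u Hu. assert (X := Rmin_l r (R0 - r)). assert (Y := Rmin_r r (R0 - r)).
    fold d in X, Y. apply Rabs_lt_between in Hu. lra. }
  evar_last; [|exact E].
  apply (is_derive_RInt_param (fun r s => Re (g (P r s)))).
  - exists (mkposreal d Hd). intros u Hu t _. eexists. apply Dr. apply Hloc. exact Hu.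
  - intros t _. apply (continuity_2d_pt_ext_loc (fun u w => Re (g' (P u w) * cis w))).
    + exists (mkposreal d Hd). intros u w Hu _. symmetry. apply is_derive_unique.
      apply Dr. apply Hloc. exact Hu.
    + apply (cont2_continuity_2d (fun u w => g' (P u w) * cis w)).
      apply cont2_mult; [|apply cont2_cis]. apply cont2_comp; [|apply cont2_P].
      apply circle_reg; auto.
  - exists (mkposreal d Hd). intros u Hu. apply circle_ex_RInt. apply Hloc. exact Hu.
Qed.

(** The mean over a circle does not depend on the radius, and tends to the value at
    the centre by continuity. *)
Lemma mean_value (r : R) : (0 < r < R0)%R ->
  RInt (fun s => Re (g (P r s))) 0 (2 * PI) = (2 * PI * Re (g c))%R.
Proof.
  intros Hr. assert (Pi := PI_RGT_0).
  assert (X : forall eps, (0 < eps)%R ->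
    (Rabs (RInt (fun s => Re (g (P r s))) 0 (2 * PI) - 2 * PI * Re (g c)) <= 2 * PI * eps)%R).
  { intros eps Heps. destruct (Hc eps Heps) as [d [Hd Hw]].
    set (r1 := (Rmin d r / 2)%R).
    assert (Q : (0 < Rmin d r)%R) by (apply Rmin_pos; lra).
    assert (Q1 := Rmin_l d r). assert (Q2 := Rmin_r d r).
    assert (Hr1 : (0 < r1 < R0)%R) by (unfold r1; lra).
    assert (Heq : RInt (fun s => Re (g (P r1 s))) 0 (2 * PI) =
      RInt (fun s => Re (g (P r s))) 0 (2 * PI)).
    { apply (eq_is_derive (fun r => RInt (fun s => Re (g (P r s))) 0 (2 * PI))).
      - intros t Ht. apply circle_mean_derive. lra.
      - unfold r1. lra. }
    rewrite <- Heq.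
    replace (2 * PI * Re (g c))%R with (RInt (fun _ => Re (g c)) 0 (2 * PI)).
    2:{ rewrite RInt_const. unfold scal; simpl. unfold mult; simpl. ring. }
    rewrite <- (RInt_minus (V := R_CompleteNormedModule)
      (fun s => Re (g (P r1 s))) (fun _ => Re (g c))).
    - replace (2 * PI * eps)%R with ((2 * PI - 0) * eps)%R by ring.
      apply abs_RInt_le_const; [lra| |].
      + apply (ex_RInt_minus (V := R_NormedModule)); [apply circle_ex_RInt; auto|apply ex_RInt_const].
      + intros t _. apply Rlt_le. eapply Rle_lt_trans; [|apply (Hw (P r1 t))].
        * eapply Rle_trans; [|apply re_le_Cmod]. apply Req_le. reflexivity.
        * rewrite circle_dist; unfold r1; lra.
    - apply circle_ex_RInt; auto.
    - apply ex_RInt_const. }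
  destruct (Req_dec (RInt (fun s => Re (g (P r s))) 0 (2 * PI)) (2 * PI * Re (g c))) as [E|E]; auto.
  exfalso.
  assert (Y := Rabs_pos_lt _ (Rminus_eq_contra _ _ E)).
  set (D := Rabs (RInt (fun s => Re (g (P r s))) 0 (2 * PI) - 2 * PI * Re (g c))) in *.
  specialize (X (D / (4 * PI))%R ltac:(apply Rdiv_lt_0_compat; lra)).
  replace (2 * PI * (D / (4 * PI)))%R with (D / 2)%R in X by (field; lra). lra.
Qed.

(** The deficit Re g(c) - Re g is nonnegative with mean zero on each circle, so it
    vanishes there. *)
Lemma local_max_const : (forall z, (Re (g z) <= Re (g c))%R) ->
  forall z, (Cmod (z - c) < R0)%R -> Re (g z) = Re (g c).
Proof.
  intros Hmax z Hz. assert (Pi := PI_RGT_0).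
  destruct (classic (z = c)) as [->|Hne]; auto.
  assert (Pz : (0 < Cmod (z - c))%R) by (apply Cmod_gt_0, Cminus_neq_0; auto).
  destruct (polar (z - c)) as [th0 Eth].
  set (r := Cmod (z - c)) in *.
  assert (Ez : z = P r th0) by (unfold P; rewrite <- Eth; ring).
  assert (Hall : forall a, Re (g (P r a)) = Re (g c)).
  { intros a.
    (* integrate over a full turn centred at the angle a *)
    set (f := fun s => (Re (g c) - Re (g (P r s)))%R).
    assert (Cf : forall s, continuous f s).
    { intros s. apply (continuous_minus (fun _ => Re (g c)) (fun s => Re (g (P r s)))).
      - apply continuous_const.
      - apply circle_continuous. lra. }
    assert (If : forall x y, ex_RInt f x y).
    { intros x y. apply (ex_RInt_continuous (V := R_CompleteNormedModule)). auto. }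
    assert (I0 : RInt f 0 (2 * PI) = 0%R).
    { unfold f. rewrite (RInt_minus (V := R_CompleteNormedModule) (fun _ => Re (g c))
        (fun s => Re (g (P r s)))).
      - rewrite mean_value by lra. rewrite RInt_const.
        unfold minus, plus, opp, scal; simpl. unfold mult; simpl. ring.
      - apply ex_RInt_const.
      - apply circle_ex_RInt. lra. }
    assert (F0 : forall s, (0 <= f s)%R).
    { intros s. unfold f. specialize (Hmax (P r s)). lra. }
    assert (Hin : forall s, (0 < s < 2 * PI)%R -> f s = 0%R).
    { intros s Hs.
      assert (Z : forall x, (0 <= x <= 2 * PI)%R -> RInt f 0 x = 0%R).
      { intros x Hx. assert (A := RInt_ge_0 f 0 x ltac:(lra) (If _ _) ltac:(intros; apply F0)).
        assert (B := RInt_ge_0 f x (2 * PI) ltac:(lra) (If _ _) ltac:(intros; apply F0)).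
        assert (S := RInt_Chasles f 0 x (2 * PI) (If _ _) (If _ _)).
        rewrite I0 in S. unfold plus in S; simpl in S. lra. }
      assert (D1 : is_derive (fun x => RInt f 0 x) s (f s)).
      { apply (is_derive_RInt f (fun x => RInt f 0 x) 0).
        - exists (mkposreal 1 Rlt_0_1). intros x _.
          apply (RInt_correct (V := R_CompleteNormedModule)). apply If.
        - apply Cf. }
      assert (D2 : is_derive (fun x => RInt f 0 x) s 0%R).
      { apply (is_derive_ext_loc (fun _ => 0%R)).
        - assert (Hd : (0 < Rmin s (2 * PI - s))%R) by (apply Rmin_pos; lra).
          exists (mkposreal _ Hd). intros x Hx. simpl in Hx.
          assert (X := Rmin_l s (2 * PI - s)). assert (Y := Rmin_r s (2 * PI - s)).
          apply Rabs_lt_between in Hx. unfold minus, plus, opp in Hx; simpl in Hx.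
          symmetry. apply Z. lra.
        - apply (is_derive_const (V := R_NormedModule)). }
      apply is_derive_unique in D1. apply is_derive_unique in D2. congruence. }
    (* every angle agrees with the half-turn up to continuity at the endpoints *)
    assert (Hper : forall s, f (s + 2 * PI)%R = f s).
    { intros s. unfold f, P, cis.
      replace (s + 2 * PI)%R with (s + 2 * INR 1 * PI)%R by (simpl; ring).
      rewrite cos_period, sin_period. reflexivity. }
    assert (Hper2 : forall (n : nat) s, f (s + 2 * INR n * PI)%R = f s).
    { intros n s. unfold f, P, cis. rewrite cos_period, sin_period. reflexivity. }
    assert (Hf0 : f 0%R = 0%R).
    { destruct (Req_dec (f 0%R) 0) as [E|E]; auto. exfalso.
      assert (Pf : (0 < f 0%R)%R) by (specialize (F0 0%R); lra).
      assert (Cf0 := Cf 0%R). apply filterlim_locally with (eps := mkposreal _ Pf) in Cf0.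
      destruct Cf0 as [d Hd].
      set (s := Rmin (d / 2) 1). assert (Pd := cond_pos d).
      assert (Hs : (0 < s)%R) by (apply Rmin_pos; lra).
      assert (Hs1 : (s <= 1)%R) by apply Rmin_r.
      assert (Hs2 : (s <= d / 2)%R) by apply Rmin_l.
      assert (P4 := PI2_1).
      specialize (Hd s). rewrite (Hin s) in Hd by lra.
      assert (Hb : ball 0%R d s).
      { unfold ball; simpl. unfold AbsRing_ball, abs, minus, plus, opp; simpl.
        rewrite Ropp_0, Rplus_0_r, Rabs_pos_eq; lra. }
      specialize (Hd Hb). unfold ball in Hd; simpl in Hd.
      unfold AbsRing_ball, abs, minus, plus, opp in Hd; simpl in Hd.
      rewrite Rplus_0_l, Rabs_Ropp, Rabs_pos_eq in Hd; lra. }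
    assert (Hpos : forall b, (0 <= b)%R -> f b = 0%R).
    { intros b Hb. destruct (euclidian_division b (2 * PI)) as [k [s [Es Hs]]]; [lra|].
      rewrite Rabs_pos_eq in Hs by lra.
      assert (Hk : (0 <= k)%Z).
      { apply le_IZR. apply Rnot_lt_le. intros Hk. assert (IZR k <= -1)%R.
        { assert (k < 0)%Z by (apply lt_IZR; auto). apply IZR_le. lia. } nra. }
      rewrite Es. replace (IZR k * (2 * PI) + s)%R with (s + 2 * INR (Z.to_nat k) * PI)%R.
      - rewrite Hper2. destruct (Req_dec s 0) as [->|Hs0]; auto. apply Hin. lra.
      - rewrite INR_IZR_INZ, Z2Nat.id by auto. ring. }
    assert (Ea : f a = 0%R).
    { destruct (Rle_dec 0 a) as [Ha|Ha]; [auto|].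
      destruct (INR_unbounded (- a / (2 * PI))) as [n Hn].
      rewrite <- (Hper2 n a). apply Hpos.
      apply (Rmult_lt_compat_r (2 * PI)) in Hn; [|lra].
      replace (- a / (2 * PI) * (2 * PI))%R with (- a)%R in Hn by (field; lra). lra. }
    unfold f in Ea. lra. }
  rewrite Ez. apply Hall.
Qed.

End Mean.

(** * Maximum principle on the torus *)

(** Maximize first in one variable, then in the other. *)
Lemma max_2d (f : R -> R -> R) (a b c d : R) : (a <= b)%R -> (c <= d)%R ->
  (forall s t, continuity_2d_pt f s t) ->
  exists s0 t0, forall s t, (a <= s <= b)%R -> (c <= t <= d)%R -> (f s t <= f s0 t0)%R.
Proof.
  intros Hab Hcd Hf.
  assert (HS : forall t, exists s, (forall x, (a <= x <= b)%R -> (f x t <= f s t)%R) /\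
    (a <= s <= b)%R).
  { intros t. apply (continuity_ab_maj (fun x => f x t) a b Hab). intros x _ eps Heps.
    destruct (Hf x t (mkposreal eps Heps)) as [e He]. exists e.
    split; [apply cond_pos|]. intros y [_ Hy]. apply He; auto.
    rewrite Rminus_diag, Rabs_R0. apply cond_pos. }
  set (m := fun t => proj1_sig (constructive_indefinite_description _ (HS t))).
  assert (Hm : forall t, (forall x, (a <= x <= b)%R -> (f x t <= f (m t) t)%R) /\
    (a <= m t <= b)%R).
  { intros t. exact (proj2_sig (constructive_indefinite_description _ (HS t))). }
  set (M := fun t => f (m t) t).
  destruct (continuity_ab_maj M c d Hcd) as [t0 [Ht0 _]].
  - intros t _ eps Heps.
    destruct (uniform_continuity_2d_1d f a b t (fun x _ => Hf x t) (mkposreal eps Heps))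
      as [e He]. simpl in He.
    exists e. split; [apply cond_pos|]. intros y [_ Hy].
    unfold dist in Hy; simpl in Hy; unfold R_dist in Hy.
    apply Rabs_lt_between in Hy. assert (Pe := cond_pos e).
    destruct (Hm t) as [A1 A2]. destruct (Hm y) as [B1 B2].
    assert (U : forall x, (a <= x <= b)%R -> (Rabs (f x y - f x t) < eps)%R).
    { intros x Hx. apply He; auto; try lra. rewrite Rminus_diag, Rabs_R0. auto. }
    unfold dist; simpl; unfold R_dist, M.
    assert (U1 := U _ A2). assert (U2 := U _ B2).
    specialize (A1 _ B2). specialize (B1 _ A2).
    apply Rabs_lt_between in U1. apply Rabs_lt_between in U2.
    apply Rabs_lt_between. lra.
  - exists (m t0), t0. intros s t Hs Ht.
    eapply Rle_trans; [apply (proj1 (Hm t)); auto|]. apply Ht0; auto.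
Qed.

Lemma seg_dist (a b : C) (s t : R) :
  Cmod (seg a b s - seg a b t) = (Rabs (s - t) * Cmod (b - a))%R.
Proof.
  unfold seg. replace (a + RtoC s * (b - a) - (a + RtoC t * (b - a))) with
    (RtoC (s - t) * (b - a)) by (rewrite RtoC_minus; ring).
  rewrite Cmod_mult, Cmod_R. reflexivity.
Qed.

(** Connectedness of segments, in the form used throughout: a property of points
   that spreads to a disc around each point near which it holds somewhere. *)
Lemma seg_propagate (Q : C -> Prop) (a b : C) :
  Q a ->
  (forall t, (0 <= t <= 1)%R -> exists r, (0 < r)%R /\
     ((exists s, (0 <= s <= 1)%R /\ (Cmod (seg a b s - seg a b t) < r)%R /\ Q (seg a b s)) ->
      forall s, (0 <= s <= 1)%R -> (Cmod (seg a b s - seg a b t) < r)%R -> Q (seg a b s))) ->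
  Q b.
Proof.
  intros Ha H.
  set (E := fun t => (0 <= t <= 1)%R /\ forall s, (0 <= s <= t)%R -> Q (seg a b s)).
  assert (E0 : E 0%R).
  { split; [lra|]. intros s Hs. replace s with 0%R by lra. rewrite seg_0. auto. }
  destruct (completeness E) as [T [U L]].
  { exists 1%R. intros t [Ht _]. lra. }
  { exists 0%R. auto. }
  assert (T0 : (0 <= T)%R) by (apply U; auto).
  assert (T1 : (T <= 1)%R) by (apply L; intros t [Ht _]; lra).
  destruct (H T ltac:(lra)) as [r [Hr Hloc]].
  set (L0 := (1 + Cmod (b - a))%R).
  assert (HL0 : (0 < L0)%R) by (unfold L0; assert (X := Cmod_ge_0 (b - a)); lra).
  assert (Hnear : forall s, (Rabs (s - T) < r / L0)%R -> (Cmod (seg a b s - seg a b T) < r)%R).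
  { intros s Hs. rewrite seg_dist. apply (Rmult_lt_compat_r L0) in Hs; auto.
    replace (r / L0 * L0)%R with r in Hs by (field; lra).
    assert (X := Rabs_pos (s - T)). unfold L0 in Hs. nra. }
  assert (Hq : (0 < r / L0)%R) by (apply Rdiv_lt_0_compat; auto).
  assert (HE : exists t, E t /\ (T - r / L0 < t)%R).
  { apply NNPP. intros Hn. assert (B : is_upper_bound E (T - r / L0)).
    { intros t Ht. apply Rnot_lt_le. intros Hl. apply Hn. exists t. auto. }
    specialize (L _ B). lra. }
  destruct HE as [t [Ht Hlt]].
  assert (HtT : (t <= T)%R) by (apply U; auto).
  assert (Hex : exists s, (0 <= s <= 1)%R /\ (Cmod (seg a b s - seg a b T) < r)%R /\
    Q (seg a b s)).
  { exists t. split; [apply Ht|]. split.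
    - apply Hnear. apply Rabs_lt_between. lra.
    - apply Ht. split; [apply Ht|lra]. }
  specialize (Hloc Hex).
  set (t1 := Rmin 1 (T + r / L0 / 2)).
  assert (A1 := Rmin_l 1 (T + r / L0 / 2)). assert (A2 := Rmin_r 1 (T + r / L0 / 2)).
  fold t1 in A1, A2.
  assert (A3 : (0 <= t1)%R) by (apply Rmin_glb; lra).
  assert (HE1 : E t1).
  { split; [lra|]. intros s Hs. destruct (Rle_dec s t) as [Hst|Hst].
    - apply Ht. lra.
    - apply Hloc; [lra|]. apply Hnear. apply Rabs_lt_between. lra. }
  assert (A4 : (t1 <= T)%R) by (apply U; auto).
  assert (E1 : t1 = 1%R).
  { unfold t1 in *. destruct (Rle_dec 1 (T + r / L0 / 2)).
    - apply Rmin_left; auto.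
    - rewrite Rmin_right in A4 by lra. lra. }
  rewrite <- (seg_1 a b). apply HE1. lra.
Qed.

Definition cfloor (x : R) : R := IZR (Int_part x).

Lemma cfloor_bound (x : R) : (0 <= x - cfloor x <= 1)%R.
Proof. unfold cfloor. destruct (base_Int_part x). lra. Qed.

Section Torus.
Variable tau : C.
Hypothesis Htau : (0 < Im tau)%R.

Definition periodic {X : Type} (v : C -> X) : Prop :=
  (forall z, v (z + 1) = v z) /\ (forall z, v (z + tau) = v z).

Lemma periodic_nat {X : Type} (v : C -> X) (w : C) : (forall z, v (z + w) = v z) ->
  forall (n : nat) z, v (z + RtoC (INR n) * w) = v z.
Proof.
  intros H n. induction n as [|n IH]; intros z.
  - simpl. f_equal. ring.
  - rewrite S_INR, RtoC_plus. replace (z + (RtoC (INR n) + 1) * w) with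
      (z + RtoC (INR n) * w + w) by ring. rewrite H. apply IH.
Qed.

Lemma periodic_Z {X : Type} (v : C -> X) (w : C) : (forall z, v (z + w) = v z) ->
  forall (n : Z) z, v (z + RtoC (IZR n) * w) = v z.
Proof.
  intros H n z. destruct (Z_le_gt_dec 0 n) as [Hn|Hn].
  - rewrite <- (Z2Nat.id n Hn), <- INR_IZR_INZ. apply periodic_nat; auto.
  - rewrite <- (periodic_nat v w H (Z.to_nat (- n)) (z + RtoC (IZR n) * w)).
    f_equal. rewrite INR_IZR_INZ, Z2Nat.id by lia. rewrite opp_IZR, RtoC_opp. ring.
Qed.

Lemma periodic_lattice {X : Type} (v : C -> X) : periodic v ->
  forall m n z, v (z + lattice_point tau m n) = v z.
Proof.
  intros [H1 H2] m n z. unfold lattice_point.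
  replace (z + (RtoC (IZR m) + RtoC (IZR n) * tau)) with
    (z + RtoC (IZR m) * 1 + RtoC (IZR n) * tau) by ring.
  rewrite (periodic_Z v tau H2), (periodic_Z v 1 H1). reflexivity.
Qed.

(** The representative in the closed fundamental parallelogram. *)
Definition torus_rep (z : C) : C := RtoC (cs tau z - cfloor (cs tau z)) +
  RtoC (ct tau z - cfloor (ct tau z)) * tau.

Lemma periodic_rep {X : Type} (v : C -> X) : periodic v -> forall z, v z = v (torus_rep z).
Proof.
  intros H z. rewrite <- (periodic_lattice v H (Int_part (cs tau z)) (Int_part (ct tau z))
    (torus_rep z)). f_equal.
  rewrite (coords tau Htau z) at 1. unfold torus_rep, lattice_point, cfloor.
  rewrite !RtoC_minus. ring.
Qed.

(** A periodic function takes all its values on a compact parallelogram. *)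
Lemma torus_max (g : C -> C) : (forall z, ccont g z) -> periodic (fun z => Re (g z)) ->
  exists p, forall z, (Re (g z) <= Re (g p))%R.
Proof.
  intros Hg Hp.
  destruct (max_2d (fun s t => Re (g (RtoC s + RtoC t * tau))) 0 1 0 1) as [s0 [t0 H]]; try lra.
  - intros s t. apply (cont2_continuity_2d (fun s t => g (RtoC s + RtoC t * tau))).
    apply cont2_comp; auto. apply cont2_plus.
    + apply (cont2_fst (fun x => x)), continuity_pt_id.
    + apply cont2_mult; [apply (cont2_snd (fun x => x)), continuity_pt_id|apply cont2_const].
  - exists (RtoC s0 + RtoC t0 * tau). intros z. rewrite (periodic_rep _ Hp z).
    apply H; apply cfloor_bound.
Qed.

(** An isolated set of exceptional points, where g is only assumed continuous,
   does not disturb the mean value property. *)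
Lemma torus_const (g : C -> C) : (forall z, ccont g z) -> periodic (fun z => Re (g z)) ->
  (forall c, exists R0 g', (0 < R0)%R /\ forall z, (0 < Cmod (z - c) < R0)%R ->
     Cder g z (g' z) /\ ccont g' z) ->
  exists k, forall z, Re (g z) = k.
Proof.
  intros Hg Hp Hh. destruct (torus_max g Hg Hp) as [p Hmax].
  exists (Re (g p)). intros z.
  apply (seg_propagate (fun x => Re (g x) = Re (g p)) p z eq_refl).
  intros t Ht. set (c := seg p z t).
  (* either the maximum is attained at c, and g is constant around c, or by
     continuity it is attained nowhere near c *)
  destruct (classic (Re (g c) = Re (g p))) as [E|E].
  - destruct (Hh c) as [R0 [g' [HR0 Hd]]]. exists R0. split; auto. intros _ s Hs Hd2.
    rewrite (local_max_const g g' c R0 Hd (Hg c)); auto.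
    intros y. rewrite E. apply Hmax.
  - assert (Hlt : (0 < Re (g p) - Re (g c))%R) by (specialize (Hmax c); lra).
    destruct (Hg c _ Hlt) as [d [Hd Hw]]. exists d. split; auto.
    intros [s [Hs [Hd2 E2]]]. exfalso. specialize (Hw _ Hd2).
    assert (X := re_le_Cmod' (g (seg p z s) - g c)).
    replace (Re (g (seg p z s) - g c)) with (Re (g (seg p z s)) - Re (g c))%R in X
      by (unfold Re, Cminus, Cplus, Copp; simpl; ring).
    rewrite E2 in X. lra.
Qed.

(** * Liouville's theorem for quasi-periodic functions *)

(** The limit at c over the punctured discs around c. *)
Definition plim (f : C -> C) (c l : C) : Prop :=
  forall eps, (0 < eps)%R -> exists d, (0 < d)%R /\ forall z,
    (0 < Cmod (z - c) < d)%R -> (Cmod (f z - l) < eps)%R.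

(** Continuously differentiable near z. Continuity of the derivative is carried along
    because primitives and circle means are taken with real integrals. *)
Definition locC1 (f : C -> C) (z : C) : Prop :=
  exists r f', (0 < r)%R /\ forall w, (Cmod (w - z) < r)%R -> Cder f w (f' w) /\ ccont f' w.

Lemma plim_unique f c l m : plim f c l -> plim f c m -> l = m.
Proof.
  intros H K. apply Cmod_eps_eq. intros eps Heps.
  destruct (H (eps / 2)%R) as [d [Hd Hw]]; [lra|].
  destruct (K (eps / 2)%R) as [d' [Hd' Hw']]; [lra|].
  set (t := (Rmin d d' / 2)%R).
  assert (Q := Rmin_pos d d' Hd Hd'). assert (Q1 := Rmin_l d d'). assert (Q2 := Rmin_r d d').
  assert (Et : Cmod (c + RtoC t - c) = t).
  { replace (c + RtoC t - c) with (RtoC t) by ring. rewrite Cmod_R, Rabs_pos_eq; auto.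
    unfold t; lra. }
  specialize (Hw (c + RtoC t)). specialize (Hw' (c + RtoC t)). rewrite Et in *.
  specialize (Hw ltac:(unfold t; lra)). specialize (Hw' ltac:(unfold t; lra)).
  eapply Rle_trans; [apply (Cmod_chain l (f (c + RtoC t)) m)|].
  rewrite (Cmod_minus_sym l). lra.
Qed.

Lemma ccont_plim f c : ccont f c -> plim f c (f c).
Proof.
  intros H eps Heps. destruct (H eps Heps) as [d [Hd Hw]]. exists d. split; auto.
  intros z Hz. apply Hw. lra.
Qed.

Lemma plim_shift f c w l : plim f (c + w) l -> plim (fun z => f (z + w)) c l.
Proof.
  intros H eps Heps. destruct (H eps Heps) as [d [Hd Hw]]. exists d. split; auto.
  intros z Hz. apply Hw. replace (z + w - (c + w)) with (z - c) by ring. auto.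
Qed.

Lemma plim_ext f g c l r : (0 < r)%R ->
  (forall z, (0 < Cmod (z - c) < r)%R -> f z = g z) -> plim f c l -> plim g c l.
Proof.
  intros Hr E H eps Heps. destruct (H eps Heps) as [d [Hd Hw]]. exists (Rmin d r).
  split; [apply Rmin_pos; auto|]. intros z Hz.
  assert (Q1 := Rmin_l d r). assert (Q2 := Rmin_r d r).
  rewrite <- E by lra. apply Hw. lra.
Qed.

Lemma plim_plus f g c l m : plim f c l -> plim g c m -> plim (fun z => f z + g z) c (l + m).
Proof.
  intros H K eps Heps.
  destruct (H (eps / 2)%R) as [d [Hd Hw]]; [lra|].
  destruct (K (eps / 2)%R) as [d' [Hd' Hw']]; [lra|].
  exists (Rmin d d'). split; [apply Rmin_pos; auto|]. intros z Hz.
  assert (Q1 := Rmin_l d d'). assert (Q2 := Rmin_r d d').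
  replace (f z + g z - (l + m)) with ((f z - l) + (g z - m)) by ring.
  eapply Rle_lt_trans; [apply Cmod_triangle|].
  specialize (Hw z ltac:(lra)). specialize (Hw' z ltac:(lra)). lra.
Qed.

Lemma plim_const a c : plim (fun _ => a) c a.
Proof. apply (ccont_plim (fun _ => a)). apply ccont_const. Qed.

Lemma locC1_unique f z : locC1 f z -> exists l, Cder f z l.
Proof.
  intros [r [f' [Hr H]]]. exists (f' z). apply H.
  replace (z - z) with (RtoC 0) by ring. rewrite Cmod_0. auto.
Qed.

Lemma locC1_ccont f z : locC1 f z -> ccont f z.
Proof. intros H. destruct (locC1_unique f z H) as [l Hl]. apply (Cder_ccont _ _ _ Hl). Qed.

(** A choice of the derivative, with a junk value where there is none. *)
Definition der (f : C -> C) (z : C) : C := epsilon (inhabits (RtoC 0)) (Cder f z).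

Lemma der_eq f z l : Cder f z l -> der f z = l.
Proof.
  intros H. apply (Cder_unique f z); auto. unfold der. apply epsilon_spec. exists l. auto.
Qed.

Lemma locC1_der f z : locC1 f z -> Cder f z (der f z) /\ ccont (der f) z.
Proof.
  intros [r [f' [Hr H]]].
  assert (Hz : (Cmod (z - z) < r)%R).
  { replace (z - z) with (RtoC 0) by ring. rewrite Cmod_0. auto. }
  split.
  - destruct (H z Hz) as [A _]. rewrite (der_eq f z _ A). exact A.
  - apply (ccont_locally_ext f' _ z r Hr).
    + intros w Hw. symmetry. apply der_eq. apply H; auto.
    + apply H; auto.
Qed.

Lemma singular_plus (z : C) (m n : Z) : singular tau (z + lattice_point tau m n) -> singular tau z.
Proof.
  intros [a [b E]]. exists (a - (m + m))%Z, (b - (n + n))%Z.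
  rewrite lp_minus, lp_plus.
  replace z with (z + lattice_point tau m n - lattice_point tau m n) by ring. rewrite E. field.
Qed.

Lemma singular_1 z : singular tau (z + 1) <-> singular tau z.
Proof.
  split; intros H.
  - apply (singular_plus z 1 0). rewrite lp_10. auto.
  - apply (singular_plus (z + 1) (-1) 0).
    replace (z + 1 + lattice_point tau (-1) 0) with z; auto. unfold lattice_point. simpl.
    rewrite opp_IZR || idtac. replace (RtoC (-1)) with (- (1)) by (rewrite <- RtoC_opp; auto). ring.
Qed.

Lemma singular_tau z : singular tau (z + tau) <-> singular tau z.
Proof.
  split; intros H.
  - apply (singular_plus z 0 1). rewrite lp_01. auto.
  - apply (singular_plus (z + tau) 0 (-1)).
    replace (z + tau + lattice_point tau 0 (-1)) with z; auto. unfold lattice_point.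
    replace (RtoC (-1)) with (- (1)) by (rewrite <- RtoC_opp; auto). ring.
Qed.

Lemma nonsingular_disc (z : C) : ~ singular tau z -> exists r, (0 < r)%R /\
  forall w, (Cmod (w - z) < r)%R -> ~ singular tau w.
Proof.
  intros Hz. destruct (singular_isolated tau Htau z) as [r [Hr H]]. exists r. split; auto.
  intros w Hw Hs. destruct (classic (w = z)) as [->|Hne]; auto.
  specialize (H w Hs Hne). rewrite Cmod_minus_sym in H. lra.
Qed.

Lemma liouville_Re (f : C -> C) (mu : C) :
  (forall z, ccont f z) -> (forall z, ~ singular tau z -> locC1 f z) ->
  periodic (fun z => Re (f z - mu * z)) ->
  exists k, forall z, Re (f z - mu * z) = k.
Proof.
  intros Hc Hl Hp. apply (torus_const (fun z => f z - mu * z)); auto.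
  - intros z. apply ccont_minus; auto. apply ccont_mult; [apply ccont_const|apply ccont_id].
  - intros c. destruct (singular_isolated tau Htau c) as [r [Hr H]].
    exists r, (fun z => der f z - mu * 1). split; auto. intros z Hz.
    assert (Hn : ~ singular tau z).
    { intros Hs. assert (Hne : z <> c).
      { intros ->. replace (c - c) with (RtoC 0) in Hz by ring. rewrite Cmod_0 in Hz. lra. }
      specialize (H z Hs Hne). rewrite Cmod_minus_sym in H. lra. }
    destruct (locC1_der f z (Hl z Hn)) as [A B]. split.
    + apply Cder_minus; auto. apply Cder_scal. apply Cder_id.
    + apply ccont_minus; auto. apply ccont_const.
Qed.

(** A function with additive quasi-periods minus the real-linear map with the same
    periods is periodic; its real part is Re (f - mu z), to which the maximum principle
    applies, and likewise for the imaginary part. *)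
Lemma liouville_cont (f : C -> C) (A B : C) :
  (forall z, ccont f z) -> (forall z, ~ singular tau z -> locC1 f z) ->
  (forall z, f (z + 1) = f z + A) -> (forall z, f (z + tau) = f z + B) ->
  exists k, forall z, f z = RtoC (cs tau z) * A + RtoC (ct tau z) * B + k.
Proof.
  intros Hc Hl H1 H2.
  (* a real-linear form with prescribed values on 1 and tau is Re (mu z) *)
  assert (X : forall g a b, (forall z, ccont g z) -> (forall z, ~ singular tau z -> locC1 g z) ->
    (forall z, Re (g (z + 1)%C) = Re (g z) + a)%R -> (forall z, Re (g (z + tau)%C) = Re (g z) + b)%R ->
    exists k, forall z, Re (g z) = (cs tau z * a + ct tau z * b + k)%R).
  { intros g a b Gc Gl G1 G2.
    (* solves Re mu = a, Re (mu tau) = b *)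
    set (mu := (a, (a * Re tau - b) / Im tau)%R : C).
    assert (M : forall z, Re (mu * z) = (cs tau z * a + ct tau z * b)%R).
    { intros z. unfold cs, ct, mu. destruct z as [x y], tau as [p q0].
      unfold Re, Im in *; simpl in *. field. lra. }
    destruct (liouville_Re g mu Gc Gl) as [k Hk].
    - split; intros z.
      + replace (Re (g (z + 1)%C - mu * (z + 1))) with
          (Re (g (z + 1)%C) - Re (mu * z) - Re mu)%R
          by (unfold Re, RtoC, Cminus, Cplus, Copp, Cmult; simpl; ring).
        rewrite G1. unfold mu, Re, Cminus, Cplus, Copp, Cmult; simpl. ring.
      + replace (Re (g (z + tau)%C - mu * (z + tau))) with
          (Re (g (z + tau)%C) - Re (mu * z) - Re (mu * tau))%R
          by (unfold Re, Cminus, Cplus, Copp, Cmult; simpl; ring).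
        rewrite G2. replace (Re (mu * tau)) with b.
        * unfold Re, Cminus, Cplus, Copp, Cmult; simpl. ring.
        * unfold mu. destruct tau as [p q0]. unfold Re, Im in *; simpl in *. field. lra.
    - exists k. intros z. specialize (Hk z). rewrite <- M.
      unfold Re, Cminus, Cplus, Copp in *; simpl in *. lra. }
  destruct (X f (Re A) (Re B) Hc Hl) as [k1 K1].
  { intros z. rewrite H1. reflexivity. }
  { intros z. rewrite H2. reflexivity. }
  destruct (X (fun z => - Ci * f z) (Im A) (Im B)) as [k2 K2].
  { intros z. apply ccont_mult; [apply ccont_const|auto]. }
  { intros z Hz. destruct (Hl z Hz) as [r [f' [Hr Hf]]].
    exists r, (fun w => - Ci * f' w). split; auto. intros w Hw. destruct (Hf w Hw).
    split; [apply Cder_scal; auto|]. apply ccont_mult; [apply ccont_const|auto]. }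
  { intros z. rewrite H1. unfold Re, Im, Ci, Cplus, Copp, Cmult; simpl. ring. }
  { intros z. rewrite H2. unfold Re, Im, Ci, Cplus, Copp, Cmult; simpl. ring. }
  exists (k1, k2). intros z. specialize (K1 z). specialize (K2 z).
  replace (Re (- Ci * f z)) with (Im (f z)) in K2
    by (unfold Re, Im, Ci, Copp, Cmult; simpl; ring).
  destruct (f z) as [u v]. unfold Re, Im, RtoC, Cplus, Cmult in *; simpl in *.
  rewrite K1, K2. f_equal; ring.
Qed.

(** After removing the singularities f is the real-linear map with f(1) = A,
    f(tau) = B, up to a constant; as f is complex differentiable at some point, this map
    is complex linear. *)
Lemma liouville (f : C -> C) (A B : C) :
  (forall z, ~ singular tau z -> locC1 f z) ->
  (forall z, ~ singular tau z -> f (z + 1) = f z + A) ->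
  (forall z, ~ singular tau z -> f (z + tau) = f z + B) ->
  (forall c, singular tau c -> exists l, plim f c l) ->
  B = A * tau /\ exists k, (forall z, ~ singular tau z -> f z = A * z + k) /\
    (forall c, singular tau c -> plim f c (A * c + k)).
Proof.
  intros Hl H1 H2 Hs.
  assert (Hlim : forall c, exists l, plim f c l).
  { intros c. destruct (classic (singular tau c)) as [Hc|Hc]; auto.
    exists (f c). apply ccont_plim. apply locC1_ccont. auto. }
  set (F := fun c => proj1_sig (constructive_indefinite_description _ (Hlim c))).
  assert (HF : forall c, plim f c (F c)).
  { intros c. exact (proj2_sig (constructive_indefinite_description _ (Hlim c))). }
  assert (Freg : forall z, ~ singular tau z -> F z = f z).
  { intros z Hz. apply (plim_unique f z); auto. apply ccont_plim. apply locC1_ccont. auto. }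
  assert (Fpunct : forall c, exists r, (0 < r)%R /\
    forall z, (0 < Cmod (z - c) < r)%R -> ~ singular tau z).
  { intros c. destruct (singular_isolated tau Htau c) as [r [Hr H]]. exists r. split; auto.
    intros z Hz Hz2. assert (Hne : z <> c).
    { intros ->. replace (c - c) with (RtoC 0) in Hz by ring. rewrite Cmod_0 in Hz. lra. }
    specialize (H z Hz2 Hne). rewrite Cmod_minus_sym in H. lra. }
  assert (Fc : forall z, ccont F z).
  { intros z eps Heps. destruct (HF z eps Heps) as [d [Hd Hw]].
    destruct (Fpunct z) as [r [Hr Hp]]. exists (Rmin d r). split; [apply Rmin_pos; auto|].
    intros w Hwd. assert (Q1 := Rmin_l d r). assert (Q2 := Rmin_r d r).
    destruct (classic (w = z)) as [->|Hne].
    - replace (F z - F z) with (RtoC 0) by ring. rewrite Cmod_0. auto.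
    - assert (Pw : (0 < Cmod (w - z))%R) by (apply Cmod_gt_0, Cminus_neq_0; auto).
      rewrite Freg by (apply Hp; lra). apply Hw. lra. }
  assert (Fl : forall z, ~ singular tau z -> locC1 F z).
  { intros z Hz. destruct (nonsingular_disc z Hz) as [r0 [Hr0 Hn]].
    destruct (Hl z Hz) as [r [f' [Hr Hf]]]. exists (Rmin r (r0 / 2)), f'.
    split; [apply Rmin_pos; lra|]. intros w Hw.
    assert (Q1 := Rmin_l r (r0 / 2)). assert (Q2 := Rmin_r r (r0 / 2)).
    destruct (Hf w ltac:(lra)) as [X Y]. split; auto.
    apply (Cder_locally_ext f F w _ (r0 / 2)); auto; [lra|]. intros y Hy.
    symmetry. apply Freg. apply Hn. assert (T := Cmod_chain y w z). lra. }
  assert (Fper : forall w D, (forall z, singular tau (z + w) <-> singular tau z) ->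
     (forall z, ~ singular tau z -> f (z + w) = f z + D) -> forall z, F (z + w) = F z + D).
  { intros w D Hw HD z. apply (plim_unique (fun y => f (y + w)) z).
    - apply plim_shift. apply HF.
    - destruct (Fpunct z) as [r [Hr Hp]].
      apply (plim_ext (fun y => f y + D) _ z _ r Hr).
      + intros y Hy. symmetry. apply HD. apply Hp; auto.
      + apply plim_plus; [apply HF|apply plim_const]. }
  destruct (liouville_cont F A B Fc Fl (Fper 1 A singular_1 H1) (Fper tau B singular_tau H2))
    as [k Hk].
  assert (Lin : forall a b s t, cs tau (a * RtoC s + b) = (s * cs tau a + cs tau b)%R /\
     ct tau (a * RtoC t + b) = (t * ct tau a + ct tau b)%R).
  { intros a b s t. unfold cs, ct, Re, Im, RtoC, Cplus, Cmult; simpl. split; field; unfold Im in Htau; lra. }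
  (* compare the difference quotients in the directions 1 and tau at a regular point *)
  assert (HBA : B = A * tau).
  { assert (Hq : exists z, ~ singular tau z).
    { destruct (Fpunct 0) as [r [Hr Hp]]. exists (RtoC (r / 2)). apply Hp.
      replace (RtoC (r / 2) - 0) with (RtoC (r / 2)) by ring. rewrite Cmod_R, Rabs_pos_eq; lra. }
    destruct Hq as [z Hz]. destruct (locC1_unique F z (Fl z Hz)) as [l Hd].
    assert (S : forall v D, (forall h, F (z + RtoC h * v) = F z + RtoC h * D) -> D = l * v).
    { intros v D Hv.
      assert (E : z = z + RtoC 0 * v) by ring. rewrite E in Hd.
      assert (Y := Cder_slice F z v l 0 Hd).
      assert (Y2 := Rder_lin (F z) D 0).
      destruct Y as [Ya Yb]. destruct Y2 as [Za Zb].
      assert (Ea : forall h, F (z + RtoC h * v) = F z + RtoC h * D) by auto.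
      apply (is_derive_ext _ (fun s => Re (F z + RtoC s * D))) in Ya; [|intros; rewrite Ea; auto].
      apply (is_derive_ext _ (fun s => Im (F z + RtoC s * D))) in Yb; [|intros; rewrite Ea; auto].
      apply is_derive_unique in Ya. apply is_derive_unique in Yb.
      apply is_derive_unique in Za. apply is_derive_unique in Zb.
      assert (R1 : Re D = Re (l * v)) by congruence.
      assert (R2 : Im D = Im (l * v)) by congruence.
      destruct D, (l * v). unfold Re, Im in *; simpl in *. congruence. }
    assert (SA : A = l * 1).
    { apply S. intros h. rewrite !Hk.
      replace (z + RtoC h * 1) with (1 * RtoC h + z) by ring.
      destruct (Lin 1 z h h) as [-> ->].
      assert (E1 : RtoC 1 = RtoC 1 + RtoC 0 * tau) by ring.
      assert (C1 := cs_coords tau Htau 1 0). assert (C2 := ct_coords tau Htau 1 0).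
      rewrite <- E1 in C1, C2. rewrite C1, C2.
      rewrite !RtoC_plus, !RtoC_mult. ring. }
    assert (SB : B = l * tau).
    { apply S. intros h. rewrite !Hk.
      replace (z + RtoC h * tau) with (tau * RtoC h + z) by ring.
      destruct (Lin tau z h h) as [-> ->].
      assert (E1 : tau = RtoC 0 + RtoC 1 * tau) by ring.
      assert (C1 := cs_coords tau Htau 0 1). assert (C2 := ct_coords tau Htau 0 1).
      rewrite <- E1 in C1, C2. rewrite C1, C2.
      rewrite !RtoC_plus, !RtoC_mult. ring. }
    rewrite SB, SA. ring. }
  split; auto. exists k.
  assert (FE : forall z, F z = A * z + k).
  { intros z. rewrite Hk, HBA. rewrite (coords tau Htau z) at 3. ring. }
  split.
  - intros z Hz. rewrite <- Freg by auto. apply FE.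
  - intros c _. rewrite <- FE. apply HF.
Qed.

End Torus.

(** * Linear equations of the second order *)

Fixpoint psum (u : nat -> C) (N : nat) : C :=
  match N with 0%nat => u 0%nat | S N => psum u N + u (S N) end.

(** Comparison with a geometric series of ratio 1/2. *)
Lemma psum_tail (u : nat -> C) (K : R) : (forall n, (Cmod (u n) <= K * / 2 ^ n)%R) ->
  forall N M, (N <= M)%nat -> (Cmod (psum u M - psum u N) <= K * / 2 ^ N - K * / 2 ^ M)%R.
Proof.
  intros H N M HM. induction HM as [|M HM IH].
  - replace (psum u N - psum u N) with (RtoC 0) by ring. rewrite Cmod_0. lra.
  - simpl psum. replace (psum u M + u (S M) - psum u N) with
      ((psum u M - psum u N) + u (S M)) by ring.
    eapply Rle_trans; [apply Cmod_triangle|]. specialize (H (S M)).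
    assert (P : (0 < 2 ^ M)%R) by (apply pow_lt; lra).
    assert (E : (/ 2 ^ S M = / 2 ^ M / 2)%R) by (simpl; field; lra).
    rewrite E in *. lra.
Qed.

Lemma pow_small (K eps : R) : (0 < eps)%R -> (0 <= K)%R ->
  exists N, forall n, (N <= n)%nat -> (K * / 2 ^ n < eps)%R.
Proof.
  intros He HK. destruct (pow_lt_1_zero (/ 2) ltac:(rewrite Rabs_pos_eq; lra)
    (eps / (K + 1)) ltac:(apply Rdiv_lt_0_compat; lra)) as [N HN].
  exists N. intros n Hn. specialize (HN n Hn).
  rewrite pow_inv in HN. rewrite Rabs_pos_eq in HN
    by (left; apply Rinv_0_lt_compat, pow_lt; lra).
  assert (P : (0 < / 2 ^ n)%R) by (apply Rinv_0_lt_compat, pow_lt; lra).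
  apply Rle_lt_trans with ((K + 1) * / 2 ^ n)%R; [nra|].
  apply (Rmult_lt_compat_l (K + 1)) in HN; [|lra].
  replace ((K + 1) * (eps / (K + 1)))%R with eps in HN by (field; lra). exact HN.
Qed.

Lemma psum_cauchy (K eps : R) : (0 < eps)%R -> (0 <= K)%R -> exists N, forall u,
  (forall n, (Cmod (u n) <= K * / 2 ^ n)%R) ->
  forall n m, (N <= n)%nat -> (N <= m)%nat -> (Cmod (psum u n - psum u m) < eps)%R.
Proof.
  intros He HK. destruct (pow_small K (eps / 2) ltac:(lra) HK) as [N HN].
  exists N. intros u Hu n m Hn Hm.
  assert (A := psum_tail u K Hu N n Hn). assert (B := psum_tail u K Hu N m Hm).
  specialize (HN N ltac:(lia)).
  assert (P : forall k, (0 <= K * / 2 ^ k)%R).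
  { intros k. apply Rmult_le_pos; auto. left. apply Rinv_0_lt_compat, pow_lt; lra. }
  assert (P1 := P n). assert (P2 := P m).
  eapply Rle_lt_trans; [apply (Cmod_chain _ (psum u N))|].
  rewrite (Cmod_minus_sym (psum u N)). lra.
Qed.

Lemma psum_limit (u : nat -> C) (K : R) : (0 <= K)%R ->
  (forall n, (Cmod (u n) <= K * / 2 ^ n)%R) -> Climit (psum u) (Clim_seq (psum u)).
Proof.
  intros HK Hu. destruct (Climit_cauchy (psum u)) as [l Hl].
  - intros eps Heps. destruct (psum_cauchy K eps Heps HK) as [N HN]. exists N. eauto.
  - rewrite (Climit_Clim_seq _ _ Hl). exact Hl.
Qed.

Lemma psum_Cder (F G : nat -> C -> C) (z : C) (N : nat) :
  (forall n, Cder (F n) z (G n z)) ->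
  Cder (fun w => psum (fun n => F n w) N) z (psum (fun n => G n z) N).
Proof.
  intros H. induction N as [|N IH]; simpl; auto. apply Cder_plus; auto.
Qed.

Definition sol (q : C -> C) (D : C -> Prop) (y dy : C -> C) : Prop :=
  forall z, D z -> Cder y z (dy z) /\ Cder dy z (q z * y z).

Lemma sol_solution_on tau p D y : solution_on tau p D y <-> exists dy, sol (q tau p) D y dy.
Proof.
  split; intros [dy H]; exists dy; intros z Hz; destruct (H z Hz) as [A B];
    split; apply Cder_iff; auto.
Qed.

Lemma sol_sub (q : C -> C) (D D' : C -> Prop) y dy : (forall z, D' z -> D z) ->
  sol q D y dy -> sol q D' y dy.
Proof. intros H S z Hz. auto. Qed.

(** Compactness of [0, 1], by the propagation argument along the segment. *)
Lemma seg_bounded (D : C -> Prop) (x0 : C) (f : C -> C) (z : C) : star x0 D ->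
  (forall y, D y -> ccont f y) -> D z ->
  exists r M, (0 < r)%R /\ forall w t, (Cmod (w - z) < r)%R -> (0 <= t <= 1)%R ->
    (Cmod (f (seg x0 w t)) <= M)%R.
Proof.
  intros Hst Hf Hz.
  set (Q := fun x : C => exists r M, (0 < r)%R /\ forall w t, (Cmod (w - z) < r)%R ->
    (0 <= t <= Re x)%R -> (Cmod (f (seg x0 w t)) <= M)%R).
  assert (Hseg : forall t, seg 0 1 t = RtoC t) by (intros; unfold seg; ring).
  assert (Hre : forall t, Re (RtoC t) = t) by reflexivity.
  assert (loc : forall t, (0 <= t <= 1)%R -> exists d M, (0 < d)%R /\ forall w s,
    (Cmod (w - z) < d)%R -> (Rabs (s - t) < d)%R -> (0 <= s <= 1)%R ->
    (Cmod (f (seg x0 w s)) <= M)%R).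
  { intros t Ht. destruct (Hf (seg x0 z t) (Hst _ _ Hz Ht) 1%R Rlt_0_1) as [d [Hd Hw]].
    set (L := (1 + Cmod (z - x0))%R). assert (P := Cmod_ge_0 (z - x0)).
    exists (d / (2 * L))%R, (Cmod (f (seg x0 z t)) + 1)%R.
    assert (HL : (0 < 2 * L)%R) by (unfold L; lra).
    split; [apply Rdiv_lt_0_compat; auto|]. intros w s Hwz Hst2 Hs.
    assert (X : (Cmod (f (seg x0 w s) - f (seg x0 z t)) < 1)%R).
    { apply Hw. replace (seg x0 w s - seg x0 z t) with
        (RtoC s * (w - z) + (seg x0 z s - seg x0 z t)) by (unfold seg; ring).
      eapply Rle_lt_trans; [apply Cmod_triangle|].
      rewrite Cmod_scal_R, seg_dist by lra.
      assert (A := Cmod_ge_0 (w - z)). assert (B := Rabs_pos (s - t)).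
      apply (Rmult_lt_compat_r (2 * L)) in Hwz; auto.
      apply (Rmult_lt_compat_r (2 * L)) in Hst2; auto.
      replace (d / (2 * L) * (2 * L))%R with d in * by (field; lra).
      unfold L in *. nra. }
    assert (T := Cmod_triangle_inv (f (seg x0 w s)) (f (seg x0 z t))). lra. }
  assert (HQ : Q 1).
  { apply (seg_propagate Q 0 1).
    - destruct (loc 0%R ltac:(lra)) as [d [M [Hd H]]]. exists d, M. split; auto.
      intros w t Hw Ht. simpl in Ht. apply H; auto; [|lra].
      replace (t - 0)%R with 0%R by lra. rewrite Rabs_R0. auto.
    - intros t Ht. destruct (loc t Ht) as [d [M [Hd H]]]. exists d. split; auto.
      intros [s [Hs [Hst1 [r [M1 [Hr HM1]]]]]] s' Hs' Hst2.
      rewrite !Hseg in *. rewrite <- RtoC_minus, Cmod_R in Hst1, Hst2.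
      exists (Rmin r d), (Rmax M M1). split; [apply Rmin_pos; auto|].
      intros w x Hw Hx. rewrite Hre in *.
      assert (B1 := Rmin_l r d). assert (B2 := Rmin_r r d).
      destruct (Rle_dec x s) as [Hxs|Hxs].
      + eapply Rle_trans; [apply HM1; try lra|apply Rmax_r].
      + eapply Rle_trans; [apply H; try lra|apply Rmax_l].
        apply Rabs_lt_between in Hst1. apply Rabs_lt_between in Hst2.
        apply Rabs_lt_between. lra. }
  destruct HQ as [r [M [Hr H]]]. exists r, M. split; auto.
Qed.

Section Volterra.
Variables (D : C -> Prop) (x0 : C) (q : C -> C) (alpha beta : C).
Hypothesis HD : open D.
Hypothesis Hst : star x0 D.
Hypothesis Hq : forall z, D z -> locC1 q z.

(** Picard iteration for y'' = q y, integrating along rays from x0. *)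
Fixpoint volt (n : nat) : C -> C :=
  match n with
  | 0%nat => fun z => alpha + beta * (z - x0)
  | S n => Prim x0 (Prim x0 (fun z => q z * volt n z))
  end.

Definition dvolt (n : nat) : C -> C :=
  match n with
  | 0%nat => fun _ => beta
  | S n => Prim x0 (fun z => q z * volt n z)
  end.

Definition ddvolt (n : nat) : C -> C :=
  match n with
  | 0%nat => fun _ => 0
  | S n => fun z => q z * volt n z
  end.

Lemma volt_reg (n : nat) : forall z, D z ->
  Cder (volt n) z (dvolt n z) /\ Cder (dvolt n) z (ddvolt n z) /\
  (Cder (fun y => q y * volt n y) z (der q z * volt n z + q z * dvolt n z) /\
   ccont (fun y => der q y * volt n y + q y * dvolt n y) z).
Proof.
  assert (Step : forall n, (forall z, D z ->
    Cder (volt n) z (dvolt n z) /\ Cder (dvolt n) z (ddvolt n z)) ->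
    forall z, D z -> Cder (fun y => q y * volt n y) z (der q z * volt n z + q z * dvolt n z) /\
      ccont (fun y => der q y * volt n y + q y * dvolt n y) z).
  { intros k Hk z Hz. destruct (Hk z Hz) as [A B]. destruct (locC1_der q z (Hq z Hz)) as [Q1 Q2].
    split; [apply Cder_mult; auto|]. apply ccont_plus; apply ccont_mult; auto.
    - apply (Cder_ccont _ _ _ A).
    - apply (Cder_ccont _ _ _ Q1).
    - apply (Cder_ccont _ _ _ B). }
  induction n as [|n IH]; intros z Hz.
  - assert (H0 : forall z, D z -> Cder (volt 0) z (dvolt 0 z) /\ Cder (dvolt 0) z (ddvolt 0 z)).
    { intros y _. simpl. split; [|apply Cder_const].
      eapply Cder_eq.
      - apply Cder_plus; [apply Cder_const|]. apply Cder_scal.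
        apply Cder_minus; [apply Cder_id|apply Cder_const].
      - ring. }
    destruct (H0 z Hz) as [X Y].
    split; [exact X|split; [exact Y|]]. apply (Step 0%nat); auto.
  - assert (H1 : forall z, D z -> Cder (volt (S n)) z (dvolt (S n) z) /\
      Cder (dvolt (S n)) z (ddvolt (S n) z)).
    { assert (HP : forall y, D y -> Cder (dvolt (S n)) y (ddvolt (S n) y)).
      { intros y Hy.
        apply (Prim_der D x0 (fun z => q z * volt n z) (fun z => der q z * volt n z + q z * dvolt n z)); auto.
        intros w Hw. apply (IH w Hw). }
      intros y Hy. split; auto.
      apply (Prim_der D x0 (dvolt (S n)) (ddvolt (S n))); auto.
      intros w Hw. split; auto. destruct (IH w Hw) as [_ [_ [A _]]].
      apply (Cder_ccont _ _ _ A). }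
    destruct (H1 z Hz) as [X Y].
    split; [exact X|split; [exact Y|]]. apply (Step (S n)); auto.
Qed.

(** On the ray from x0 to w, the weight exp (lam t) with lam large turns each double
    integration into a contraction by the factor 1/2, whatever the length of the ray; the
    bounds are uniform for w near z. *)
Lemma volt_bound (z : C) : D z -> exists r K, (0 < r)%R /\ (0 <= K)%R /\
  forall w, (Cmod (w - z) < r)%R -> D w /\ forall n,
    (Cmod (volt n w) <= K * / 2 ^ n)%R /\ (Cmod (dvolt n w) <= K * / 2 ^ n)%R /\
    (Cmod (ddvolt n w) <= K * / 2 ^ n)%R.
Proof.
  intros Hz.
  destruct (seg_bounded D x0 q z Hst) as [r1 [M [Hr1 HM]]]; auto.
  { intros y Hy. apply locC1_ccont. auto. }
  destruct (seg_bounded D x0 (volt 0) z Hst) as [r2 [A [Hr2 HA]]]; auto.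
  { intros y Hy. destruct (volt_reg 0 y Hy) as [X _]. apply (Cder_ccont _ _ _ X). }
  destruct (proj1 (open_C_iff D) HD z Hz) as [r3 [Hr3 HD3]].
  assert (HM0 : (0 <= M)%R).
  { eapply Rle_trans; [|apply (HM z 0%R); [|lra]]. apply Cmod_ge_0.
    replace (z - z) with (RtoC 0) by ring. rewrite Cmod_0. auto. }
  assert (HA0 : (0 <= A)%R).
  { eapply Rle_trans; [|apply (HA z 0%R); [|lra]]. apply Cmod_ge_0.
    replace (z - z) with (RtoC 0) by ring. rewrite Cmod_0. auto. }
  set (L := (1 + Cmod (z - x0))%R). assert (PL := Cmod_ge_0 (z - x0)).
  (* chosen so that M L^2 / lam^2 <= 1 / 2 *)
  set (lam := (1 + 2 * M * L * L)%R).
  assert (HL : (1 <= L)%R) by (unfold L; lra).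
  assert (HMLL : (0 <= M * L * L)%R) by (repeat apply Rmult_le_pos; lra).
  assert (Hlam : (1 <= lam)%R) by (unfold lam; lra).
  assert (Hlam2 : (M * L * L <= lam * lam / 2)%R).
  { assert (lam <= lam * lam)%R by nra. unfold lam at 1 in H. lra. }
  set (E := exp lam).
  assert (HE : (0 < E)%R) by apply exp_pos.
  set (K := (A * E + 2 * (M * L * A * E) + 2 * (M * A * E) + Cmod beta)%R).
  assert (Pb := Cmod_ge_0 beta).
  assert (K1 : (0 <= A * E)%R) by (apply Rmult_le_pos; lra).
  assert (K2 : (0 <= M * L * A * E)%R) by (repeat apply Rmult_le_pos; lra).
  assert (K3 : (0 <= M * A * E)%R) by (repeat apply Rmult_le_pos; lra).
  set (r := Rmin (Rmin r1 r2) (Rmin r3 1)).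
  exists r, K. split; [repeat apply Rmin_pos; lra|].
  split; [unfold K; lra|].
  intros w Hw.
  assert (W1 : (r <= r1)%R) by (eapply Rle_trans; [apply Rmin_l|apply Rmin_l]).
  assert (W2 : (r <= r2)%R) by (eapply Rle_trans; [apply Rmin_l|apply Rmin_r]).
  assert (W3 : (r <= r3)%R) by (eapply Rle_trans; [apply Rmin_r|apply Rmin_l]).
  assert (W4 : (r <= 1)%R) by (eapply Rle_trans; [apply Rmin_r|apply Rmin_r]).
  assert (HwD : D w) by (apply HD3; lra).
  split; auto.
  assert (HwL : (Cmod (w - x0) <= L)%R).
  { assert (T := Cmod_chain w z x0). unfold L. lra. }
  assert (Pw := Cmod_ge_0 (w - x0)).
  assert (P2 : forall n, (0 < / 2 ^ n)%R) by (intros; apply Rinv_0_lt_compat, pow_lt; lra).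
  assert (Main : forall n t, (0 <= t <= 1)%R ->
    (Cmod (volt n (seg x0 w t)) <= A * / 2 ^ n * exp (lam * t))%R).
  { assert (Dv : forall n, (forall t, (0 <= t <= 1)%R ->
      (Cmod (volt n (seg x0 w t)) <= A * / 2 ^ n * exp (lam * t))%R) ->
      forall t, (0 <= t <= 1)%R -> (Cmod (dvolt (S n) (seg x0 w t)) <=
        (M * (A * / 2 ^ n)) * Cmod (w - x0) / lam * exp (lam * t))%R).
    { intros n Hn.
      apply (Prim_bound D x0 (fun z => q z * volt n z) (fun z => der q z * volt n z + q z * dvolt n z)); auto; [|lra|].
      - intros y Hy. apply (volt_reg n y Hy).
      - intros t Ht. rewrite Cmod_mult, Rmult_assoc.
        apply Rmult_le_compat; try apply Cmod_ge_0; [|auto]. apply HM; auto; lra. }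
    induction n as [|n IH]; intros t Ht.
    - eapply Rle_trans; [apply HA; auto; lra|]. simpl. rewrite Rinv_1, Rmult_1_r.
      assert (1 <= exp (lam * t))%R.
      { rewrite <- exp_0. destruct (Req_dec (lam * t) 0) as [->|Hne]; [lra|].
        left. apply exp_increasing. nra. }
      nra.
    - change (volt (S n)) with (Prim x0 (dvolt (S n))).
      eapply Rle_trans; [apply (Prim_bound D x0 (dvolt (S n)) (ddvolt (S n)) w
        (M * (A * / 2 ^ n) * Cmod (w - x0) / lam) lam HD Hst); auto; [|lra]|].
      + intros y Hy. destruct (volt_reg (S n) y Hy) as [_ [X _]]. split; auto.
        destruct (volt_reg n y Hy) as [_ [_ [Y _]]]. apply (Cder_ccont _ _ _ Y).
      + apply Rmult_le_compat_r; [left; apply exp_pos|].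
        replace (M * (A * / 2 ^ n) * Cmod (w - x0) / lam * Cmod (w - x0) / lam)%R with
          ((A * / 2 ^ n) * (M * Cmod (w - x0) * Cmod (w - x0) * / (lam * lam)))%R
          by (field; split; try lra; apply pow_nonzero; lra).
        replace (A * / 2 ^ S n)%R with ((A * / 2 ^ n) * / 2)%R
          by (simpl; field; apply pow_nonzero; lra).
        apply Rmult_le_compat_l; [apply Rmult_le_pos; [auto|left; auto]|].
        apply (Rmult_le_reg_r (lam * lam)); [nra|].
        rewrite Rmult_assoc, Rinv_l, Rmult_1_r by nra.
        assert (M * Cmod (w - x0) * Cmod (w - x0) <= M * L * L)%R.
        { apply Rmult_le_compat; try nra. }
        lra. }
  assert (B0 : forall n, (Cmod (volt n w) <= A * E * / 2 ^ n)%R).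
  { intros n. assert (X := Main n 1%R ltac:(lra)). rewrite seg_1, Rmult_1_r in X.
    fold E in X. lra. }
  assert (Qw : (Cmod (q w) <= M)%R).
  { assert (X := HM w 1%R ltac:(lra) ltac:(lra)). rewrite seg_1 in X. auto. }
  assert (B2 : forall n, (Cmod (q w * volt n w) <= M * (A * E * / 2 ^ n))%R).
  { intros n. rewrite Cmod_mult. apply Rmult_le_compat; try apply Cmod_ge_0; auto. }
  intros n. split; [|split].
  - eapply Rle_trans; [apply B0|]. apply Rmult_le_compat_r; [left; auto|]. unfold K. lra.
  - destruct n as [|n].
    + simpl. rewrite Rinv_1, Rmult_1_r. unfold K. lra.
    + assert (X := Prim_bound D x0 (fun z => q z * volt n z)
        (fun z => der q z * volt n z + q z * dvolt n z) w (M * (A * / 2 ^ n)) lam HD Hst).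
      assert (X1 : (Cmod (dvolt (S n) (seg x0 w 1)) <=
        (M * (A * / 2 ^ n)) * Cmod (w - x0) / lam * exp (lam * 1))%R).
      { apply X; auto; try lra.
        - intros y Hy. apply (volt_reg n y Hy).
        - intros t Ht. rewrite Cmod_mult, Rmult_assoc.
          apply Rmult_le_compat; try apply Cmod_ge_0; auto. apply HM; auto; lra. }
      rewrite seg_1, Rmult_1_r in X1. fold E in X1.
      eapply Rle_trans; [exact X1|].
      replace (K * / 2 ^ S n)%R with ((K / 2) * / 2 ^ n)%R
        by (simpl; field; apply pow_nonzero; lra).
      replace (M * (A * / 2 ^ n) * Cmod (w - x0) / lam * E)%R with
        ((M * A * E) * (Cmod (w - x0) * / lam) * / 2 ^ n)%R
        by (field; split; try lra; apply pow_nonzero; lra).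
      apply Rmult_le_compat_r; [left; auto|].
      assert (Y : (Cmod (w - x0) * / lam <= L)%R).
      { assert (/ lam <= 1)%R by (rewrite <- Rinv_1; apply Rinv_le_contravar; lra).
        assert (0 < / lam)%R by (apply Rinv_0_lt_compat; lra). nra. }
      assert (Z : (M * A * E * (Cmod (w - x0) * / lam) <= M * A * E * L)%R)
        by (apply Rmult_le_compat_l; auto).
      unfold K. lra.
  - destruct n as [|n].
    + simpl. rewrite Cmod_0, Rinv_1, Rmult_1_r. unfold K. lra.
    + eapply Rle_trans; [apply (B2 n)|].
      replace (K * / 2 ^ S n)%R with ((K / 2) * / 2 ^ n)%R
        by (simpl; field; apply pow_nonzero; lra).
      replace (M * (A * E * / 2 ^ n))%R with ((M * A * E) * / 2 ^ n)%R by ring.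
      apply Rmult_le_compat_r; [left; auto|]. unfold K. lra.
Qed.

(** The Picard series and its first two derived series converge locally uniformly.
    On a star-shaped domain this gives a solution on the whole domain at once, without
    continuation. *)
Lemma ode_exists : exists y dy, sol q D y dy /\ (D x0 -> y x0 = alpha /\ dy x0 = beta).
Proof.
  exists (fun z => Clim_seq (psum (fun n => volt n z))),
    (fun z => Clim_seq (psum (fun n => dvolt n z))).
  split.
  - intros z Hz. destruct (volt_bound z Hz) as [r [K [Hr [HK HB]]]].
    assert (Hzz : (Cmod (z - z) < r)%R).
    { replace (z - z) with (RtoC 0) by ring. rewrite Cmod_0. auto. }
    assert (L0 : forall w, (Cmod (w - z) < r)%R ->
      Climit (psum (fun n => volt n w)) (Clim_seq (psum (fun n => volt n w)))).
    { intros w Hw. apply (psum_limit _ K HK). intros n. apply (HB w Hw). }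
    assert (L1 : forall w, (Cmod (w - z) < r)%R ->
      Climit (psum (fun n => dvolt n w)) (Clim_seq (psum (fun n => dvolt n w)))).
    { intros w Hw. apply (psum_limit _ K HK). intros n. apply (HB w Hw). }
    split.
    + apply (Cder_termwise (fun N w => psum (fun n => volt n w) N)
        (fun N w => psum (fun n => dvolt n w) N)
        (fun w => Clim_seq (psum (fun n => volt n w)))
        (fun w => Clim_seq (psum (fun n => dvolt n w))) z r Hr).
      * intros N w Hw. apply psum_Cder. intros n. apply volt_reg. apply (HB w Hw).
      * exact L0.
      * apply L1; auto.
      * intros eps Heps. destruct (psum_cauchy K eps Heps HK) as [N HN]. exists N.
        intros n m w Hn Hm Hw. left. apply HN; auto. intros k. apply (HB w Hw).
    + apply (Cder_termwise (fun N w => psum (fun n => dvolt n w) N)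
        (fun N w => psum (fun n => ddvolt n w) N)
        (fun w => Clim_seq (psum (fun n => dvolt n w)))
        (fun w => q w * Clim_seq (psum (fun n => volt n w))) z r Hr).
      * intros N w Hw. apply psum_Cder. intros n. apply volt_reg. apply (HB w Hw).
      * exact L1.
      * intros eps Heps.
        assert (Pq := Cmod_ge_0 (q z)).
        destruct (L0 z Hzz (eps / (1 + Cmod (q z)))%R) as [N HN].
        { apply Rdiv_lt_0_compat; lra. }
        exists (S N). intros n Hn. destruct n as [|n]; [lia|].
        specialize (HN n ltac:(lia)).
        assert (E : forall n, psum (fun n => ddvolt n z) (S n) = q z * psum (fun n => volt n z) n).
        { induction n0 as [|k IH]; [simpl; ring|].
          change (psum (fun n => ddvolt n z) (S (S k))) with
            (psum (fun n => ddvolt n z) (S k) + q z * volt (S k) z).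
          rewrite IH. simpl. ring. }
        rewrite E. replace (q z * psum (fun n => volt n z) n -
          q z * Clim_seq (psum (fun n => volt n z))) with
          (q z * (psum (fun n => volt n z) n - Clim_seq (psum (fun n => volt n z)))) by ring.
        rewrite Cmod_mult.
        apply (Rmult_lt_compat_r (1 + Cmod (q z))) in HN; [|lra].
        replace (eps / (1 + Cmod (q z)) * (1 + Cmod (q z)))%R with eps in HN by (field; lra).
        assert (X := Cmod_ge_0 (psum (fun n => volt n z) n - Clim_seq (psum (fun n => volt n z)))).
        nra.
      * intros eps Heps. destruct (psum_cauchy K eps Heps HK) as [N HN]. exists N.
        intros n m w Hn Hm Hw. left. apply HN; auto. intros k. apply (HB w Hw).
  - intros _. split.
    + apply Climit_Clim_seq. apply (Climit_ext (fun _ => alpha) _ _ 0%nat); [|apply Climit_const].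
      intros N _. induction N as [|N IH]; simpl; [ring|].
      rewrite <- IH, Prim_base. ring.
    + apply Climit_Clim_seq. apply (Climit_ext (fun _ => beta) _ _ 0%nat); [|apply Climit_const].
      intros N _. induction N as [|N IH]; [reflexivity|].
      change (psum (fun n => dvolt n x0) (S N)) with
        (psum (fun n => dvolt n x0) N + Prim x0 (fun z => q z * volt N z) x0).
      rewrite <- IH, Prim_base. ring.
Qed.

End Volterra.

(** * Wronskians *)

(** The Wronskian of y and v. *)
Definition wr (y dy v dv : C -> C) (z : C) : C := y z * dv z - dy z * v z.

Lemma wr_Cder (q : C -> C) (D : C -> Prop) y dy v dv z : sol q D y dy -> sol q D v dv -> D z ->
  Cder (wr y dy v dv) z 0.
Proof.
  intros Hy Hv Hz. destruct (Hy z Hz) as [A B]. destruct (Hv z Hz) as [A' B'].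
  eapply Cder_eq.
  - apply Cder_minus; apply Cder_mult; eauto.
  - ring.
Qed.

Lemma wr_const (q : C -> C) (D : C -> Prop) y dy v dv x0 z : star x0 D ->
  sol q D y dy -> sol q D v dv -> D z -> wr y dy v dv z = wr y dy v dv x0.
Proof.
  intros Hst Hy Hv Hz. apply Cder_zero_const. intros t Ht.
  apply (wr_Cder q D); auto.
Qed.

(** The domains on which initial value problems are solvable: star-shaped about x0, with
    a regular coefficient. *)
Definition ode_domain (q : C -> C) (D : C -> Prop) (x0 : C) : Prop :=
  open D /\ star x0 D /\ D x0 /\ forall z, D z -> locC1 q z.

Definition normal_basis (q : C -> C) (D : C -> Prop) (v1 dv1 v2 dv2 : C -> C) : Prop :=
  sol q D v1 dv1 /\ sol q D v2 dv2 /\ forall z, D z -> wr v1 dv1 v2 dv2 z = 1.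

Lemma ode_basis (q : C -> C) (D : C -> Prop) (x0 : C) : ode_domain q D x0 ->
  exists v1 dv1 v2 dv2, normal_basis q D v1 dv1 v2 dv2.
Proof.
  intros [HD [Hst [H0 Hq]]].
  destruct (ode_exists D x0 q 1 0 HD Hst Hq) as [v1 [dv1 [S1 I1]]].
  destruct (ode_exists D x0 q 0 1 HD Hst Hq) as [v2 [dv2 [S2 I2]]].
  exists v1, dv1, v2, dv2. split; [auto|split; auto].
  intros z Hz. rewrite (wr_const q D v1 dv1 v2 dv2 x0 z Hst S1 S2 Hz).
  destruct (I1 H0) as [A A']. destruct (I2 H0) as [B B'].
  unfold wr. rewrite A, A', B, B'. ring.
Qed.

Lemma normal_basis_sub (q : C -> C) (D D' : C -> Prop) v1 dv1 v2 dv2 :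
  (forall z, D' z -> D z) -> normal_basis q D v1 dv1 v2 dv2 ->
  normal_basis q D' v1 dv1 v2 dv2.
Proof.
  intros H [A [B E]]. split; [|split]; auto.
  - apply (sol_sub q D); auto.
  - apply (sol_sub q D); auto.
Qed.

(** Cramer's rule, as all Wronskians are constant. *)
Lemma sol_decomp (q : C -> C) (D : C -> Prop) (x0 : C) v1 dv1 v2 dv2 u du :
  star x0 D -> normal_basis q D v1 dv1 v2 dv2 -> sol q D u du ->
  forall z, D z ->
    u z = wr u du v2 dv2 x0 * v1 z + wr v1 dv1 u du x0 * v2 z /\
    du z = wr u du v2 dv2 x0 * dv1 z + wr v1 dv1 u du x0 * dv2 z.
Proof.
  intros Hst [S1 [S2 W]] Su z Hz.
  rewrite <- (wr_const q D u du v2 dv2 x0 z), <- (wr_const q D v1 dv1 u du x0 z) by auto.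
  assert (E := W z Hz). unfold wr in *. split.
  - transitivity (u z * (v1 z * dv2 z - dv1 z * v2 z)); [rewrite E; ring|ring].
  - transitivity (du z * (v1 z * dv2 z - dv1 z * v2 z)); [rewrite E; ring|ring].
Qed.

Lemma sol_zero (q : C -> C) (D : C -> Prop) (x0 a : C) u du : ode_domain q D x0 ->
  sol q D u du -> D a -> u a = 0 -> du a = 0 -> forall z, D z -> u z = 0.
Proof.
  intros HO Su Ha U0 U1 z Hz.
  destruct (ode_basis q D x0 HO) as [v1 [dv1 [v2 [dv2 HB]]]].
  destruct HO as [_ [Hst _]].
  destruct (sol_decomp q D x0 _ _ _ _ _ _ Hst HB Su z Hz) as [E _].
  destruct HB as [S1 [S2 _]].
  rewrite <- (wr_const q D u du v2 dv2 x0 a) in E by auto.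
  rewrite <- (wr_const q D v1 dv1 u du x0 a) in E by auto.
  unfold wr in E. rewrite U0, U1 in E. rewrite E. ring.
Qed.

Lemma sol_lin (q : C -> C) (D : C -> Prop) (a b : C) y dy v dv : sol q D y dy -> sol q D v dv ->
  sol q D (fun z => a * y z + b * v z) (fun z => a * dy z + b * dv z).
Proof.
  intros Hy Hv z Hz. destruct (Hy z Hz) as [A B]. destruct (Hv z Hz) as [A' B']. split.
  - apply Cder_plus; apply Cder_scal; auto.
  - eapply Cder_eq; [apply Cder_plus; apply Cder_scal; eauto|]. ring.
Qed.

(** * Quadratic forms in solutions *)

Definition QF (a b c : C) (v1 v2 : C -> C) (z : C) : C :=
  a * (v1 z * v1 z) + b * (v1 z * v2 z) + c * (v2 z * v2 z).

(** The functions on D that are quadratic forms in solutions. For a basis of solutions on D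
    they form a space of dimension three, and they satisfy a linear equation of third
    order. *)
Definition sym2 (q : C -> C) (D : C -> Prop) (U : C -> C) : Prop :=
  exists v1 dv1 v2 dv2 a b c, sol q D v1 dv1 /\ sol q D v2 dv2 /\
    forall z, D z -> U z = QF a b c v1 v2 z.

Lemma sym2_sub (q : C -> C) (D D' : C -> Prop) U : (forall z, D' z -> D z) ->
  sym2 q D U -> sym2 q D' U.
Proof.
  intros H [v1 [dv1 [v2 [dv2 [a [b [c [S1 [S2 E]]]]]]]]].
  exists v1, dv1, v2, dv2, a, b, c. split; [|split]; auto.
  - apply (sol_sub q D); auto.
  - apply (sol_sub q D); auto.
Qed.

Lemma sym2_ext_eq (q : C -> C) (D : C -> Prop) U V : (forall z, D z -> U z = V z) ->
  sym2 q D U -> sym2 q D V.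
Proof.
  intros H [v1 [dv1 [v2 [dv2 [a [b [c [S1 [S2 E]]]]]]]]].
  exists v1, dv1, v2, dv2, a, b, c. split; [|split]; auto.
  intros z Hz. rewrite <- H; auto.
Qed.

(** Express the solutions in the basis and expand. *)
Lemma sym2_in_basis (q : C -> C) (D : C -> Prop) (x0 : C) v1 dv1 v2 dv2 U :
  star x0 D -> normal_basis q D v1 dv1 v2 dv2 -> sym2 q D U ->
  exists a b c, forall z, D z -> U z = QF a b c v1 v2 z.
Proof.
  intros Hst HB [u1 [du1 [u2 [du2 [a [b [c [S1 [S2 E]]]]]]]]].
  set (p1 := wr u1 du1 v2 dv2 x0). set (p2 := wr v1 dv1 u1 du1 x0).
  set (r1 := wr u2 du2 v2 dv2 x0). set (r2 := wr v1 dv1 u2 du2 x0).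
  exists (a * (p1 * p1) + b * (p1 * r1) + c * (r1 * r1)),
    (2 * a * (p1 * p2) + b * (p1 * r2 + p2 * r1) + 2 * c * (r1 * r2)),
    (a * (p2 * p2) + b * (p2 * r2) + c * (r2 * r2)).
  intros z Hz. rewrite E by auto. unfold QF.
  destruct (sol_decomp q D x0 _ _ _ _ _ _ Hst HB S1 z Hz) as [-> _].
  destruct (sol_decomp q D x0 _ _ _ _ _ _ Hst HB S2 z Hz) as [-> _].
  fold p1 p2 r1 r2. ring.
Qed.

Lemma real_zero_der (f : C -> C) (z l : C) (r : R) : (0 < r)%R -> Cder f z l ->
  (forall t, (Rabs t < r)%R -> f (z + RtoC t) = 0) -> l = 0.
Proof.
  intros Hr Hf H0. apply Cmod_eps_eq. intros eps Heps. destruct (Hf eps Heps) as [d [Hd Hw]].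
  set (t := (Rmin d r / 2)%R).
  assert (Q := Rmin_pos d r Hd Hr). assert (Q1 := Rmin_l d r). assert (Q2 := Rmin_r d r).
  assert (Ht : (0 < t)%R) by (unfold t; lra).
  assert (Et : Cmod (z + RtoC t - z) = t).
  { replace (z + RtoC t - z) with (RtoC t) by ring. rewrite Cmod_R, Rabs_pos_eq; lra. }
  specialize (Hw (z + RtoC t)). rewrite Et in Hw. specialize (Hw ltac:(unfold t; lra)).
  rewrite H0 in Hw by (rewrite Rabs_pos_eq; unfold t; lra).
  assert (Z0 := H0 0%R ltac:(rewrite Rabs_R0; auto)).
  replace (z + RtoC 0) with z in Z0 by ring. rewrite Z0 in Hw.
  replace (0 - 0 - (z + RtoC t - z) * l) with (- (RtoC t * l)) in Hw by ring.
  rewrite Cmod_opp, Cmod_scal_R in Hw by lra.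
  replace (l - 0) with l by ring.
  apply (Rmult_le_reg_l t); auto. lra.
Qed.

Definition QF1 (a b c : C) (v1 dv1 v2 dv2 : C -> C) (z : C) : C :=
  2 * a * (v1 z * dv1 z) + b * (dv1 z * v2 z + v1 z * dv2 z) + 2 * c * (v2 z * dv2 z).

Lemma QF_Cder q D a b c v1 dv1 v2 dv2 z : sol q D v1 dv1 -> sol q D v2 dv2 -> D z ->
  Cder (QF a b c v1 v2) z (QF1 a b c v1 dv1 v2 dv2 z).
Proof.
  intros S1 S2 Hz. destruct (S1 z Hz) as [A _]. destruct (S2 z Hz) as [B _].
  eapply Cder_eq.
  - apply Cder_plus; [apply Cder_plus|]; apply Cder_scal; apply Cder_mult; eauto.
  - unfold QF1. ring.
Qed.

Lemma QF1_Cder q D a b c v1 dv1 v2 dv2 z : sol q D v1 dv1 -> sol q D v2 dv2 -> D z ->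
  Cder (QF1 a b c v1 dv1 v2 dv2) z (2 * QF a b c dv1 dv2 z + 2 * q z * QF a b c v1 v2 z).
Proof.
  intros S1 S2 Hz. destruct (S1 z Hz) as [A A']. destruct (S2 z Hz) as [B B'].
  eapply Cder_eq.
  - apply Cder_plus; [apply Cder_plus|]; apply Cder_scal;
      [| apply Cder_plus |]; apply Cder_mult; eauto.
  - unfold QF. ring.
Qed.

(** The vectors (x, y), (x', y') are a basis of C^2, and the three equations say that the
    quadratic form vanishes on both and that they are orthogonal. *)
Lemma quad_zero (x y x' y' a b c : C) : x * y' - x' * y <> 0 ->
  a * (x * x) + b * (x * y) + c * (y * y) = 0 ->
  2 * a * (x * x') + b * (x' * y + x * y') + 2 * c * (y * y') = 0 ->
  a * (x' * x') + b * (x' * y') + c * (y' * y') = 0 -> a = 0 /\ b = 0 /\ c = 0.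
Proof.
  intros HW E0 E1 E2.
  assert (HW2 : (x * y' - x' * y) * (x * y' - x' * y) <> 0) by (apply Cmult_neq_0; auto).
  assert (K : forall u, u * ((x * y' - x' * y) * (x * y' - x' * y)) = 0 -> u = 0).
  { intros u Hu. replace u with (u * ((x * y' - x' * y) * (x * y' - x' * y)) *
      / ((x * y' - x' * y) * (x * y' - x' * y))) by (field; auto). rewrite Hu. ring. }
  split; [|split]; apply K.
  - transitivity (y' * y' * (a * (x * x) + b * (x * y) + c * (y * y))
      - y * y' * (2 * a * (x * x') + b * (x' * y + x * y') + 2 * c * (y * y'))
      + y * y * (a * (x' * x') + b * (x' * y') + c * (y' * y'))); [ring|].
    rewrite E0, E1, E2. ring.
  - transitivity (- (2) * x' * y' * (a * (x * x) + b * (x * y) + c * (y * y))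
      + (x * y' + x' * y) * (2 * a * (x * x') + b * (x' * y + x * y') + 2 * c * (y * y'))
      - 2 * x * y * (a * (x' * x') + b * (x' * y') + c * (y' * y'))); [ring|].
    rewrite E0, E1, E2. ring.
  - transitivity (x' * x' * (a * (x * x) + b * (x * y) + c * (y * y))
      - x * x' * (2 * a * (x * x') + b * (x' * y + x * y') + 2 * c * (y * y'))
      + x * x * (a * (x' * x') + b * (x' * y') + c * (y' * y'))); [ring|].
    rewrite E0, E1, E2. ring.
Qed.

(** Differentiating twice along the real direction, the form vanishes on (v1, v2) and
    (v1', v2') and pairs them to zero, whence [quad_zero]. *)
Lemma QF_zero (q : C -> C) (D : C -> Prop) a b c v1 dv1 v2 dv2 z r : open D ->
  sol q D v1 dv1 -> sol q D v2 dv2 -> D z -> wr v1 dv1 v2 dv2 z <> 0 -> (0 < r)%R ->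
  (forall t, (Rabs t < r)%R -> QF a b c v1 v2 (z + RtoC t) = 0) -> a = 0 /\ b = 0 /\ c = 0.
Proof.
  intros HD S1 S2 Hz HW Hr H0.
  destruct (proj1 (open_C_iff D) HD z Hz) as [d [Hd Hin]].
  set (r1 := Rmin r d). assert (Hr1 : (0 < r1)%R) by (apply Rmin_pos; auto).
  assert (B1 := Rmin_l r d). assert (B2 := Rmin_r r d). fold r1 in B1, B2.
  assert (Dt : forall t, (Rabs t < r1)%R -> D (z + RtoC t)).
  { intros t Ht. apply Hin. replace (z + RtoC t - z) with (RtoC t) by ring.
    rewrite Cmod_R. lra. }
  assert (H1 : forall t, (Rabs t < r1)%R -> QF1 a b c v1 dv1 v2 dv2 (z + RtoC t) = 0).
  { intros t Ht.
    apply (real_zero_der (QF a b c v1 v2) (z + RtoC t) _ (r1 - Rabs t)); [lra| |].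
    - apply (QF_Cder q D); auto.
    - intros s Hs. replace (z + RtoC t + RtoC s) with (z + RtoC (t + s))
        by (rewrite RtoC_plus; ring).
      apply H0. assert (T := Rabs_triang t s). lra. }
  assert (H2 : 2 * QF a b c dv1 dv2 z + 2 * q z * QF a b c v1 v2 z = 0).
  { apply (real_zero_der (QF1 a b c v1 dv1 v2 dv2) z _ r1 Hr1); auto.
    apply (QF1_Cder q D); auto. }
  assert (E0 := H0 0%R ltac:(rewrite Rabs_R0; lra)).
  assert (E1 := H1 0%R ltac:(rewrite Rabs_R0; lra)).
  replace (z + RtoC 0) with z in E0, E1 by ring.
  rewrite E0 in H2.
  assert (E2 : QF a b c dv1 dv2 z = 0).
  { replace (QF a b c dv1 dv2 z) with ((2 * QF a b c dv1 dv2 z + 2 * q z * 0) * / 2) by field.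
    rewrite H2. ring. }
  apply (quad_zero (v1 z) (v2 z) (dv1 z) (dv2 z)); auto.
Qed.

(** In a basis, both functions have coefficients, and these agree by [QF_zero]. *)
Lemma sym2_unique (q : C -> C) (D : C -> Prop) (x0 z : C) (r : R) U V : ode_domain q D x0 ->
  sym2 q D U -> sym2 q D V -> D z -> (0 < r)%R ->
  (forall t, (Rabs t < r)%R -> U (z + RtoC t) = V (z + RtoC t)) ->
  forall w, D w -> U w = V w.
Proof.
  intros HO HU HV Hz Hr E w Hw.
  destruct (ode_basis q D x0 HO) as [v1 [dv1 [v2 [dv2 HB]]]].
  destruct HO as [HD [Hst [H0 Hq]]].
  destruct (sym2_in_basis q D x0 _ _ _ _ U Hst HB HU) as [a [b [c EU]]].
  destruct (sym2_in_basis q D x0 _ _ _ _ V Hst HB HV) as [a' [b' [c' EV]]].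
  destruct HB as [S1 [S2 W]].
  destruct (proj1 (open_C_iff D) HD z Hz) as [d [Hd Hin]].
  assert (X : a - a' = 0 /\ b - b' = 0 /\ c - c' = 0).
  { apply (QF_zero q D _ _ _ v1 dv1 v2 dv2 z (Rmin r d)); auto.
    - rewrite W by auto. apply C1_nz.
    - apply Rmin_pos; auto.
    - intros t Ht. assert (B1 := Rmin_l r d). assert (B2 := Rmin_r r d).
      assert (Dt : D (z + RtoC t)).
      { apply Hin. replace (z + RtoC t - z) with (RtoC t) by ring. rewrite Cmod_R. lra. }
      specialize (E t ltac:(lra)). rewrite EU, EV in E by auto.
      transitivity (QF a b c v1 v2 (z + RtoC t) - QF a' b' c' v1 v2 (z + RtoC t)).
      + unfold QF. ring.
      + rewrite E. ring. }
  destruct X as [X1 [X2 X3]]. rewrite EU, EV by auto.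
  replace (QF a b c v1 v2 w) with (QF a' b' c' v1 v2 w +
    ((a - a') * (v1 w * v1 w) + (b - b') * (v1 w * v2 w) + (c - c') * (v2 w * v2 w)))
    by (unfold QF; ring).
  rewrite X1, X2, X3. ring.
Qed.

(** Write the function in the restriction of a basis of solutions on D. *)
Lemma sym2_extend (q : C -> C) (D D1 : C -> Prop) (x0 x1 : C) U : ode_domain q D x0 ->
  star x1 (fun z => D z /\ D1 z) -> sym2 q D1 U ->
  exists V, sym2 q D V /\ forall z, D z -> D1 z -> V z = U z.
Proof.
  intros HO Hst1 HU.
  destruct (ode_basis q D x0 HO) as [v1 [dv1 [v2 [dv2 HB]]]].
  assert (HB1 : normal_basis q (fun z => D z /\ D1 z) v1 dv1 v2 dv2).
  { apply (normal_basis_sub q D); auto. intros z [A _]; auto. }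
  destruct (sym2_in_basis q _ x1 _ _ _ _ U Hst1 HB1) as [a [b [c E]]].
  { apply (sym2_sub q D1); auto. intros z [_ A]; auto. }
  exists (QF a b c v1 v2). split.
  - destruct HB as [S1 [S2 _]]. exists v1, dv1, v2, dv2, a, b, c. auto.
  - intros z A B. symmetry. apply E. auto.
Qed.

Lemma sym2_locC1 (q : C -> C) (D : C -> Prop) U z : open D ->
  (forall z, D z -> locC1 q z) -> sym2 q D U -> D z -> locC1 U z.
Proof.
  intros HD Hq [v1 [dv1 [v2 [dv2 [a [b [c [S1 [S2 E]]]]]]]]] Hz.
  destruct (proj1 (open_C_iff D) HD z Hz) as [d [Hd Hin]].
  exists (d / 2)%R, (QF1 a b c v1 dv1 v2 dv2). split; [lra|]. intros w Hw.
  assert (Dw : D w) by (apply Hin; lra). split.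
  - apply (Cder_locally_ext (QF a b c v1 v2) U w _ (d / 2)); [lra| |apply (QF_Cder q D); auto].
    intros y Hy. symmetry. apply E. apply Hin. assert (T := Cmod_chain y w z). lra.
  - apply (Cder_ccont _ _ _ (QF1_Cder q D a b c v1 dv1 v2 dv2 w S1 S2 Dw)).
Qed.

(** * Punctured limits and regularity *)

Lemma plim_mult f g c l m : plim f c l -> plim g c m -> plim (fun z => f z * g z) c (l * m).
Proof.
  intros Hf Hg eps Heps.
  set (A := (1 + Cmod l + Cmod m)%R).
  assert (P1 := Cmod_ge_0 l). assert (P2 := Cmod_ge_0 m).
  assert (HA : (0 < A)%R) by (unfold A; lra).
  set (e := Rmin 1 (eps / (2 * A))).
  assert (He : (0 < e)%R).
  { apply Rmin_pos; [lra|]. apply Rdiv_lt_0_compat; lra. }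
  destruct (Hf e He) as [d [Hd Hw]].
  destruct (Hg e He) as [d' [Hd' Hw']].
  exists (Rmin d d'). split; [apply Rmin_pos; auto|].
  intros w Hwd. assert (B1 := Rmin_l d d'). assert (B2 := Rmin_r d d').
  specialize (Hw w ltac:(lra)). specialize (Hw' w ltac:(lra)).
  replace (f w * g w - l * m) with
    ((f w - l) * (g w - m) + (l * (g w - m) + (f w - l) * m)) by ring.
  eapply Rle_lt_trans; [apply Cmod_triangle|].
  eapply Rle_lt_trans; [apply Rplus_le_compat_l; apply Cmod_triangle|].
  rewrite !Cmod_mult.
  assert (E1 : (e <= 1)%R) by apply Rmin_l.
  assert (E2 : (e * (2 * A) <= eps)%R).
  { assert (X : (e <= eps / (2 * A))%R) by apply Rmin_r.
    apply (Rmult_le_compat_r (2 * A)) in X; [|lra].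
    replace (eps / (2 * A) * (2 * A))%R with eps in X by (field; lra). exact X. }
  assert (Q1 := Cmod_ge_0 (f w - l)). assert (Q2 := Cmod_ge_0 (g w - m)).
  unfold A in E2. nra.
Qed.

Lemma plim_eq f c l m : plim f c l -> l = m -> plim f c m.
Proof. intros; subst; auto. Qed.

Lemma plim_center f c c' l : plim f c l -> c = c' -> plim f c' l.
Proof. intros; subst; auto. Qed.

Lemma plim_scal a f c l : plim f c l -> plim (fun z => a * f z) c (a * l).
Proof. intros H. apply (plim_mult (fun _ => a)); auto. apply plim_const. Qed.

Lemma plim_quot f l : Cder f 0 l -> f 0 = 0 -> plim (fun z => f z * / z) 0 l.
Proof.
  intros Hf H0 eps Heps. destruct (Hf (eps / 2)%R) as [d [Hd Hw]]; [lra|].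
  exists d. split; auto. intros z Hz. specialize (Hw z ltac:(lra)).
  rewrite H0 in Hw. replace (z - 0) with z in * by ring.
  assert (Hz0 : z <> 0) by (apply Cmod_gt_0; lra).
  replace (f z * / z - l) with ((f z - 0 - z * l) * / z) by (field; auto).
  rewrite Cmod_mult, Cmod_inv by auto.
  apply Rle_lt_trans with (eps / 2)%R; [|lra].
  apply (Rmult_le_reg_r (Cmod z)); [lra|]. rewrite Rmult_assoc, Rinv_l, Rmult_1_r by lra. auto.
Qed.

(** Twice differentiable functions are continuously differentiable. *)
Lemma twice_locC1 (f f1 f2 : C -> C) (D : C -> Prop) z :
  (exists r, (0 < r)%R /\ forall w, (Cmod (w - z) < r)%R -> D w) ->
  (forall w, D w -> Cder f w (f1 w) /\ Cder f1 w (f2 w)) -> locC1 f z.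
Proof.
  intros [r [Hr HD]] H. exists r, f1. split; auto. intros w Hw.
  destruct (H w (HD w Hw)) as [A B]. split; auto. apply (Cder_ccont _ _ _ B).
Qed.

Lemma locC1_plus f g z : locC1 f z -> locC1 g z -> locC1 (fun w => f w + g w) z.
Proof.
  intros [r [f' [Hr Hf]]] [s [g' [Hs Hg]]].
  exists (Rmin r s), (fun w => f' w + g' w). split; [apply Rmin_pos; auto|].
  intros w Hw. assert (B1 := Rmin_l r s). assert (B2 := Rmin_r r s).
  destruct (Hf w ltac:(lra)). destruct (Hg w ltac:(lra)).
  split; [apply Cder_plus|apply ccont_plus]; auto.
Qed.

Lemma locC1_mult f g z : locC1 f z -> locC1 g z -> locC1 (fun w => f w * g w) z.
Proof.
  intros [r [f' [Hr Hf]]] [s [g' [Hs Hg]]].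
  exists (Rmin r s), (fun w => f' w * g w + f w * g' w). split; [apply Rmin_pos; auto|].
  intros w Hw. assert (B1 := Rmin_l r s). assert (B2 := Rmin_r r s).
  destruct (Hf w ltac:(lra)) as [A1 A2]. destruct (Hg w ltac:(lra)) as [A3 A4].
  split; [apply Cder_mult; auto|].
  apply ccont_plus; apply ccont_mult; auto; eapply Cder_ccont; eauto.
Qed.

Lemma locC1_const a z : locC1 (fun _ => a) z.
Proof.
  exists 1%R, (fun _ => 0). split; [lra|]. intros w _.
  split; [apply Cder_const|apply ccont_const].
Qed.

Lemma locC1_scal a f z : locC1 f z -> locC1 (fun w => a * f w) z.
Proof. intros. apply (locC1_mult (fun _ => a)); auto. apply locC1_const. Qed.

Lemma locC1_ext f g z r : (0 < r)%R -> (forall w, (Cmod (w - z) < r)%R -> f w = g w) ->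
  locC1 f z -> locC1 g z.
Proof.
  intros Hr E [s [f' [Hs Hf]]]. exists (Rmin s (r / 2)), f'. split; [apply Rmin_pos; lra|].
  intros w Hw. assert (B1 := Rmin_l s (r / 2)). assert (B2 := Rmin_r s (r / 2)).
  destruct (Hf w ltac:(lra)) as [A1 A2]. split; auto.
  apply (Cder_locally_ext f g w _ (r / 2)); auto; [lra|]. intros y Hy. apply E.
  assert (T := Cmod_chain y w z). lra.
Qed.

Section Phi.
Variable tau : C.
Hypothesis Htau : (0 < Im tau)%R.

Let ns (z : C) : Prop := ~ singular tau z.

(** * Half-periods *)

Lemma half_shift (z : C) (m n : Z) : ns z -> ~ in_lattice tau (z + lattice_point tau m n / 2).
Proof.
  intros Hz [a [b E]]. apply Hz. exists (a + a - m)%Z, (b + b - n)%Z.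
  rewrite lp_minus, lp_plus, <- E. field.
Qed.

Lemma ns_half (z : C) (m n : Z) : ns z -> ns (z + lattice_point tau m n / 2).
Proof.
  intros Hz [a [b E]]. apply Hz. exists (a - m)%Z, (b - n)%Z.
  rewrite lp_minus. replace z with (z + lattice_point tau m n / 2 - lattice_point tau m n / 2) by ring.
  rewrite E. field.
Qed.

Lemma half_not_lattice (m n : Z) : (Z.odd m || Z.odd n)%bool = true ->
  ~ in_lattice tau (lattice_point tau m n / 2).
Proof.
  intros H [a [b E]].
  assert (E2 : lattice_point tau m n = lattice_point tau (a + a) (b + b)).
  { rewrite lp_plus, <- E. field. }
  destruct (lp_coords tau Htau m n) as [A1 A2].
  destruct (lp_coords tau Htau (a + a) (b + b)) as [B1 B2].
  rewrite E2 in A1, A2. rewrite A1 in B1. rewrite A2 in B2.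
  apply eq_IZR in B1. apply eq_IZR in B2. subst.
  rewrite !Z.odd_add, !Bool.xorb_nilpotent in H. discriminate.
Qed.

Lemma h1_lp : RtoC 1 / 2 = lattice_point tau 1 0 / 2.
Proof. rewrite lp_10. reflexivity. Qed.
Lemma h2_lp : tau / 2 = lattice_point tau 0 1 / 2.
Proof. rewrite lp_01. reflexivity. Qed.
Lemma lp_11 : lattice_point tau 1 1 = 1 + tau.
Proof. unfold lattice_point. ring. Qed.
Lemma h3_lp : (1 + tau) / 2 = lattice_point tau 1 1 / 2.
Proof. rewrite lp_11. reflexivity. Qed.

Lemma half_lp_neg (z : C) (m n : Z) :
  z - lattice_point tau m n / 2 = z + lattice_point tau (- m) (- n) / 2.
Proof. rewrite lp_opp. field. Qed.

Lemma ns_off (z : C) : ns z -> ~ in_lattice tau z /\ ~ in_lattice tau (z - 1 / 2) /\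
  ~ in_lattice tau (z - tau / 2) /\ ~ in_lattice tau (z - (1 + tau) / 2).
Proof.
  intros Hz. rewrite h1_lp, h2_lp, h3_lp, !half_lp_neg.
  repeat split; try (apply half_shift; auto).
  intros H. apply Hz. apply in_lattice_singular. auto.
Qed.

Lemma ns_h1 z : ns z -> ns (z + 1 / 2).
Proof. rewrite h1_lp. apply ns_half. Qed.
Lemma ns_h2 z : ns z -> ns (z + tau / 2).
Proof. rewrite h2_lp. apply ns_half. Qed.
Lemma ns_h1' z : ns z -> ns (z - 1 / 2).
Proof. rewrite h1_lp, half_lp_neg. apply ns_half. Qed.
Lemma ns_h2' z : ns z -> ns (z - tau / 2).
Proof. rewrite h2_lp, half_lp_neg. apply ns_half. Qed.

Lemma near_0 : exists r, (0 < r)%R /\ forall z, (Cmod (z - 0) < r)%R ->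
  off_star tau z /\ ~ in_lattice tau (z - 1 / 2) /\
  ~ in_lattice tau (z - tau / 2) /\ ~ in_lattice tau (z - (1 + tau) / 2) /\
  (z <> 0 -> ns z).
Proof.
  destruct (singular_isolated tau Htau 0) as [r [Hr H]]. exists r. split; auto.
  intros z Hz.
  assert (Hns : z <> 0 -> ns z).
  { intros Hne Hs. specialize (H z Hs Hne). rewrite Cmod_minus_sym in H. lra. }
  assert (Hh : forall m n, (Z.odd m || Z.odd n)%bool = true ->
    ~ in_lattice tau (z - lattice_point tau m n / 2)).
  { intros m n Hmn. destruct (classic (z = 0)) as [->|Hne].
    - intros K. apply (half_not_lattice m n Hmn). apply in_lattice_opp.
      replace (- (lattice_point tau m n / 2)) with (0 - lattice_point tau m n / 2) by ring. auto.
    - rewrite half_lp_neg. apply half_shift. auto. }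
  rewrite h1_lp, h2_lp, h3_lp. repeat split; auto.
  destruct (classic (z = 0)) as [->|Hne]; [right; auto|left].
  intros K. apply (Hns Hne). apply in_lattice_singular. auto.
Qed.

(** The increment of zeta over the period 1, which is the value of zeta at both sides of the
    half-period by oddness; similarly [eta2] for the period tau. *)
Definition eta1 : C := 2 * wzeta tau (1 / 2).
Definition eta2 : C := 2 * wzeta tau (tau / 2).

Lemma h1_not : ~ in_lattice tau (1 / 2).
Proof. rewrite h1_lp. apply half_not_lattice. reflexivity. Qed.
Lemma h2_not : ~ in_lattice tau (tau / 2).
Proof. rewrite h2_lp. apply half_not_lattice. reflexivity. Qed.
Lemma h3_not : ~ in_lattice tau ((1 + tau) / 2).
Proof. rewrite h3_lp. apply half_not_lattice. reflexivity. Qed.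

Lemma not_opp z : ~ in_lattice tau z -> ~ in_lattice tau (- z).
Proof. intros H K. apply H. apply in_lattice_opp. auto. Qed.

Lemma wzeta_1 z : ~ in_lattice tau z -> wzeta tau (z + 1) = wzeta tau z + eta1.
Proof.
  intros Hz. assert (X := wzeta_shift_1_indep tau Htau z (- (1 / 2)) Hz (not_opp _ h1_not)).
  replace (- (1 / 2) + 1) with (RtoC 1 / 2) in X by field.
  rewrite (wzeta_odd tau Htau) in X by apply h1_not.
  replace (wzeta tau (z + 1)) with (wzeta tau (z + 1) - wzeta tau z + wzeta tau z) by ring.
  rewrite X. unfold eta1. ring.
Qed.

Lemma wzeta_tau z : ~ in_lattice tau z -> wzeta tau (z + tau) = wzeta tau z + eta2.
Proof.
  intros Hz. assert (X := wzeta_shift_tau_indep tau Htau z (- (tau / 2)) Hz (not_opp _ h2_not)).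
  replace (- (tau / 2) + tau) with (tau / 2) in X by field.
  rewrite (wzeta_odd tau Htau) in X by apply h2_not.
  replace (wzeta tau (z + tau)) with (wzeta tau (z + tau) - wzeta tau z + wzeta tau z) by ring.
  rewrite X. unfold eta2. ring.
Qed.

Lemma wzeta_h3 : wzeta tau ((1 + tau) / 2) = (eta1 + eta2) / 2.
Proof.
  assert (H := not_opp _ h3_not).
  assert (H1 : ~ in_lattice tau (- ((1 + tau) / 2) + 1)).
  { rewrite <- (lp_10 tau) at 2. apply lattice_shift_not. auto. }
  assert (X : wzeta tau ((1 + tau) / 2) = - wzeta tau ((1 + tau) / 2) + eta1 + eta2).
  { rewrite <- (wzeta_odd tau Htau) by apply h3_not.
    rewrite <- wzeta_1, <- wzeta_tau by auto. f_equal. field. }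
  replace (wzeta tau ((1 + tau) / 2)) with
    ((wzeta tau ((1 + tau) / 2) + wzeta tau ((1 + tau) / 2)) / 2) by field.
  rewrite X at 1. field.
Qed.

Lemma not_lattice_disc z : ~ in_lattice tau z -> exists r, (0 < r)%R /\
  forall w, (Cmod (w - z) < r)%R -> ~ in_lattice tau w.
Proof.
  intros Hz. destruct (singular_isolated tau Htau z) as [r [Hr H]]. exists r. split; auto.
  intros w Hw Hs. destruct (classic (w = z)) as [->|Hne]; auto.
  specialize (H w (in_lattice_singular _ _ Hs) Hne). rewrite Cmod_minus_sym in H. lra.
Qed.

Lemma wp_period (w e : C) : (forall z, ~ in_lattice tau z -> ~ in_lattice tau (z + w)) ->
  (forall z, ~ in_lattice tau z -> wzeta tau (z + w) = wzeta tau z + e) ->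
  forall z, ~ in_lattice tau z -> wp tau (z + w) = wp tau z.
Proof.
  intros Hw He z Hz.
  assert (A : Cder (fun y => wzeta tau (y + w)) z (- wp tau (z + w))).
  { apply Cder_shift. apply wzeta_Cder; auto. }
  assert (B : Cder (fun y => wzeta tau (y + w)) z (- wp tau z + 0)).
  { destruct (not_lattice_disc z Hz) as [r [Hr H]].
    apply (Cder_locally_ext (fun y => wzeta tau y + e) _ z _ r Hr).
    - intros y Hy. symmetry. auto.
    - apply Cder_plus; [apply wzeta_Cder; auto|apply Cder_const]. }
  assert (E := Cder_unique _ _ _ _ A B).
  replace (wp tau (z + w)) with (- - wp tau (z + w)) by ring. rewrite E. ring.
Qed.

Lemma lat_1 z : ~ in_lattice tau z -> ~ in_lattice tau (z + 1).
Proof. rewrite <- (lp_10 tau). apply lattice_shift_not. Qed.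
Lemma lat_tau z : ~ in_lattice tau z -> ~ in_lattice tau (z + tau).
Proof. rewrite <- (lp_01 tau) at 3. apply lattice_shift_not. Qed.

Lemma wp_1 z : ~ in_lattice tau z -> wp tau (z + 1) = wp tau z.
Proof. apply (wp_period 1 eta1 lat_1 wzeta_1). Qed.
Lemma wp_tau z : ~ in_lattice tau z -> wp tau (z + tau) = wp tau z.
Proof. apply (wp_period tau eta2 lat_tau wzeta_tau). Qed.

(** * The functions phi *)

(** Combinations of the translates of zeta by half-periods, with residue 1 at 0. *)
Definition ph (a b c d z : C) : C :=
  wzeta tau z + a * wzeta tau (z - 1 / 2) + b * wzeta tau (z - tau / 2)
  + c * wzeta tau (z - (1 + tau) / 2) + d.

Definition wpsum (a b c z : C) : C :=
  wp tau z + a * wp tau (z - 1 / 2) + b * wp tau (z - tau / 2) + c * wp tau (z - (1 + tau) / 2).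

Definition wp1sum (a b c z : C) : C :=
  wp1 tau z + a * wp1 tau (z - 1 / 2) + b * wp1 tau (z - tau / 2) + c * wp1 tau (z - (1 + tau) / 2).

Lemma comb_Cder (F F' : C -> C) (a b c z : C) :
  (forall z, ~ in_lattice tau z -> Cder F z (F' z)) -> ns z ->
  Cder (fun z => F z + a * F (z - 1 / 2) + b * F (z - tau / 2) + c * F (z - (1 + tau) / 2)) z
    (F' z + a * F' (z - 1 / 2) + b * F' (z - tau / 2) + c * F' (z - (1 + tau) / 2)).
Proof.
  intros H Hz. destruct (ns_off z Hz) as [A0 [A1 [A2 A3]]].
  repeat apply Cder_plus; auto; apply Cder_scal;
    [apply (Cder_shift F z (- (1 / 2)))|apply (Cder_shift F z (- (tau / 2)))
    |apply (Cder_shift F z (- ((1 + tau) / 2)))]; apply H; auto.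
Qed.

Lemma ph_Cder a b c d z : ns z -> Cder (ph a b c d) z (- wpsum a b c z).
Proof.
  intros Hz. eapply Cder_eq.
  - apply (Cder_plus _ (fun _ => d)); [|apply Cder_const].
    apply (comb_Cder (wzeta tau) (fun z => - wp tau z)); auto. apply wzeta_Cder; auto.
  - unfold wpsum. ring.
Qed.

Lemma wpsum_Cder a b c z : ns z -> Cder (wpsum a b c) z (wp1sum a b c z).
Proof. intros Hz. apply (comb_Cder (wp tau) (wp1 tau)); auto. apply wp_Cder; auto. Qed.

Lemma wp1sum_Cder a b c z : ns z -> exists l, Cder (wp1sum a b c) z l.
Proof.
  intros Hz. eexists. apply (comb_Cder (wp1 tau) (der (wp1 tau))); auto.
  intros y Hy. destruct (wp1_Cder tau Htau y Hy) as [l Hl]. rewrite (der_eq _ _ _ Hl). auto.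
Qed.

Lemma ns_disc z : ns z -> exists r, (0 < r)%R /\ forall w, (Cmod (w - z) < r)%R -> ns w.
Proof. apply nonsingular_disc. auto. Qed.

Lemma ph_locC1 a b c d z : ns z -> locC1 (ph a b c d) z.
Proof.
  intros Hz. apply (twice_locC1 _ (fun z => - wpsum a b c z) (fun z => - wp1sum a b c z) ns).
  - apply ns_disc; auto.
  - intros w Hw. split; [apply ph_Cder|apply Cder_opp, wpsum_Cder]; auto.
Qed.

Lemma wpsum_locC1 a b c z : ns z -> locC1 (wpsum a b c) z.
Proof.
  intros Hz. apply (twice_locC1 _ (wp1sum a b c) (der (wp1sum a b c)) ns).
  - apply ns_disc; auto.
  - intros w Hw. split; [apply wpsum_Cder; auto|].
    destruct (wp1sum_Cder a b c w Hw) as [l Hl]. rewrite (der_eq _ _ _ Hl). auto.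
Qed.

(** The four arguments are permuted by a translation by a half-period. *)
Lemma comb_h1 (F : C -> C) (e : C) (a b c z : C) :
  (forall z, ~ in_lattice tau z -> F (z + 1) = F z + e) -> ns z ->
  F (z + 1 / 2) + a * F (z + 1 / 2 - 1 / 2) + b * F (z + 1 / 2 - tau / 2)
    + c * F (z + 1 / 2 - (1 + tau) / 2) =
  (F (z - 1 / 2) + e) + a * F z + b * (F (z - (1 + tau) / 2) + e) + c * F (z - tau / 2).
Proof.
  intros H Hz. destruct (ns_off z Hz) as [A0 [A1 [A2 A3]]].
  rewrite <- (H (z - 1 / 2)), <- (H (z - (1 + tau) / 2)) by auto.
  f_equal; [f_equal; [f_equal|]|]; try (f_equal; field); f_equal; f_equal; field.
Qed.

Lemma comb_h2 (F : C -> C) (e : C) (a b c z : C) :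
  (forall z, ~ in_lattice tau z -> F (z + tau) = F z + e) -> ns z ->
  F (z + tau / 2) + a * F (z + tau / 2 - 1 / 2) + b * F (z + tau / 2 - tau / 2)
    + c * F (z + tau / 2 - (1 + tau) / 2) =
  (F (z - tau / 2) + e) + a * (F (z - (1 + tau) / 2) + e) + b * F z + c * F (z - 1 / 2).
Proof.
  intros H Hz. destruct (ns_off z Hz) as [A0 [A1 [A2 A3]]].
  rewrite <- (H (z - tau / 2)), <- (H (z - (1 + tau) / 2)) by auto.
  f_equal; [f_equal; [f_equal|]|]; try (f_equal; field); f_equal; f_equal; field.
Qed.

Lemma ph_h1 a b c d z : ns z -> ph a b c d (z + 1 / 2) =
  wzeta tau (z - 1 / 2) + a * wzeta tau z + b * wzeta tau (z - (1 + tau) / 2)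
  + c * wzeta tau (z - tau / 2) + (1 + b) * eta1 + d.
Proof. intros Hz. unfold ph. rewrite (comb_h1 _ eta1) by auto using wzeta_1. ring. Qed.

Lemma ph_h2 a b c d z : ns z -> ph a b c d (z + tau / 2) =
  wzeta tau (z - tau / 2) + a * wzeta tau (z - (1 + tau) / 2) + b * wzeta tau z
  + c * wzeta tau (z - 1 / 2) + (1 + a) * eta2 + d.
Proof. intros Hz. unfold ph. rewrite (comb_h2 _ eta2) by auto using wzeta_tau. ring. Qed.

Lemma wpsum_h1 a b c z : ns z -> wpsum a b c (z + 1 / 2) =
  wp tau (z - 1 / 2) + a * wp tau z + b * wp tau (z - (1 + tau) / 2) + c * wp tau (z - tau / 2).
Proof.
  intros Hz. unfold wpsum. rewrite (comb_h1 _ 0) by (auto; intros; rewrite wp_1; auto; ring). ring.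
Qed.

Lemma wpsum_h2 a b c z : ns z -> wpsum a b c (z + tau / 2) =
  wp tau (z - tau / 2) + a * wp tau (z - (1 + tau) / 2) + b * wp tau z + c * wp tau (z - 1 / 2).
Proof.
  intros Hz. unfold wpsum. rewrite (comb_h2 _ 0) by (auto; intros; rewrite wp_tau; auto; ring). ring.
Qed.

(** The regular part of [ph] at 0. [sig] plays the same role for [wpsum]. *)
Definition rho (a b c d z : C) : C :=
  zr tau z + a * wzeta tau (z - 1 / 2) + b * wzeta tau (z - tau / 2)
  + c * wzeta tau (z - (1 + tau) / 2) + d.

Definition sig (a b c z : C) : C :=
  pr tau z + a * wp tau (z - 1 / 2) + b * wp tau (z - tau / 2) + c * wp tau (z - (1 + tau) / 2).

Lemma ph_rho a b c d z : ph a b c d z = / z + rho a b c d z.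
Proof. unfold ph, rho. rewrite (wzeta_zr tau z). ring. Qed.

Lemma wpsum_sig a b c z : wpsum a b c z = / (z * z) + sig a b c z.
Proof. unfold wpsum, sig. rewrite (wp_pr tau z). ring. Qed.

Lemma near_comb_Cder (f f' F F' : C -> C) (a b c : C) :
  (forall z, off_star tau z -> Cder f z (f' z)) ->
  (forall z, ~ in_lattice tau z -> Cder F z (F' z)) ->
  Cder (fun z => f z + a * F (z - 1 / 2) + b * F (z - tau / 2) + c * F (z - (1 + tau) / 2)) 0
    (f' 0 + a * F' (0 - 1 / 2) + b * F' (0 - tau / 2) + c * F' (0 - (1 + tau) / 2)).
Proof.
  intros Hf HF. destruct near_0 as [r [Hr H]].
  destruct (H 0) as [A0 [A1 [A2 [A3 _]]]].
  { replace (0 - 0) with (RtoC 0) by ring. rewrite Cmod_0. auto. }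
  repeat apply Cder_plus; auto; apply Cder_scal;
    [apply (Cder_shift F 0 (- (1 / 2)))|apply (Cder_shift F 0 (- (tau / 2)))
    |apply (Cder_shift F 0 (- ((1 + tau) / 2)))]; apply HF; auto.
Qed.

Lemma rho_Cder a b c d : Cder (rho a b c d) 0 (- sig a b c 0).
Proof.
  eapply Cder_eq.
  - apply (Cder_plus _ (fun _ => d)); [|apply Cder_const].
    apply (near_comb_Cder (zr tau) (fun z => - pr tau z) (wzeta tau) (fun z => - wp tau z)).
    + intros; apply zr_Cder; auto.
    + intros; apply wzeta_Cder; auto.
  - unfold sig. ring.
Qed.

Lemma sig_ccont a b c : ccont (sig a b c) 0.
Proof.
  eapply Cder_ccont.
  apply (near_comb_Cder (pr tau) (pr1 tau) (wp tau) (wp1 tau)).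
  - intros; apply pr_Cder; auto.
  - intros; apply wp_Cder; auto.
Qed.

Lemma rho_0 a b c d : rho a b c d 0 = d - (a * eta1 + b * eta2 + c * (eta1 + eta2)) / 2.
Proof.
  unfold rho. rewrite zr_0 by auto.
  replace (0 - 1 / 2) with (- (RtoC 1 / 2)) by ring.
  replace (0 - tau / 2) with (- (tau / 2)) by ring.
  replace (0 - (1 + tau) / 2) with (- ((1 + tau) / 2)) by ring.
  rewrite !(wzeta_odd tau Htau) by (apply h1_not || apply h2_not || apply h3_not).
  rewrite wzeta_h3. unfold eta1, eta2. field.
Qed.

(** By periodicity e1, e2 and e3 are the values of wp at the three half-periods. *)
Definition e1 : C := wp tau (0 - 1 / 2).
Definition e2 : C := wp tau (0 - tau / 2).
Definition e3 : C := wp tau (0 - (1 + tau) / 2).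

Lemma sig_0 a b c : sig a b c 0 = a * e1 + b * e2 + c * e3.
Proof. unfold sig, e1, e2, e3. rewrite pr_0 by auto. ring. Qed.

(** * Liouville's theorem for functions with signs under half-periods *)

(** The sign may depend on m, so that it is only claimed to exist. *)
Lemma sign_iter (f : C -> C) (w s : C) : (s * s = 1) ->
  (forall z, ns z -> ns (z + w)) -> (forall z, ns z -> ns (z - w)) ->
  (forall z, ns z -> f (z + w) = s * f z) ->
  forall m : Z, exists t, forall z, ns z -> ns (z + RtoC (IZR m) * w) /\
    f (z + RtoC (IZR m) * w) = t * f z.
Proof.
  intros Hs Hw Hw' H.
  assert (Hm : forall z, ns z -> f (z - w) = s * f z).
  { intros z Hz. assert (X := H (z - w) (Hw' z Hz)). replace (z - w + w) with z in X by ring.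
    rewrite X. transitivity ((s * s) * f (z - w)); [rewrite Hs; ring|ring]. }
  assert (N : forall n : nat, exists t, forall z, ns z -> ns (z + RtoC (INR n) * w) /\
    f (z + RtoC (INR n) * w) = t * f z).
  { induction n as [|n [t IH]].
    - exists 1. intros z Hz. simpl INR. replace (z + 0 * w) with z by ring. split; auto. ring.
    - exists (s * t). intros z Hz. destruct (IH z Hz) as [A B].
      rewrite S_INR, RtoC_plus. replace (z + (RtoC (INR n) + 1) * w) with
        (z + RtoC (INR n) * w + w) by ring.
      split; auto. rewrite H, B by auto. ring. }
  assert (N' : forall n : nat, exists t, forall z, ns z -> ns (z - RtoC (INR n) * w) /\
    f (z - RtoC (INR n) * w) = t * f z).
  { induction n as [|n [t IH]].
    - exists 1. intros z Hz. simpl INR. replace (z - 0 * w) with z by ring. split; auto. ring.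
    - exists (s * t). intros z Hz. destruct (IH z Hz) as [A B].
      rewrite S_INR, RtoC_plus. replace (z - (RtoC (INR n) + 1) * w) with
        (z - RtoC (INR n) * w - w) by ring.
      split; auto. rewrite Hm, B by auto. ring. }
  intros m. destruct (Z_le_gt_dec 0 m) as [Hp|Hp].
  - destruct (N (Z.to_nat m)) as [t Ht]. exists t. intros z Hz. specialize (Ht z Hz).
    rewrite INR_IZR_INZ, Z2Nat.id in Ht by auto. auto.
  - destruct (N' (Z.to_nat (- m))) as [t Ht]. exists t. intros z Hz. specialize (Ht z Hz).
    rewrite INR_IZR_INZ, Z2Nat.id in Ht by lia. rewrite opp_IZR, RtoC_opp in Ht.
    replace (z - - RtoC (IZR m) * w) with (z + RtoC (IZR m) * w) in Ht by ring. auto.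
Qed.

(** A limit at one point is carried to all its translates, up to a sign; it yields
    the limits at all half-lattice points from the one at 0. *)
Lemma iter_plim (f : C -> C) (w1 w2 s1 s2 c0 l : C) : s1 * s1 = 1 -> s2 * s2 = 1 ->
  (forall z, ns z -> ns (z + w1)) -> (forall z, ns z -> ns (z - w1)) ->
  (forall z, ns z -> ns (z + w2)) -> (forall z, ns z -> ns (z - w2)) ->
  (forall z, ns z -> f (z + w1) = s1 * f z) ->
  (forall z, ns z -> f (z + w2) = s2 * f z) ->
  plim f c0 l -> forall m n : Z, exists l',
    plim f (c0 + RtoC (IZR m) * w1 + RtoC (IZR n) * w2) l'.
Proof.
  intros Hs1 Hs2 P1 P1' P2 P2' H1 H2 Hl m n.
  destruct (sign_iter f _ s1 Hs1 P1 P1' H1 m) as [t1 T1].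
  destruct (sign_iter f _ s2 Hs2 P2 P2' H2 n) as [t2 T2].
  set (v := RtoC (IZR m) * w1 + RtoC (IZR n) * w2).
  replace (c0 + RtoC (IZR m) * w1 + RtoC (IZR n) * w2) with (c0 + v) by (unfold v; ring).
  exists (t2 * t1 * l).
  destruct (singular_isolated tau Htau c0) as [r [Hr Hn]].
  assert (X : plim (fun z => t2 * t1 * f (z + - v)) (c0 + v) (t2 * t1 * l)).
  { apply plim_scal. apply plim_shift. replace (c0 + v + - v) with c0 by ring. auto. }
  apply (plim_ext _ f (c0 + v) _ r Hr) in X; auto.
  intros z Hz. set (x := z + - v).
  assert (Ex : Cmod (x - c0) = Cmod (z - (c0 + v))) by (f_equal; unfold x; ring).
  assert (Hx : ns x).
  { intros K. assert (Hne : x <> c0).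
    { intros E. rewrite E in Ex. replace (c0 - c0) with (RtoC 0) in Ex by ring.
      rewrite Cmod_0 in Ex. lra. }
    specialize (Hn x K Hne). rewrite Cmod_minus_sym in Hn. lra. }
  destruct (T1 x Hx) as [A1 A2]. destruct (T2 _ A1) as [B1 B2].
  replace z with (x + RtoC (IZR m) * w1 + RtoC (IZR n) * w2) at 1 by (unfold x, v; ring).
  rewrite B2, A2. ring.
Qed.

(** A function multiplied by signs under half-periods is elliptic, and its only
    singularities are the translates of 0, so it is constant; the signs then act trivially
    on the constant. *)
Lemma half_liouville (f : C -> C) (s1 s2 l : C) : s1 * s1 = 1 -> s2 * s2 = 1 ->
  (forall z, ns z -> locC1 f z) ->
  (forall z, ns z -> f (z + 1 / 2) = s1 * f z) ->
  (forall z, ns z -> f (z + tau / 2) = s2 * f z) ->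
  plim f 0 l -> (forall z, ns z -> f z = l) /\ s1 * l = l /\ s2 * l = l.
Proof.
  intros Hs1 Hs2 Hf H1 H2 Hl.
  destruct (liouville tau Htau f 0 0 Hf) as [_ [k [Hk Hk2]]].
  - intros z Hz. replace (z + 1) with (z + 1 / 2 + 1 / 2) by field.
    rewrite H1, H1 by auto using ns_h1. transitivity (s1 * s1 * f z); [ring|rewrite Hs1; ring].
  - intros z Hz. replace (z + tau) with (z + tau / 2 + tau / 2) by field.
    rewrite H2, H2 by auto using ns_h2. transitivity (s2 * s2 * f z); [ring|rewrite Hs2; ring].
  - intros c [m [n Ec]].
    destruct (iter_plim f _ _ s1 s2 0 l Hs1 Hs2 ns_h1 ns_h1' ns_h2 ns_h2' H1 H2 Hl m n) as [l' X].
    exists l'. rewrite Ec. eapply plim_center; [exact X|]. unfold lattice_point. field.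
  - assert (E : forall z, ns z -> f z = l).
    { intros z Hz. rewrite Hk by auto. apply (plim_unique f 0); auto.
      replace (0 * z + k) with (0 * 0 + k) by ring. apply Hk2.
      apply in_lattice_singular, in_lattice_0. }
    split; auto.
    destruct near_0 as [r [Hr Hn]].
    assert (Hz : ns (RtoC (r / 2))).
    { apply Hn.
      - replace (RtoC (r / 2) - 0) with (RtoC (r / 2)) by ring. rewrite Cmod_R, Rabs_pos_eq; lra.
      - intros K. apply RtoC_inj in K. lra. }
    split.
    + rewrite <- (E _ Hz) at 1. rewrite <- H1 by auto. apply E. apply ns_h1; auto.
    + rewrite <- (E _ Hz) at 1. rewrite <- H2 by auto. apply E. apply ns_h2; auto.
Qed.

(** * The identities between the three functions *)

(** The residues are +1 at 0 and omega_l / 2, and -1 at the other two half-periods; the constants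
    remove the constant term at 0, as [rho1_0] and its analogues say. *)
Definition phi1 : C -> C := ph 1 (- (1)) (- (1)) (- eta2).
Definition phi2 : C -> C := ph (- (1)) 1 (- (1)) (- eta1).
Definition phi3 : C -> C := ph (- (1)) (- (1)) 1 0.

Lemma phi1_h1 z : ns z -> phi1 (z + 1 / 2) = phi1 z.
Proof. intros Hz. unfold phi1. rewrite ph_h1 by auto. unfold ph. ring. Qed.
Lemma phi1_h2 z : ns z -> phi1 (z + tau / 2) = - phi1 z.
Proof. intros Hz. unfold phi1. rewrite ph_h2 by auto. unfold ph. ring. Qed.
Lemma phi2_h1 z : ns z -> phi2 (z + 1 / 2) = - phi2 z.
Proof. intros Hz. unfold phi2. rewrite ph_h1 by auto. unfold ph. ring. Qed.
Lemma phi2_h2 z : ns z -> phi2 (z + tau / 2) = phi2 z.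
Proof. intros Hz. unfold phi2. rewrite ph_h2 by auto. unfold ph. ring. Qed.
Lemma phi3_h1 z : ns z -> phi3 (z + 1 / 2) = - phi3 z.
Proof. intros Hz. unfold phi3. rewrite ph_h1 by auto. unfold ph. ring. Qed.
Lemma phi3_h2 z : ns z -> phi3 (z + tau / 2) = - phi3 z.
Proof. intros Hz. unfold phi3. rewrite ph_h2 by auto. unfold ph. ring. Qed.

Lemma rho1_0 : rho 1 (- (1)) (- (1)) (- eta2) 0 = 0.
Proof. rewrite rho_0. field. Qed.
Lemma rho2_0 : rho (- (1)) 1 (- (1)) (- eta1) 0 = 0.
Proof. rewrite rho_0. field. Qed.
Lemma rho3_0 : rho (- (1)) (- (1)) 1 0 0 = 0.
Proof. rewrite rho_0. field. Qed.

(** phi' + psi chi is regular at 0 when the three constant terms vanish. *)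
Lemma triple_plim a b c a1 b1 c1 d1 a2 b2 c2 d2 :
  rho a1 b1 c1 d1 0 = 0 -> rho a2 b2 c2 d2 0 = 0 ->
  plim (fun z => - wpsum a b c z + ph a1 b1 c1 d1 z * ph a2 b2 c2 d2 z) 0
    (- sig a b c 0 - sig a1 b1 c1 0 - sig a2 b2 c2 0).
Proof.
  intros H1 H2.
  assert (X1 := plim_quot _ _ (rho_Cder a1 b1 c1 d1) H1).
  assert (X2 := plim_quot _ _ (rho_Cder a2 b2 c2 d2) H2).
  assert (Y1 := ccont_plim _ _ (Cder_ccont _ _ _ (rho_Cder a1 b1 c1 d1))).
  assert (Y2 := ccont_plim _ _ (Cder_ccont _ _ _ (rho_Cder a2 b2 c2 d2))).
  assert (X3 := plim_scal (- (1)) _ _ _ (ccont_plim _ _ (sig_ccont a b c))).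
  assert (Z := plim_plus _ _ _ _ _ X3 (plim_plus _ _ _ _ _ (plim_plus _ _ _ _ _ X1 X2)
    (plim_mult _ _ _ _ _ Y1 Y2))).
  cbv beta in Z. rewrite H1, H2 in Z.
  apply (plim_ext _ (fun z => - wpsum a b c z + ph a1 b1 c1 d1 z * ph a2 b2 c2 d2 z) 0 _ 1
    Rlt_0_1) in Z.
  - eapply plim_eq; [exact Z|ring].
  - intros z Hz. assert (Hz0 : z <> 0).
    { intros ->. replace (0 - 0) with (RtoC 0) in Hz by ring. rewrite Cmod_0 in Hz. lra. }
    rewrite wpsum_sig, !ph_rho. field. auto.
Qed.

(** The double poles cancel, and so do the simple ones when the constant term vanishes. *)
Lemma square_plim a b c d : rho a b c d 0 = 0 ->
  plim (fun z => wpsum 1 1 1 z - ph a b c d z * ph a b c d z) 0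
    (sig 1 1 1 0 + 2 * sig a b c 0).
Proof.
  intros H1.
  assert (X1 := plim_scal (- (2)) _ _ _ (plim_quot _ _ (rho_Cder a b c d) H1)).
  assert (Y1 := ccont_plim _ _ (Cder_ccont _ _ _ (rho_Cder a b c d))).
  assert (Y2 := plim_scal (- (1)) _ _ _ (plim_mult _ _ _ _ _ Y1 Y1)).
  assert (X3 := ccont_plim _ _ (sig_ccont 1 1 1)).
  assert (Z := plim_plus _ _ _ _ _ X3 (plim_plus _ _ _ _ _ X1 Y2)).
  cbv beta in Z. rewrite H1 in Z.
  apply (plim_ext _ (fun z => wpsum 1 1 1 z - ph a b c d z * ph a b c d z) 0 _ 1
    Rlt_0_1) in Z.
  - eapply plim_eq; [exact Z|ring].
  - intros z Hz. assert (Hz0 : z <> 0).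
    { intros ->. replace (0 - 0) with (RtoC 0) in Hz by ring. rewrite Cmod_0 in Hz. lra. }
    rewrite wpsum_sig, !ph_rho. field. auto.
Qed.

(** This is how a nontrivial sign kills the constant of [half_liouville]. *)
Lemma C_self_opp (l : C) : - (1) * l = l -> l = 0.
Proof.
  intros H. replace l with ((l - - (1) * l) / 2) by field. rewrite H. field.
Qed.

Lemma phi_locC1 a b c a1 b1 c1 d1 a2 b2 c2 d2 z : ns z ->
  locC1 (fun z => - wpsum a b c z + ph a1 b1 c1 d1 z * ph a2 b2 c2 d2 z) z.
Proof.
  intros Hz. apply locC1_plus.
  - apply (locC1_ext (fun z => - (1) * wpsum a b c z) _ z 1 Rlt_0_1).
    + intros. ring.
    + apply locC1_scal. apply wpsum_locC1; auto.
  - apply locC1_mult; apply ph_locC1; auto.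
Qed.

(** phi_1' and - phi_2 phi_3 have the same double poles and the same signs under
    half-periods; the sign under tau / 2 is -1, so that the constant difference is zero.
    The value of this constant is a multiple of e1 + e2 + e3. *)
Lemma phi1_der_aux : (forall z, ns z -> wpsum 1 (- (1)) (- (1)) z = phi2 z * phi3 z) /\
  e1 + e2 + e3 = 0.
Proof.
  destruct (half_liouville (fun z => - wpsum 1 (- (1)) (- (1)) z + phi2 z * phi3 z) 1 (- (1))
    (- sig 1 (- (1)) (- (1)) 0 - sig (- (1)) 1 (- (1)) 0 - sig (- (1)) (- (1)) 1 0))
    as [A [_ B]]; try ring.
  - intros. apply phi_locC1; auto.
  - intros z Hz. rewrite wpsum_h1, phi2_h1, phi3_h1 by auto. unfold wpsum. ring.
  - intros z Hz. rewrite wpsum_h2, phi2_h2, phi3_h2 by auto. unfold wpsum. ring.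
  - apply triple_plim; [apply rho2_0|apply rho3_0].
  - apply C_self_opp in B. split.
    + intros z Hz. specialize (A z Hz). rewrite B in A.
      replace (phi2 z * phi3 z) with (- wpsum 1 (- (1)) (- (1)) z + phi2 z * phi3 z +
        wpsum 1 (- (1)) (- (1)) z) by ring. rewrite A. ring.
    + rewrite !sig_0 in B. rewrite <- B. ring.
Qed.

Lemma e_sum : e1 + e2 + e3 = 0.
Proof. apply phi1_der_aux. Qed.

Lemma phi2_der_aux : forall z, ns z -> wpsum (- (1)) 1 (- (1)) z = phi1 z * phi3 z.
Proof.
  destruct (half_liouville (fun z => - wpsum (- (1)) 1 (- (1)) z + phi1 z * phi3 z) (- (1)) 1
    (- sig (- (1)) 1 (- (1)) 0 - sig 1 (- (1)) (- (1)) 0 - sig (- (1)) (- (1)) 1 0))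
    as [A [B _]]; try ring.
  - intros. apply phi_locC1; auto.
  - intros z Hz. rewrite wpsum_h1, phi1_h1, phi3_h1 by auto. unfold wpsum. ring.
  - intros z Hz. rewrite wpsum_h2, phi1_h2, phi3_h2 by auto. unfold wpsum. ring.
  - apply triple_plim; [apply rho1_0|apply rho3_0].
  - apply C_self_opp in B. intros z Hz. specialize (A z Hz). rewrite B in A.
    replace (phi1 z * phi3 z) with (- wpsum (- (1)) 1 (- (1)) z + phi1 z * phi3 z +
      wpsum (- (1)) 1 (- (1)) z) by ring. rewrite A. ring.
Qed.

Lemma phi3_der_aux : forall z, ns z -> wpsum (- (1)) (- (1)) 1 z = phi1 z * phi2 z.
Proof.
  destruct (half_liouville (fun z => - wpsum (- (1)) (- (1)) 1 z + phi1 z * phi2 z) (- (1)) (- (1))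
    (- sig (- (1)) (- (1)) 1 0 - sig 1 (- (1)) (- (1)) 0 - sig (- (1)) 1 (- (1)) 0))
    as [A [B _]]; try ring.
  - intros. apply phi_locC1; auto.
  - intros z Hz. rewrite wpsum_h1, phi1_h1, phi2_h1 by auto. unfold wpsum. ring.
  - intros z Hz. rewrite wpsum_h2, phi1_h2, phi2_h2 by auto. unfold wpsum. ring.
  - apply triple_plim; [apply rho1_0|apply rho2_0].
  - apply C_self_opp in B. intros z Hz. specialize (A z Hz). rewrite B in A.
    replace (phi1 z * phi2 z) with (- wpsum (- (1)) (- (1)) 1 z + phi1 z * phi2 z +
      wpsum (- (1)) (- (1)) 1 z) by ring. rewrite A. ring.
Qed.

Lemma phi1_Cder z : ns z -> Cder phi1 z (- (phi2 z * phi3 z)).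
Proof. intros Hz. rewrite <- (proj1 phi1_der_aux) by auto. apply ph_Cder; auto. Qed.
Lemma phi2_Cder z : ns z -> Cder phi2 z (- (phi1 z * phi3 z)).
Proof. intros Hz. rewrite <- phi2_der_aux by auto. apply ph_Cder; auto. Qed.
Lemma phi3_Cder z : ns z -> Cder phi3 z (- (phi1 z * phi2 z)).
Proof. intros Hz. rewrite <- phi3_der_aux by auto. apply ph_Cder; auto. Qed.

(** phi_l^2 is invariant under all half-periods, so it differs by a constant from the sum of
    wp over the half-periods. *)
Lemma phi_square a b c d s1 s2 : rho a b c d 0 = 0 -> s1 * s1 = 1 -> s2 * s2 = 1 ->
  (forall z, ns z -> ph a b c d (z + 1 / 2) = s1 * ph a b c d z) ->
  (forall z, ns z -> ph a b c d (z + tau / 2) = s2 * ph a b c d z) ->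
  forall z, ns z -> wpsum 1 1 1 z = ph a b c d z * ph a b c d z + 2 * (a * e1 + b * e2 + c * e3).
Proof.
  intros H0 Hs1 Hs2 H1 H2.
  destruct (half_liouville (fun z => wpsum 1 1 1 z - ph a b c d z * ph a b c d z) 1 1
    (sig 1 1 1 0 + 2 * sig a b c 0)) as [A _]; try ring.
  - intros z Hz. apply locC1_plus; [apply wpsum_locC1; auto|].
    apply (locC1_ext (fun z => - (1) * (ph a b c d z * ph a b c d z)) _ z 1 Rlt_0_1).
    + intros. ring.
    + apply locC1_scal. apply locC1_mult; apply ph_locC1; auto.
  - intros z Hz. rewrite wpsum_h1, H1 by auto.
    transitivity (wpsum 1 1 1 z - (s1 * s1) * (ph a b c d z * ph a b c d z)).
    + unfold wpsum. ring.
    + rewrite Hs1. ring.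
  - intros z Hz. rewrite wpsum_h2, H2 by auto.
    transitivity (wpsum 1 1 1 z - (s2 * s2) * (ph a b c d z * ph a b c d z)).
    + unfold wpsum. ring.
    + rewrite Hs2. ring.
  - apply square_plim; auto.
  - intros z Hz. specialize (A z Hz). rewrite !sig_0 in A. assert (E := e_sum).
    replace (wpsum 1 1 1 z) with (wpsum 1 1 1 z - ph a b c d z * ph a b c d z +
      ph a b c d z * ph a b c d z) by ring.
    rewrite A. replace (1 * e1 + 1 * e2 + 1 * e3) with (e1 + e2 + e3) by ring. rewrite E. ring.
Qed.

Lemma phi1_square z : ns z -> wpsum 1 1 1 z = phi1 z * phi1 z + 4 * e1.
Proof.
  intros Hz. rewrite (phi_square _ _ _ _ 1 (- (1)) rho1_0); auto; try ring.
  - fold phi1. assert (E := e_sum). transitivity (phi1 z * phi1 z + 4 * e1 - 2 * (e1 + e2 + e3)).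
    ring. rewrite E. ring.
  - intros y Hy. fold phi1. rewrite phi1_h1 by auto. ring.
  - intros y Hy. fold phi1. rewrite phi1_h2 by auto. ring.
Qed.

Lemma phi2_square z : ns z -> wpsum 1 1 1 z = phi2 z * phi2 z + 4 * e2.
Proof.
  intros Hz. rewrite (phi_square _ _ _ _ (- (1)) 1 rho2_0); auto; try ring.
  - fold phi2. assert (E := e_sum). transitivity (phi2 z * phi2 z + 4 * e2 - 2 * (e1 + e2 + e3)).
    ring. rewrite E. ring.
  - intros y Hy. fold phi2. rewrite phi2_h1 by auto. ring.
  - intros y Hy. fold phi2. rewrite phi2_h2 by auto. ring.
Qed.

Lemma phi3_square z : ns z -> wpsum 1 1 1 z = phi3 z * phi3 z + 4 * e3.
Proof.
  intros Hz. rewrite (phi_square _ _ _ _ (- (1)) (- (1)) rho3_0); auto; try ring.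
  - fold phi3. assert (E := e_sum). transitivity (phi3 z * phi3 z + 4 * e3 - 2 * (e1 + e2 + e3)).
    ring. rewrite E. ring.
  - intros y Hy. fold phi3. rewrite phi3_h1 by auto. ring.
  - intros y Hy. fold phi3. rewrite phi3_h2 by auto. ring.
Qed.

(** The average of the three formulas for phi_l^2, since e1 + e2 + e3 = 0. *)
Lemma wpsum_phi z : ns z ->
  wpsum 1 1 1 z = (phi1 z * phi1 z + phi2 z * phi2 z + phi3 z * phi3 z) / 3.
Proof.
  intros Hz. assert (A := phi1_square z Hz). assert (B := phi2_square z Hz).
  assert (D := phi3_square z Hz). assert (E := e_sum).
  replace (wpsum 1 1 1 z) with ((wpsum 1 1 1 z + wpsum 1 1 1 z + wpsum 1 1 1 z) / 3) by field.
  rewrite A at 1. rewrite B at 1. rewrite D at 1.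
  replace (phi1 z * phi1 z + 4 * e1 + (phi2 z * phi2 z + 4 * e2) + (phi3 z * phi3 z + 4 * e3))
    with (phi1 z * phi1 z + phi2 z * phi2 z + phi3 z * phi3 z + 4 * (e1 + e2 + e3)) by ring.
  rewrite E. field.
Qed.

(** * The half-period values are distinct *)

Lemma disc_domain (q : C -> C) (c : C) (r : R) : (0 < r)%R ->
  (forall z, (Cmod (z - c) < r)%R -> locC1 q z) ->
  ode_domain q (fun z => (Cmod (z - c) < r)%R) c.
Proof.
  intros Hr Hq. split; [|split; [|split]]; auto.
  - apply open_C_iff. intros z Hz. exists (r - Cmod (z - c))%R. split; [lra|].
    intros w Hw. assert (T := Cmod_chain w z c). lra.
  - intros z t Hz Ht. unfold seg. replace (c + RtoC t * (z - c) - c) with (RtoC t * (z - c)) by ring.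
    rewrite Cmod_scal_R by lra. assert (P := Cmod_ge_0 (z - c)). nra.
  - replace (c - c) with (RtoC 0) by ring. rewrite Cmod_0. auto.
Qed.

Lemma sum_pole_neq_0 (rf rg : C -> C) : ccont rf 0 -> ccont rg 0 -> exists r, (0 < r)%R /\
  forall z : C, z <> 0 -> (Cmod z < r)%R -> (/ z + rf z) + (/ z + rg z) <> 0.
Proof.
  intros Hf Hg.
  assert (H : ccont (fun z => 2 + z * (rf z + rg z)) 0).
  { apply ccont_plus; [apply ccont_const|]. apply ccont_mult; [apply ccont_id|].
    apply ccont_plus; auto. }
  destruct (ccont_neq_0 _ _ H) as [r [Hr Hn]].
  { intros K. replace (2 + 0 * (rf 0 + rg 0)) with (RtoC 2) in K by ring.
    apply RtoC_inj in K. lra. }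
  exists r. split; auto. intros z Hz Hzr K.
  apply (Hn z). { replace (z - 0) with z by ring. auto. }
  transitivity (z * ((/ z + rf z) + (/ z + rg z))); [field; auto|]. rewrite K. ring.
Qed.

(** If f^2 = g^2 with f and g both asymptotic to 1/z at 0, then f = g near 0. As
    (f - g)' = h (f - g), the equality continues along the segment to the half-period w, where f and
    g have opposite poles: a contradiction. *)
Lemma distinct_aux (f g h rf rg : C -> C) (m n : Z) :
  (Z.odd m || Z.odd n)%bool = true -> (Z.abs m <= 1)%Z -> (Z.abs n <= 1)%Z ->
  (forall z, ns z -> Cder f z (- (g z * h z))) ->
  (forall z, ns z -> Cder g z (- (f z * h z))) ->
  (forall z, ns z -> Cder h z (- (f z * g z))) ->
  (forall z, f z = / z + rf z) -> (forall z, g z = / z + rg z) ->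
  ccont rf 0 -> ccont rg 0 ->
  (forall z, ns z -> f (z + lattice_point tau m n / 2) = f z) ->
  (forall z, ns z -> g (z + lattice_point tau m n / 2) = - g z) ->
  (forall z, ns z -> f z * f z = g z * g z) -> False.
Proof.
  intros Hodd Hm Hn Df Dg Dh Ef Eg Cf Cg Pf Pg Esq.
  set (w := lattice_point tau m n / 2) in *.
  assert (Hw0 : w <> 0).
  { intros K. apply (half_not_lattice m n Hodd). fold w. rewrite K. apply in_lattice_0. }
  assert (Pw := proj1 (Cmod_gt_0 w) Hw0).
  assert (Hseg : forall t, (0 < t < 1)%R -> ns (RtoC t * w)).
  { intros t Ht [a [b E]]. unfold w in E.
    assert (E2 : RtoC t * lattice_point tau m n = lattice_point tau a b).
    { replace (lattice_point tau a b) with (2 * (lattice_point tau a b / 2)) by field.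
      rewrite <- E. field. }
    assert (E3 : RtoC (t * IZR m) + RtoC (t * IZR n) * tau = RtoC (IZR a) + RtoC (IZR b) * tau).
    { fold (lattice_point tau a b). rewrite <- E2. unfold lattice_point.
      rewrite !RtoC_mult. ring. }
    assert (A := cs_coords tau Htau (t * IZR m) (t * IZR n)).
    assert (B := ct_coords tau Htau (t * IZR m) (t * IZR n)).
    rewrite E3, cs_coords in A by auto. rewrite E3, ct_coords in B by auto.
    assert (Z0 : forall k l, (Z.abs k <= 1)%Z -> IZR l = (t * IZR k)%R -> k = 0%Z).
    { intros k l Hk HE. destruct (Z.eq_dec k 0) as [|Hk0]; auto. exfalso.
      assert (k = 1 \/ k = -1)%Z as [-> | ->] by lia.
      - assert (0 < l < 1)%Z by (split; apply lt_IZR; lra). lia.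
      - assert (-1 < l < 0)%Z by (split; apply lt_IZR; lra). lia. }
    apply Z0 in A; auto. apply Z0 in B; auto. subst. discriminate. }
  destruct (sum_pole_neq_0 rf rg Cf Cg) as [r [Hr Hs]].
  set (t0 := Rmin (/ 4) (r / (2 * Cmod w))).
  assert (Ht0 : (0 < t0)%R) by (apply Rmin_pos; [lra|apply Rdiv_lt_0_compat; lra]).
  assert (Ht1 : (t0 <= / 4)%R) by apply Rmin_l.
  assert (Ht2 : (t0 * Cmod w < r)%R).
  { assert (X : (t0 <= r / (2 * Cmod w))%R) by apply Rmin_r.
    apply (Rmult_le_compat_r (Cmod w)) in X; [|lra].
    replace (r / (2 * Cmod w) * Cmod w)%R with (r / 2)%R in X by (field; lra). lra. }
  assert (Hne : forall s, (Rabs s = t0)%R -> f (RtoC s * w) + g (RtoC s * w) <> 0).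
  { intros s Hs0. rewrite Ef, Eg. apply Hs.
    - apply Cmult_neq_0; auto. intros K. apply RtoC_inj in K. rewrite K, Rabs_R0 in Hs0. lra.
    - rewrite Cmod_mult, Cmod_R, Hs0. auto. }
  set (d := fun z => f z - g z).
  assert (D0 : d (RtoC t0 * w) = 0).
  { assert (Hz : ns (RtoC t0 * w)) by (apply Hseg; lra).
    assert (X : d (RtoC t0 * w) * (f (RtoC t0 * w) + g (RtoC t0 * w)) = 0).
    { transitivity (f (RtoC t0 * w) * f (RtoC t0 * w) - g (RtoC t0 * w) * g (RtoC t0 * w)).
      unfold d; ring. rewrite Esq by auto. ring. }
    assert (Y := Hne t0 ltac:(apply Rabs_pos_eq; lra)).
    replace (d (RtoC t0 * w)) with (d (RtoC t0 * w) * (f (RtoC t0 * w) + g (RtoC t0 * w)) *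
      / (f (RtoC t0 * w) + g (RtoC t0 * w))) by (field; auto).
    rewrite X. ring. }
  (* d' = h d, hence d'' = (h' + h^2) d, a linear equation without singularity
     on the open segment *)
  set (q := fun z => - (f z * g z) + h z * h z).
  assert (Dd : forall z, ns z -> Cder d z (h z * d z)).
  { intros z Hz. eapply Cder_eq; [apply Cder_minus; [apply Df|apply Dg]; auto|]. unfold d. ring. }
  assert (Sd : sol q ns d (fun z => h z * d z)).
  { intros z Hz. split; auto. eapply Cder_eq; [apply Cder_mult; [apply Dh|apply Dd]; auto|].
    unfold q. ring. }
  assert (Lq : forall z, ns z -> locC1 q z).
  { assert (Lf : forall z, ns z -> locC1 f z).
    { intros z Hz. apply (twice_locC1 f (fun z => - (g z * h z))
        (fun z => - (- (f z * h z) * h z + g z * - (f z * g z))) ns); [apply ns_disc; auto|].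
      intros y Hy. split; auto. apply Cder_opp, Cder_mult; auto. }
    assert (Lg : forall z, ns z -> locC1 g z).
    { intros z Hz. apply (twice_locC1 g (fun z => - (f z * h z))
        (fun z => - (- (g z * h z) * h z + f z * - (f z * g z))) ns); [apply ns_disc; auto|].
      intros y Hy. split; auto. apply Cder_opp, Cder_mult; auto. }
    assert (Lh : forall z, ns z -> locC1 h z).
    { intros z Hz. apply (twice_locC1 h (fun z => - (f z * g z))
        (fun z => - (- (g z * h z) * g z + f z * - (f z * h z))) ns); [apply ns_disc; auto|].
      intros y Hy. split; auto. apply Cder_opp, Cder_mult; auto. }
    intros z Hz. apply locC1_plus.
    - apply (locC1_ext (fun z => - (1) * (f z * g z)) _ z 1 Rlt_0_1); [intros; ring|].
      apply locC1_scal, locC1_mult; auto.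
    - apply locC1_mult; auto. }
  assert (D1 : d (RtoC (1 - t0) * w) = 0).
  { apply (seg_propagate (fun z => d z = 0) (RtoC t0 * w) (RtoC (1 - t0) * w) D0).
    intros t Ht. set (c := seg (RtoC t0 * w) (RtoC (1 - t0) * w) t).
    assert (Hc : ns c).
    { replace c with (RtoC (t0 + t * (1 - t0 - t0)) * w).
      - apply Hseg. nra.
      - unfold c, seg. rewrite RtoC_plus, RtoC_mult, !RtoC_minus. ring. }
    destruct (ns_disc c Hc) as [rc [Hrc Hdc]]. exists rc. split; auto.
    intros [s [Hs1 [Hs2 Hs3]]] s' Hs1' Hs2'.
    apply (sol_zero q (fun z => (Cmod (z - c) < rc)%R) c
      (seg (RtoC t0 * w) (RtoC (1 - t0) * w) s) d (fun z => h z * d z)); auto.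
    - apply disc_domain; auto.
    - apply (sol_sub q ns); auto.
    - rewrite Hs3. ring. }
  assert (Hb : ns (RtoC (- t0) * w)).
  { intros K. apply (Hseg (1 - t0)%R ltac:(lra)).
    destruct K as [a [b E]]. exists (a + m)%Z, (b + n)%Z. rewrite lp_plus.
    rewrite RtoC_minus. replace ((1 - RtoC t0) * w) with (w + RtoC (- t0) * w)
      by (rewrite RtoC_opp; ring).
    rewrite E. unfold w. field. }
  assert (F1 := Pf _ Hb). assert (G1 := Pg _ Hb). fold w in F1, G1.
  replace (RtoC (- t0) * w + w) with (RtoC (1 - t0) * w) in F1, G1
    by (rewrite RtoC_opp, RtoC_minus; ring).
  unfold d in D1. rewrite F1, G1 in D1.
  apply (Hne (- t0)%R).
  - rewrite Rabs_Ropp. apply Rabs_pos_eq; lra.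
  - rewrite <- D1. ring.
Qed.

Lemma rho_ccont a b c d : ccont (rho a b c d) 0.
Proof. apply (Cder_ccont _ _ _ (rho_Cder a b c d)). Qed.

(** Otherwise phi_1^2 = phi_2^2, although the half-period 1/2 fixes phi_1 and negates phi_2. *)
Lemma e1_neq_e2 : e1 <> e2.
Proof.
  intros E. apply (distinct_aux phi1 phi2 phi3 (rho 1 (- (1)) (- (1)) (- eta2))
    (rho (- (1)) 1 (- (1)) (- eta1)) 1 0 eq_refl); try lia.
  - apply phi1_Cder.
  - apply phi2_Cder.
  - apply phi3_Cder.
  - intros; apply ph_rho.
  - intros; apply ph_rho.
  - apply rho_ccont.
  - apply rho_ccont.
  - intros z Hz. rewrite <- h1_lp. apply phi1_h1; auto.
  - intros z Hz. rewrite <- h1_lp. apply phi2_h1; auto.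
  - intros z Hz. assert (A := phi1_square z Hz). rewrite (phi2_square z Hz), E in A.
    replace (phi1 z * phi1 z) with (phi1 z * phi1 z + 4 * e2 - 4 * e2) by ring.
    rewrite <- A. ring.
Qed.

(** Here the half-period tau / 2 separates the two functions. *)
Lemma e2_neq_e3 : e2 <> e3.
Proof.
  intros E. apply (distinct_aux phi2 phi3 phi1 (rho (- (1)) 1 (- (1)) (- eta1))
    (rho (- (1)) (- (1)) 1 0) 0 1 eq_refl); try lia.
  - intros z Hz. eapply Cder_eq; [apply phi2_Cder; auto|ring].
  - intros z Hz. eapply Cder_eq; [apply phi3_Cder; auto|ring].
  - intros z Hz. eapply Cder_eq; [apply phi1_Cder; auto|ring].
  - intros; apply ph_rho.
  - intros; apply ph_rho.
  - apply rho_ccont.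
  - apply rho_ccont.
  - intros z Hz. rewrite <- h2_lp. apply phi2_h2; auto.
  - intros z Hz. rewrite <- h2_lp. apply phi3_h2; auto.
  - intros z Hz. assert (A := phi2_square z Hz). rewrite (phi3_square z Hz), E in A.
    replace (phi2 z * phi2 z) with (phi2 z * phi2 z + 4 * e3 - 4 * e3) by ring.
    rewrite <- A. ring.
Qed.

Lemma e1_neq_e3 : e1 <> e3.
Proof.
  intros E. apply (distinct_aux phi1 phi3 phi2 (rho 1 (- (1)) (- (1)) (- eta2))
    (rho (- (1)) (- (1)) 1 0) 1 0 eq_refl); try lia.
  - intros z Hz. eapply Cder_eq; [apply phi1_Cder; auto|ring].
  - intros z Hz. eapply Cder_eq; [apply phi3_Cder; auto|ring].
  - intros z Hz. eapply Cder_eq; [apply phi2_Cder; auto|ring].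
  - intros; apply ph_rho.
  - intros; apply ph_rho.
  - apply rho_ccont.
  - apply rho_ccont.
  - intros z Hz. rewrite <- h1_lp. apply phi1_h1; auto.
  - intros z Hz. rewrite <- h1_lp. apply phi3_h1; auto.
  - intros z Hz. assert (A := phi1_square z Hz). rewrite (phi3_square z Hz), E in A.
    replace (phi1 z * phi1 z) with (phi1 z * phi1 z + 4 * e3 - 4 * e3) by ring.
    rewrite <- A. ring.
Qed.

(** * No elliptic function has a single simple pole *)

Lemma ns_1 z : ns z -> ns (z + 1).
Proof. intros H K. apply H. apply singular_1. auto. Qed.
Lemma ns_1' z : ns z -> ns (z - 1).
Proof. intros H K. apply H. apply singular_1 in K. replace (z - 1 + 1) with z in K by ring. auto. Qed.
Lemma ns_tau z : ns z -> ns (z + tau).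
Proof. intros H K. apply H. apply singular_tau. auto. Qed.
Lemma ns_tau' z : ns z -> ns (z - tau).
Proof. intros H K. apply H. apply singular_tau in K. replace (z - tau + tau) with z in K by ring. auto. Qed.

Lemma lattice_plim (f : C -> C) : (forall z, ns z -> f (z + 1) = f z) ->
  (forall z, ns z -> f (z + tau) = f z) ->
  forall c0 l, plim f c0 l -> forall m n, exists l', plim f (c0 + lattice_point tau m n) l'.
Proof.
  intros H1 H2 c0 l Hl m n.
  destruct (iter_plim f 1 tau 1 1 c0 l ltac:(ring) ltac:(ring) ns_1 ns_1' ns_tau ns_tau')
    with (m := m) (n := n) as [l' X]; auto.
  - intros z Hz. rewrite H1 by auto. ring.
  - intros z Hz. rewrite H2 by auto. ring.
  - exists l'. eapply plim_center; [exact X|]. unfold lattice_point. ring.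
Qed.

(** If eta2 = eta1 tau, then g = zeta - eta1 z is elliptic with simple poles at the
    lattice points only. Then g^2 - wp has no poles, so it is constant; since g vanishes at
    the half-periods by oddness, wp takes the same value at two of them.
    This is the weak form of Legendre's relation that is needed: no elliptic function has
    a single simple pole. *)
Lemma legendre_weak : eta2 <> eta1 * tau.
Proof.
  intros E. apply e1_neq_e2.
  set (g := fun z => wzeta tau z - eta1 * z).
  set (f := fun z => g z * g z - wp tau z).
  assert (Freg : forall z, ~ in_lattice tau z -> locC1 f z).
  { intros z Hz.
    apply (twice_locC1 f (fun z => - (2) * (wp tau z + eta1) * g z - wp1 tau z)
      (fun z => - (2) * (wp1 tau z * g z + (wp tau z + eta1) * (- (wp tau z) - eta1)) - der (wp1 tau) z)
      (fun z => ~ in_lattice tau z)).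
    - apply not_lattice_disc; auto.
    - intros y Hy.
      assert (Dg : Cder g y (- wp tau y - eta1)).
      { eapply Cder_eq; [apply Cder_minus; [apply wzeta_Cder; auto|apply Cder_scal, Cder_id]|]. ring. }
      assert (Dp := wp_Cder tau Htau y Hy). split.
      + eapply Cder_eq; [apply Cder_minus; [apply Cder_mult; exact Dg|exact Dp]|]. ring.
      + destruct (wp1_Cder tau Htau y Hy) as [l Hl]. rewrite (der_eq _ _ _ Hl).
        eapply Cder_eq.
        * apply (Cder_minus (fun z => - (2) * (wp tau z + eta1) * g z)); [|exact Hl].
          apply (Cder_mult (fun z => - (2) * (wp tau z + eta1)) g); [|exact Dg].
          apply Cder_scal. apply (Cder_plus (wp tau) (fun _ => eta1)); [exact Dp|apply Cder_const].
        * cbv beta. ring. }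
  assert (P1 : forall z, ns z -> f (z + 1) = f z).
  { intros z Hz. destruct (ns_off z Hz) as [A _]. unfold f, g.
    rewrite wzeta_1, wp_1 by auto. ring. }
  assert (P2 : forall z, ns z -> f (z + tau) = f z).
  { intros z Hz. destruct (ns_off z Hz) as [A _]. unfold f, g.
    rewrite wzeta_tau, wp_tau, E by auto. ring. }
  assert (L0 : exists l, plim f 0 l).
  { assert (Dz : Cder (fun z => zr tau z - eta1 * z) 0 (- pr tau 0 - eta1 * 1)).
    { apply Cder_minus; [apply zr_Cder; auto; right; auto|apply Cder_scal, Cder_id]. }
    assert (Z0 : zr tau 0 - eta1 * 0 = 0) by (rewrite zr_0 by auto; ring).
    assert (X1 := plim_scal 2 _ _ _ (plim_quot _ _ Dz Z0)).
    assert (Y1 := ccont_plim _ _ (Cder_ccont _ _ _ Dz)).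
    assert (Y2 := plim_mult _ _ _ _ _ Y1 Y1).
    assert (X3 := plim_scal (- (1)) _ _ _ (ccont_plim _ _ (Cder_ccont _ _ _
      (pr_Cder tau Htau 0 (or_intror eq_refl))))).
    assert (Z := plim_plus _ _ _ _ _ X3 (plim_plus _ _ _ _ _ X1 Y2)).
    eexists. eapply (plim_ext _ f 0 _ 1 Rlt_0_1); [|exact Z].
    intros z Hz. assert (Hz0 : z <> 0).
    { intros ->. replace (0 - 0) with (RtoC 0) in Hz by ring. rewrite Cmod_0 in Hz. lra. }
    unfold f, g. rewrite wzeta_zr, wp_pr. field. auto. }
  destruct (liouville tau Htau f 0 0) as [_ [k [_ Hk]]].
  - intros z Hz. apply Freg. apply ns_off; auto.
  - intros z Hz. rewrite P1 by auto. ring.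
  - intros z Hz. rewrite P2 by auto. ring.
  - intros c Hc. destruct (classic (in_lattice tau c)) as [[m [n Ec]]|Hn].
    + destruct L0 as [l Hl]. destruct (lattice_plim f P1 P2 0 l Hl m n) as [l' X].
      exists l'. eapply plim_center; [exact X|]. rewrite Ec. ring.
    + exists (f c). apply ccont_plim. apply locC1_ccont. auto.
  - assert (V : forall c, singular tau c -> ~ in_lattice tau c -> f c = k).
    { intros c Hc Hn. apply (plim_unique f c).
      - apply ccont_plim, locC1_ccont. auto.
      - replace k with (0 * c + k) by ring. auto. }
    assert (S1 : singular tau (1 / 2)) by (rewrite h1_lp; exists 1%Z, 0%Z; reflexivity).
    assert (S2 : singular tau (tau / 2)) by (rewrite h2_lp; exists 0%Z, 1%Z; reflexivity).
    assert (V1 := V _ S1 h1_not). assert (V2 := V _ S2 h2_not).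
    unfold f, g in V1, V2.
    assert (Z1 : wzeta tau (1 / 2) - eta1 * (1 / 2) = 0) by (unfold eta1; field).
    assert (Z2 : wzeta tau (tau / 2) - eta1 * (tau / 2) = 0).
    { replace (eta1 * (tau / 2)) with (eta1 * tau / 2) by field. rewrite <- E. unfold eta2. field. }
    rewrite Z1 in V1. rewrite Z2 in V2.
    assert (W1 : e1 = wp tau (1 / 2)).
    { unfold e1. rewrite <- wp_1 by (replace (0 - 1 / 2) with (- (RtoC 1 / 2)) by ring; apply not_opp, h1_not).
      f_equal. field. }
    assert (W2 : e2 = wp tau (tau / 2)).
    { unfold e2. rewrite <- wp_tau by (replace (0 - tau / 2) with (- (tau / 2)) by ring; apply not_opp, h2_not).
      f_equal. field. }
    rewrite W1, W2.
    replace (wp tau (1 / 2)) with (- (0 * 0 - wp tau (1 / 2))) by ring. rewrite V1, <- V2. ring.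
Qed.

End Phi.

(** * The coefficient of the equation *)

Lemma RtoC_neq (r s : R) : r <> s -> RtoC r <> RtoC s.
Proof. intros H E. apply H. apply RtoC_inj. auto. Qed.

Lemma sum_n_3 (f : nat -> C) : sum_n f 3 = f 0%nat + f 1%nat + f 2%nat + f 3%nat.
Proof. rewrite !sum_Sn, sum_O. reflexivity. Qed.

Lemma wp_shift_0 tau z : wp tau (z - 0 / 2) = wp tau z.
Proof. f_equal. field. Qed.

Lemma wzeta_shift_0 tau z : wzeta tau (z - 0 / 2) = wzeta tau z.
Proof. f_equal. field. Qed.

Section Coefficient.
Variable tau : C.
Hypothesis Htau : (0 < Im tau)%R.
Variable p : params.

Let ns (z : C) : Prop := ~ singular tau z.

Definition zsum (z : C) : C :=
  T0 p * wzeta tau z + T1 p * wzeta tau (z - 1 / 2) + T2 p * wzeta tau (z - tau / 2)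
  + T3 p * wzeta tau (z - (1 + tau) / 2).

Lemma q_expand z : q tau p z = RtoC (3 / 4) * wpsum tau 1 1 1 z + zsum z + B p.
Proof.
  unfold q. rewrite !sum_n_3. simpl omega. simpl Tcoef.
  rewrite wp_shift_0, wzeta_shift_0. unfold wpsum, zsum. ring.
Qed.

Lemma zsum_Cder z : ns z -> Cder zsum z (- (T0 p * wp tau z + T1 p * wp tau (z - 1 / 2)
  + T2 p * wp tau (z - tau / 2) + T3 p * wp tau (z - (1 + tau) / 2))).
Proof.
  intros Hz. destruct (ns_off tau z Hz) as [A0 [A1 [A2 A3]]].
  eapply Cder_eq.
  - repeat apply Cder_plus; apply Cder_scal;
    [|apply (Cder_shift (wzeta tau) z (- (1 / 2)))|apply (Cder_shift (wzeta tau) z (- (tau / 2)))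
    |apply (Cder_shift (wzeta tau) z (- ((1 + tau) / 2)))]; apply wzeta_Cder; auto.
  - unfold Cminus. ring.
Qed.

Lemma q_locC1 z : ns z -> locC1 (q tau p) z.
Proof.
  intros Hz.
  apply (locC1_ext (fun z => RtoC (3 / 4) * wpsum tau 1 1 1 z + (zsum z + B p)) _ z 1 Rlt_0_1).
  - intros w _. rewrite q_expand. ring.
  - apply locC1_plus; [apply locC1_scal, wpsum_locC1; auto|].
    apply locC1_plus; [|apply locC1_const].
    apply (twice_locC1 _ (fun z => - (T0 p * wp tau z + T1 p * wp tau (z - 1 / 2)
      + T2 p * wp tau (z - tau / 2) + T3 p * wp tau (z - (1 + tau) / 2)))
      (fun z => - (T0 p * wp1 tau z + T1 p * wp1 tau (z - 1 / 2)
      + T2 p * wp1 tau (z - tau / 2) + T3 p * wp1 tau (z - (1 + tau) / 2))) ns).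
    + apply ns_disc; auto.
    + intros w Hw. split; [apply zsum_Cder; auto|].
      destruct (ns_off tau w Hw) as [A0 [A1 [A2 A3]]].
      apply Cder_opp. repeat apply Cder_plus; apply Cder_scal;
      [|apply (Cder_shift (wp tau) w (- (1 / 2)))|apply (Cder_shift (wp tau) w (- (tau / 2)))
      |apply (Cder_shift (wp tau) w (- ((1 + tau) / 2)))]; apply wp_Cder; auto.
Qed.

Hypothesis HT : T0 p + T1 p + T2 p + T3 p = 0.

Lemma comb_shift (F : C -> C) (w e a0 a1 a2 a3 z : C) :
  (forall y, ~ in_lattice tau y -> F (y + w) = F y + e) -> ns z ->
  a0 * F (z + w) + a1 * F (z + w - 1 / 2) + a2 * F (z + w - tau / 2)
    + a3 * F (z + w - (1 + tau) / 2) =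
  a0 * F z + a1 * F (z - 1 / 2) + a2 * F (z - tau / 2)
    + a3 * F (z - (1 + tau) / 2) + (a0 + a1 + a2 + a3) * e.
Proof.
  intros H Hz. destruct (ns_off tau z Hz) as [A0 [A1 [A2 A3]]].
  replace (z + w - 1 / 2) with (z - 1 / 2 + w) by ring.
  replace (z + w - tau / 2) with (z - tau / 2 + w) by ring.
  replace (z + w - (1 + tau) / 2) with (z - (1 + tau) / 2 + w) by ring.
  rewrite !H by auto. ring.
Qed.

(** The quasi-periods of the zeta terms cancel because the residues add up to zero. *)
Lemma q_period w e : (forall y, ~ in_lattice tau y -> wzeta tau (y + w) = wzeta tau y + e) ->
  (forall y, ~ in_lattice tau y -> wp tau (y + w) = wp tau y) ->
  forall z, ns z -> q tau p (z + w) = q tau p z.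
Proof.
  intros He Hp z Hz. rewrite !q_expand. unfold zsum. rewrite (comb_shift (wzeta tau) w e) by auto.
  rewrite HT. replace (wpsum tau 1 1 1 (z + w)) with (wpsum tau 1 1 1 z); [ring|].
  assert (X := comb_shift (wp tau) w 0 1 1 1 1 z).
  unfold wpsum. rewrite !Cmult_1_l in X. rewrite !Cmult_1_l.
  rewrite X; auto; [ring|]. intros y Hy. rewrite Hp by auto. ring.
Qed.

Lemma q_1 z : ns z -> q tau p (z + 1) = q tau p z.
Proof. apply (q_period 1 (eta1 tau)); [apply wzeta_1|apply wp_1]; auto. Qed.

Lemma q_tau z : ns z -> q tau p (z + tau) = q tau p z.
Proof. apply (q_period tau (eta2 tau)); [apply wzeta_tau|apply wp_tau]; auto. Qed.

Lemma ns_lattice m n z : ns z -> ns (z + lattice_point tau m n).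
Proof. intros Hz K. apply Hz. eapply singular_plus; eauto. Qed.

Lemma ns_lattice' m n z : ns (z + lattice_point tau m n) -> ns z.
Proof.
  intros Hz K. apply Hz. apply (singular_plus tau _ (- m) (- n)). rewrite lp_opp.
  replace (z + lattice_point tau m n + - lattice_point tau m n) with z by ring. auto.
Qed.

(** Functions that are periodic off the singular points become periodic everywhere
    after extension by a dummy value, to which [periodic_lattice] applies. *)
Lemma periodic_off {X : Type} (f : C -> X) : (forall z, ns z -> f (z + 1) = f z) ->
  (forall z, ns z -> f (z + tau) = f z) ->
  forall m n z, ns z -> f (z + lattice_point tau m n) = f z.
Proof.
  intros H1 H2 m n z Hz.
  set (F := fun z => if excluded_middle_informative (ns z) then Some (f z) else None).
  assert (HF : periodic tau F).
  { split; intros y; unfold F; destruct (excluded_middle_informative (ns y)) as [A|A].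
    - destruct (excluded_middle_informative (ns (y + 1))) as [B0|B0].
      + rewrite H1; auto.
      + exfalso. apply B0. apply ns_1; auto.
    - destruct (excluded_middle_informative (ns (y + 1))) as [B0|B0]; auto.
      exfalso. apply A. replace y with (y + 1 - 1) by ring. apply ns_1'; auto.
    - destruct (excluded_middle_informative (ns (y + tau))) as [B0|B0].
      + rewrite H2; auto.
      + exfalso. apply B0. apply ns_tau; auto.
    - destruct (excluded_middle_informative (ns (y + tau))) as [B0|B0]; auto.
      exfalso. apply A. replace y with (y + tau - tau) by ring. apply ns_tau'; auto. }
  assert (E := periodic_lattice tau F HF m n z). unfold F in E.
  destruct (excluded_middle_informative (ns z)) as [A|A]; [|contradiction].
  destruct (excluded_middle_informative (ns (z + lattice_point tau m n))) as [B0|B0].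
  - congruence.
  - exfalso. apply B0. apply ns_lattice. auto.
Qed.

Lemma q_lattice m n z : ns z -> q tau p (z + lattice_point tau m n) = q tau p z.
Proof. apply periodic_off; [apply q_1|apply q_tau]. Qed.

(** * Polar parts of the coefficient *)

(** The coordinates of [omega] in the basis (1, tau). *)
Definition omx (k : nat) : Z * Z :=
  match k with 0%nat => (0, 0)%Z | 1%nat => (1, 0)%Z | 2%nat => (0, 1)%Z | _ => (1, 1)%Z end.

Lemma omega_lp k : omega tau k = lattice_point tau (fst (omx k)) (snd (omx k)).
Proof.
  destruct k as [|[|[|k]]]; simpl; symmetry;
    [apply lp_00|apply lp_10|apply lp_01|apply lp_11].
Qed.

Lemma omega_diff j k : (j <= 3)%nat -> (k <= 3)%nat -> j <> k ->
  ~ in_lattice tau (omega tau k / 2 - omega tau j / 2).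
Proof.
  intros Hj Hk Hjk. rewrite !omega_lp.
  replace (lattice_point tau (fst (omx k)) (snd (omx k)) / 2 -
    lattice_point tau (fst (omx j)) (snd (omx j)) / 2) with
    (lattice_point tau (fst (omx k) - fst (omx j)) (snd (omx k) - snd (omx j)) / 2)
    by (rewrite lp_minus; field).
  apply half_not_lattice; auto.
  destruct j as [|[|[|[|j]]]]; try lia; destruct k as [|[|[|[|k]]]]; try lia; reflexivity.
Qed.

Lemma omega_singular k : singular tau (omega tau k / 2).
Proof. rewrite omega_lp. eexists _, _. reflexivity. Qed.

(** The parities of the two coordinates decide the class modulo the lattice. *)
Lemma singular_class c : singular tau c -> exists k m n, (k <= 3)%nat /\
  c = omega tau k / 2 + lattice_point tau m n.
Proof.
  intros [m [n ->]].
  set (b := fun x : Z => if Z.odd x then 1%Z else 0%Z).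
  assert (E : forall x, exists x', x = (b x + (x' + x'))%Z).
  { intros x. exists (Z.div2 x). unfold b. assert (X := Z.div2_odd x).
    destruct (Z.odd x); simpl Z.b2z in X; lia. }
  destruct (E m) as [m' Em]. destruct (E n) as [n' En].
  assert (K : exists k, (k <= 3)%nat /\ omx k = (b m, b n)).
  { unfold b. destruct (Z.odd m), (Z.odd n);
    [exists 3%nat|exists 1%nat|exists 2%nat|exists 0%nat]; split; auto. }
  destruct K as [k [Hk Ek]]. exists k, m', n'. split; auto.
  rewrite omega_lp, Ek. simpl. rewrite Em at 1. rewrite En at 1.
  rewrite lp_plus. rewrite lp_plus. field.
Qed.

(** All other terms of q are continuous at the half-period considered. *)
Lemma polar_part k : (k <= 3)%nat -> exists r K, (0 < r)%R /\
  forall x : C, x <> 0 -> (Cmod x < r)%R ->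
  (Cmod (q tau p (omega tau k / 2 + x) - RtoC (3 / 4) * / (x * x) - Tcoef p k * / x) <= K)%R.
Proof.
  intros Hk.
  set (A := fun j x => RtoC (3 / 4) * wp tau (omega tau k / 2 + x - omega tau j / 2)
    + Tcoef p j * wzeta tau (omega tau k / 2 + x - omega tau j / 2)).
  set (A0 := fun x => RtoC (3 / 4) * pr tau x + Tcoef p k * zr tau x).
  assert (H0 : ccont A0 0).
  { apply ccont_plus; apply ccont_mult; try apply ccont_const.
    - eapply Cder_ccont. apply pr_Cder; auto. right; auto.
    - eapply Cder_ccont. apply zr_Cder; auto. right; auto. }
  assert (Hj : forall j, (j <= 3)%nat -> j <> k -> ccont (A j) 0).
  { intros j Hj Hjk. assert (N := omega_diff j k Hj Hk Hjk).
    assert (S : forall F : C -> C, ccont F (omega tau k / 2 - omega tau j / 2) ->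
      ccont (fun x => F (omega tau k / 2 + x - omega tau j / 2)) 0).
    { intros F HF.
      apply (ccont_locally_ext (fun x => F (x + (omega tau k / 2 - omega tau j / 2))) _ 0 1 Rlt_0_1).
      - intros w _. f_equal. ring.
      - apply ccont_shift. replace (0 + (omega tau k / 2 - omega tau j / 2)) with
          (omega tau k / 2 - omega tau j / 2) by ring. auto. }
    apply ccont_plus; apply ccont_mult; try apply ccont_const; apply S; eapply Cder_ccont.
    - apply wp_Cder; auto.
    - apply wzeta_Cder; auto. }
  set (Bj := fun j x => if Nat.eq_dec j k then A0 x else A j x).
  assert (HB : forall j, (j <= 3)%nat -> ccont (Bj j) 0).
  { intros j Hj3. unfold Bj. destruct (Nat.eq_dec j k); auto. }
  assert (Hc : ccont (fun x => Bj 0%nat x + Bj 1%nat x + Bj 2%nat x + Bj 3%nat x + B p) 0).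
  { repeat apply ccont_plus; try apply HB; try lia. apply ccont_const. }
  destruct (Hc 1%R Rlt_0_1) as [r [Hr Hw]].
  eexists r, _. split; auto. intros x Hx Hxr.
  assert (E : q tau p (omega tau k / 2 + x) - RtoC (3 / 4) * / (x * x) - Tcoef p k * / x =
    Bj 0%nat x + Bj 1%nat x + Bj 2%nat x + Bj 3%nat x + B p).
  { assert (EA : A k x = A0 x + RtoC (3 / 4) * / (x * x) + Tcoef p k * / x).
    { unfold A, A0. replace (omega tau k / 2 + x - omega tau k / 2) with x by ring.
      rewrite wp_pr, wzeta_zr. ring. }
    assert (Eq : q tau p (omega tau k / 2 + x) =
      A 0%nat x + A 1%nat x + A 2%nat x + A 3%nat x + B p).
    { unfold q. rewrite !sum_n_3. unfold A. ring. }
    rewrite Eq. unfold Bj.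
    destruct k as [|[|[|[|k]]]]; try lia; simpl; rewrite EA; simpl; ring. }
  rewrite E. specialize (Hw x ltac:(replace (x - 0) with x by ring; auto)).
  assert (T := Cmod_triangle_inv (Bj 0%nat x + Bj 1%nat x + Bj 2%nat x + Bj 3%nat x + B p)
    (Bj 0%nat 0 + Bj 1%nat 0 + Bj 2%nat 0 + Bj 3%nat 0 + B p)).
  instantiate (1 := (1 + Cmod (Bj 0%nat 0 + Bj 1%nat 0 + Bj 2%nat 0 + Bj 3%nat 0 + B p))%R).
  lra.
Qed.

End Coefficient.

(** * The principal square root *)

Definition slit_plane (w : C) : Prop := (0 < Re w)%R \/ Im w <> 0%R.

Lemma slit_plane_pos (w : C) : slit_plane w -> (0 < Cmod w + Re w)%R.
Proof.
  intros H. assert (E := Cmod2_alt w). assert (P := Cmod_ge_0 w).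
  destruct H as [H|H]; [lra|].
  assert (A := re_le_Cmod w). apply Rabs_le_between in A.
  destruct (Rle_lt_or_eq_dec (- Cmod w) (Re w)) as [L|L]; [lra|lra|].
  exfalso. rewrite <- L in E. simpl in E. apply H. nra.
Qed.

Lemma Csqrt_square (w : C) : slit_plane w -> Csqrt w * Csqrt w = w.
Proof.
  intros H. assert (P := slit_plane_pos w H). assert (E := Cmod2_alt w).
  unfold Csqrt. set (a := sqrt ((Cmod w + Re w) / 2)).
  assert (Ha : (0 < a)%R) by (apply sqrt_lt_R0; lra).
  assert (Ha2 : (a * a = (Cmod w + Re w) / 2)%R) by (apply sqrt_sqrt; lra).
  destruct w as [x y]. unfold Re, Im in *. simpl in *. unfold Cmult. simpl.
  set (m := Cmod (x, y)) in *. f_equal.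
  - replace (y / (2 * a) * (y / (2 * a)))%R with (y * y / (4 * (a * a)))%R by (field; lra).
    rewrite Ha2. replace (y * y)%R with ((m - x) * (m + x))%R by lra. field. lra.
  - field. lra.
Qed.

Lemma Csqrt_Re_pos (w : C) : slit_plane w -> (0 < Re (Csqrt w))%R.
Proof.
  intros H. assert (P := slit_plane_pos w H). unfold Csqrt, Re at 1. simpl.
  apply sqrt_lt_R0. lra.
Qed.

Lemma Csqrt_neq_0 (w : C) : slit_plane w -> Csqrt w <> 0.
Proof.
  intros H E. assert (P := Csqrt_Re_pos w H). rewrite E in P. simpl in P. lra.
Qed.

Lemma slit_plane_open (w : C) : slit_plane w -> exists r, (0 < r)%R /\
  forall v, (Cmod (v - w) < r)%R -> slit_plane v.
Proof.
  intros [H|H].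
  - exists (Re w). split; auto. intros v Hv. left.
    assert (X := re_le_Cmod' (w - v)). rewrite Cmod_minus_sym in X.
    replace (Re (w - v)) with (Re w - Re v)%R in X by (unfold Re, Cminus, Cplus, Copp; simpl; ring).
    lra.
  - exists (Rabs (Im w)). split; [apply Rabs_pos_lt; auto|]. intros v Hv. right. intros K.
    assert (X := im_le_Cmod (v - w)).
    replace (Im (v - w)) with (Im v - Im w)%R in X by (unfold Im, Cminus, Cplus, Copp; simpl; ring).
    rewrite K in X. replace (0 - Im w)%R with (- Im w)%R in X by ring. rewrite Rabs_Ropp in X. lra.
Qed.

(** From sqrt v - sqrt w = (v - w) / (sqrt v + sqrt w), with a lower bound on the real part
    of the denominator. *)
Lemma Csqrt_Cder (w : C) : slit_plane w -> Cder Csqrt w (/ (2 * Csqrt w)).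
Proof.
  intros H eps Heps. destruct (slit_plane_open w H) as [r [Hr Hop]].
  set (s := Csqrt w). set (a := Re s). assert (Ha : (0 < a)%R) by (apply Csqrt_Re_pos; auto).
  assert (Hs0 : s <> 0) by (apply Csqrt_neq_0; auto).
  assert (Hsa : (a <= Cmod s)%R) by apply re_le_Cmod'.
  exists (Rmin r (eps * (2 * a * a * a))). split.
  { apply Rmin_pos; auto. repeat apply Rmult_lt_0_compat; lra. }
  intros v Hv. assert (B1 := Rmin_l r (eps * (2 * a * a * a))).
  assert (B2 := Rmin_r r (eps * (2 * a * a * a))).
  assert (Hv' : slit_plane v) by (apply Hop; lra).
  set (u := Csqrt v).
  assert (Hu : (0 < Re u)%R) by (apply Csqrt_Re_pos; auto).
  assert (Hsum : (a <= Cmod (u + s))%R).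
  { eapply Rle_trans; [|apply re_le_Cmod'].
    replace (Re (u + s)) with (Re u + a)%R by (unfold a, Re, Cplus; simpl; ring). lra. }
  assert (Hsum0 : u + s <> 0) by (apply Cmod_gt_0; lra).
  assert (Ev : v = u * u) by (symmetry; apply Csqrt_square; auto).
  assert (Ew : w = s * s) by (symmetry; apply Csqrt_square; auto).
  assert (D : u - s = (v - w) * / (u + s)) by (rewrite Ev, Ew; field; auto).
  fold s u.
  replace (u - s - (v - w) * / (2 * s)) with
    (- (v - w) * ((v - w) * (/ (u + s) * / (u + s) * / (2 * s)))).
  2:{ rewrite Ev, Ew. field. split; auto. }
  assert (H2s : 2 * s <> 0) by (apply Cmult_neq_0; auto; apply RtoC_neq; lra).
  rewrite !Cmod_mult, Cmod_opp, (Cmod_inv (u + s)), (Cmod_inv (2 * s)) by auto.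
  rewrite Cmod_mult, Cmod_R, (Rabs_pos_eq 2) by lra.
  set (t := Cmod (v - w)) in *. assert (Ht : (0 <= t)%R) by apply Cmod_ge_0.
  rewrite (Rmult_comm eps). apply Rmult_le_compat_l; auto.
  set (b := Cmod (u + s)) in *. set (d := Cmod s) in *.
  apply Rle_trans with ((eps * (2 * a * a * a)) * (/ a * / a * / (2 * a)))%R.
  - apply Rmult_le_compat; auto.
    + left. repeat apply Rmult_lt_0_compat; apply Rinv_0_lt_compat; lra.
    + lra.
    + apply Rmult_le_compat.
      * left. apply Rmult_lt_0_compat; apply Rinv_0_lt_compat; lra.
      * left. apply Rinv_0_lt_compat; lra.
      * apply Rmult_le_compat; try (left; apply Rinv_0_lt_compat; lra);
          apply Rinv_le_contravar; lra.
      * apply Rinv_le_contravar; lra.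
  - apply Req_le. field. lra.
Qed.

(** * The first coefficient at an apparent singularity *)

(** With y = h / sqrt x the equation becomes
      (h' / x)' = (q - 3/(4 x^2)) h / x.
    The right-hand side is T h(0) / x^2 up to O(1/x), so that m = h' / x + T h(0) / x is
    O(x^(-1/2)) by integration along the positive ray. Hence h' -> - T h(0). *)
Lemma apparent_derivative (Q y dy h : C -> C) (c T l : C) (r K : R) : (0 < r)%R ->
  sol Q (slit_disc c r) y dy ->
  (forall z, slit_disc c r z -> y z = h z / Csqrt (z - c)) ->
  Cder h c l ->
  (forall x : C, x <> 0 -> (Cmod x < r)%R ->
    (Cmod (Q (c + x) - RtoC (3 / 4) * / (x * x) - T * / x)%C <= K)%R) ->
  l = - T * h c.
Proof.
  intros Hr Hs Hh Hl HQ.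
  set (s := fun z => Csqrt (z - c)).
  set (D := slit_disc c r).
  assert (HD : forall z, D z -> slit_plane (z - c)) by (intros z [_ A]; exact A).
  assert (Hsq : forall z, D z -> z - c = s z * s z) by (intros; symmetry; apply Csqrt_square; auto).
  assert (Hs0 : forall z, D z -> s z <> 0) by (intros; apply Csqrt_neq_0; auto).
  assert (Ds : forall z, D z -> Cder s z (/ (2 * s z))).
  { intros z Hz. apply (Cder_shift Csqrt z (- c)). apply Csqrt_Cder. apply HD; auto. }
  assert (Eh : forall z, D z -> h z = y z * s z).
  { intros z Hz. rewrite Hh by auto. fold (s z). field. auto. }
  assert (Dopen : forall z, D z -> exists d, (0 < d)%R /\ forall w, (Cmod (w - z) < d)%R -> D w).
  { intros z [A B]. unfold Defs.disc in A. destruct (slit_plane_open (z - c) B) as [d [Hd Hop]].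
    exists (Rmin d (r - Cmod (z - c))). split; [apply Rmin_pos; lra|]. intros w Hw.
    assert (B1 := Rmin_l d (r - Cmod (z - c))). assert (B2 := Rmin_r d (r - Cmod (z - c))).
    split.
    - unfold Defs.disc. assert (X := Cmod_chain w z c). lra.
    - apply Hop. replace (w - c - (z - c)) with (w - z) by ring. lra. }
  set (dh := fun z => dy z * s z + y z * / (2 * s z)).
  assert (Dh : forall z, D z -> Cder h z (dh z)).
  { intros z Hz. destruct (Dopen z Hz) as [d [Hd Hw]]. destruct (Hs z Hz) as [A _].
    apply (Cder_locally_ext (fun z => y z * s z) h z _ d Hd).
    - intros w Hwd. symmetry. auto.
    - apply Cder_mult; auto. }
  set (R0 := fun z => Q z - RtoC (3 / 4) * / ((z - c) * (z - c)) - T * / (z - c)).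
  set (m := fun z => dh z * / (z - c) + T * h c * / (z - c)).
  set (dm := fun z => R0 z * h z * / (z - c) + T * (h z - h c) * / ((z - c) * (z - c))).
  assert (Dm : forall z, D z -> Cder m z (dm z)).
  { intros z Hz. destruct (Hs z Hz) as [A A']. assert (S0 := Hs0 z Hz).
    assert (DI : Cder (fun z => / (z - c)) z (- (1 * / ((z - c) * (z - c))))).
    { apply (Cder_inv (fun z => z - c)).
      - eapply Cder_eq; [apply Cder_minus; [apply Cder_id|apply Cder_const]|]. ring.
      - rewrite (Hsq z Hz). apply Cmult_neq_0; auto. }
    assert (D2s : Cder (fun z => / (2 * s z)) z (- (2 * / (2 * s z) * / (2 * s z * (2 * s z))))).
    { apply (Cder_inv (fun z => 2 * s z)); [apply Cder_scal; auto|].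
      apply Cmult_neq_0; auto. apply RtoC_neq; lra. }
    eapply Cder_eq.
    - apply Cder_plus.
      + apply Cder_mult; [|exact DI]. apply Cder_plus.
        * apply Cder_mult; [exact A'|apply Ds; auto].
        * apply Cder_mult; [exact A|exact D2s].
      + apply Cder_scal. exact DI.
    - unfold dm, dh, R0. rewrite (Eh z Hz), (Hsq z Hz).
      replace (RtoC (3 / 4)) with (RtoC 3 / RtoC 4).
      + field. repeat split; auto.
      + rewrite RtoC_div; auto. }
  destruct (Hl 1%R Rlt_0_1) as [d0 [Hd0 Hw0]].
  set (t1 := Rmin (Rmin (r / 2) (d0 / 2)) 1).
  assert (Pt1 : (0 < t1)%R) by (repeat apply Rmin_pos; lra).
  assert (Q1 : (t1 <= r / 2)%R) by (eapply Rle_trans; [apply Rmin_l|apply Rmin_l]).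
  assert (Q2 : (t1 <= d0 / 2)%R) by (eapply Rle_trans; [apply Rmin_l|apply Rmin_r]).
  assert (Q3 : (t1 <= 1)%R) by apply Rmin_r.
  set (L := (1 + Cmod l)%R). assert (HL : (1 <= L)%R) by (unfold L; assert (X := Cmod_ge_0 l); lra).
  assert (Hray : forall t, (0 < t <= t1)%R -> D (c + RtoC t)%C /\ c + RtoC t - c = RtoC t).
  { intros t Ht. assert (E : c + RtoC t - c = RtoC t) by ring. split; auto. split.
    - unfold Defs.disc. rewrite E, Cmod_R, Rabs_pos_eq; lra.
    - left. rewrite E. simpl. lra. }
  assert (Hlip : forall t, (0 < t <= t1)%R -> (Cmod (h (c + RtoC t)%C - h c) <= L * t)%R).
  { intros t Ht. destruct (Hray t Ht) as [_ E]. specialize (Hw0 (c + RtoC t)%C).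
    rewrite E, Cmod_R, Rabs_pos_eq in Hw0 by lra. specialize (Hw0 ltac:(lra)).
    replace (h (c + RtoC t)%C - h c) with ((h (c + RtoC t)%C - h c - RtoC t * l) + RtoC t * l) by ring.
    eapply Rle_trans; [apply Cmod_triangle|]. rewrite Cmod_scal_R by lra. unfold L. lra. }
  set (M := (Rabs K * (Cmod (h c) + L) + Cmod T * L)%R).
  assert (PM : (0 <= M)%R).
  { unfold M. assert (X1 := Rabs_pos K). assert (X2 := Cmod_ge_0 (h c)). assert (X3 := Cmod_ge_0 T).
    assert (0 <= Rabs K * (Cmod (h c) + L))%R by (apply Rmult_le_pos; lra).
    assert (0 <= Cmod T * L)%R by (apply Rmult_le_pos; lra). lra. }
  assert (Hdm : forall t, (0 < t <= t1)%R -> (Cmod (dm (c + RtoC t)%C) <= M * / t)%R).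
  { intros t Ht. destruct (Hray t Ht) as [_ E]. unfold dm. rewrite E.
    assert (T0 : RtoC t <> 0) by (apply RtoC_neq; lra).
    assert (HR : (Cmod (R0 (c + RtoC t)%C) <= Rabs K)%R).
    { unfold R0. rewrite E. eapply Rle_trans; [apply HQ; auto|apply Rle_abs].
      rewrite Cmod_R, Rabs_pos_eq; lra. }
    assert (Hh1 : (Cmod (h (c + RtoC t)%C) <= Cmod (h c) + L)%R).
    { assert (X := Cmod_triangle_inv (h (c + RtoC t)%C) (h c)). specialize (Hlip t Ht). nra. }
    eapply Rle_trans; [apply Cmod_triangle|].
    rewrite !Cmod_mult, !Cmod_inv by (auto; apply Cmult_neq_0; auto).
    rewrite Cmod_mult, Cmod_R, Rabs_pos_eq by lra.
    assert (It : (0 < / t)%R) by (apply Rinv_0_lt_compat; lra).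
    assert (Y1 : (Cmod (R0 (c + RtoC t)%C) * Cmod (h (c + RtoC t)%C) * / t <=
      Rabs K * (Cmod (h c) + L) * / t)%R).
    { apply Rmult_le_compat_r; [lra|]. apply Rmult_le_compat; auto; apply Cmod_ge_0. }
    assert (Y2 : (Cmod T * Cmod (h (c + RtoC t)%C - h c) * / (t * t) <= Cmod T * L * / t)%R).
    { replace (Cmod T * L * / t)%R with (Cmod T * (L * t) * / (t * t))%R by (field; lra).
      apply Rmult_le_compat_r; [left; apply Rinv_0_lt_compat; nra|].
      apply Rmult_le_compat_l; [apply Cmod_ge_0|auto]. }
    unfold M. lra. }
  set (M1 := Cmod (m (c + RtoC t1)%C)).
  assert (Hm : forall t, (0 < t <= t1)%R -> (Cmod (m (c + RtoC t)%C) <= M1 + 2 * M * / sqrt t)%R).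
  { intros t Ht.
    assert (X := Rder_compare (fun s => m (c + RtoC s)%C) (fun s => dm (c + RtoC s)%C)
      (fun s => - (2 * M) * / sqrt s)%R (fun s => M * / (s * sqrt s))%R t t1 ltac:(lra)).
    assert (St : (0 < sqrt t)%R) by (apply sqrt_lt_R0; lra).
    assert (St1 : (0 < / sqrt t1)%R) by (apply Rinv_0_lt_compat, sqrt_lt_R0; lra).
    assert (Y : (Cmod (m (c + RtoC t1)%C - m (c + RtoC t)%C)%C <=
      - (2 * M) * / sqrt t1 - - (2 * M) * / sqrt t)%R).
    { apply X.
      - intros u Hu. destruct (Hray u ltac:(lra)) as [HuD _].
        assert (Y := Cder_slice m c 1 (dm (c + RtoC u)%C) u).
        replace (c + RtoC u * 1) with (c + RtoC u)%C in Y by ring.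
        specialize (Y (Dm _ HuD)). rewrite Cmult_1_r in Y.
        destruct Y as [Y1 Y2]. split.
        + eapply is_derive_ext; [|exact Y1]. intros v. cbv beta. do 2 f_equal. ring.
        + eapply is_derive_ext; [|exact Y2]. intros v. cbv beta. do 2 f_equal. ring.
      - intros u Hu. assert (Su : (0 < sqrt u)%R) by (apply sqrt_lt_R0; lra).
        assert (Su2 : (sqrt u * sqrt u = u)%R) by (apply sqrt_sqrt; lra).
        auto_derive; [repeat split; lra|]. rewrite Su2. field. lra.
      - intros u Hu. eapply Rle_trans; [apply Hdm; lra|]. apply Rmult_le_compat_l; auto.
        assert (Su : (0 < sqrt u)%R) by (apply sqrt_lt_R0; lra).
        assert (Su1 : (sqrt u <= 1)%R) by (rewrite <- sqrt_1; apply sqrt_le_1; lra).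
        apply Rinv_le_contravar; [apply Rmult_lt_0_compat; lra|]. nra. }
    assert (Z := Cmod_triangle_inv (m (c + RtoC t)%C) (m (c + RtoC t1)%C)).
    rewrite Cmod_minus_sym in Z. unfold M1.
    assert (0 <= M * / sqrt t1)%R by (apply Rmult_le_pos; lra). lra. }
  (* dh = t m - T h(c), and t m tends to 0 *)
  assert (Hdh : forall eps, (0 < eps)%R -> exists t2, (0 < t2 <= t1)%R /\ forall t, (0 < t <= t2)%R ->
    (Cmod (dh (c + RtoC t)%C - - T * h c) <= eps)%R).
  { intros eps Heps.
    assert (PM1 : (0 <= M1)%R) by apply Cmod_ge_0.
    set (e := (eps / (M1 + 2 * M + 1))%R).
    assert (He : (0 < e)%R) by (apply Rdiv_lt_0_compat; lra).
    assert (He2 : (0 < e * e)%R) by nra.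
    exists (Rmin t1 (e * e)). split; [split; [apply Rmin_pos; auto|apply Rmin_l]|].
    intros t Ht. assert (B1 := Rmin_l t1 (e * e)). assert (B2 := Rmin_r t1 (e * e)).
    destruct (Hray t ltac:(lra)) as [_ E].
    assert (T0 : RtoC t <> 0) by (apply RtoC_neq; lra).
    replace (dh (c + RtoC t)%C - - T * h c) with (RtoC t * m (c + RtoC t)%C)
      by (unfold m; rewrite E; field; auto).
    rewrite Cmod_scal_R by lra. specialize (Hm t ltac:(lra)).
    assert (St : (0 < sqrt t)%R) by (apply sqrt_lt_R0; lra).
    assert (St2 : (sqrt t * sqrt t = t)%R) by (apply sqrt_sqrt; lra).
    assert (Ste : (sqrt t <= e)%R).
    { rewrite <- (sqrt_square e) by lra. apply sqrt_le_1; nra. }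
    assert (St1 : (sqrt t <= 1)%R) by (rewrite <- sqrt_1; apply sqrt_le_1; lra).
    assert (X : (t * Cmod (m (c + RtoC t)%C) <= t * (M1 + 2 * M * / sqrt t))%R)
      by (apply Rmult_le_compat_l; lra).
    assert (Y : (t * (M1 + 2 * M * / sqrt t) = sqrt t * (sqrt t * M1 + 2 * M))%R).
    { rewrite <- St2 at 1. field. lra. }
    rewrite Y in X.
    assert (Z1 : (sqrt t * (sqrt t * M1 + 2 * M) <= e * (M1 + 2 * M + 1))%R).
    { apply Rmult_le_compat; nra. }
    assert (Z2 : (e * (M1 + 2 * M + 1) = eps)%R) by (unfold e; field; lra).
    lra. }
  apply Cmod_eps_eq. intros eps Heps.
  destruct (Hdh (eps / 4)%R ltac:(lra)) as [t2 [Ht2 H2]].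
  destruct (Hl (eps / 4)%R ltac:(lra)) as [d3 [Hd3 Hw3]].
  set (t := Rmin t2 (d3 / 2)).
  assert (Pt : (0 < t)%R) by (apply Rmin_pos; lra).
  assert (B1 : (t <= t2)%R) by apply Rmin_l. assert (B2 : (t <= d3 / 2)%R) by apply Rmin_r.
  assert (Main : (Cmod (h (c + RtoC t)%C - h c - RtoC t * (- T * h c)) <= eps / 2 * t)%R).
  {
    (* compare on the interval from u to t and let u tend to 0 *)
    apply Rnot_lt_le. intros Hlt.
    set (g := fun u => h (c + RtoC u)%C - (h c + RtoC u * (- T * h c))).
    assert (Hg : forall u, (0 < u <= t)%R -> (Cmod (g t - g u) <= eps / 4 * t)%R).
    { intros u Hu.
      assert (X := Rder_compare g (fun s => dh (c + RtoC s)%C - - T * h c)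
        (fun s => eps / 4 * s)%R (fun _ => eps / 4)%R u t ltac:(lra)).
      assert (Y : (Cmod (g t - g u) <= eps / 4 * t - eps / 4 * u)%R); [|nra].
      apply X.
      - intros v Hv. unfold g. apply Rder_minus; [|apply Rder_lin].
        destruct (Hray v ltac:(lra)) as [HvD _].
        assert (Y := Cder_slice h c 1 (dh (c + RtoC v)%C) v).
        replace (c + RtoC v * 1) with (c + RtoC v)%C in Y by ring.
        specialize (Y (Dh _ HvD)). rewrite Cmult_1_r in Y.
        destruct Y as [Y1 Y2]. split.
        + eapply is_derive_ext; [|exact Y1]. intros w. cbv beta. do 2 f_equal. ring.
        + eapply is_derive_ext; [|exact Y2]. intros w. cbv beta. do 2 f_equal. ring.
      - intros v Hv. auto_derive; auto. ring.
      - intros v Hv. apply H2. lra. }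
    set (k := (eps / 4 * t)%R). assert (Pk : (0 < k)%R) by (unfold k; nra).
    set (W := (L + Cmod (T * h c))%R).
    assert (PW : (0 < W)%R) by (unfold W; assert (X := Cmod_ge_0 (T * h c)); lra).
    set (u := Rmin t (k / (2 * W))).
    assert (Pu : (0 < u)%R) by (apply Rmin_pos; auto; apply Rdiv_lt_0_compat; lra).
    assert (U1 : (u <= t)%R) by apply Rmin_l.
    assert (U2 : (W * u <= k / 2)%R).
    { assert (X : (u <= k / (2 * W))%R) by apply Rmin_r.
      apply (Rmult_le_compat_l W) in X; [|lra].
      replace (W * (k / (2 * W)))%R with (k / 2)%R in X by (field; lra). exact X. }
    specialize (Hg u ltac:(lra)).
    assert (Hgu : (Cmod (g u) <= W * u)%R).
    { unfold g. replace (h (c + RtoC u)%C - (h c + RtoC u * (- T * h c))) with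
        ((h (c + RtoC u)%C - h c) + RtoC u * (T * h c)) by ring.
      eapply Rle_trans; [apply Cmod_triangle|]. rewrite Cmod_scal_R by lra.
      specialize (Hlip u ltac:(lra)). unfold W. lra. }
    assert (X := Cmod_triangle (g t - g u) (g u)).
    replace (g t - g u + g u) with (h (c + RtoC t)%C - h c - RtoC t * (- T * h c)) in X
      by (unfold g; ring).
    fold k in Hg. replace (eps / 2 * t)%R with (2 * k)%R in Hlt by (unfold k; field). lra. }
  specialize (Hw3 (c + RtoC t)%C).
  replace (c + RtoC t - c) with (RtoC t) in Hw3 by ring.
  rewrite Cmod_R, Rabs_pos_eq in Hw3 by lra. specialize (Hw3 ltac:(lra)).
  assert (X := Cmod_triangle_minus (h (c + RtoC t)%C - h c - RtoC t * (- T * h c))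
    (h (c + RtoC t)%C - h c - RtoC t * l)).
  replace (h (c + RtoC t)%C - h c - RtoC t * (- T * h c) - (h (c + RtoC t)%C - h c - RtoC t * l)) with
    (RtoC t * (l - - T * h c)) in X by ring.
  rewrite Cmod_scal_R in X by lra.
  apply (Rmult_le_reg_l t); auto. nra.
Qed.

(** * Translations and convex domains *)

(** Continuous functions that agree at points accumulating at s agree at s. *)
Lemma ccont_eq_limit (F G : C -> C) (s : C) : ccont F s -> ccont G s ->
  (forall d, (0 < d)%R -> exists z, (Cmod (z - s) < d)%R /\ F z = G z) -> F s = G s.
Proof.
  intros HF HG H. apply Cmod_eps_eq. intros eps Heps.
  destruct (HF (eps / 2)%R) as [d [Hd Hw]]; [lra|].
  destruct (HG (eps / 2)%R) as [d' [Hd' Hw']]; [lra|].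
  destruct (H (Rmin d d')) as [z [Hz E]]; [apply Rmin_pos; auto|].
  assert (B1 := Rmin_l d d'). assert (B2 := Rmin_r d d').
  specialize (Hw z ltac:(lra)). specialize (Hw' z ltac:(lra)).
  eapply Rle_trans; [apply (Cmod_chain _ (F z))|].
  rewrite (Cmod_minus_sym (F s)). rewrite E at 2. lra.
Qed.

Lemma sol_shift (q : C -> C) (D : C -> Prop) (w : C) y dy :
  (forall z, D z -> q (z + w) = q z) -> sol q (fun z => D (z - w)) y dy ->
  sol q D (fun z => y (z + w)) (fun z => dy (z + w)).
Proof.
  intros Hq H z Hz. destruct (H (z + w)) as [A B].
  { replace (z + w - w) with z by ring. auto. }
  split; [apply Cder_shift; auto|]. rewrite <- Hq by auto. apply Cder_shift; auto.
Qed.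

Lemma sym2_shift (q : C -> C) (D : C -> Prop) (w : C) U :
  (forall z, D z -> q (z + w) = q z) -> sym2 q (fun z => D (z - w)) U ->
  sym2 q D (fun z => U (z + w)).
Proof.
  intros Hq [v1 [dv1 [v2 [dv2 [a [b [c [S1 [S2 E]]]]]]]]].
  exists (fun z => v1 (z + w)), (fun z => dv1 (z + w)), (fun z => v2 (z + w)),
    (fun z => dv2 (z + w)), a, b, c.
  split; [apply sol_shift; auto|split; [apply sol_shift; auto|]].
  intros z Hz. rewrite E; auto. replace (z + w - w) with z by ring. auto.
Qed.

Definition convex (D : C -> Prop) : Prop :=
  forall a b t, D a -> D b -> (0 <= t <= 1)%R -> D (seg a b t).

Lemma convex_star D x0 : convex D -> D x0 -> star x0 D.
Proof. intros H H0 z t Hz Ht. apply H; auto. Qed.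

Lemma convex_and D D' : convex D -> convex D' -> convex (fun z => D z /\ D' z).
Proof. intros H H' a b t [A1 A2] [B1 B2] Ht. split; auto. Qed.

Lemma open_and' (D D' : C -> Prop) : open D -> open D' -> open (fun z => D z /\ D' z).
Proof. intros. apply (open_and (T := C_UniformSpace)); auto. Qed.

Lemma convex_ball c r : convex (fun z => (Cmod (z - c) < r)%R).
Proof.
  intros a b t Ha Hb Ht.
  replace (seg a b t - c) with (RtoC (1 - t) * (a - c) + RtoC t * (b - c))
    by (unfold seg; rewrite RtoC_minus; ring).
  eapply Rle_lt_trans; [apply Cmod_triangle|]. rewrite !Cmod_scal_R by lra.
  destruct (Req_dec t 0) as [->|Ht0]; [lra|].
  assert (t * Cmod (b - c) < t * r)%R by (apply Rmult_lt_compat_l; lra).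
  assert ((1 - t) * Cmod (a - c) <= (1 - t) * r)%R by (apply Rmult_le_compat_l; lra). lra.
Qed.

Section Gluing.
Variable tau : C.
Hypothesis Htau : (0 < Im tau)%R.
Variable p : params.
Hypothesis HAP : AP tau p.

Let ns (z : C) : Prop := ~ singular tau z.
Let Q : C -> C := q tau p.

Lemma HT : T0 p + T1 p + T2 p + T3 p = 0.
Proof. apply HAP. Qed.

(** * Strips and cells *)

(** The open strips between consecutive horizontal, respectively slanted, lines of half-lattice
    points, indexed by twice the coordinate of their lower edge. *)
Definition Row (j : Z) (z : C) : Prop := (IZR j / 2 < ct tau z < (IZR j + 1) / 2)%R.
Definition Col (i : Z) (z : C) : Prop := (IZR i / 2 < cs tau z < (IZR i + 1) / 2)%R.

Lemma ct_lin a b x y : ct tau (RtoC a * x + RtoC b * y) = (a * ct tau x + b * ct tau y)%R.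
Proof. unfold ct, Im, RtoC, Cplus, Cmult; simpl. field. unfold Im in Htau; lra. Qed.

Lemma cs_lin a b x y : cs tau (RtoC a * x + RtoC b * y) = (a * cs tau x + b * cs tau y)%R.
Proof.
  unfold cs. rewrite ct_lin. unfold Re, RtoC, Cplus, Cmult; simpl. ring.
Qed.

Lemma ct_minus x y : ct tau (x - y) = (ct tau x - ct tau y)%R.
Proof. replace (x - y) with (RtoC 1 * x + RtoC (-1) * y); [rewrite ct_lin; ring|].
  replace (RtoC (-1)) with (- (1)) by (rewrite <- RtoC_opp; auto). ring. Qed.

Lemma cs_minus x y : cs tau (x - y) = (cs tau x - cs tau y)%R.
Proof. replace (x - y) with (RtoC 1 * x + RtoC (-1) * y); [rewrite cs_lin; ring|].
  replace (RtoC (-1)) with (- (1)) by (rewrite <- RtoC_opp; auto). ring. Qed.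

Lemma ct_plus x y : ct tau (x + y) = (ct tau x + ct tau y)%R.
Proof. replace (x + y) with (RtoC 1 * x + RtoC 1 * y) by ring. rewrite ct_lin; ring. Qed.

Lemma cs_plus x y : cs tau (x + y) = (cs tau x + cs tau y)%R.
Proof. replace (x + y) with (RtoC 1 * x + RtoC 1 * y) by ring. rewrite cs_lin; ring. Qed.

Lemma half_coords m n : cs tau (lattice_point tau m n / 2) = (IZR m / 2)%R /\
  ct tau (lattice_point tau m n / 2) = (IZR n / 2)%R.
Proof.
  assert (E : lattice_point tau m n / 2 = RtoC (/ 2) * lattice_point tau m n + RtoC 0 * 0).
  { rewrite RtoC_inv by lra. field. }
  destruct (lp_coords tau Htau m n) as [A B0].
  rewrite E, cs_lin, ct_lin, A, B0. split; lra.
Qed.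

Lemma strip_open (f : C -> R) (a b : R) : (forall x, (Rabs (f x) <= Kt tau * Cmod x)%R) ->
  (forall x y, f (x - y) = (f x - f y)%R) -> open (fun z => (a < f z < b)%R).
Proof.
  intros Hf Hm. assert (K1 := Kt_ge_1 tau Htau). apply open_C_iff. intros z Hz.
  set (d := Rmin (f z - a) (b - f z)).
  assert (Hd : (0 < d)%R) by (apply Rmin_pos; lra).
  assert (B1 := Rmin_l (f z - a) (b - f z)). assert (B2 := Rmin_r (f z - a) (b - f z)).
  fold d in B1, B2.
  exists (d / Kt tau)%R. split; [apply Rdiv_lt_0_compat; lra|]. intros w Hw.
  specialize (Hf (w - z)). rewrite Hm in Hf.
  apply (Rmult_lt_compat_l (Kt tau)) in Hw; [|lra].
  replace (Kt tau * (d / Kt tau))%R with d in Hw by (field; lra).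
  assert (X : (Rabs (f w - f z) < d)%R) by lra. apply Rabs_lt_between in X. lra.
Qed.

Lemma Row_open j : open (Row j).
Proof. apply strip_open; [apply ct_bound; auto|apply ct_minus]. Qed.
Lemma Col_open i : open (Col i).
Proof. apply strip_open; [apply cs_bound; auto|apply cs_minus]. Qed.

Lemma seg_lin a b t : seg a b t = RtoC (1 - t) * a + RtoC t * b.
Proof. unfold seg. rewrite RtoC_minus. ring. Qed.

Lemma between_convex (a b x y t : R) : (a < x < b)%R -> (a < y < b)%R -> (0 <= t <= 1)%R ->
  (a < (1 - t) * x + t * y < b)%R.
Proof.
  intros Hx Hy Ht. destruct (Req_dec t 0) as [->|Ht0]; [lra|].
  assert (t * a < t * y)%R by (apply Rmult_lt_compat_l; lra).
  assert (t * y < t * b)%R by (apply Rmult_lt_compat_l; lra).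
  assert ((1 - t) * a <= (1 - t) * x)%R by (apply Rmult_le_compat_l; lra).
  assert ((1 - t) * x <= (1 - t) * b)%R by (apply Rmult_le_compat_l; lra). lra.
Qed.

Lemma Row_convex j : convex (Row j).
Proof. intros a b t Ha Hb Ht. unfold Row. rewrite seg_lin, ct_lin. apply between_convex; auto. Qed.
Lemma Col_convex j : convex (Col j).
Proof. intros a b t Ha Hb Ht. unfold Col. rewrite seg_lin, cs_lin. apply between_convex; auto. Qed.

(** Strips contain no singular point for this reason. *)
Lemma no_half_int (i m : Z) : ~ (IZR i / 2 < IZR m / 2 < (IZR i + 1) / 2)%R.
Proof.
  intros H. assert (A : (i < m)%Z) by (apply lt_IZR; lra).
  assert (D : (m < i + 1)%Z) by (apply lt_IZR; rewrite plus_IZR; lra). lia.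
Qed.

Lemma Row_ns j z : Row j z -> ns z.
Proof.
  intros H [m [n ->]]. unfold Row in H. destruct (half_coords m n) as [_ E].
  rewrite E in H. apply (no_half_int _ _ H).
Qed.
Lemma Col_ns j z : Col j z -> ns z.
Proof.
  intros H [m [n ->]]. unfold Col in H. destruct (half_coords m n) as [E _].
  rewrite E in H. apply (no_half_int _ _ H).
Qed.

Lemma Row_domain j x0 : Row j x0 -> ode_domain Q (Row j) x0.
Proof.
  intros H. split; [apply Row_open|split; [apply convex_star; auto; apply Row_convex|split; auto]].
  intros z Hz. apply q_locC1; auto. apply (Row_ns j); auto.
Qed.
Lemma Col_domain j x0 : Col j x0 -> ode_domain Q (Col j) x0.
Proof.
  intros H. split; [apply Col_open|split; [apply convex_star; auto; apply Col_convex|split; auto]].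
  intros z Hz. apply q_locC1; auto. apply (Col_ns j); auto.
Qed.

Definition centre (i j : Z) : C := RtoC (IZR i / 2 + / 4) + RtoC (IZR j / 2 + / 4) * tau.

Lemma centre_cell i j : Col i (centre i j) /\ Row j (centre i j).
Proof.
  unfold Col, Row, centre. rewrite cs_coords, ct_coords by auto. split; lra.
Qed.

(** A point on an edge of a row and on an edge of a column is a half-lattice
    point. *)
Lemma strip_cover z : ns z -> (exists j, Row j z) \/ (exists i, Col i z).
Proof.
  intros Hz.
  assert (F : forall x : R, (exists i : Z, x = (IZR i / 2)%R) \/
    (exists i : Z, (IZR i / 2 < x < (IZR i + 1) / 2)%R)).
  { intros x. destruct (base_Int_part (2 * x)) as [A B0].
    destruct (Req_dec (IZR (Int_part (2 * x))) (2 * x)) as [E|E].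
    - left. exists (Int_part (2 * x)). lra.
    - right. exists (Int_part (2 * x)). lra. }
  destruct (F (ct tau z)) as [[n En]|[j Hj]]; [|left; exists j; auto].
  destruct (F (cs tau z)) as [[m Em]|[i Hi]]; [|right; exists i; auto].
  exfalso. apply Hz. exists m, n. rewrite (coords tau Htau z), Em, En.
  unfold lattice_point, Rdiv. rewrite !RtoC_mult, !RtoC_inv by lra. field.
Qed.

(** By [global_unique] such a function is determined by its germ at one point. *)
Definition global_sym2 (Y : C -> C) : Prop :=
  (forall j, sym2 Q (Row j) Y) /\ (forall i, sym2 Q (Col i) Y).

Lemma sym2_unique_near D x0 z r U V : ode_domain Q D x0 -> sym2 Q D U -> sym2 Q D V -> D z ->
  (0 < r)%R -> (forall w, D w -> (Cmod (w - z) < r)%R -> U w = V w) -> forall w, D w -> U w = V w.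
Proof.
  intros HO HU HV Hz Hr E.
  destruct (proj1 (open_C_iff D) (proj1 HO) z Hz) as [d [Hd Hin]].
  apply (sym2_unique Q D x0 z (Rmin r d)); auto; [apply Rmin_pos; auto|].
  intros t Ht. assert (B1 := Rmin_l r d). assert (B2 := Rmin_r r d).
  assert (Et : (Cmod (z + RtoC t - z) = Rabs t)%R).
  { replace (z + RtoC t - z) with (RtoC t) by ring. apply Cmod_R. }
  apply E; [apply Hin|]; rewrite Et; lra.
Qed.

Lemma cell_near (D : C -> Prop) z : open D -> D z -> forall P : C -> Prop,
  (forall w, D w -> P w) -> exists r, (0 < r)%R /\ forall w, (Cmod (w - z) < r)%R -> P w.
Proof.
  intros HD Hz P HP. destruct (proj1 (open_C_iff D) HD z Hz) as [d [Hd Hin]].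
  exists d. split; auto.
Qed.

(** Every column meets every row in a cell, so agreement spreads from one row to all
    columns and from there to all rows. *)
Lemma global_unique Y Y' j z r : global_sym2 Y -> global_sym2 Y' -> Row j z -> (0 < r)%R ->
  (forall w, (Cmod (w - z) < r)%R -> Y w = Y' w) -> forall w, ns w -> Y w = Y' w.
Proof.
  intros [R1 C1] [R2 C2] Hz Hr E.
  assert (A : forall w, Row j w -> Y w = Y' w).
  { apply (sym2_unique_near (Row j) z z r); auto. apply Row_domain; auto. }
  assert (AC : forall i w, Col i w -> Y w = Y' w).
  { intros i. destruct (centre_cell i j) as [X1 X2].
    destruct (cell_near (Row j) (centre i j) (Row_open j) X2 _ A) as [d [Hd Hin]].
    apply (sym2_unique_near (Col i) (centre i j) (centre i j) d); auto. apply Col_domain; auto. }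
  assert (AR : forall i w, Row i w -> Y w = Y' w).
  { intros i. destruct (centre_cell 0 i) as [X1 X2].
    destruct (cell_near (Col 0) (centre 0 i) (Col_open 0) X1 _ (AC 0%Z)) as [d [Hd Hin]].
    apply (sym2_unique_near (Row i) (centre 0 i) (centre 0 i) d); auto. apply Row_domain; auto. }
  intros w Hw. destruct (strip_cover w Hw) as [[i Hi]|[i Hi]]; eauto.
Qed.

Lemma Row_shift_1 j z : Row j (z - 1) <-> Row j z.
Proof.
  unfold Row. rewrite ct_minus. replace (ct tau 1) with 0%R; [rewrite Rminus_0_r; tauto|].
  assert (E := proj2 (lp_coords tau Htau 1 0)). rewrite lp_10 in E. auto.
Qed.
Lemma Col_shift_1 i z : Col i (z - 1) <-> Col (i + 2) z.
Proof.
  unfold Col. rewrite cs_minus, plus_IZR. replace (cs tau 1) with 1%R; [split; intros; lra|].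
  assert (E := proj1 (lp_coords tau Htau 1 0)). rewrite lp_10 in E. auto.
Qed.
Lemma Row_shift_tau j z : Row j (z - tau) <-> Row (j + 2) z.
Proof.
  unfold Row. rewrite ct_minus, plus_IZR. replace (ct tau tau) with 1%R; [split; intros; lra|].
  assert (E := proj2 (lp_coords tau Htau 0 1)). rewrite lp_01 in E. auto.
Qed.
Lemma Col_shift_tau i z : Col i (z - tau) <-> Col i z.
Proof.
  unfold Col. rewrite cs_minus. replace (cs tau tau) with 0%R; [rewrite Rminus_0_r; tauto|].
  assert (E := proj1 (lp_coords tau Htau 0 1)). rewrite lp_01 in E. auto.
Qed.

Lemma global_sym2_1 Y : global_sym2 Y -> global_sym2 (fun z => Y (z + 1)).
Proof.
  intros [R1 C1]. split; intros k; apply sym2_shift.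
  - intros z Hz. apply q_1; auto; [apply HT|apply (Row_ns k); auto].
  - apply (sym2_sub Q (Row k)); auto. intros z. apply Row_shift_1.
  - intros z Hz. apply q_1; auto; [apply HT|apply (Col_ns k); auto].
  - apply (sym2_sub Q (Col (k + 2))); auto. intros z. apply Col_shift_1.
Qed.

Lemma global_sym2_tau Y : global_sym2 Y -> global_sym2 (fun z => Y (z + tau)).
Proof.
  intros [R1 C1]. split; intros k; apply sym2_shift.
  - intros z Hz. apply q_tau; auto; [apply HT|apply (Row_ns k); auto].
  - apply (sym2_sub Q (Row (k + 2))); auto. intros z. apply Row_shift_tau.
  - intros z Hz. apply q_tau; auto; [apply HT|apply (Col_ns k); auto].
  - apply (sym2_sub Q (Col k)); auto. intros z. apply Col_shift_tau.
Qed.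

(** * Around an apparent singularity *)

(** Discs of this radius around singular points contain no other singular point and lie in the
    four cells around the centre together with their common edges. *)
Definition rad : R := (/ (2 * Kt tau))%R.

Lemma rad_pos : (0 < rad)%R.
Proof. unfold rad. apply Rinv_0_lt_compat. assert (K1 := Kt_ge_1 tau Htau). lra. Qed.

Lemma disc_ns c z : singular tau c -> Defs.disc c rad z -> z <> c -> ns z.
Proof.
  intros Hc Hz Hne Hs. assert (X := singular_dist tau Htau z c Hs Hc Hne).
  unfold Defs.disc in Hz. unfold rad in Hz. lra.
Qed.

Lemma slit_not_c c z : slit_disc c rad z -> z <> c.
Proof.
  intros [_ H] ->. replace (c - c) with (RtoC 0) in H by ring. simpl in H. destruct H; lra.
Qed.

Lemma slit_domain c : singular tau c ->
  ode_domain Q (slit_disc c rad) (c + RtoC (rad / 2)).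
Proof.
  intros Hc. assert (Hr := rad_pos).
  assert (E : c + RtoC (rad / 2) - c = RtoC (rad / 2)) by ring.
  split; [|split; [|split]].
  - apply open_C_iff. intros z [A B0]. unfold Defs.disc in A.
    destruct (slit_plane_open (z - c) B0) as [d [Hd Hop]].
    exists (Rmin d (rad - Cmod (z - c))). split; [apply Rmin_pos; lra|]. intros w Hw.
    assert (B1 := Rmin_l d (rad - Cmod (z - c))). assert (B2 := Rmin_r d (rad - Cmod (z - c))).
    split.
    + unfold Defs.disc. assert (X := Cmod_chain w z c). lra.
    + apply Hop. replace (w - c - (z - c)) with (w - z) by ring. lra.
  - intros z t [A B0] Ht. split.
    + apply (convex_ball c rad); auto. rewrite E, Cmod_R, Rabs_pos_eq; lra.
    + replace (seg (c + RtoC (rad / 2)) z t - c) with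
        (RtoC ((1 - t) * (rad / 2)) + RtoC t * (z - c))
        by (unfold seg; rewrite RtoC_mult, RtoC_minus; ring).
      replace (Re (RtoC ((1 - t) * (rad / 2)) + RtoC t * (z - c))) with
        ((1 - t) * (rad / 2) + t * Re (z - c))%R
        by (unfold Re, RtoC, Cplus, Cmult; simpl; ring).
      replace (Im (RtoC ((1 - t) * (rad / 2)) + RtoC t * (z - c))) with (t * Im (z - c))%R
        by (unfold Im, RtoC, Cplus, Cmult; simpl; ring).
      destruct B0 as [B0|B0].
      * left. destruct (Req_dec t 0) as [->|Ht0]; [lra|].
        assert (0 < t * Re (z - c))%R by (apply Rmult_lt_0_compat; lra).
        assert (0 <= (1 - t) * (rad / 2))%R by (apply Rmult_le_pos; lra). lra.
      * destruct (Req_dec t 0) as [->|Ht0]; [left; lra|right].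
        apply Rmult_integral_contrapositive; auto.
  - split.
    + unfold Defs.disc. rewrite E, Cmod_R, Rabs_pos_eq; lra.
    + left. rewrite E. simpl. lra.
  - intros z Hz. apply q_locC1; auto. apply (disc_ns c); auto; [apply Hz|].
    apply slit_not_c; auto.
Qed.

(** Translate by a lattice vector, which leaves q unchanged, to one of the four
    points for which the hypothesis is made. The derivative at the centre comes from
    [apparent_derivative]. *)
Lemma log_free_everywhere k m n y dy : (k <= 3)%nat ->
  let c := omega tau k / 2 + lattice_point tau m n in
  sol Q (slit_disc c rad) y dy ->
  exists h, (forall z, Defs.disc c rad z -> ccont h z) /\
    (forall z, slit_disc c rad z -> y z = h z / Csqrt (z - c)) /\
    Cder h c (- Tcoef p k * h c).
Proof.
  intros Hk c Hs. set (w := lattice_point tau m n) in *. set (c0 := omega tau k / 2) in *.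
  assert (Hc0 : singular tau c0) by apply omega_singular.
  assert (Hr := rad_pos).
  assert (E0 : forall z, z + w - c = z - c0) by (intros; unfold c; ring).
  assert (Hs0 : sol Q (slit_disc c0 rad) (fun z => y (z + w)) (fun z => dy (z + w))).
  { apply sol_shift.
    - intros z Hz. apply q_lattice; [auto|apply HT|]. apply (disc_ns c0); auto; [apply Hz|].
      apply slit_not_c; auto.
    - apply (sol_sub Q (slit_disc c rad)); auto. intros z Hz. unfold slit_disc, Defs.disc in *.
      replace (z - c) with (z - w - c0) by (unfold c; ring). auto. }
  destruct (proj2 HAP k Hk rad (fun z => y (z + w)) Hr) as [h [H1 H2]].
  - intros z Hz Hne. apply (disc_ns c0); auto.
  - apply sol_solution_on. eexists. exact Hs0.
  - assert (Hcont : forall z, Defs.disc c0 rad z -> exists l, Cder h z l).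
    { intros z Hz. destruct (H1 z Hz) as [l Hl]. exists l. apply Cder_iff. exact Hl. }
    exists (fun z => h (z + - w)). split; [|split].
    + intros z Hz. apply ccont_shift. destruct (Hcont (z + - w)) as [l Hl].
      * unfold Defs.disc in *. replace (z + - w - c0) with (z - c) by (unfold c; ring). auto.
      * apply (Cder_ccont _ _ _ Hl).
    + intros z Hz. specialize (H2 (z + - w)). fold c0 in H2. cbv beta in H2.
      replace (z + - w + w) with z in H2 by ring.
      replace (z + - w - c0) with (z - c) in H2 by (unfold c; ring). apply H2.
      unfold slit_disc, Defs.disc in *. replace (z + - w - c0) with (z - c) by (unfold c; ring). auto.
    + apply Cder_shift. replace (c + - w) with c0 by (unfold c; ring).
      destruct (Hcont c0) as [l Hl].
      { unfold Defs.disc. replace (c0 - c0) with (RtoC 0) by ring. rewrite Cmod_0. auto. }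
      assert (El : l = - Tcoef p k * h c0); [|rewrite <- El; auto].
      destruct (polar_part tau Htau p k Hk) as [r [K [Hr' HK]]].
      set (r1 := Rmin r rad).
      assert (B1 : (r1 <= r)%R) by apply Rmin_l. assert (B2 : (r1 <= rad)%R) by apply Rmin_r.
      assert (Sub : forall z, slit_disc c0 r1 z -> slit_disc c0 rad z).
      { intros z [A B0]. split; auto. unfold Defs.disc in *. lra. }
      apply (apparent_derivative Q (fun z => y (z + w)) (fun z => dy (z + w)) h c0
        (Tcoef p k) l r1 K); auto.
      * apply Rmin_pos; auto.
      * apply (sol_sub Q (slit_disc c0 rad)); auto.
      * intros x Hx Hxr. apply HK; auto. lra.
Qed.

Lemma half_disc_convex (f : C -> R) c :
  (forall a b x y, f (RtoC a * x + RtoC b * y) = (a * f x + b * f y)%R) ->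
  convex (fun z => Defs.disc c rad z /\ (0 < f (z - c)%C)%R).
Proof.
  intros Hf a b t [A1 A2] [B1 B2] Ht. split.
  - apply (convex_ball c rad); auto.
  - replace (seg a b t - c) with (RtoC (1 - t) * (a - c) + RtoC t * (b - c))
      by (unfold seg; rewrite RtoC_minus; ring).
    rewrite Hf. destruct (Req_dec t 0) as [->|Ht0]; [lra|].
    assert (0 < t * f (b - c)%C)%R by (apply Rmult_lt_0_compat; lra).
    assert (0 <= (1 - t) * f (a - c)%C)%R by (apply Rmult_le_pos; lra). lra.
Qed.

Lemma disc_coords i j z : let c := lattice_point tau i j / 2 in Defs.disc c rad z ->
  ((0 < cs tau (z - c)%C)%R -> Col i z) /\ ((cs tau (z - c)%C < 0)%R -> Col (i - 1) z) /\
  ((0 < ct tau (z - c)%C)%R -> Row j z) /\ ((ct tau (z - c)%C < 0)%R -> Row (j - 1) z).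
Proof.
  intros c Hz. assert (K1 := Kt_ge_1 tau Htau).
  assert (X := cs_bound tau Htau (z - c)). assert (Y := ct_bound tau Htau (z - c)).
  assert (Hk : (Kt tau * Cmod (z - c) < / 2)%R).
  { unfold Defs.disc, rad in Hz. apply (Rmult_lt_compat_l (Kt tau)) in Hz; [|lra].
    replace (Kt tau * / (2 * Kt tau))%R with (/ 2)%R in Hz by (field; lra). auto. }
  assert (X' : (Rabs (cs tau (z - c)%C) < / 2)%R) by lra.
  assert (Y' : (Rabs (ct tau (z - c)%C) < / 2)%R) by lra.
  apply Rabs_lt_between in X'. apply Rabs_lt_between in Y'.
  destruct (half_coords i j) as [E1 E2]. fold c in E1, E2.
  rewrite cs_minus, E1 in *. rewrite ct_minus, E2 in *.
  unfold Col, Row. rewrite !minus_IZR. repeat split; intros; lra.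
Qed.

Lemma Im_ct z : Im z = (ct tau z * Im tau)%R.
Proof. unfold ct. field. lra. Qed.

Lemma Re_cs z : Im z = 0%R -> Re z = cs tau z.
Proof. intros H. unfold cs, ct. rewrite H. field. lra. Qed.

(** A displacement given by its coordinates. *)
Definition step (a b : R) : C := RtoC a + RtoC b * tau.

Lemma step_small (d : R) : (0 < d)%R -> exists e, (0 < e)%R /\ forall a b,
  (Rabs a <= 2 * e)%R -> (Rabs b <= e)%R -> (Cmod (step a b) < d)%R.
Proof.
  intros Hd. assert (P := Cmod_ge_0 tau).
  exists (d / (3 + Cmod tau))%R. split; [apply Rdiv_lt_0_compat; lra|].
  intros a b Ha Hb. unfold step. eapply Rle_lt_trans; [apply Cmod_triangle|].
  rewrite Cmod_mult, !Cmod_R.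
  set (e := (d / (3 + Cmod tau))%R) in *.
  assert (He : (e * (3 + Cmod tau) = d)%R) by (unfold e; field; lra).
  assert (0 < e)%R by (apply Rdiv_lt_0_compat; lra).
  assert (Rabs b * Cmod tau <= e * Cmod tau)%R by (apply Rmult_le_compat_r; lra). nra.
Qed.

Lemma step_coords a b : cs tau (step a b) = a /\ ct tau (step a b) = b.
Proof. unfold step. rewrite cs_coords, ct_coords by auto. auto. Qed.

(** [QF] with its coefficients packed in a triple. *)
Definition QT (A : C * C * C) (f g : C -> C) (z : C) : C :=
  QF (fst (fst A)) (snd (fst A)) (snd A) f g z.

(** Every quadratic form in solutions on one of the four half-discs at a corner of
   the strips is the restriction of a single-valued function N A on the punctured
   disc; A is determined by any quarter-disc. *)
Lemma corner (i j : Z) : let c := lattice_point tau i j / 2 in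
  exists (k : nat) (m n : Z) (N : C * C * C -> C -> C) (g : C * C * C -> C), (k <= 3)%nat /\
  c = omega tau k / 2 + lattice_point tau m n /\
  (forall A, plim (fun z => N A z - g A * / (z - c)) c (- (2) * Tcoef p k * g A)) /\
  (forall U, sym2 Q (Row j) U -> exists A, forall z, Defs.disc c rad z ->
     (0 < ct tau (z - c)%C)%R -> U z = N A z) /\
  (forall U, sym2 Q (Row (j - 1)) U -> exists A, forall z, Defs.disc c rad z ->
     (ct tau (z - c)%C < 0)%R -> U z = N A z) /\
  (forall U, sym2 Q (Col i) U -> exists A, forall z, Defs.disc c rad z ->
     (0 < cs tau (z - c)%C)%R -> U z = N A z) /\
  (forall U, sym2 Q (Col (i - 1)) U -> exists A, forall z, Defs.disc c rad z ->
     (cs tau (z - c)%C < 0)%R -> U z = N A z) /\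
  (forall A A' s1 s2, (s1 * s1 = 1)%R -> (s2 * s2 = 1)%R ->
     (forall z, Defs.disc c rad z -> (0 < s1 * cs tau (z - c)%C)%R ->
        (0 < s2 * ct tau (z - c)%C)%R -> N A z = N A' z) -> A = A').
Proof.
  intros c. assert (Hr := rad_pos).
  assert (Hc : singular tau c) by (exists i, j; reflexivity).
  destruct (singular_class tau c Hc) as [k [m [n [Hk Ec]]]].
  assert (HO := slit_domain c Hc).
  destruct (ode_basis Q _ _ HO) as [v1 [dv1 [v2 [dv2 HB]]]].
  assert (HS := HB). destruct HS as [S1 [S2 W]].
  assert (L1 := S1). assert (L2 := S2). rewrite Ec in L1, L2.
  destruct (log_free_everywhere k m n v1 dv1 Hk L1) as [h1 [C1 [V1 D1]]].
  destruct (log_free_everywhere k m n v2 dv2 Hk L2) as [h2 [C2 [V2 D2]]].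
  rewrite <- Ec in C1, V1, D1, C2, V2, D2.
  (* the form A in v_i = h_i / sqrt (z - c): the two square roots multiply to z - c *)
  set (N := fun A z => QT A h1 h2 z * / (z - c)).
  set (g := fun A => QT A h1 h2 c).
  assert (Hcc : forall z, z <> c -> z - c <> 0) by (intros; apply Cminus_neq_0; auto).
  assert (NQ : forall A z, slit_disc c rad z -> N A z = QT A v1 v2 z).
  { intros A z Hz. unfold N, QT, QF. rewrite V1, V2 by auto.
    assert (E := Csqrt_square (z - c) (proj2 Hz)).
    assert (S0 := Csqrt_neq_0 (z - c) (proj2 Hz)). rewrite <- E at 1. field. auto. }
  assert (Ncont : forall A z, Defs.disc c rad z -> z <> c -> ccont (N A) z).
  { intros A z Hz Hne. unfold N, QT, QF. apply ccont_mult.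
    - repeat apply ccont_plus; apply ccont_mult; try apply ccont_const; apply ccont_mult; auto.
    - eapply Cder_ccont. apply (Cder_inv (fun z => z - c)); [|auto].
      apply Cder_minus; [apply Cder_id|apply Cder_const]. }
  assert (Uniq : forall A A' s1 s2, (s1 * s1 = 1)%R -> (s2 * s2 = 1)%R ->
     (forall z, Defs.disc c rad z -> (0 < s1 * cs tau (z - c)%C)%R ->
        (0 < s2 * ct tau (z - c)%C)%R -> N A z = N A' z) -> A = A').
  { intros [[a b] d] [[a' b'] d'] s1 s2 Hs1 Hs2 E.
    destruct (step_small rad Hr) as [e [He Hst]].
    assert (As1 : Rabs s1 = 1%R).
    { assert (X := Rabs_mult s1 s1). rewrite Hs1, Rabs_R1 in X. assert (Y := Rabs_pos s1). nra. }
    assert (As2 : Rabs s2 = 1%R).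
    { assert (X := Rabs_mult s2 s2). rewrite Hs2, Rabs_R1 in X. assert (Y := Rabs_pos s2). nra. }
    set (z1 := c + step (e * s1) (e * s2)).
    assert (Hz1 : forall t, (Rabs t < e)%R -> Defs.disc c rad (z1 + RtoC t) /\
      (0 < s1 * cs tau (z1 + RtoC t - c)%C)%R /\ (0 < s2 * ct tau (z1 + RtoC t - c)%C)%R /\
      slit_disc c rad (z1 + RtoC t)).
    { intros t Ht.
      assert (Es : z1 + RtoC t - c = step (e * s1 + t) (e * s2)).
      { unfold z1, step. rewrite RtoC_plus. ring. }
      destruct (step_coords (e * s1 + t) (e * s2)) as [X1 X2].
      assert (Dd : Defs.disc c rad (z1 + RtoC t)).
      { unfold Defs.disc. rewrite Es. apply Hst.
        - eapply Rle_trans; [apply Rabs_triang|]. rewrite Rabs_mult, As1, Rabs_pos_eq; lra.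
        - rewrite Rabs_mult, As2, Rabs_pos_eq; lra. }
      assert (Ht' : (Rabs (s1 * t) < e)%R) by (rewrite Rabs_mult, As1; lra).
      apply Rabs_lt_between in Ht'.
      rewrite Es, X1, X2. split; [auto|split; [nra|split; [nra|]]].
      split; auto. right. rewrite Es, Im_ct, X2.
      apply Rmult_integral_contrapositive; split; [|lra].
      intros K. assert (s2 * s2 = 0)%R by nra. lra. }
    assert (H0 := Hz1 0%R ltac:(rewrite Rabs_R0; auto)).
    replace (z1 + RtoC 0) with z1 in H0 by ring. destruct H0 as [_ [_ [_ Hsl]]].
    destruct (QF_zero Q _ (a - a') (b - b') (d - d') v1 dv1 v2 dv2 z1 e (proj1 HO) S1 S2 Hsl)
      as [X1 [X2 X3]]; auto.
    - rewrite W by auto. apply C1_nz.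
    - intros t Ht. destruct (Hz1 t Ht) as [Y1 [Y2 [Y3 Y4]]].
      specialize (E _ Y1 Y2 Y3). rewrite !NQ in E by auto. unfold QT in E. simpl in E.
      transitivity (QF a b d v1 v2 (z1 + RtoC t) - QF a' b' d' v1 v2 (z1 + RtoC t)).
      + unfold QF. ring.
      + rewrite E. ring.
    - assert (Z : forall x y : C, x - y = 0 -> x = y).
      { intros x y Hxy. replace x with (x - y + y) by ring. rewrite Hxy. ring. }
      rewrite (Z _ _ X1), (Z _ _ X2), (Z _ _ X3). auto. }
  assert (RepSlit : forall D' x1 U, convex D' -> D' x1 -> (forall z, D' z -> slit_disc c rad z) ->
    sym2 Q D' U -> exists A, forall z, D' z -> U z = N A z).
  { intros D' x1 U Hcv Hx1 Hsub HU.
    destruct (sym2_in_basis Q D' x1 v1 dv1 v2 dv2 U) as [a [b [d E]]]; auto.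
    - apply convex_star; auto.
    - apply (normal_basis_sub Q (slit_disc c rad)); auto.
    - exists (a, b, d). intros z Hz. rewrite NQ by auto. apply E; auto. }
  assert (Fct := ct_lin). assert (Fcs := cs_lin).
  assert (Fct' : forall a b x y, (- ct tau (RtoC a * x + RtoC b * y)%C = a * - ct tau x + b * - ct tau y)%R)
    by (intros; rewrite ct_lin; ring).
  assert (Fcs' : forall a b x y, (- cs tau (RtoC a * x + RtoC b * y)%C = a * - cs tau x + b * - cs tau y)%R)
    by (intros; rewrite cs_lin; ring).
  assert (Cct := half_disc_convex (ct tau) c Fct).
  assert (Ccs := half_disc_convex (cs tau) c Fcs).
  assert (Cct' := half_disc_convex (fun z => - ct tau z)%R c Fct').
  assert (Ccs' := half_disc_convex (fun z => - cs tau z)%R c Fcs').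
  destruct (step_small rad Hr) as [e [He Hst]].
  assert (Hpt : forall a b, (Rabs a <= 1)%R -> (Rabs b <= 1)%R ->
    Defs.disc c rad (c + step (e * a) (e * b)) /\
    c + step (e * a) (e * b) - c = step (e * a) (e * b)).
  { intros a b Ha Hb. assert (E : c + step (e * a) (e * b) - c = step (e * a) (e * b)) by ring.
    split; auto. unfold Defs.disc. rewrite E. apply Hst; rewrite Rabs_mult, (Rabs_pos_eq e) by lra; nra. }
  assert (R0 : Rabs 0 = 0%R) by apply Rabs_R0. assert (R1 : Rabs 1 = 1%R) by apply Rabs_R1.
  assert (Rm1 : Rabs (-1) = 1%R) by (rewrite Rabs_left; lra).
  exists k, m, n, N, g. repeat apply conj; auto.
  - intros A. unfold N, g.
    assert (DQ : Cder (QT A h1 h2) c (- (2) * Tcoef p k * QT A h1 h2 c)).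
    { unfold QT, QF. eapply Cder_eq.
      - repeat apply Cder_plus; apply Cder_scal; apply Cder_mult; eauto.
      - ring. }
    assert (Dx : Cder (fun x => QT A h1 h2 (x + c) - QT A h1 h2 c) 0 (- (2) * Tcoef p k * QT A h1 h2 c)).
    { eapply Cder_eq; [apply Cder_minus; [apply Cder_shift|apply Cder_const]|].
      - replace (0 + c) with c by ring. exact DQ.
      - ring. }
    assert (P := plim_quot _ _ Dx). cbv beta in P. replace (0 + c) with c in P by ring.
    specialize (P ltac:(ring)).
    assert (P2 : plim (fun z => (QT A h1 h2 (z + - c + c) - QT A h1 h2 c) * / (z + - c)) c
      (- (2) * Tcoef p k * QT A h1 h2 c)).
    { assert (P' : plim (fun x => (QT A h1 h2 (x + c) - QT A h1 h2 c) * / x) (c + - c)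
        (- (2) * Tcoef p k * QT A h1 h2 c)) by (replace (c + - c) with (RtoC 0) by ring; exact P).
      exact (plim_shift _ _ _ _ P'). }
    apply (plim_ext _ _ c _ 1 Rlt_0_1) with (2 := P2). intros z _. cbv beta.
    replace (z + - c + c) with z by ring. replace (z + - c) with (z - c) by ring. ring.
  - intros U HU. destruct (RepSlit _ (c + step (e * 0) (e * 1)) U Cct) as [A EA].
    + destruct (Hpt 0%R 1%R) as [X1 X2]; try lra. split; auto.
      rewrite X2, (proj2 (step_coords _ _)). lra.
    + intros z [X1 X2]. split; auto. right. rewrite Im_ct.
      apply Rmult_integral_contrapositive; split; lra.
    + apply (sym2_sub Q (Row j)); auto. intros z [X1 X2]. apply (disc_coords i j z X1); auto.
    + exists A. intros z X1 X2. apply EA. auto.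
  - intros U HU. destruct (RepSlit _ (c + step (e * 0) (e * -1)) U Cct') as [A EA].
    + destruct (Hpt 0%R (-1)%R) as [X1 X2]; try lra. split; auto.
      rewrite X2, (proj2 (step_coords _ _)). lra.
    + intros z [X1 X2]. split; auto. right. rewrite Im_ct.
      apply Rmult_integral_contrapositive; split; lra.
    + apply (sym2_sub Q (Row (j - 1))); auto. intros z [X1 X2].
      apply (disc_coords i j z X1); fold c; lra.
    + exists A. intros z X1 X2. apply EA. split; auto. lra.
  - intros U HU. destruct (RepSlit _ (c + step (e * 1) (e * 0)) U Ccs) as [A EA].
    + destruct (Hpt 1%R 0%R) as [X1 X2]; try lra. split; auto.
      rewrite X2, (proj1 (step_coords _ _)). lra.
    + intros z [X1 X2]. split; auto. unfold slit_plane.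
      destruct (Req_dec (Im (z - c)) 0) as [E|E]; [left|right; auto]. rewrite Re_cs; auto.
    + apply (sym2_sub Q (Col i)); auto. intros z [X1 X2]. apply (disc_coords i j z X1); auto.
    + exists A. intros z X1 X2. apply EA. auto.
  -
    (* this half-disc contains the slit: compare the two sides there *)
    intros U HU.
    set (L := fun z => Defs.disc c rad z /\ (0 < - cs tau (z - c)%C)%R).
    assert (HLcol : forall z, L z -> Col (i - 1) z).
    { intros z [X1 X2]. apply (disc_coords i j z X1); fold c; lra. }
    set (xL := c + step (e * -1) (e * 0)).
    assert (HxL : L xL).
    { destruct (Hpt (-1)%R 0%R) as [X1 X2]; try lra. split; auto. unfold xL.
      rewrite X2, (proj1 (step_coords _ _)). lra. }
    assert (HOc := Col_domain (i - 1) xL (HLcol _ HxL)).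
    destruct (ode_basis Q _ _ HOc) as [b1 [db1 [b2 [db2 Hb]]]].
    assert (HbS := Hb). destruct HbS as [T1 [T2 Wb]].
    destruct (sym2_in_basis Q _ xL _ _ _ _ U (proj1 (proj2 HOc)) Hb HU) as [a [b [d EU]]].
    assert (Quarter : forall s, (s * s = 1)%R -> let D' := fun z => L z /\ (0 < s * ct tau (z - c)%C)%R in
      convex D' /\ D' (c + step (e * -1) (e * s)) /\ (forall z, D' z -> slit_disc c rad z)).
    { intros s Hs D'.
      assert (As : Rabs s = 1%R).
      { assert (X := Rabs_mult s s). rewrite Hs, Rabs_R1 in X. assert (Y := Rabs_pos s). nra. }
      split; [|split].
      - intros x y t [X1 X2] [Y1 Y2] Ht. split; [apply Ccs'; auto|].
        replace (seg x y t - c) with (RtoC (1 - t) * (x - c) + RtoC t * (y - c))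
          by (unfold seg; rewrite RtoC_minus; ring).
        rewrite ct_lin. destruct (Req_dec t 0) as [->|Ht0]; [lra|].
        assert (0 < t * (s * ct tau (y - c)%C))%R by (apply Rmult_lt_0_compat; lra).
        assert (0 <= (1 - t) * (s * ct tau (x - c)%C))%R by (apply Rmult_le_pos; lra). lra.
      - destruct (Hpt (-1)%R s) as [X1 X2]; try lra. destruct (step_coords (e * -1) (e * s)) as [Z1 Z2].
        unfold D', L. rewrite X2, Z1, Z2. split; [split; [auto|lra]|nra].
      - intros z [[X1 X2] X3]. split; auto. right. rewrite Im_ct.
        apply Rmult_integral_contrapositive; split; [|lra]. intros K. rewrite K in X3. lra. }
    destruct (Quarter 1%R ltac:(ring)) as [Q1 [Q2 Q3]].
    destruct (Quarter (-1)%R ltac:(ring)) as [P1 [P2 P3]].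
    set (Dup := fun z => L z /\ (0 < 1 * ct tau (z - c)%C)%R) in *.
    set (Ddn := fun z => L z /\ (0 < -1 * ct tau (z - c)%C)%R) in *.
    destruct (RepSlit Dup _ U Q1 Q2 Q3) as [A EA].
    { apply (sym2_sub Q (Col (i - 1))); auto. intros z [X _]. auto. }
    assert (HbD : normal_basis Q Ddn b1 db1 b2 db2).
    { apply (normal_basis_sub Q (Col (i - 1))); auto. intros z [X _]. auto. }
    destruct (sym2_in_basis Q Ddn _ _ _ _ _ (N A) (convex_star _ _ P1 P2) HbD) as [a' [b' [d' EN]]].
    { exists v1, dv1, v2, dv2, (fst (fst A)), (snd (fst A)), (snd A).
      split; [apply (sol_sub Q (slit_disc c rad)); auto|].
      split; [apply (sol_sub Q (slit_disc c rad)); auto|]. intros z Hz. apply NQ. auto. }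
    assert (Slit : forall t, (0 < t < rad)%R -> let s := c + RtoC (- t) in L s /\ s <> c /\
      (forall d0, (0 < d0)%R -> exists z, (Cmod (z - s) < d0)%R /\ Dup z) /\
      (forall d0, (0 < d0)%R -> exists z, (Cmod (z - s) < d0)%R /\ Ddn z)).
    { intros t Ht s.
      assert (Es : s - c = step (- t) 0) by (unfold s, step; ring).
      assert (Ds : Cmod (s - c) = t).
      { replace (s - c) with (RtoC (- t)) by (unfold s; ring). rewrite Cmod_R, Rabs_Ropp, Rabs_pos_eq; lra. }
      assert (Near : forall d0 u, (0 < d0)%R -> (u * u = 1)%R -> exists z, (Cmod (z - s) < d0)%R /\
        L z /\ (0 < u * ct tau (z - c)%C)%R).
      { intros d0 u Hd0 Hu.
        destruct (step_small (Rmin d0 (rad - t))) as [e0 [He0 Hs0]]; [apply Rmin_pos; lra|].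
        assert (B1 := Rmin_l d0 (rad - t)). assert (B2 := Rmin_r d0 (rad - t)).
        assert (Au : Rabs u = 1%R).
        { assert (X := Rabs_mult u u). rewrite Hu, Rabs_R1 in X. assert (Y := Rabs_pos u). nra. }
        specialize (Hs0 0%R (e0 * u)%R ltac:(rewrite Rabs_R0; lra)
          ltac:(rewrite Rabs_mult, Au, Rabs_pos_eq; lra)).
        exists (s + step 0 (e0 * u)).
        replace (s + step 0 (e0 * u) - s) with (step 0 (e0 * u)) by ring.
        assert (Ez : s + step 0 (e0 * u) - c = step (- t) (e0 * u)).
        { replace (s + step 0 (e0 * u) - c) with (s - c + step 0 (e0 * u)) by ring.
          rewrite Es. unfold step. ring. }
        destruct (step_coords (- t) (e0 * u)) as [Z1 Z2].
        split; [lra|]. unfold L, Defs.disc. rewrite Ez, Z1, Z2. split; [split; [|lra]|nra].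
        rewrite <- Ez. replace (s + step 0 (e0 * u) - c) with ((s - c) + step 0 (e0 * u)) by ring.
        eapply Rle_lt_trans; [apply Cmod_triangle|]. lra. }
      split; [|split; [|split]].
      - unfold L, Defs.disc. rewrite Ds, Es, (proj1 (step_coords _ _)). lra.
      - intros K. rewrite K in Ds. replace (c - c) with (RtoC 0) in Ds by ring.
        rewrite Cmod_0 in Ds. lra.
      - intros d0 Hd0. destruct (Near d0 1%R Hd0 ltac:(ring)) as [z [X1 [X2 X3]]].
        exists z. split; auto. split; auto.
      - intros d0 Hd0. destruct (Near d0 (-1)%R Hd0 ltac:(ring)) as [z [X1 [X2 X3]]].
        exists z. split; auto. split; auto. }
    assert (QFc : forall x y w z, Col (i - 1) z -> ccont (QF x y w b1 b2) z).
    { intros x y w z Hz. eapply Cder_ccont. apply (QF_Cder Q (Col (i - 1)) x y w b1 db1 b2 db2); auto. }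
    assert (OnSlit : forall t, (0 < t < rad)%R -> let s := c + RtoC (- t) in
      QF a b d b1 b2 s = N A s /\ QF a' b' d' b1 b2 s = N A s).
    { intros t Ht s. destruct (Slit t Ht) as [X1 [X2 [X3 X4]]]. fold s in X1, X2, X3, X4.
      assert (Y1 := HLcol _ X1). split; apply ccont_eq_limit; auto.
      - apply Ncont; auto. apply X1.
      - intros d0 Hd0. destruct (X3 d0 Hd0) as [z [Z1 Z2]]. exists z. split; auto.
        rewrite <- EU by (apply HLcol, Z2). apply EA. auto.
      - apply Ncont; auto. apply X1.
      - intros d0 Hd0. destruct (X4 d0 Hd0) as [z [Z1 Z2]]. exists z. split; auto.
        rewrite EN by auto. auto. }
    set (s0 := c + RtoC (- (rad / 2))).
    destruct (Slit (rad / 2)%R ltac:(lra)) as [Ls0 _]. fold s0 in Ls0.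
    destruct (QF_zero Q _ (a - a') (b - b') (d - d') b1 db1 b2 db2 s0 (rad / 2) (Col_open (i - 1))
      T1 T2 (HLcol _ Ls0)) as [X1 [X2 X3]]; [rewrite Wb by auto; apply C1_nz|lra| |].
    { intros t Ht. apply Rabs_lt_between in Ht.
      destruct (OnSlit (rad / 2 - t)%R ltac:(lra)) as [Y1 Y2].
      replace (c + RtoC (- (rad / 2 - t))) with (s0 + RtoC t) in Y1, Y2
        by (unfold s0; rewrite !RtoC_opp, RtoC_minus; ring).
      transitivity (QF a b d b1 b2 (s0 + RtoC t) - QF a' b' d' b1 b2 (s0 + RtoC t)).
      - unfold QF. ring.
      - rewrite Y1, Y2. ring. }
    assert (Z : forall x y : C, x - y = 0 -> x = y).
    { intros x y Hxy. replace x with (x - y + y) by ring. rewrite Hxy. ring. }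
    apply Z in X1. apply Z in X2. apply Z in X3. subst a' b' d'.
    exists A. intros z Hz Hcs. assert (Lz : L z) by (split; [auto|lra]).
    destruct (Rtotal_order (ct tau (z - c)) 0) as [Hl|[He0|Hg]].
    + rewrite EU by auto. rewrite EN by (split; [auto|lra]). auto.
    + rewrite EU by auto.
      assert (Ez : z = c + RtoC (- (- cs tau (z - c)))).
      { assert (X := coords tau Htau (z - c)). rewrite He0 in X.
        rewrite Ropp_involutive. replace z with (z - c + c) at 1 by ring. rewrite X at 1. ring. }
      destruct (OnSlit (- cs tau (z - c))%R) as [Y1 _].
      { split; [lra|]. assert (X : Cmod (z - c) = (- cs tau (z - c))%R).
        { rewrite Ez at 1. replace (c + RtoC (- - cs tau (z - c)) - c) with
            (RtoC (- - cs tau (z - c))) by ring.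
          rewrite Ropp_involutive, Cmod_R, Rabs_left; lra. }
        rewrite <- X. apply Hz. }
      rewrite <- Ez in Y1. auto.
    + apply EA. split; [auto|lra].
Qed.

(** * The quadratic form as a single-valued function *)

(** Each quarter of the disc around a singular point is open and nonempty. *)
Lemma quadrant_point c s1 s2 : (s1 * s1 = 1)%R -> (s2 * s2 = 1)%R -> exists z1 r, (0 < r)%R /\
  forall w, (Cmod (w - z1) < r)%R -> Defs.disc c rad w /\
    (0 < s1 * cs tau (w - c)%C)%R /\ (0 < s2 * ct tau (w - c)%C)%R.
Proof.
  intros H1 H2. assert (Hr := rad_pos). assert (K1 := Kt_ge_1 tau Htau).
  assert (As : forall s, (s * s = 1)%R -> Rabs s = 1%R).
  { intros s Hs. assert (X := Rabs_mult s s). rewrite Hs, Rabs_R1 in X.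
    assert (Y := Rabs_pos s). nra. }
  destruct (step_small (rad / 2) ltac:(lra)) as [e [He Hst]].
  set (z1 := c + step (e * s1) (e * s2)).
  assert (E1 : z1 - c = step (e * s1) (e * s2)) by (unfold z1; ring).
  destruct (step_coords (e * s1) (e * s2)) as [X1 X2].
  assert (Hek : (0 < e / Kt tau)%R) by (apply Rdiv_lt_0_compat; lra).
  exists z1, (Rmin (rad / 2) (e / Kt tau)). split; [apply Rmin_pos; lra|].
  intros w Hw. assert (B1 := Rmin_l (rad / 2) (e / Kt tau)).
  assert (B2 := Rmin_r (rad / 2) (e / Kt tau)).
  assert (Hk : (Kt tau * Cmod (w - z1) < e)%R).
  { assert (X : (Cmod (w - z1) < e / Kt tau)%R) by lra.
    apply (Rmult_lt_compat_l (Kt tau)) in X; [|lra].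
    replace (Kt tau * (e / Kt tau))%R with e in X by (field; lra). auto. }
  assert (Small : forall f x s, (s * s = 1)%R -> (Rabs (f (w - z1)%C) <= Kt tau * Cmod (w - z1)%C)%R ->
    f (w - c)%C = (e * s + f (w - z1)%C)%R -> x = (s * f (w - c)%C)%R -> (0 < x)%R).
  { intros f x s Hs Hf E ->. rewrite E.
    assert (X : (Rabs (s * f (w - z1)%C) < e)%R) by (rewrite Rabs_mult, As by auto; lra).
    apply Rabs_lt_between in X. nra. }
  assert (Ew : w - c = (w - z1) - (c - z1)) by ring.
  assert (Ec : c - z1 = step (- (e * s1)) (- (e * s2))).
  { replace (c - z1) with (- (z1 - c)) by ring. rewrite E1. unfold step. rewrite !RtoC_opp. ring. }
  destruct (step_coords (- (e * s1)) (- (e * s2))) as [Y1 Y2].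
  split; [|split].
  - unfold Defs.disc. assert (X := Cmod_chain w z1 c). rewrite E1 in X.
    assert (Z : (Cmod (step (e * s1) (e * s2)) < rad / 2)%R).
    { apply Hst; rewrite Rabs_mult; [rewrite (As s1 H1)|rewrite (As s2 H2)];
        rewrite Rabs_pos_eq; lra. }
    lra.
  - apply (Small (cs tau) _ s1 H1); auto; [apply cs_bound; auto|].
    rewrite Ew at 1. rewrite cs_minus, Ec, Y1. ring.
  - apply (Small (ct tau) _ s2 H2); auto; [apply ct_bound; auto|].
    rewrite Ew at 1. rewrite ct_minus, Ec, Y2. ring.
Qed.

Lemma cell_domain i j z : Col i z -> Row j z -> ode_domain Q (fun z => Col i z /\ Row j z) z.
Proof.
  intros Hi Hj. split; [|split; [|split; auto]].
  - apply open_and'; [apply Col_open|apply Row_open].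
  - apply convex_star; auto. apply convex_and; [apply Col_convex|apply Row_convex].
  - intros w [Hw _]. apply q_locC1; auto. apply (Col_ns i); auto.
Qed.

Lemma Zind2 (P : Z -> Prop) (i0 : Z) : P i0 -> (forall i, P i -> P (i + 1)%Z) ->
  (forall i, P i -> P (i - 1)%Z) -> forall i, P i.
Proof.
  intros H0 Hu Hd i. replace i with (i0 + (i - i0))%Z by lia.
  induction (i - i0)%Z using Z.peano_ind.
  - rewrite Z.add_0_r. auto.
  - replace (i0 + Z.succ z)%Z with (i0 + z + 1)%Z by lia. auto.
  - replace (i0 + Z.pred z)%Z with (i0 + z - 1)%Z by lia. auto.
Qed.

Definition agree (U W : Z -> C -> C) (i j : Z) : Prop :=
  forall z, Col i z -> Row j z -> U j z = W i z.

(** Each of the four strips at c carries a triple of coefficients, and agreement on a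
    cell is equality of two triples, by uniqueness on a quarter of the disc. This turns the gluing
    condition into an equation between constants. *)
Lemma corner_cells (U W : Z -> C -> C) (i j : Z) :
  (forall j, sym2 Q (Row j) (U j)) -> (forall i, sym2 Q (Col i) (W i)) ->
  let c := lattice_point tau i j / 2 in
  exists (k : nat) (m n : Z) (N : C * C * C -> C -> C) (g : C * C * C -> C)
    (Au Ad Ar Al : C * C * C), (k <= 3)%nat /\
  c = omega tau k / 2 + lattice_point tau m n /\
  (forall A, plim (fun z => N A z - g A * / (z - c)) c (- (2) * Tcoef p k * g A)) /\
  (forall z, Defs.disc c rad z -> (0 < ct tau (z - c)%C)%R -> U j z = N Au z) /\
  (forall z, Defs.disc c rad z -> (ct tau (z - c)%C < 0)%R -> U (j - 1)%Z z = N Ad z) /\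
  (forall z, Defs.disc c rad z -> (0 < cs tau (z - c)%C)%R -> W i z = N Ar z) /\
  (forall z, Defs.disc c rad z -> (cs tau (z - c)%C < 0)%R -> W (i - 1)%Z z = N Al z) /\
  (agree U W i j <-> Au = Ar) /\ (agree U W (i - 1) j <-> Au = Al) /\
  (agree U W i (j - 1) <-> Ad = Ar) /\ (agree U W (i - 1) (j - 1) <-> Ad = Al).
Proof.
  intros HU HW c.
  destruct (corner i j) as [k [m [n [N [g [Hk [Ec [HN [Fu [Fd [Fr [Fl Uniq]]]]]]]]]]]].
  fold c in Ec, HN, Fu, Fd, Fr, Fl, Uniq.
  destruct (Fu _ (HU j)) as [Au Eu]. destruct (Fd _ (HU (j - 1)%Z)) as [Ad Ed].
  destruct (Fr _ (HW i)) as [Ar Er]. destruct (Fl _ (HW (i - 1)%Z)) as [Al El].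
  assert (Key : forall i' j' s1 s2 A A', (s1 * s1 = 1)%R -> (s2 * s2 = 1)%R ->
    (forall z, Defs.disc c rad z -> (0 < s1 * cs tau (z - c)%C)%R -> Col i' z /\ W i' z = N A' z) ->
    (forall z, Defs.disc c rad z -> (0 < s2 * ct tau (z - c)%C)%R -> Row j' z /\ U j' z = N A z) ->
    (agree U W i' j' <-> A = A')).
  { intros i' j' s1 s2 A A' H1 H2 HA' HA. split.
    - intros Ha. apply (Uniq A A' s1 s2 H1 H2). intros z Hz X1 X2.
      destruct (HA' z Hz X1) as [Y1 Y2]. destruct (HA z Hz X2) as [Y3 Y4].
      rewrite <- Y2, <- Y4. apply Ha; auto.
    - intros <- z Hi Hj.
      destruct (quadrant_point c s1 s2 H1 H2) as [z1 [r [Hr Hq]]].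
      assert (Hz1 : Col i' z1 /\ Row j' z1).
      { destruct (Hq z1) as [X1 [X2 X3]].
        - replace (z1 - z1) with (RtoC 0) by ring. rewrite Cmod_0. auto.
        - split; [apply (HA' z1 X1 X2)|apply (HA z1 X1 X3)]. }
      apply (sym2_unique_near _ z z1 r (U j') (W i') (cell_domain i' j' z Hi Hj)); auto.
      + apply (sym2_sub Q (Row j')); auto. intros w [_ X]; auto.
      + apply (sym2_sub Q (Col i')); auto. intros w [X _]; auto.
      + intros w _ Hw. destruct (Hq w Hw) as [X1 [X2 X3]].
        rewrite (proj2 (HA' w X1 X2)), (proj2 (HA w X1 X3)). auto. }
  assert (DC := disc_coords i j). fold c in DC. cbv zeta in DC. fold c in DC.
  exists k, m, n, N, g, Au, Ad, Ar, Al.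
  split; [auto|split; [auto|split; [auto|split; [auto|split; [auto|split; [auto|split; [auto|]]]]]]].
  split; [|split; [|split]].
  - apply (Key i j 1%R 1%R); try ring; intros z Hz X;
      (split; [apply (DC z Hz); lra|]); [apply Er|apply Eu]; auto; lra.
  - apply (Key (i - 1)%Z j (-1)%R 1%R); try ring; intros z Hz X;
      (split; [apply (DC z Hz); lra|]); [apply El|apply Eu]; auto; lra.
  - apply (Key i (j - 1)%Z 1%R (-1)%R); try ring; intros z Hz X;
      (split; [apply (DC z Hz); lra|]); [apply Er|apply Ed]; auto; lra.
  - apply (Key (i - 1)%Z (j - 1)%Z (-1)%R (-1)%R); try ring; intros z Hz X;
      (split; [apply (DC z Hz); lra|]); [apply El|apply Ed]; auto; lra.
Qed.

(** Equality of triples is transitive, so agreement on three of the cells at a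
    corner implies agreement on the fourth; then induct over rows and columns. *)
Lemma agree_everywhere (U W : Z -> C -> C) (i0 j0 : Z) :
  (forall j, sym2 Q (Row j) (U j)) -> (forall i, sym2 Q (Col i) (W i)) ->
  (forall j, agree U W i0 j) -> (forall i, agree U W i j0) -> forall i j, agree U W i j.
Proof.
  intros HU HW H1 H2.
  assert (F : forall i j, exists Au Ad Ar Al : C * C * C,
    (agree U W i j <-> Au = Ar) /\ (agree U W (i - 1) j <-> Au = Al) /\
    (agree U W i (j - 1) <-> Ad = Ar) /\ (agree U W (i - 1) (j - 1) <-> Ad = Al)).
  { intros i j. destruct (corner_cells U W i j HU HW) as
      [k [m [n [N [g [Au [Ad [Ar [Al [_ [_ [_ [_ [_ [_ [_ H]]]]]]]]]]]]]]]].
    exists Au, Ad, Ar, Al. auto. }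
  assert (G1 : forall i j, agree U W i j -> agree U W i (j + 1) -> agree U W (i + 1) j ->
    agree U W (i + 1) (j + 1)).
  { intros i j. destruct (F (i + 1)%Z (j + 1)%Z) as [Au [Ad [Ar [Al [E1 [E2 [E3 E4]]]]]]].
    replace (i + 1 - 1)%Z with i in * by lia. replace (j + 1 - 1)%Z with j in * by lia.
    rewrite E1, E2, E3, E4. intros; congruence. }
  assert (G2 : forall i j, agree U W i j -> agree U W i (j + 1) -> agree U W (i - 1) j ->
    agree U W (i - 1) (j + 1)).
  { intros i j. destruct (F i (j + 1)%Z) as [Au [Ad [Ar [Al [E1 [E2 [E3 E4]]]]]]].
    replace (j + 1 - 1)%Z with j in * by lia.
    rewrite E1, E2, E3, E4. intros; congruence. }
  assert (G3 : forall i j, agree U W i j -> agree U W i (j - 1) -> agree U W (i + 1) j ->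
    agree U W (i + 1) (j - 1)).
  { intros i j. destruct (F (i + 1)%Z j) as [Au [Ad [Ar [Al [E1 [E2 [E3 E4]]]]]]].
    replace (i + 1 - 1)%Z with i in * by lia.
    rewrite E1, E2, E3, E4. intros; congruence. }
  assert (G4 : forall i j, agree U W i j -> agree U W i (j - 1) -> agree U W (i - 1) j ->
    agree U W (i - 1) (j - 1)).
  { intros i j. destruct (F i j) as [Au [Ad [Ar [Al [E1 [E2 [E3 E4]]]]]]].
    rewrite E1, E2, E3, E4. intros; congruence. }
  intros i j. revert i.
  apply (Zind2 (fun j => forall i, agree U W i j) j0); auto.
  - intros j' Hj'. apply (Zind2 (fun i => agree U W i (j' + 1)) i0); auto.
  - intros j' Hj'. apply (Zind2 (fun i => agree U W i (j' - 1)) i0); auto.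
Qed.

Lemma star_cell i j : star (centre i j) (fun z => Col i z /\ Row j z).
Proof.
  apply convex_star; [|apply centre_cell].
  apply convex_and; [apply Col_convex|apply Row_convex].
Qed.

(** Extend to all columns across the given row, then to all rows along one column;
    [agree_everywhere] makes the extensions compatible. At a singular point all four
    triples of coefficients coincide, and [corner] gives the limit there. *)
Theorem sym2_globalize (j0 : Z) (V0 : C -> C) : sym2 Q (Row j0) V0 ->
  exists Y, global_sym2 Y /\ (forall z, Row j0 z -> Y z = V0 z) /\
  forall k, (k <= 3)%nat -> exists g,
    plim (fun z => Y z - g * / (z - omega tau k / 2)) (omega tau k / 2) (- (2) * Tcoef p k * g).
Proof.
  intros HV0.
  destruct (choice (fun i W => sym2 Q (Col i) W /\ forall z, Col i z -> Row j0 z -> W z = V0 z))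
    as [W HW].
  { intros i. apply (sym2_extend Q (Col i) (Row j0) (centre i j0) (centre i j0)); auto.
    - apply Col_domain, centre_cell.
    - apply star_cell. }
  destruct (choice (fun j U => sym2 Q (Row j) U /\ forall z, Row j z -> Col 0 z -> U z = W 0%Z z))
    as [U' HU'].
  { intros j. apply (sym2_extend Q (Row j) (Col 0) (centre 0 j) (centre 0 j)); auto.
    - apply Row_domain, centre_cell.
    - apply (convex_star (fun z => Row j z /\ Col 0 z)).
      + apply convex_and; [apply Row_convex|apply Col_convex].
      + split; apply centre_cell.
    - apply HW. }
  (* V0 itself is kept on its own row, where U' is an extension of an extension *)
  set (U := fun j => if Z.eq_dec j j0 then V0 else U' j).
  assert (SU : forall j, sym2 Q (Row j) (U j)).
  { intros j. unfold U. destruct (Z.eq_dec j j0) as [->|_]; [auto|apply HU']. }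
  assert (SW : forall i, sym2 Q (Col i) (W i)) by apply HW.
  assert (AG : forall i j, agree U W i j).
  { apply (agree_everywhere U W 0%Z j0 SU SW).
    - intros j z Hi Hj. unfold U. destruct (Z.eq_dec j j0) as [->|_].
      + symmetry. apply HW; auto.
      + apply HU'; auto.
    - intros i z Hi Hj. unfold U. destruct (Z.eq_dec j0 j0) as [_|K]; [|congruence].
      symmetry. apply HW; auto. }
  set (jz := fun z => Int_part (2 * ct tau z)). set (iz := fun z => Int_part (2 * cs tau z)).
  assert (Jz : forall j z, Row j z -> jz z = j).
  { intros j z Hz. unfold Row in Hz. unfold jz. symmetry. apply Int_part_spec. lra. }
  assert (Iz : forall i z, Col i z -> iz z = i).
  { intros j z Hz. unfold Col in Hz. unfold iz. symmetry. apply Int_part_spec. lra. }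
  (* points on the boundary of a row are covered by a column *)
  set (Y := fun z => if excluded_middle_informative (Row (jz z) z) then U (jz z) z else W (iz z) z).
  assert (YU : forall j z, Row j z -> Y z = U j z).
  { intros j z Hz. unfold Y. rewrite (Jz j z Hz).
    destruct (excluded_middle_informative (Row j z)) as [_|K]; [auto|contradiction]. }
  assert (YW : forall i z, Col i z -> Y z = W i z).
  { intros i z Hz. unfold Y. destruct (excluded_middle_informative (Row (jz z) z)) as [K|K].
    - apply AG; auto.
    - rewrite (Iz i z Hz). auto. }
  exists Y. split; [|split].
  - split; intros k.
    + apply (sym2_ext_eq Q (Row k) (U k)); auto. intros z Hz. symmetry. auto.
    + apply (sym2_ext_eq Q (Col k) (W k)); auto. intros z Hz. symmetry. auto.
  - intros z Hz. rewrite (YU j0 z Hz). unfold U.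
    destruct (Z.eq_dec j0 j0) as [_|K]; [auto|congruence].
  - intros k Hk. destruct (omega_singular tau k) as [i [j Eij]].
    destruct (corner_cells U W i j SU SW) as [k' [m [n [N [g [Au [Ad [Ar [Al
      [Hk' [Ec [HN [Fu [Fd [Fr [Fl [A1 [A2 [A3 A4]]]]]]]]]]]]]]]]]]].
    rewrite <- Eij in Ec, HN, Fu, Fd, Fr, Fl.
    set (c := omega tau k / 2) in *.

    assert (E1 := proj1 A1 (AG i j)). assert (E2 := proj1 A2 (AG (i - 1)%Z j)).
    assert (E3 := proj1 A3 (AG i (j - 1)%Z)). subst Ar Al Ad.
    assert (Ek : k' = k).
    { destruct (Nat.eq_dec k' k) as [|K]; auto. exfalso.
      apply (omega_diff tau Htau k' k Hk' Hk K). fold c.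
      exists m, n. rewrite Ec. ring. }
    subst k'. exists (g Au).
    apply (plim_ext (fun z => N Au z - g Au * / (z - c)) _ c _ rad rad_pos); [|apply HN].
    intros z Hz. f_equal. symmetry.
    assert (Hd : Defs.disc c rad z) by apply Hz.
    destruct (disc_coords i j z) as [X1 [X2 [X3 X4]]]; [rewrite <- Eij; exact Hd|].
    rewrite <- Eij in X1, X2, X3, X4. fold c in X1, X2, X3, X4.
    destruct (Rtotal_order (ct tau (z - c)) 0) as [K|[K|K]].
    + rewrite (YU _ z (X4 K)). auto.
    + destruct (Rtotal_order (cs tau (z - c)) 0) as [L|[L|L]].
      * rewrite (YW _ z (X2 L)). auto.
      * exfalso. assert (X := coords tau Htau (z - c)). rewrite K, L in X.
        assert (X' : z - c = 0) by (rewrite X; ring). rewrite X', Cmod_0 in Hz. lra.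
      * rewrite (YW _ z (X1 L)). auto.
    + rewrite (YU _ z (X3 K)). auto.
Qed.

End Gluing.

(** * Solutions with scalar monodromy *)

(** Matrix entries, with a default value that is never reached. *)
Definition entry (M : @matrix C 2 2) (i j : nat) : C := coeff_mat (RtoC 0) M i j.

Lemma Mmult_col2 (M : @matrix C 2 2) a b a' b' :
  col2 a b = Mmult M (col2 a' b') ->
  a = entry M 0 0 * a' + entry M 0 1 * b' /\ b = entry M 1 0 * a' + entry M 1 1 * b'.
Proof.
  intros H.
  assert (X := f_equal (fun A => coeff_mat (RtoC 0) A 0 0) H).
  assert (Y := f_equal (fun A => coeff_mat (RtoC 0) A 1 0) H).
  unfold entry, Mmult, mk_matrix, col2, coeff_mat in *. simpl in *.
  rewrite sum_Sn, sum_O in X, Y. split; assumption.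
Qed.

Lemma mat2_scalar (M : @matrix C 2 2) e : entry M 0 0 = e -> entry M 0 1 = 0 ->
  entry M 1 0 = 0 -> entry M 1 1 = e -> M = scalar_mat2 e.
Proof.
  intros H1 H2 H3 H4.
  rewrite <- (mk_matrix_bij (RtoC 0) M). unfold scalar_mat2.
  apply mk_matrix_ext. intros i j Hi Hj.
  destruct i as [|[|i]]; [| |exfalso; lia]; (destruct j as [|[|j]]; [| |exfalso; lia]); assumption.
Qed.

Lemma scalar_entry e i j : (i < 2)%nat -> (j < 2)%nat ->
  entry (scalar_mat2 e) i j = if Nat.eqb i j then e else RtoC 0.
Proof. intros Hi Hj. unfold entry, scalar_mat2. rewrite coeff_mat_bij by auto. auto. Qed.

Lemma line_0 z0 w : line z0 w 0 = z0.
Proof. unfold line. ring. Qed.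

Lemma line_seg z0 w t : seg z0 (z0 + w) t = line z0 w t.
Proof. unfold seg, line. ring. Qed.

Section Basis.
Variable tau : C.
Hypothesis Htau : (0 < Im tau)%R.
Variable p : params.
Variable z0 : C.
Hypothesis Hz0 : regular_base_point tau z0.
Variables y1 y2 : C -> C.
Hypothesis HB : local_basis tau p z0 y1 y2.

Let ns (z : C) : Prop := ~ singular tau z.
Let Q : C -> C := q tau p.

Lemma base_ns : ns z0.
Proof. rewrite <- (line_0 z0 1). apply (proj1 (Hz0 0%R)). Qed.

(** If the Wronskian vanished at z0, a nontrivial combination would have zero initial
    values at z0, hence vanish near z0. *)
Lemma basis_disc : exists r dy1 dy2, (0 < r)%R /\
  ode_domain Q (fun z => (Cmod (z - z0) < r)%R) z0 /\
  sol Q (fun z => (Cmod (z - z0) < r)%R) y1 dy1 /\ sol Q (fun z => (Cmod (z - z0) < r)%R) y2 dy2 /\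
  wr y1 dy1 y2 dy2 z0 <> 0.
Proof.
  destruct HB as [[D [HD [D0 [S1 S2]]]] Hind].
  apply sol_solution_on in S1. apply sol_solution_on in S2.
  destruct S1 as [dy1 S1]. destruct S2 as [dy2 S2].
  destruct (proj1 (open_C_iff D) HD z0 D0) as [r1 [Hr1 H1]].
  destruct (ns_disc tau Htau z0 base_ns) as [r2 [Hr2 H2]].
  assert (B1 := Rmin_l r1 r2). assert (B2 := Rmin_r r1 r2).
  set (r := Rmin r1 r2) in *. assert (Hr : (0 < r)%R) by (apply Rmin_pos; auto).
  assert (HO : ode_domain Q (fun z => (Cmod (z - z0) < r)%R) z0).
  { apply disc_domain; auto. intros z Hz. apply q_locC1; auto. apply H2. lra. }
  assert (S1' : sol Q (fun z => (Cmod (z - z0) < r)%R) y1 dy1).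
  { apply (sol_sub Q D); auto. intros z Hz. apply H1. lra. }
  assert (S2' : sol Q (fun z => (Cmod (z - z0) < r)%R) y2 dy2).
  { apply (sol_sub Q D); auto. intros z Hz. apply H1. lra. }
  exists r, dy1, dy2. split; [auto|split; [auto|split; [auto|split; [auto|]]]].
  intros W. unfold wr in W.
  assert (Key : forall a b, a * y1 z0 + b * y2 z0 = 0 -> a * dy1 z0 + b * dy2 z0 = 0 ->
    a = 0 /\ b = 0).
  { intros a b E1 E2. apply Hind. apply locally_C_iff. exists r. split; auto.
    apply (sol_zero Q _ z0 z0 (fun z => a * y1 z + b * y2 z) (fun z => a * dy1 z + b * dy2 z) HO);
      auto.
    - apply sol_lin; auto.
    - apply HO. }
  destruct (Key (dy2 z0) (- dy1 z0)) as [X1 X2].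
  { rewrite <- W. ring. } { ring. }
  destruct (Key (y2 z0) (- y1 z0)) as [X3 X4].
  { ring. } { rewrite X1. assert (X : dy1 z0 = 0) by (replace (dy1 z0) with (- - dy1 z0) by ring;
    rewrite X2; ring). rewrite X. ring. }
  destruct (Key 1 0) as [X5 _].
  - assert (X : y1 z0 = 0) by (replace (y1 z0) with (- - y1 z0) by ring; rewrite X4; ring).
    rewrite X. ring.
  - assert (X : dy1 z0 = 0) by (replace (dy1 z0) with (- - dy1 z0) by ring; rewrite X2; ring).
    rewrite X. ring.
  - apply C1_nz. auto.
Qed.

(** A single-valued function that is a quadratic form in the basis near z0 is one in
   the continued basis along the whole line. *)
Lemma line_propagate (S D : C -> Prop) (w : C) (a b c : C) (u1 u2 Y : C -> C) :
  open S -> (forall z, S z -> locC1 Q z) -> sym2 Q S Y -> (forall t, S (line z0 w t)) ->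
  open D -> (forall t, D (line z0 w t)) -> solution_on tau p D u1 -> solution_on tau p D u2 ->
  (exists r, (0 < r)%R /\ forall z, (Cmod (z - z0) < r)%R -> Y z = QF a b c u1 u2 z) ->
  exists r, (0 < r)%R /\ forall z, (Cmod (z - (z0 + w)) < r)%R -> Y z = QF a b c u1 u2 z.
Proof.
  intros HS HQ HY HlS HD HlD S1 S2 H0.
  apply sol_solution_on in S1. apply sol_solution_on in S2.
  destruct S1 as [du1 S1]. destruct S2 as [du2 S2].
  apply (seg_propagate (fun x => exists r, (0 < r)%R /\
    forall z, (Cmod (z - x) < r)%R -> Y z = QF a b c u1 u2 z) z0 (z0 + w)); auto.
  intros t _. rewrite line_seg.
  destruct (proj1 (open_C_iff D) HD _ (HlD t)) as [r1 [Hr1 H1]].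
  destruct (proj1 (open_C_iff S) HS _ (HlS t)) as [r2 [Hr2 H2]].
  assert (B1 := Rmin_l r1 r2). assert (B2 := Rmin_r r1 r2).
  set (r := Rmin r1 r2) in *. assert (Hr : (0 < r)%R) by (apply Rmin_pos; auto).
  exists r. split; auto. intros [s [Hs [Hsr [d [Hd E]]]]].
  set (x := line z0 w t) in *.
  assert (HO : ode_domain Q (fun z => (Cmod (z - x) < r)%R) x).
  { apply disc_domain; auto. intros z Hz. apply HQ, H2. lra. }
  assert (All : forall z, (Cmod (z - x) < r)%R -> Y z = QF a b c u1 u2 z).
  { apply (sym2_unique_near tau p _ x (seg z0 (z0 + w) s) d _ _ HO); auto.
    - apply (sym2_sub Q S); auto. intros z Hz. apply H2. lra.
    - exists u1, du1, u2, du2, a, b, c. split; [|split]; auto; apply (sol_sub Q D); auto;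
        intros z Hz; apply H1; lra. }
  intros s' Hs' Hsr'. exists (r - Cmod (seg z0 (z0 + w) s' - x))%R. split; [lra|].
  intros z Hz. apply All. assert (X := Cmod_chain z (seg z0 (z0 + w) s') x). lra.
Qed.

(** The continued solutions are multiplied by e after the translation, hence
    their products by e * e = 1. *)
Lemma line_periodic (S : C -> Prop) (w e : C) (a b c : C) (Y : C -> C) :
  e * e = 1 -> is_monodromy tau p z0 w y1 y2 (scalar_mat2 e) ->
  open S -> (forall z, S z -> locC1 Q z) -> sym2 Q S Y -> (forall t, S (line z0 w t)) ->
  (exists r, (0 < r)%R /\ forall z, (Cmod (z - z0) < r)%R -> Y z = QF a b c y1 y2 z) ->
  exists r, (0 < r)%R /\ forall z, (Cmod (z - z0) < r)%R -> Y (z + w) = Y z.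
Proof.
  intros He [D [u1 [u2 [HD [HlD [S1 [S2 [Hloc HM]]]]]]]] HS HQ HY HlS [r1 [Hr1 E1]].
  apply locally_C_iff in Hloc. destruct Hloc as [r2 [Hr2 E2]].
  specialize (HM 0%R). rewrite line_0 in HM. apply locally_C_iff in HM.
  destruct HM as [r3 [Hr3 E3]].
  destruct (line_propagate S D w a b c u1 u2 Y) as [r4 [Hr4 E4]]; auto.
  { exists (Rmin r1 r2). split; [apply Rmin_pos; auto|]. intros z Hz.
    assert (B1 := Rmin_l r1 r2). assert (B2 := Rmin_r r1 r2).
    rewrite E1 by lra. destruct (E2 z) as [X1 X2]; [lra|]. unfold QF. rewrite X1, X2. auto. }
  set (m := Rmin (Rmin r1 r2) (Rmin r3 r4)).
  assert (C1 := Rmin_l r1 r2). assert (C2 := Rmin_r r1 r2).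
  assert (C3 := Rmin_l r3 r4). assert (C4 := Rmin_r r3 r4).
  assert (C5 := Rmin_l (Rmin r1 r2) (Rmin r3 r4)). assert (C6 := Rmin_r (Rmin r1 r2) (Rmin r3 r4)).
  exists m. split; [repeat apply Rmin_pos; auto|]. intros z Hz. unfold m in Hz.
  rewrite E4 by (replace (z + w - (z0 + w)) with (z - z0) by ring; lra).
  rewrite E1 by lra.
  destruct (E2 z) as [X1 X2]; [lra|].
  destruct (Mmult_col2 _ _ _ _ _ (E3 z ltac:(lra))) as [Z1 Z2].
  rewrite !scalar_entry in Z1, Z2 by lia. simpl in Z1, Z2.
  unfold QF. rewrite Z1, Z2, X1, X2.
  transitivity ((e * e) * (a * (y1 z * y1 z) + b * (y1 z * y2 z) + c * (y2 z * y2 z))); [ring|].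
  rewrite He. ring.
Qed.

(** An elliptic function that continues the quadratic form with coefficients a, b, c in the basis,
    together with its residues g_k at omega_k / 2 and the constant terms there. *)
Definition form (a b c : C) (Y : C -> C) (g : nat -> C) : Prop :=
  (forall z, ns z -> locC1 Y z) /\ (forall z, ns z -> Y (z + 1) = Y z) /\
  (forall z, ns z -> Y (z + tau) = Y z) /\
  (forall k, (k <= 3)%nat ->
    plim (fun z => Y z - g k * / (z - omega tau k / 2)) (omega tau k / 2) (- (2) * Tcoef p k * g k)) /\
  exists r, (0 < r)%R /\ forall z, (Cmod (z - z0) < r)%R -> Y z = QF a b c y1 y2 z.

Lemma form_lin s s' a b c Y g a' b' c' Y' g' : form a b c Y g -> form a' b' c' Y' g' ->
  form (s * a + s' * a') (s * b + s' * b') (s * c + s' * c')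
    (fun z => s * Y z + s' * Y' z) (fun k => s * g k + s' * g' k).
Proof.
  intros [H1 [H2 [H3 [H4 [r [Hr H5]]]]]] [K1 [K2 [K3 [K4 [r' [Hr' K5]]]]]].
  split; [|split; [|split; [|split]]].
  - intros z Hz. apply locC1_plus; apply locC1_scal; auto.
  - intros z Hz. rewrite H2, K2; auto.
  - intros z Hz. rewrite H3, K3; auto.
  - intros k Hk.
    assert (X := plim_plus _ _ _ _ _ (plim_scal s _ _ _ (H4 k Hk)) (plim_scal s' _ _ _ (K4 k Hk))).
    apply (plim_ext _ (fun z => s * Y z + s' * Y' z -
      (s * g k + s' * g' k) * / (z - omega tau k / 2)) _ _ 1 Rlt_0_1) in X.
    + eapply plim_eq; [exact X|ring].
    + intros z _. ring.
  - exists (Rmin r r'). split; [apply Rmin_pos; auto|]. intros z Hz.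
    assert (B1 := Rmin_l r r'). assert (B2 := Rmin_r r r').
    rewrite H5, K5 by lra. unfold QF. ring.
Qed.

Hypothesis HAP : AP tau p.

(** The line z0 + R stays in one row and z0 + tau R in one column, so that the globalized
    form is periodic in both directions by [line_periodic] and unique continuation. *)
Lemma form_exists (e1 e2 a b c : C) : e1 * e1 = 1 -> e2 * e2 = 1 ->
  is_monodromy tau p z0 1 y1 y2 (scalar_mat2 e1) ->
  is_monodromy tau p z0 tau y1 y2 (scalar_mat2 e2) -> exists Y g, form a b c Y g.
Proof.
  intros He1 He2 HM1 HM2.
  destruct basis_disc as [r [dy1 [dy2 [Hr [HO [S1 [S2 W]]]]]]].
  assert (Coord : forall t, ct tau (line z0 1 t) = ct tau z0 /\ cs tau (line z0 tau t) = cs tau z0 /\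
    cs tau (line z0 1 t) = (cs tau z0 + t)%R /\ ct tau (line z0 tau t) = (ct tau z0 + t)%R).
  { intros t.
    assert (F1 : line z0 1 t = z0 + (RtoC t + RtoC 0 * tau)) by (unfold line; ring).
    assert (F2 : line z0 tau t = z0 + (RtoC 0 + RtoC t * tau)) by (unfold line; ring).
    rewrite F1, F2, !(ct_plus tau Htau z0), !(cs_plus tau Htau z0), !cs_coords, !ct_coords by auto.
    repeat split; ring. }
  set (j0 := Int_part (2 * ct tau z0)). set (i0 := Int_part (2 * cs tau z0)).
  destruct (base_Int_part (2 * ct tau z0)) as [A1 A2].
  destruct (base_Int_part (2 * cs tau z0)) as [A3 A4].
  fold j0 in A1, A2. fold i0 in A3, A4.
  assert (Hrow : Row tau j0 z0).
  { unfold Row. split; [|lra]. destruct (Req_dec (IZR j0) (2 * ct tau z0)) as [E|E]; [|lra].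
    exfalso. apply (proj1 (Hz0 (- cs tau z0)%R)). exists 0%Z, j0.
    destruct (Coord (- cs tau z0)%R) as [X1 [_ [X3 _]]].
    rewrite (coords tau Htau (line z0 1 (- cs tau z0))), X1, X3.
    replace (ct tau z0) with (IZR j0 / 2)%R by lra. replace (cs tau z0 + - cs tau z0)%R with 0%R by ring.
    unfold lattice_point, Rdiv. rewrite RtoC_mult, RtoC_inv by lra. field. }
  assert (Hcol : Col tau i0 z0).
  { unfold Col. split; [|lra]. destruct (Req_dec (IZR i0) (2 * cs tau z0)) as [E|E]; [|lra].
    exfalso. apply (proj2 (Hz0 (- ct tau z0)%R)). exists i0, 0%Z.
    destruct (Coord (- ct tau z0)%R) as [_ [X1 [_ X3]]].
    rewrite (coords tau Htau (line z0 tau (- ct tau z0))), X1, X3.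
    replace (cs tau z0) with (IZR i0 / 2)%R by lra. replace (ct tau z0 + - ct tau z0)%R with 0%R by ring.
    unfold lattice_point, Rdiv. rewrite RtoC_mult, RtoC_inv by lra. field. }
  assert (HOr := Row_domain tau Htau p j0 z0 Hrow).
  assert (HOc := Col_domain tau Htau p i0 z0 Hcol).
  destruct (sym2_extend Q (Row tau j0) (fun z => (Cmod (z - z0) < r)%R) z0 z0 (QF a b c y1 y2) HOr)
    as [V [SV EV]].
  { apply (convex_star (fun z => Row tau j0 z /\ (Cmod (z - z0) < r)%R)).
    - apply convex_and; [apply Row_convex; auto|apply convex_ball].
    - split; [auto|apply HO]. }
  { exists y1, dy1, y2, dy2, a, b, c. auto. }
  destruct (sym2_globalize tau Htau p HAP j0 V SV) as [Y [GY [EY HP]]].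
  destruct (proj1 (open_C_iff _) (Row_open tau Htau j0) z0 Hrow) as [d [Hd Hin]].
  assert (Near : exists r, (0 < r)%R /\ forall z, (Cmod (z - z0) < r)%R -> Y z = QF a b c y1 y2 z).
  { exists (Rmin r d). split; [apply Rmin_pos; auto|]. intros z Hz.
    assert (B1 := Rmin_l r d). assert (B2 := Rmin_r r d).
    rewrite EY by (apply Hin; lra). apply EV; [apply Hin|]; lra. }
  destruct (choice (fun k g => (k <= 3)%nat ->
    plim (fun z => Y z - g * / (z - omega tau k / 2)) (omega tau k / 2) (- (2) * Tcoef p k * g)))
    as [g Hg].
  { intros k. destruct (le_dec k 3) as [Hk|Hk]; [|exists 0; intros; lia].
    destruct (HP k Hk) as [g Hg]. exists g. auto. }
  exists Y, g. split; [|split; [|split; [|split]]]; auto.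
  - intros z Hz. destruct (strip_cover tau Htau z Hz) as [[j Hj]|[i Hi]].
    + apply (sym2_locC1 Q (Row tau j)); auto; [apply Row_open; auto| |apply GY].
      intros w Hw. apply (Row_domain tau Htau p j w Hw). auto.
    + apply (sym2_locC1 Q (Col tau i)); auto; [apply Col_open; auto| |apply GY].
      intros w Hw. apply (Col_domain tau Htau p i w Hw). auto.
  - destruct (line_periodic (Row tau j0) 1 e1 a b c Y) as [s [Hs E]]; auto.
    + apply Row_open; auto.
    + apply HOr.
    + apply GY.
    + intros t. unfold Row. rewrite (proj1 (Coord t)). apply Hrow.
    + apply (global_unique tau Htau p (fun z => Y (z + 1)) Y j0 z0 s); auto.
      apply global_sym2_1; auto.
  - destruct (line_periodic (Col tau i0) tau e2 a b c Y) as [s [Hs E]]; auto.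
    + apply Col_open; auto.
    + apply HOc.
    + apply GY.
    + intros t. unfold Col. rewrite (proj1 (proj2 (Coord t))). apply Hcol.
    + apply (global_unique tau Htau p (fun z => Y (z + tau)) Y j0 z0 s); auto.
      apply global_sym2_tau; auto.
Qed.

End Basis.

(** * Scalar monodromy forces the trivial equation *)

Lemma Cmult_0_reg (x y : C) : x * y = 0 -> x = 0 \/ y = 0.
Proof.
  intros H. destruct (classic (x = 0)) as [|Hx]; auto. right.
  replace y with (/ x * (x * y)) by (field; auto). rewrite H. ring.
Qed.

Lemma Csub_0 (x y : C) : x - y = 0 -> x = y.
Proof. intros H. replace x with (x - y + y) by ring. rewrite H. ring. Qed.

(** The cross product of the coefficient vectors is a solution; if it vanishes, any vector
    orthogonal to one nonzero coefficient vector will do. *)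
Lemma common_zero (f1 f2 f3 g1 g2 g3 : C) : exists x y z : C, ~ (x = 0 /\ y = 0 /\ z = 0) /\
  x * f1 + y * f2 + z * f3 = 0 /\ x * g1 + y * g2 + z * g3 = 0.
Proof.
  destruct (classic (f2 * g3 - f3 * g2 = 0 /\ f3 * g1 - f1 * g3 = 0 /\ f1 * g2 - f2 * g1 = 0))
    as [[E1 [E2 E3]]|N].
  2:{ exists (f2 * g3 - f3 * g2), (f3 * g1 - f1 * g3), (f1 * g2 - f2 * g1).
      split; auto. split; ring. }
  destruct (classic (f1 = 0 /\ f2 = 0)) as [[-> ->]|N].
  - destruct (classic (f3 = 0)) as [->|N].
    + destruct (classic (g1 = 0 /\ g2 = 0)) as [[-> ->]|N].
      * exists 1, 0, 0. split; [|split; ring]. intros [K _]. apply C1_nz. auto.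
      * exists (- g2), g1, 0. split; [|split; ring]. intros [K1 [K2 _]]. apply N. split; auto.
        replace g2 with (- - g2) by ring. rewrite K1. ring.
    + exists 0, (- f3), 0. split; [|split].
      * intros [_ [K _]]. apply N. replace f3 with (- - f3) by ring. rewrite K. ring.
      * ring.
      * apply (eq_trans (y := 0 * g3 - f3 * g2)); [ring|exact E1].
  - exists (- f2), f1, 0. split; [|split].
    + intros [K1 [K2 _]]. apply N. split; auto. replace f2 with (- - f2) by ring. rewrite K1. ring.
    + ring.
    + apply (eq_trans (y := f1 * g2 - f2 * g1)); [ring|exact E3].
Qed.

Section Trivial.
Variable tau : C.
Hypothesis Htau : (0 < Im tau)%R.

Let ns (z : C) : Prop := ~ singular tau z.

(** Subtracting the real-linear map with the same quasi-periods gives a periodic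
    function, so the values at translates differ by a constant. *)
Lemma quasi_plim (f : C -> C) (A B c0 l : C) m n :
  (forall z, ns z -> f (z + 1) = f z + A) -> (forall z, ns z -> f (z + tau) = f z + B) ->
  plim f c0 l -> exists l', plim f (c0 + lattice_point tau m n) l'.
Proof.
  intros H1 H2 Hl. set (w := lattice_point tau m n).
  set (L := fun z => RtoC (cs tau z) * A + RtoC (ct tau z) * B).
  assert (E : forall z, ns z -> f (z + w) = f z + (L (z + w) - L z)).
  { intros z Hz.
    assert (X := periodic_off tau (fun z => f z - L z)).
    destruct (lp_coords tau Htau 1 0) as [P1 P2]. rewrite lp_10 in P1, P2.
    destruct (lp_coords tau Htau 0 1) as [P3 P4]. rewrite lp_01 in P3, P4.
    assert (Y := X ltac:(intros y Hy; cbv beta; rewrite H1 by auto; unfold L;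
      rewrite cs_plus, ct_plus, P1, P2, !RtoC_plus by auto; ring)
      ltac:(intros y Hy; cbv beta; rewrite H2 by auto; unfold L;
      rewrite cs_plus, ct_plus, P3, P4, !RtoC_plus by auto; ring) m n z Hz).
    cbv beta in Y. fold w in Y. replace (f (z + w)) with (f (z + w) - L (z + w) + L (z + w)) by ring.
    rewrite Y. ring. }
  set (D := RtoC (cs tau w) * A + RtoC (ct tau w) * B).
  assert (E' : forall z, ns z -> f (z + w) = f z + D).
  { intros z Hz. rewrite E by auto. unfold L, D. rewrite cs_plus, ct_plus, !RtoC_plus by auto. ring. }
  assert (P : plim (fun z => f (z + - w)) (c0 + w) l).
  { apply plim_shift. replace (c0 + w + - w) with c0 by ring. auto. }
  destruct (singular_isolated tau Htau (c0 + w)) as [r [Hr Hn]].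
  assert (P2 := plim_plus _ _ _ _ _ P (plim_const D (c0 + w))).
  exists (l + D). apply (plim_ext _ f _ _ r Hr) with (2 := P2).
  intros z Hz. cbv beta. rewrite <- E'.
  - f_equal. ring.
  - apply (ns_lattice' tau m n). fold w. replace (z + - w + w) with z by ring.
    intros K. assert (Hne : z <> c0 + w).
    { intros ->. replace (c0 + w - (c0 + w)) with (RtoC 0) in Hz by ring.
      rewrite Cmod_0 in Hz. lra. }
    assert (X := Hn z K Hne). rewrite Cmod_minus_sym in X. lra.
Qed.

(** The signs of the residues of phi1, phi2, phi3. *)
Definition eps1 (k : nat) : C := match k with 0%nat | 1%nat => 1 | _ => - (1) end.
Definition eps2 (k : nat) : C := match k with 0%nat | 2%nat => 1 | _ => - (1) end.
Definition eps3 (k : nat) : C := match k with 1%nat | 2%nat => - (1) | _ => 1 end.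

Lemma phi_omega k z : ns z -> (k <= 3)%nat ->
  phi1 tau (z + omega tau k / 2) = eps1 k * phi1 tau z /\
  phi2 tau (z + omega tau k / 2) = eps2 k * phi2 tau z /\
  phi3 tau (z + omega tau k / 2) = eps3 k * phi3 tau z.
Proof.
  intros Hz Hk. destruct k as [|[|[|[|k]]]]; [| | | |lia]; simpl.
  - replace (z + 0 / 2) with z by field. repeat split; ring.
  - rewrite phi1_h1, phi2_h1, phi3_h1 by auto. repeat split; ring.
  - rewrite phi1_h2, phi2_h2, phi3_h2 by auto. repeat split; ring.
  - replace (z + (1 + tau) / 2) with (z + 1 / 2 + tau / 2) by field.
    rewrite phi1_h2, phi2_h2, phi3_h2 by (auto; apply ns_h1; auto).
    rewrite phi1_h1, phi2_h1, phi3_h1 by auto. repeat split; ring.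
Qed.

Lemma punctured_ns c : exists r, (0 < r)%R /\ forall z, (0 < Cmod (z - c) < r)%R -> ns z.
Proof.
  destruct (singular_isolated tau Htau c) as [r [Hr H]]. exists r. split; auto.
  intros z Hz K. assert (Hne : z <> c).
  { intros ->. replace (c - c) with (RtoC 0) in Hz by ring. rewrite Cmod_0 in Hz. lra. }
  assert (X := H z K Hne). rewrite Cmod_minus_sym in X. lra.
Qed.

(** At 0 this is the vanishing of the constant term, and translation by a half-period only
    changes the sign. *)
Lemma phi_polar k : (k <= 3)%nat -> let c := omega tau k / 2 in
  plim (fun z => phi1 tau z - eps1 k * / (z - c)) c 0 /\
  plim (fun z => phi2 tau z - eps2 k * / (z - c)) c 0 /\
  plim (fun z => phi3 tau z - eps3 k * / (z - c)) c 0.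
Proof.
  intros Hk c. destruct (punctured_ns 0) as [r [Hr Hn]].
  assert (Key : forall (phi f : C -> C) (e : C), ccont f 0 -> f 0 = 0 ->
    (forall z, phi z = / z + f z) ->
    (forall z, ns z -> exists s, phi (z + c) = e * phi z /\ s = e) ->
    plim (fun z => phi z - e * / (z - c)) c 0).
  { intros phi f e Hf H0 E H.
    assert (P := plim_scal e _ _ _ (ccont_plim _ _ Hf)). rewrite H0 in P.
    assert (P' : plim (fun z => e * f z) (c + - c) (e * 0))
      by (replace (c + - c) with (RtoC 0) by ring; exact P).
    apply plim_shift in P'.
    apply (plim_ext _ (fun z => phi z - e * / (z - c)) _ _ r Hr) in P'.
    - eapply plim_eq; [exact P'|ring].
    - intros z Hz. cbv beta. replace (z + - c) with (z - c) by ring.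
      assert (Hzc : ns (z - c)).
      { apply Hn. replace (z - c - 0) with (z - c) by ring. auto. }
      destruct (H _ Hzc) as [_ [X _]]. replace (z - c + c) with z in X by ring.
      rewrite X, E. ring. }
  split; [|split].
  - apply (Key _ (rho tau 1 (- (1)) (- (1)) (- eta2 tau))).
    + apply rho_ccont; auto.
    + apply rho1_0; auto.
    + intros z. exact (ph_rho tau 1 (- (1)) (- (1)) (- eta2 tau) z).
    + intros z Hz. exists (eps1 k). split; auto. apply phi_omega; auto.
  - apply (Key _ (rho tau (- (1)) 1 (- (1)) (- eta1 tau))).
    + apply rho_ccont; auto.
    + apply rho2_0; auto.
    + intros z. exact (ph_rho tau (- (1)) 1 (- (1)) (- eta1 tau) z).
    + intros z Hz. exists (eps2 k). split; auto. apply phi_omega; auto.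
  - apply (Key _ (rho tau (- (1)) (- (1)) 1 0)).
    + apply rho_ccont; auto.
    + apply rho3_0; auto.
    + intros z. exact (ph_rho tau (- (1)) (- (1)) 1 0 z).
    + intros z Hz. exists (eps3 k). split; auto. apply phi_omega; auto.
Qed.

Lemma zeta_polar k : (k <= 3)%nat -> let c := omega tau k / 2 in
  exists l, plim (fun z => wzeta tau z - (match k with 0%nat => 1 | _ => 0 end) * / (z - c)) c l.
Proof.
  intros Hk c. destruct (Nat.eq_dec k 0) as [->|Hk0].
  - assert (Ec : c = 0) by (unfold c; simpl; field). rewrite Ec.
    assert (Hc : ccont (rho tau 0 0 0 0) 0) by (apply rho_ccont; auto).
    assert (P := ccont_plim _ _ Hc). exists (rho tau 0 0 0 0 0).
    apply (plim_ext _ (fun z => wzeta tau z - 1 * / (z - 0)) _ _ 1 Rlt_0_1) in P; auto.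
    intros z Hz. assert (X := ph_rho tau 0 0 0 0 z). replace (z - 0) with z by ring.
    replace (rho tau 0 0 0 0 z) with (/ z + rho tau 0 0 0 0 z - / z) by ring.
    rewrite <- X. unfold ph. ring.
  - assert (Hn : ~ in_lattice tau c).
    { assert (X := omega_diff tau Htau 0 k ltac:(lia) Hk ltac:(auto)).
      replace (omega tau k / 2 - omega tau 0 / 2) with c in X by (unfold c; simpl; field). auto. }
    assert (P := ccont_plim _ _ (Cder_ccont _ _ _ (wzeta_Cder tau Htau c Hn))).
    exists (wzeta tau c).
    apply (plim_ext _ _ _ _ 1 Rlt_0_1) with (2 := P). intros z _.
    destruct k; [congruence|]. ring.
Qed.

Variable p : params.
Variable z0 : C.
Hypothesis Hz0 : regular_base_point tau z0.
Variables y1 y2 : C -> C.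
Hypothesis HB : local_basis tau p z0 y1 y2.

Let form := form tau p z0 y1 y2.

(** Subtract from Y the combination of the phi_l and of zeta with the same residues; the
    coefficient s of zeta is the sum of the residues. The difference has limits
    everywhere and quasi-periods - s eta1 and - s eta2, so by Liouville's theorem
    s (eta2 - eta1 tau) = 0, whence s = 0, and the difference is a constant K. The
    constant terms of the phi_l being zero, K is the constant term of Y at each
    half-period. *)
Lemma form_phi a b c Y g : form a b c Y g -> exists b1 b2 b3 K,
  (forall z, ns z -> Y z = b1 * phi1 tau z + b2 * phi2 tau z + b3 * phi3 tau z + K) /\
  forall k, (k <= 3)%nat -> g k = b1 * eps1 k + b2 * eps2 k + b3 * eps3 k /\
    K = - (2) * Tcoef p k * g k.
Proof.
  intros [H1 [H2 [H3 [H4 _]]]].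
  (* s, b1, b2, b3 solve the linear system [Hg] below; s enters at k = 0 only *)
  set (s := g 0%nat + g 1%nat + g 2%nat + g 3%nat).
  set (b1 := - ((g 2%nat + g 3%nat) / 2)). set (b2 := - ((g 1%nat + g 3%nat) / 2)).
  set (b3 := - ((g 1%nat + g 2%nat) / 2)).
  set (zp := fun k : nat => match k with 0%nat => RtoC 1 | _ => RtoC 0 end).
  assert (Hg : forall k, (k <= 3)%nat -> g k = b1 * eps1 k + b2 * eps2 k + b3 * eps3 k + s * zp k).
  { intros k Hk. destruct k as [|[|[|[|k]]]]; [| | | |lia]; unfold b1, b2, b3, s; simpl; field. }
  set (R := fun z => Y z + - (1) * (b1 * phi1 tau z + b2 * phi2 tau z + b3 * phi3 tau z +
    s * wzeta tau z)).
  assert (Per : forall z, ns z ->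
    (phi1 tau (z + 1) = phi1 tau z /\ phi2 tau (z + 1) = phi2 tau z /\ phi3 tau (z + 1) = phi3 tau z) /\
    (phi1 tau (z + tau) = phi1 tau z /\ phi2 tau (z + tau) = phi2 tau z /\
      phi3 tau (z + tau) = phi3 tau z)).
  { intros z Hz. assert (Z1 := ns_h1 tau z Hz). assert (Z2 := ns_h2 tau z Hz).
    replace (z + 1) with (z + 1 / 2 + 1 / 2) by field.
    replace (z + tau) with (z + tau / 2 + tau / 2) by field.
    rewrite !phi1_h1, !phi2_h1, !phi3_h1, !phi1_h2, !phi2_h2, !phi3_h2 by auto.
    repeat split; ring. }
  assert (R1 : forall z, ns z -> R (z + 1) = R z + - (s * eta1 tau)).
  { intros z Hz. destruct (Per z Hz) as [[E1 [E2 E3]] _]. unfold R.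
    rewrite H2, E1, E2, E3, wzeta_1 by (auto; apply (ns_off tau z Hz)). ring. }
  assert (R2 : forall z, ns z -> R (z + tau) = R z + - (s * eta2 tau)).
  { intros z Hz. destruct (Per z Hz) as [_ [E1 [E2 E3]]]. unfold R.
    rewrite H3, E1, E2, E3, wzeta_tau by (auto; apply (ns_off tau z Hz)). ring. }
  assert (Pol : forall k, (k <= 3)%nat -> forall l,
    plim (fun z => wzeta tau z - zp k * / (z - omega tau k / 2)) (omega tau k / 2) l ->
    plim R (omega tau k / 2) (- (2) * Tcoef p k * g k - s * l)).
  { intros k Hk l Hl. destruct (phi_polar k Hk) as [P1 [P2 P3]].
    assert (X := plim_plus _ _ _ _ _ (H4 k Hk) (plim_scal (- (1)) _ _ _
      (plim_plus _ _ _ _ _ (plim_plus _ _ _ _ _ (plim_plus _ _ _ _ _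
        (plim_scal b1 _ _ _ P1) (plim_scal b2 _ _ _ P2)) (plim_scal b3 _ _ _ P3))
        (plim_scal s _ _ _ Hl)))).
    apply (plim_ext _ R _ _ 1 Rlt_0_1) in X.
    - eapply plim_eq; [exact X|ring].
    - intros z _. cbv beta. unfold R. rewrite (Hg k Hk). ring. }
  assert (ZP : forall k, (k <= 3)%nat -> exists l,
    plim (fun z => wzeta tau z - zp k * / (z - omega tau k / 2)) (omega tau k / 2) l).
  { intros k Hk. destruct (zeta_polar k Hk) as [l Hl]. exists l. exact Hl. }
  destruct (liouville tau Htau R (- (s * eta1 tau)) (- (s * eta2 tau))) as [E [K [HK1 HK2]]]; auto.
  - intros z Hz.
    assert (L1 : locC1 (phi1 tau) z) by (unfold phi1; apply ph_locC1; auto).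
    assert (L2 : locC1 (phi2 tau) z) by (unfold phi2; apply ph_locC1; auto).
    assert (L3 : locC1 (phi3 tau) z) by (unfold phi3; apply ph_locC1; auto).
    assert (L4 : locC1 (wzeta tau) z).
    { apply (locC1_ext (ph tau 0 0 0 0) _ z 1 Rlt_0_1).
      - intros w _. unfold ph. ring.
      - apply ph_locC1; auto. }
    exact (locC1_plus _ _ z (H1 z Hz) (locC1_scal (- (1)) _ z
      (locC1_plus _ _ z (locC1_plus _ _ z (locC1_plus _ _ z (locC1_scal b1 _ z L1)
        (locC1_scal b2 _ z L2)) (locC1_scal b3 _ z L3)) (locC1_scal s _ z L4)))).
  - intros x Hx. destruct (singular_class tau x Hx) as [k [m [n [Hk ->]]]].
    destruct (ZP k Hk) as [l Hl]. apply (quasi_plim R _ _ _ _ m n R1 R2 (Pol k Hk l Hl)).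
  - assert (Hs : s = 0).
    { destruct (Cmult_0_reg s (eta2 tau - eta1 tau * tau)) as [|X]; auto.
      - transitivity (- (- (s * eta2 tau)) + - (s * eta1 tau) * tau); [ring|]. rewrite E. ring.
      - exfalso. apply (legendre_weak tau Htau). apply Csub_0. auto. }
    exists b1, b2, b3, K. split.
    + intros z Hz. assert (X := HK1 z Hz). rewrite Hs in X. unfold R in X. rewrite Hs in X.
      transitivity (b1 * phi1 tau z + b2 * phi2 tau z + b3 * phi3 tau z +
        (Y z + - (1) * (b1 * phi1 tau z + b2 * phi2 tau z + b3 * phi3 tau z + 0 * wzeta tau z)));
        [ring|]. rewrite X. ring.
    + intros k Hk. split.
      * rewrite (Hg k Hk), Hs. ring.
      * destruct (ZP k Hk) as [l Hl].
        assert (X := plim_unique _ _ _ _ (HK2 _ (omega_singular tau k)) (Pol k Hk l Hl)).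
        rewrite Hs in X. transitivity (- (0 * eta1 tau) * (omega tau k / 2) + K); [ring|].
        rewrite X. ring.
Qed.

(** Near z0 the function is the quadratic form in a basis. *)
Lemma form_nonzero a b c Y g : form a b c Y g -> (forall z, ns z -> Y z = 0) ->
  a = 0 /\ b = 0 /\ c = 0.
Proof.
  intros [_ [_ [_ [_ [r [Hr H]]]]]] H0.
  destruct (basis_disc tau Htau p z0 Hz0 y1 y2 HB) as [r' [dy1 [dy2 [Hr' [HO [S1 [S2 W]]]]]]].
  destruct (ns_disc tau Htau z0 (base_ns tau z0 Hz0)) as [d [Hd Hn]].
  apply (QF_zero _ _ a b c y1 dy1 y2 dy2 z0 (Rmin r d) (proj1 HO) S1 S2); auto.
  - apply HO.
  - apply Rmin_pos; auto.
  - intros t Ht. assert (B1 := Rmin_l r d). assert (B2 := Rmin_r r d).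
    assert (Et : (Cmod (z0 + RtoC t - z0) = Rabs t)%R).
    { replace (z0 + RtoC t - z0) with (RtoC t) by ring. apply Cmod_R. }
    rewrite <- H by (rewrite Et; lra). apply H0. apply Hn. rewrite Et. lra.
Qed.

Hypothesis HAP : AP tau p.
Hypothesis forms : forall a b c, exists Y g, form a b c Y g.

(** Among the forms, a space of dimension three, some nonzero one has vanishing
    residues at i and k. Then K = 0, so the residue at j vanishes with T_j nonzero, and so
    does the last one since the residues add up to zero. Its function is zero. *)
Lemma no_two_residues i j k : (i <= 3)%nat -> (j <= 3)%nat -> (k <= 3)%nat -> i <> j -> i <> k ->
  j <> k -> Tcoef p i <> 0 -> Tcoef p j <> 0 -> False.
Proof.
  intros Hi Hj Hk Hij Hik Hjk Ti Tj.
  destruct (forms 1 0 0) as [Y1 [g1 F1]]. destruct (forms 0 1 0) as [Y2 [g2 F2]].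
  destruct (forms 0 0 1) as [Y3 [g3 F3]].
  destruct (common_zero (g1 i) (g2 i) (g3 i) (g1 k) (g2 k) (g3 k)) as [x [y [z [Hne [E1 E2]]]]].
  (* F3 is paired with itself with coefficient 0, as [form_lin] combines two forms *)
  assert (F := form_lin tau p z0 y1 y2 1 1 _ _ _ _ _ _ _ _ _ _
    (form_lin tau p z0 y1 y2 x y _ _ _ _ _ _ _ _ _ _ F1 F2)
    (form_lin tau p z0 y1 y2 z 0 _ _ _ _ _ _ _ _ _ _ F3 F3)).
  set (G := fun k => 1 * (x * g1 k + y * g2 k) + 1 * (z * g3 k + 0 * g3 k)) in F.
  assert (Gi : G i = 0) by (rewrite <- E1 at 1; unfold G; ring).
  assert (Gk : G k = 0) by (rewrite <- E2 at 1; unfold G; ring).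
  destruct (form_phi _ _ _ _ _ F) as [b1 [b2 [b3 [K [HY Hg]]]]].
  assert (K0 : K = 0) by (rewrite (proj2 (Hg i Hi)), Gi; ring).
  assert (Gj : G j = 0).
  { assert (X := proj2 (Hg j Hj)). rewrite K0 in X. symmetry in X.
    destruct (Cmult_0_reg _ _ X) as [X1|X1]; auto.
    destruct (Cmult_0_reg _ _ X1) as [X2|X2]; [|contradiction].
    exfalso. apply (RtoC_neq 2 0); [lra|]. replace (RtoC 2) with (- - (RtoC 2)) by ring.
    rewrite X2. ring. }
  assert (A0 := proj1 (Hg 0%nat ltac:(lia))). assert (A1 := proj1 (Hg 1%nat ltac:(lia))).
  assert (A2 := proj1 (Hg 2%nat ltac:(lia))). assert (A3 := proj1 (Hg 3%nat ltac:(lia))).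
  simpl in A0, A1, A2, A3.
  assert (S : G 0%nat + G 1%nat + G 2%nat + G 3%nat = 0) by (rewrite A0, A1, A2, A3; ring).
  assert (All : G 0%nat = 0 /\ G 1%nat = 0 /\ G 2%nat = 0 /\ G 3%nat = 0).
  { assert (Z : forall u v w t : C, u + v + w + t = 0 -> u = 0 -> v = 0 -> w = 0 -> t = 0).
    { intros u v w t E -> -> ->. rewrite <- E. ring. }
    clearbody G. clear - S Hi Hj Hk Hij Hik Hjk Gi Gj Gk Z.
    destruct i as [|[|[|[|i]]]]; [| | | |lia];
    destruct j as [|[|[|[|j]]]]; try lia; destruct k as [|[|[|[|k]]]]; try lia;
    repeat split; auto;
    first [apply (Z (G 1%nat) (G 2%nat) (G 3%nat)); auto; rewrite <- S; ring
          |apply (Z (G 0%nat) (G 2%nat) (G 3%nat)); auto; rewrite <- S; ring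
          |apply (Z (G 0%nat) (G 1%nat) (G 3%nat)); auto; rewrite <- S; ring
          |apply (Z (G 0%nat) (G 1%nat) (G 2%nat)); auto]. }
  destruct All as [Z0 [Z1 [Z2 Z3]]].
  assert (X1 : b1 = 0) by (transitivity ((G 0%nat + G 1%nat) / 2);
    [rewrite A0, A1; field|rewrite Z0, Z1; field]).
  assert (X2 : b2 = 0) by (transitivity ((G 0%nat + G 2%nat) / 2);
    [rewrite A0, A2; field|rewrite Z0, Z2; field]).
  assert (X3 : b3 = 0) by (transitivity ((G 0%nat + G 3%nat) / 2);
    [rewrite A0, A3; field|rewrite Z0, Z3; field]).
  destruct (form_nonzero _ _ _ _ _ F) as [W1 [W2 W3]].
  { intros w Hw. rewrite HY by auto. rewrite X1, X2, X3, K0. ring. }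
  apply Hne. split; [|split]; [rewrite <- W1|rewrite <- W2|rewrite <- W3]; ring.
Qed.

(** The T_k add up to zero, so a nonzero one is accompanied by another. *)
Lemma residues_vanish i : (i <= 3)%nat -> Tcoef p i = 0.
Proof.
  intros Hi. destruct (classic (Tcoef p i = 0)) as [|Ti]; auto. exfalso.
  assert (HS : Tcoef p 0 + Tcoef p 1 + Tcoef p 2 + Tcoef p 3 = 0) by apply (proj1 HAP).
  assert (N : forall j, (j <= 3)%nat -> j <> i -> Tcoef p j = 0).
  { intros j Hj Hji. destruct (classic (Tcoef p j = 0)) as [|Tj]; auto. exfalso.
    assert (Hk : exists k, (k <= 3)%nat /\ i <> k /\ j <> k).
    { destruct (Nat.eq_dec i 0), (Nat.eq_dec j 0); subst;
        [lia|destruct (Nat.eq_dec j 1); [exists 2%nat|exists 1%nat]; lia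
        |destruct (Nat.eq_dec i 1); [exists 2%nat|exists 1%nat]; lia|exists 0%nat; lia]. }
    destruct Hk as [k [Hk [K1 K2]]]. apply (no_two_residues i j k); auto. }
  apply Ti. destruct i as [|[|[|[|i]]]]; [| | | |lia];
    rewrite ?(N 0%nat), ?(N 1%nat), ?(N 2%nat), ?(N 3%nat) in HS by lia; rewrite <- HS; ring.
Qed.

End Trivial.

(** * The accessory parameter *)

Lemma q_no_residues tau p z : (0 < Im tau)%R -> (forall i, (i <= 3)%nat -> Tcoef p i = 0) ->
  ~ singular tau z -> q tau p z = (phi1 tau z * phi1 tau z + phi2 tau z * phi2 tau z +
    phi3 tau z * phi3 tau z) / 4 + B p.
Proof.
  intros Htau HT Hz. rewrite q_expand. unfold zsum.
  assert (A0 := HT 0%nat ltac:(lia)). assert (A1 := HT 1%nat ltac:(lia)).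
  assert (A2 := HT 2%nat ltac:(lia)). assert (A3 := HT 3%nat ltac:(lia)).
  simpl in A0, A1, A2, A3. rewrite A0, A1, A2, A3, wpsum_phi by auto.
  replace (RtoC (3 / 4)) with (RtoC 3 / 4) by (rewrite <- RtoC_div by lra; auto). field.
Qed.

(** The square of the Wronskian is the discriminant
    (x' y + x y')^2 - 4 (x x') (y y'). *)
Lemma polarization_zero (x x' y y' : C) : x * x' = 0 -> x' * y + x * y' = 0 -> y * y' = 0 ->
  x * y' - x' * y = 0.
Proof.
  intros H1 H2 H3.
  assert (X : (x * y' - x' * y) * (x * y' - x' * y) = 0).
  { transitivity ((x' * y + x * y') * (x' * y + x * y') - 4 * ((x * x') * (y * y'))); [ring|].
    rewrite H1, H2, H3. ring. }
  destruct (Cmult_0_reg _ _ X); auto.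
Qed.

Section Accessory.
Variable tau : C.
Hypothesis Htau : (0 < Im tau)%R.
Variable p : params.
Variable z0 : C.
Hypothesis Hz0 : regular_base_point tau z0.
Variables y1 y2 : C -> C.
Hypothesis HB : local_basis tau p z0 y1 y2.
Hypothesis HT : forall i, (i <= 3)%nat -> Tcoef p i = 0.
Hypothesis forms : forall a b c, exists Y g, form tau p z0 y1 y2 a b c Y g.

Let ns (z : C) : Prop := ~ singular tau z.

(** The third-order equation of products of solutions is used in the form E' = q Y' with
    E = Y'' / 2 - q Y. The phi_l satisfy it with q - B in place of q, which leaves B Y' = 0.
    If B were nonzero, Y'(z0) = 0 for every quadratic form, which contradicts the linear
    independence of the basis by [polarization_zero]. *)
Lemma accessory_vanishes : B p = 0.
Proof.
  destruct (basis_disc tau Htau p z0 Hz0 y1 y2 HB) as [r' [dy1 [dy2 [Hr' [HO [S1 [S2 W]]]]]]].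
  destruct (ns_disc tau Htau z0 (base_ns tau z0 Hz0)) as [d [Hd Hn]].
  destruct (classic (B p = 0)) as [|HBp]; auto. exfalso. apply W.
  assert (Key : forall a b c, QF1 a b c y1 dy1 y2 dy2 z0 = 0).
  { intros a b c. destruct (forms a b c) as [Y [g F]].
    destruct (form_phi tau Htau p z0 y1 y2 a b c Y g F) as [b1 [b2 [b3 [K [HY Hg]]]]].
    assert (K0 : K = 0).
    { rewrite (proj2 (Hg 0%nat ltac:(lia))), HT by lia. ring. }
    destruct F as [_ [_ [_ [_ [s [Hs HQ]]]]]].
    set (m := Rmin r' (Rmin d s)). assert (Hm : (0 < m)%R) by (repeat apply Rmin_pos; auto).
    assert (M1 := Rmin_l r' (Rmin d s)). assert (M2 := Rmin_r r' (Rmin d s)).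
    assert (M3 := Rmin_l d s). assert (M4 := Rmin_r d s). fold m in M1, M2.
    set (f1 := phi1 tau) in *. set (f2 := phi2 tau) in *. set (f3 := phi3 tau) in *.
    set (Y0 := fun z => b1 * f1 z + b2 * f2 z + b3 * f3 z).
    set (Y1 := fun z => - (b1 * (f2 z * f3 z) + b2 * (f1 z * f3 z) + b3 * (f1 z * f2 z))).
    set (Y2 := fun z => b1 * (f1 z * (f2 z * f2 z + f3 z * f3 z)) +
      b2 * (f2 z * (f1 z * f1 z + f3 z * f3 z)) + b3 * (f3 z * (f1 z * f1 z + f2 z * f2 z))).
    set (P := fun z => (f1 z * f1 z + f2 z * f2 z + f3 z * f3 z) / 4).
    assert (D1 := phi1_Cder tau Htau). assert (D2 := phi2_Cder tau Htau).
    assert (D3 := phi3_Cder tau Htau). fold f1 f2 f3 in D1, D2, D3.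
    assert (N : forall z, (Cmod (z - z0) < m)%R -> ns z) by (intros z Hz; apply Hn; lra).
    assert (Eq : forall z, (Cmod (z - z0) < m)%R -> q tau p z = P z + B p).
    { intros z Hz. apply q_no_residues; auto. apply N; auto. }
    assert (E0 : forall z, (Cmod (z - z0) < m)%R -> QF a b c y1 y2 z = Y0 z).
    { intros z Hz. rewrite <- HQ by lra. rewrite HY by (apply N; auto). rewrite K0. unfold Y0. ring. }
    assert (DY0 : forall z, ns z -> Cder Y0 z (Y1 z)).
    { intros z Hz. eapply Cder_eq.
      - apply (Cder_plus (fun z => b1 * f1 z + b2 * f2 z));
          [apply (Cder_plus (fun z => b1 * f1 z))|];
          apply Cder_scal; eauto.
      - unfold Y1. ring. }
    assert (Dp : forall (u v : C -> C) u' v' z, Cder u z u' -> Cder v z v' ->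
      Cder (fun z => u z * v z) z (u' * v z + u z * v')) by (intros; apply Cder_mult; auto).
    assert (DY1 : forall z, ns z -> Cder Y1 z (Y2 z)).
    { intros z Hz. eapply Cder_eq.
      - apply Cder_opp. apply (Cder_plus (fun z => b1 * (f2 z * f3 z) + b2 * (f1 z * f3 z)));
          [apply (Cder_plus (fun z => b1 * (f2 z * f3 z)))|];
          apply Cder_scal, Dp; eauto.
      - unfold Y2. ring. }
    (* Y'' / 2 - q Y, expressed without second derivatives *)
    set (E := fun z => a * (dy1 z * dy1 z) + b * (dy1 z * dy2 z) + c * (dy2 z * dy2 z)).
    assert (B0 : forall z, (Cmod (z - z0) < m)%R -> forall w, (Cmod (w - z) < m - Cmod (z - z0))%R ->
      (Cmod (w - z0) < m)%R).
    { intros z Hz w Hw. assert (X := Cmod_chain w z z0). lra. }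
    assert (E1 : forall z, (Cmod (z - z0) < m)%R -> QF1 a b c y1 dy1 y2 dy2 z = Y1 z).
    { intros z Hz. apply (Cder_unique Y0 z); [|apply DY0, N; auto].
      apply (Cder_locally_ext (QF a b c y1 y2) _ z _ (m - Cmod (z - z0))); [lra| |].
      - intros w Hw. apply E0. apply (B0 z); auto.
      - apply (QF_Cder (q tau p) (fun z => (Cmod (z - z0) < r')%R)); auto. lra. }
    assert (E2 : forall z, (Cmod (z - z0) < m)%R -> 2 * (E z + (P z + B p) * Y0 z) = Y2 z).
    { intros z Hz. apply (Cder_unique Y1 z); [|apply DY1, N; auto].
      apply (Cder_locally_ext (QF1 a b c y1 dy1 y2 dy2) _ z _ (m - Cmod (z - z0))); [lra| |].
      - intros w Hw. apply E1. apply (B0 z); auto.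
      - eapply Cder_eq.
        + apply (QF1_Cder (q tau p) (fun z => (Cmod (z - z0) < r')%R)); auto. lra.
        + rewrite Eq, <- E0 by auto. unfold E, QF. ring. }
    assert (Hc : (Cmod (z0 - z0) < m)%R).
    { replace (z0 - z0) with (RtoC 0) by ring. rewrite Cmod_0. auto. }
    assert (Hzr : (Cmod (z0 - z0) < r')%R) by lra.
    assert (DE : Cder E z0 ((P z0 + B p) * Y1 z0)).
    { destruct (S1 z0 Hzr) as [X1 X2]. destruct (S2 z0 Hzr) as [X3 X4].
      rewrite Eq in X2, X4 by auto. eapply Cder_eq.
      - apply (Cder_plus (fun z => a * (dy1 z * dy1 z) + b * (dy1 z * dy2 z)));
          [apply (Cder_plus (fun z => a * (dy1 z * dy1 z)))|];
          apply Cder_scal, Dp; eauto.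
      - rewrite <- E1 by auto. unfold QF1. ring. }
    assert (Hns := N z0 Hc).
    set (P1 := - (RtoC 3 / 2) * (f1 z0 * f2 z0 * f3 z0)).
    assert (DP : Cder P z0 P1).
    { apply (Cder_locally_ext (fun z => / 4 * (f1 z * f1 z + f2 z * f2 z + f3 z * f3 z)) _ z0 _ 1
        Rlt_0_1); [intros; unfold P; field|]. eapply Cder_eq.
      - apply Cder_scal. apply (Cder_plus (fun z => f1 z * f1 z + f2 z * f2 z));
          [apply (Cder_plus (fun z => f1 z * f1 z))|];
          apply Dp; eauto.
      - unfold P1. field. }
    set (Y3 := b1 * (- (f2 z0 * f3 z0) * (f2 z0 * f2 z0 + f3 z0 * f3 z0) - 4 * (f1 z0 * f1 z0 * f2 z0 * f3 z0))
      + b2 * (- (f1 z0 * f3 z0) * (f1 z0 * f1 z0 + f3 z0 * f3 z0) - 4 * (f2 z0 * f2 z0 * f1 z0 * f3 z0))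
      + b3 * (- (f1 z0 * f2 z0) * (f1 z0 * f1 z0 + f2 z0 * f2 z0) - 4 * (f3 z0 * f3 z0 * f1 z0 * f2 z0))).
    assert (DY2 : Cder Y2 z0 Y3).
    { eapply Cder_eq.
      - apply (Cder_plus (fun z => b1 * (f1 z * (f2 z * f2 z + f3 z * f3 z)) +
          b2 * (f2 z * (f1 z * f1 z + f3 z * f3 z)))).
        apply (Cder_plus (fun z => b1 * (f1 z * (f2 z * f2 z + f3 z * f3 z)))).
        + apply Cder_scal, Dp; [eauto|].
          apply (Cder_plus (fun z => f2 z * f2 z)); apply Dp; eauto.
        + apply Cder_scal, Dp; [eauto|].
          apply (Cder_plus (fun z => f1 z * f1 z)); apply Dp; eauto.
        + apply Cder_scal, Dp; [eauto|].
          apply (Cder_plus (fun z => f1 z * f1 z)); apply Dp; eauto.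
      - unfold Y3. ring. }
    assert (DL : Cder Y2 z0 (2 * ((P z0 + B p) * Y1 z0 + (P1 * Y0 z0 + (P z0 + B p) * Y1 z0)))).
    { apply (Cder_locally_ext (fun z => 2 * (E z + (P z + B p) * Y0 z)) _ z0 _ m); auto.
      apply Cder_scal. apply Cder_plus; [exact DE|].
      apply (Dp (fun z => P z + B p)); [|apply DY0; auto].
      eapply Cder_eq; [apply Cder_plus; [exact DP|apply Cder_const]|ring]. }
    assert (X := Cder_unique _ _ _ _ DY2 DL).
    rewrite E1 by auto.
    assert (Z : B p * Y1 z0 = 0).
    { transitivity ((2 * ((P z0 + B p) * Y1 z0 + (P1 * Y0 z0 + (P z0 + B p) * Y1 z0)) - Y3) / 4).
      - unfold Y1, Y0, Y3, P1, P. field.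
      - rewrite <- X. field. }
    destruct (Cmult_0_reg _ _ Z); auto. contradiction. }
  unfold wr. apply polarization_zero.
  - assert (X := Key 1 0 0). unfold QF1 in X.
    transitivity ((2 * 1 * (y1 z0 * dy1 z0) + 0 * (dy1 z0 * y2 z0 + y1 z0 * dy2 z0) +
      2 * 0 * (y2 z0 * dy2 z0)) / 2); [field|rewrite X; field].
  - assert (X := Key 0 1 0). unfold QF1 in X.
    transitivity (2 * 0 * (y1 z0 * dy1 z0) + 1 * (dy1 z0 * y2 z0 + y1 z0 * dy2 z0) +
      2 * 0 * (y2 z0 * dy2 z0)); [ring|exact X].
  - assert (X := Key 0 0 1). unfold QF1 in X.
    transitivity ((2 * 0 * (y1 z0 * dy1 z0) + 0 * (dy1 z0 * y2 z0 + y1 z0 * dy2 z0) +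
      2 * 1 * (y2 z0 * dy2 z0)) / 2); [field|rewrite X; field].
Qed.

End Accessory.

Lemma params_zero p : (forall i, (i <= 3)%nat -> Tcoef p i = 0) -> B p = 0 -> p = params0.
Proof.
  intros HT HB. destruct p as [t0 t1 t2 t3 b]. simpl in HB.
  assert (A0 := HT 0%nat ltac:(lia)). assert (A1 := HT 1%nat ltac:(lia)).
  assert (A2 := HT 2%nat ltac:(lia)). assert (A3 := HT 3%nat ltac:(lia)).
  simpl in A0, A1, A2, A3. subst. reflexivity.
Qed.

Theorem scalar_monodromy_trivial tau p z0 y1 y2 e1 e2 : (0 < Im tau)%R -> AP tau p ->
  regular_base_point tau z0 -> local_basis tau p z0 y1 y2 -> e1 * e1 = 1 -> e2 * e2 = 1 ->
  is_monodromy tau p z0 1 y1 y2 (scalar_mat2 e1) ->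
  is_monodromy tau p z0 tau y1 y2 (scalar_mat2 e2) -> p = params0.
Proof.
  intros Htau HAP Hz0 HB He1 He2 HM1 HM2.
  assert (forms : forall a b c, exists Y g, form tau p z0 y1 y2 a b c Y g).
  { intros a b c. apply (form_exists tau Htau p z0 Hz0 y1 y2 HB HAP e1 e2); auto. }
  assert (HT := residues_vanish tau Htau p z0 Hz0 y1 y2 HB HAP forms).
  apply params_zero; auto. apply (accessory_vanishes tau Htau p z0 Hz0 y1 y2 HB HT forms).
Qed.

(** * The monodromy of the trivial equation *)

(** A polynomial of degree two with three distinct roots is zero. *)
Lemma three_roots (x y t s1 s2 s3 : C) : s1 <> s2 -> s2 <> s3 -> s1 <> s3 ->
  - x * (s1 * s1) + t * s1 + y = 0 -> - x * (s2 * s2) + t * s2 + y = 0 ->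
  - x * (s3 * s3) + t * s3 + y = 0 -> x = 0 /\ t = 0 /\ y = 0.
Proof.
  intros H12 H23 H13 E1 E2 E3.
  assert (N : forall u v : C, u <> v -> forall k, (u - v) * k = 0 -> k = 0).
  { intros u v H k E. destruct (Cmult_0_reg _ _ E) as [K|K]; auto. exfalso. apply H, Csub_0; auto. }
  assert (F1 : - x * (s1 + s2) + t = 0).
  { apply (N s1 s2 H12). transitivity ((- x * (s1 * s1) + t * s1 + y) - (- x * (s2 * s2) + t * s2 + y));
    [ring|rewrite E1, E2; ring]. }
  assert (F2 : - x * (s2 + s3) + t = 0).
  { apply (N s2 s3 H23). transitivity ((- x * (s2 * s2) + t * s2 + y) - (- x * (s3 * s3) + t * s3 + y));
    [ring|rewrite E2, E3; ring]. }
  assert (X : x = 0).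
  { apply (N s1 s3 H13). transitivity (- ((- x * (s1 + s2) + t) - (- x * (s2 + s3) + t)));
    [ring|rewrite F1, F2; ring]. }
  assert (T : t = 0) by (transitivity (- x * (s1 + s2) + t); [rewrite X; ring|auto]).
  split; [auto|split; [auto|]].
  transitivity (- x * (s1 * s1) + t * s1 + y); [rewrite X, T; ring|auto].
Qed.

(** Multiplied by p_i, the i-th equation says that p_i^2 is a root of one and
    the same polynomial - x s^2 + (S x / 2 + 2 t) s + p_1 p_2 p_3 y, with S the sum of the
    squares; [three_roots] applies. To recover y, note that at most one p_i vanishes. *)
Lemma invariants_injective (p1 p2 p3 x y t : C) : p1 * p1 <> p2 * p2 -> p2 * p2 <> p3 * p3 ->
  p1 * p1 <> p3 * p3 ->
  p1 * (p2 * p2 + p3 * p3 - p1 * p1) / 2 * x + p2 * p3 * y + 2 * p1 * t = 0 ->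
  p2 * (p1 * p1 + p3 * p3 - p2 * p2) / 2 * x + p1 * p3 * y + 2 * p2 * t = 0 ->
  p3 * (p1 * p1 + p2 * p2 - p3 * p3) / 2 * x + p1 * p2 * y + 2 * p3 * t = 0 ->
  x = 0 /\ y = 0 /\ t = 0.
Proof.
  intros H12 H23 H13 E1 E2 E3.
  set (S := p1 * p1 + p2 * p2 + p3 * p3).
  destruct (three_roots x (p1 * p2 * p3 * y) (S / 2 * x + 2 * t) (p1 * p1) (p2 * p2) (p3 * p3))
    as [X [T _]]; auto.
  - transitivity (p1 * (p1 * (p2 * p2 + p3 * p3 - p1 * p1) / 2 * x + p2 * p3 * y + 2 * p1 * t));
      [unfold S; field|rewrite E1; ring].
  - transitivity (p2 * (p2 * (p1 * p1 + p3 * p3 - p2 * p2) / 2 * x + p1 * p3 * y + 2 * p2 * t));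
      [unfold S; field|rewrite E2; ring].
  - transitivity (p3 * (p3 * (p1 * p1 + p2 * p2 - p3 * p3) / 2 * x + p1 * p2 * y + 2 * p3 * t));
      [unfold S; field|rewrite E3; ring].
  - assert (T' : t = 0) by (transitivity ((S / 2 * x + 2 * t) / 2 - S / 4 * x);
      [field|rewrite T, X; field]).
    split; [auto|split; [|auto]]. rewrite X, T' in E1, E2, E3.
    assert (Z : forall u v w : C, (u / 2 * 0 + v * y + 2 * w * 0 = 0) -> v <> 0 -> y = 0).
    { intros u v w E Hv. destruct (Cmult_0_reg v y) as [|]; auto; [|contradiction].
      rewrite <- E. field. }
    (* two of the three products p_j p_k could vanish, but not all three *)
    destruct (classic (p1 = 0)) as [P1|P1].
    + assert (P2 : p2 <> 0) by (intros P2; apply H12; rewrite P1, P2; auto).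
      assert (P3 : p3 <> 0) by (intros P3; apply H13; rewrite P1, P3; auto).
      apply (Z _ _ _ E1). apply Cmult_neq_0; auto.
    + destruct (classic (p2 = 0)) as [P2|P2].
      * assert (P3 : p3 <> 0) by (intros P3; apply H23; rewrite P2, P3; auto).
        apply (Z _ _ _ E2). apply Cmult_neq_0; auto.
      * apply (Z _ _ _ E3). apply Cmult_neq_0; auto.
Qed.

Lemma equal_squares (x1 x2 a1 a2 : C) : x1 * x1 = a1 * a1 -> x1 * x2 = a1 * a2 ->
  x2 * x2 = a2 * a2 -> exists e : C, (e = 1 \/ e = - (1)) /\ x1 = e * a1 /\ x2 = e * a2.
Proof.
  assert (Sq : forall x a : C, x * x = a * a -> exists e : C, (e = 1 \/ e = - (1)) /\ x = e * a).
  { intros x a E. destruct (Cmult_0_reg (x - a) (x + a)) as [H|H].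
    - transitivity (x * x - a * a); [ring|rewrite E; ring].
    - exists 1. split; auto. rewrite (Csub_0 _ _ H). ring.
    - exists (- (1)). split; auto. transitivity (x + a - a); [ring|rewrite H; ring]. }
  intros E1 E2 E3. destruct (classic (a1 = 0)) as [A|A].
  - destruct (Sq x2 a2 E3) as [e [He E]]. exists e. split; auto. split; auto.
    rewrite A in *. replace (0 * 0) with (RtoC 0) in E1 by ring.
    replace (e * 0) with (RtoC 0) by ring.
    destruct (Cmult_0_reg x1 x1 E1); auto.
  - destruct (Sq x1 a1 E1) as [e [He E]]. exists e. split; auto. split; auto.
    assert (Hee : e * e = 1) by (destruct He as [-> | ->]; ring).
    assert (X : a1 * (x2 - e * a2) = 0).
    { transitivity (e * (e * a1 * x2 - a1 * a2) + (1 - e * e) * (a1 * x2)); [ring|].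
      rewrite <- E, E2, Hee. ring. }
    destruct (Cmult_0_reg _ _ X) as [|K]; [contradiction|]. apply Csub_0; auto.
Qed.

(** By [equal_squares] the matrix multiplies a by e and b by f, with e and f signs; if
    e f = -1 the mixed products would vanish, against [polarization_zero]. *)
Lemma sym_square_trivial (m11 m12 m21 m22 a1 a2 b1 b2 : C) : a1 * b2 - b1 * a2 <> 0 ->
  let x1 := m11 * a1 + m12 * a2 in let x2 := m21 * a1 + m22 * a2 in
  let v1 := m11 * b1 + m12 * b2 in let v2 := m21 * b1 + m22 * b2 in
  x1 * x1 = a1 * a1 -> x1 * x2 = a1 * a2 -> x2 * x2 = a2 * a2 ->
  v1 * v1 = b1 * b1 -> v1 * v2 = b1 * b2 -> v2 * v2 = b2 * b2 ->
  x1 * v1 = a1 * b1 -> x1 * v2 + x2 * v1 = a1 * b2 + a2 * b1 -> x2 * v2 = a2 * b2 ->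
  exists e : C, (e = 1 \/ e = - (1)) /\ m11 = e /\ m12 = 0 /\ m21 = 0 /\ m22 = e.
Proof.
  intros HW x1 x2 v1 v2 A1 A2 A3 B1 B2 B3 C1 C2 C3.
  destruct (equal_squares _ _ _ _ A1 A2 A3) as [e [He [X1 X2]]].
  destruct (equal_squares _ _ _ _ B1 B2 B3) as [f [Hf [V1 V2]]].
  assert (Hee : e * e = 1) by (destruct He as [-> | ->]; ring).
  assert (Hff : f * f = 1) by (destruct Hf as [-> | ->]; ring).
  rewrite X1, V1 in C1. rewrite X1, X2, V1, V2 in C2. rewrite X2, V2 in C3.
  assert (Eef : e = f).
  { destruct (classic (e * f = 1)) as [H|H].
    - transitivity (e * (f * f)); [rewrite Hff; ring|].
      transitivity ((e * f) * f); [ring|rewrite H; ring].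
    - exfalso. apply HW.
      assert (N : forall k, e * f * k = k -> k = 0).
      { intros k E. destruct (Cmult_0_reg (e * f - 1) k) as [K|K]; auto.
        - transitivity (e * f * k - k); [ring|rewrite E; ring].
        - exfalso. apply H, Csub_0; auto. }
      apply polarization_zero; apply N.
      + rewrite <- C1 at 2. ring.
      + transitivity (e * a1 * (f * b2) + e * a2 * (f * b1)); [ring|rewrite C2; ring].
      + rewrite <- C3 at 2. ring. }
  subst f. exists e. split; auto.
  assert (D : forall u v w, u * a1 + v * a2 = w * a1 -> u * b1 + v * b2 = w * b1 ->
    u = w /\ v = 0).
  { intros u v w E1 E2.
    assert (K : forall k, k * (a1 * b2 - b1 * a2) = 0 -> k = 0).
    { intros k E. destruct (Cmult_0_reg _ _ E); auto; contradiction. }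
    split.
    - apply Csub_0, K. transitivity ((u * a1 + v * a2 - w * a1) * b2 - (u * b1 + v * b2 - w * b1) * a2);
      [ring|rewrite E1, E2; ring].
    - apply K. transitivity ((u * b1 + v * b2 - w * b1) * a1 - (u * a1 + v * a2 - w * a1) * b1);
      [ring|rewrite E1, E2; ring]. }
  destruct (D m11 m12 e X1 V1) as [Y1 Y2].
  assert (D' : forall u v w, u * a1 + v * a2 = w * a2 -> u * b1 + v * b2 = w * b2 ->
    u = 0 /\ v = w).
  { intros u v w E1 E2.
    assert (K : forall k, k * (a1 * b2 - b1 * a2) = 0 -> k = 0).
    { intros k E. destruct (Cmult_0_reg _ _ E); auto; contradiction. }
    split.
    - apply K. transitivity ((u * a1 + v * a2 - w * a2) * b2 - (u * b1 + v * b2 - w * b2) * a2);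
      [ring|rewrite E1, E2; ring].
    - apply Csub_0, K. transitivity ((u * b1 + v * b2 - w * b2) * a1 - (u * a1 + v * a2 - w * a2) * b1);
      [ring|rewrite E1, E2; ring]. }
  destruct (D' m21 m22 e X2 V2) as [Y3 Y4]. auto.
Qed.

Section TrivialEquation.
Variable tau : C.
Hypothesis Htau : (0 < Im tau)%R.

Let ns (z : C) : Prop := ~ singular tau z.

(** The polarization of 2 Y Y'' - Y'^2 - 4 q Y^2, a first integral of the third-order equation
    of products of solutions, at the two solutions f and u v of that equation. *)
Definition invariant (f g h u du v dv : C -> C) (z : C) : C :=
  f z * (g z * g z + h z * h z - f z * f z) / 2 * (u z * v z)
  + g z * h z * (u z * dv z + du z * v z) + 2 * f z * (du z * dv z).

Lemma invariant_Cder (f g h u du v dv : C -> C) (P z : C) :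
  Cder f z (- (g z * h z)) -> Cder g z (- (f z * h z)) -> Cder h z (- (f z * g z)) ->
  P = (f z * f z + g z * g z + h z * h z) / 4 ->
  Cder u z (du z) -> Cder du z (P * u z) -> Cder v z (dv z) -> Cder dv z (P * v z) ->
  Cder (invariant f g h u du v dv) z 0.
Proof.
  intros Df Dg Dh HP Du Ddu Dv Ddv.
  apply (Cder_locally_ext (fun z => / 2 * (f z * (g z * g z + h z * h z - f z * f z)) * (u z * v z)
    + g z * h z * (u z * dv z + du z * v z) + 2 * f z * (du z * dv z)) _ z _ 1 Rlt_0_1).
  { intros w _. unfold invariant. field. }
  eapply Cder_eq.
  - apply (Cder_plus (fun z => / 2 * (f z * (g z * g z + h z * h z - f z * f z)) * (u z * v z)
      + g z * h z * (u z * dv z + du z * v z)));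
    [apply (Cder_plus (fun z => / 2 * (f z * (g z * g z + h z * h z - f z * f z)) * (u z * v z)))|].
    + apply (Cder_mult (fun z => / 2 * (f z * (g z * g z + h z * h z - f z * f z))));
        [apply Cder_scal, Cder_mult; [exact Df|]|apply Cder_mult; eassumption].
      apply (Cder_minus (fun z => g z * g z + h z * h z));
        [apply (Cder_plus (fun z => g z * g z))|]; apply Cder_mult; eassumption.
    + apply (Cder_mult (fun z => g z * h z)); [apply Cder_mult; eassumption|].
      apply (Cder_plus (fun z => u z * dv z)); apply Cder_mult; eassumption.
    + apply (Cder_mult (fun z => 2 * f z)); [apply Cder_scal; exact Df|apply Cder_mult; eassumption].
  - cbv beta. rewrite HP. field.
Qed.

Variable z0 : C.
Variables y1 y2 : C -> C.
Hypothesis Hz0 : regular_base_point tau z0.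
Hypothesis HB : local_basis tau params0 z0 y1 y2.

(** The three invariants obtained by permuting the phi_l are constant along the
    line from z0 to z0 + w and have periodic coefficients, so the products of the
    continued solutions and their derivatives return to their values. *)
Theorem trivial_monodromy (w : C) M : w = 1 \/ w = tau ->
  is_monodromy tau params0 z0 w y1 y2 M ->
  exists e : C, (e = 1 \/ e = - (1)) /\ M = scalar_mat2 e.
Proof.
  intros Hw [D [u1 [u2 [HD [HlD [S1 [S2 [Hloc HM]]]]]]]].
  set (Q := q tau params0) in *.
  apply sol_solution_on in S1. apply sol_solution_on in S2.
  destruct S1 as [du1 S1]. destruct S2 as [du2 S2]. fold Q in S1, S2.
  assert (Hns : forall t, ns (line z0 w t)).
  { intros t. destruct (Hz0 t) as [A B0]. destruct Hw as [-> | ->]; auto. }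
  assert (L1 : line z0 w 1 = z0 + w) by (unfold line; ring).
  assert (D0 : D z0) by (rewrite <- (line_0 z0 w); auto).
  assert (D1 : D (z0 + w)) by (rewrite <- L1; auto).
  assert (N0 : ns z0) by (rewrite <- (line_0 z0 w); auto).
  assert (Per : phi1 tau (z0 + w) = phi1 tau z0 /\ phi2 tau (z0 + w) = phi2 tau z0 /\
    phi3 tau (z0 + w) = phi3 tau z0).
  { assert (Z1 := ns_h1 tau z0 N0). assert (Z2 := ns_h2 tau z0 N0).
    destruct Hw as [-> | ->].
    - replace (z0 + 1) with (z0 + 1 / 2 + 1 / 2) by field.
      rewrite !phi1_h1, !phi2_h1, !phi3_h1 by auto. repeat split; ring.
    - replace (z0 + tau) with (z0 + tau / 2 + tau / 2) by field.
      rewrite !phi1_h2, !phi2_h2, !phi3_h2 by auto. repeat split; ring. }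
  assert (HQ : forall z, ns z -> Q z = (phi1 tau z * phi1 tau z + phi2 tau z * phi2 tau z +
    phi3 tau z * phi3 tau z) / 4).
  { intros z Hz. unfold Q. rewrite q_no_residues; auto.
    - simpl. ring.
    - intros i _. destruct i as [|[|[|i]]]; reflexivity. }
  assert (Prod : forall u du v dv, sol Q D u du -> sol Q D v dv ->
    u (z0 + w) * v (z0 + w) = u z0 * v z0 /\
    u (z0 + w) * dv (z0 + w) + du (z0 + w) * v (z0 + w) = u z0 * dv z0 + du z0 * v z0 /\
    du (z0 + w) * dv (z0 + w) = du z0 * dv z0).
  { intros u du v dv Su Sv.
    assert (Inv : forall f g h, (forall z, ns z -> Cder f z (- (g z * h z))) ->
      (forall z, ns z -> Cder g z (- (f z * h z))) -> (forall z, ns z -> Cder h z (- (f z * g z))) ->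
      (forall z, ns z -> Q z = (f z * f z + g z * g z + h z * h z) / 4) ->
      invariant f g h u du v dv (z0 + w) = invariant f g h u du v dv z0).
    { intros f g h Df Dg Dh HP. apply Cder_zero_const. intros t _. rewrite line_seg.
      destruct (Su _ (HlD t)) as [A1 A2]. destruct (Sv _ (HlD t)) as [A3 A4].
      apply (invariant_Cder f g h u du v dv (Q (line z0 w t))); auto. }
    assert (I1 := Inv (phi1 tau) (phi2 tau) (phi3 tau) (phi1_Cder tau Htau) (phi2_Cder tau Htau)
      (phi3_Cder tau Htau) HQ).
    assert (I2 := Inv (phi2 tau) (phi1 tau) (phi3 tau) (phi2_Cder tau Htau) (phi1_Cder tau Htau)
      ltac:(intros z Hz; eapply Cder_eq; [apply phi3_Cder; auto|ring])
      ltac:(intros z Hz; rewrite HQ by auto; field)).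
    assert (I3 := Inv (phi3 tau) (phi1 tau) (phi2 tau) (phi3_Cder tau Htau)
      ltac:(intros z Hz; eapply Cder_eq; [apply phi1_Cder; auto|ring])
      ltac:(intros z Hz; eapply Cder_eq; [apply phi2_Cder; auto|ring])
      ltac:(intros z Hz; rewrite HQ by auto; field)).
    unfold invariant in I1, I2, I3. destruct Per as [P1 [P2 P3]].
    rewrite P1, P2, P3 in I1, I2, I3.
    assert (Q1 := phi1_square tau Htau z0 N0). assert (Q2 := phi2_square tau Htau z0 N0).
    assert (Q3 := phi3_square tau Htau z0 N0).
    set (f1 := phi1 tau z0) in *. set (f2 := phi2 tau z0) in *. set (f3 := phi3 tau z0) in *.
    assert (Dist : forall a b e e', wpsum tau 1 1 1 z0 = a + 4 * e ->
      wpsum tau 1 1 1 z0 = b + 4 * e' -> e <> e' -> a <> b).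
    { intros a b e e' E E' Hne ->. apply Hne.
      transitivity ((b + 4 * e - b) / 4); [field|]. rewrite <- E, E'. field. }
    destruct (invariants_injective f1 f2 f3 (u (z0 + w) * v (z0 + w) - u z0 * v z0)
      (u (z0 + w) * dv (z0 + w) + du (z0 + w) * v (z0 + w) - (u z0 * dv z0 + du z0 * v z0))
      (du (z0 + w) * dv (z0 + w) - du z0 * dv z0)) as [X [Y T]].
    - apply (Dist _ _ _ _ Q1 Q2). apply e1_neq_e2; auto.
    - apply (Dist _ _ _ _ Q2 Q3). apply e2_neq_e3; auto.
    - apply (Dist _ _ _ _ Q1 Q3). apply e1_neq_e3; auto.
    - match type of I1 with ?L = ?R => transitivity (L - R); [field|rewrite I1; ring] end.
    - match type of I2 with ?L = ?R => transitivity (L - R); [field|rewrite I2; ring] end.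
    - match type of I3 with ?L = ?R => transitivity (L - R); [field|rewrite I3; ring] end.
    - split; [|split]; apply Csub_0; auto. }
  destruct (basis_disc tau Htau params0 z0 Hz0 y1 y2 HB) as [r [dy1 [dy2 [Hr [HO [T1 [T2 W]]]]]]].
  apply locally_C_iff in Hloc. destruct Hloc as [r2 [Hr2 E2]].
  assert (Hc : forall s, (0 < s)%R -> (Cmod (z0 - z0) < s)%R).
  { intros s Hs. replace (z0 - z0) with (RtoC 0) by ring. rewrite Cmod_0. auto. }
  assert (Wu : u1 z0 * du2 z0 - du1 z0 * u2 z0 <> 0).
  { destruct (E2 z0 (Hc _ Hr2)) as [-> ->].
    assert (F1 : du1 z0 = dy1 z0).
    { apply (Cder_unique y1 z0); [|apply (T1 z0); auto].
      apply (Cder_locally_ext u1 _ _ _ r2 Hr2); [intros; apply E2; auto|apply (S1 z0 D0)]. }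
    assert (F2 : du2 z0 = dy2 z0).
    { apply (Cder_unique y2 z0); [|apply (T2 z0); auto].
      apply (Cder_locally_ext u2 _ _ _ r2 Hr2); [intros; apply E2; auto|apply (S2 z0 D0)]. }
    rewrite F1, F2. exact W. }
  specialize (HM 0%R). rewrite line_0 in HM. apply locally_C_iff in HM.
  destruct HM as [r3 [Hr3 E3]].
  assert (E4 : forall z, (Cmod (z - z0) < r3)%R ->
    u1 (z + w) = entry M 0 0 * u1 z + entry M 0 1 * u2 z /\
    u2 (z + w) = entry M 1 0 * u1 z + entry M 1 1 * u2 z) by (intros; apply Mmult_col2; auto).
  destruct (E4 z0 (Hc _ Hr3)) as [U1 U2].
  assert (DU : forall u du a b, sol Q D u du ->
    (forall z, (Cmod (z - z0) < r3)%R -> u (z + w) = a * u1 z + b * u2 z) ->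
    du (z0 + w) = a * du1 z0 + b * du2 z0).
  { intros u du a b Su E. apply (Cder_unique (fun z => u (z + w)) z0).
    - apply Cder_shift. apply (Su _ D1).
    - apply (Cder_locally_ext (fun z => a * u1 z + b * u2 z) _ z0 _ r3 Hr3).
      + intros z Hz. symmetry. auto.
      + apply Cder_plus; apply Cder_scal; [apply (S1 _ D0)|apply (S2 _ D0)]. }
  assert (DU1 := DU u1 du1 _ _ S1 (fun z Hz => proj1 (E4 z Hz))).
  assert (DU2 := DU u2 du2 _ _ S2 (fun z Hz => proj2 (E4 z Hz))).
  destruct (Prod _ _ _ _ S1 S1) as [A1 [A2 A3]].
  destruct (Prod _ _ _ _ S1 S2) as [B1 [B2 B3]].
  destruct (Prod _ _ _ _ S2 S2) as [C1 [C2 C3]].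
  rewrite U1 in A1. rewrite U1, DU1 in A2. rewrite DU1 in A3.
  rewrite U1, U2 in B1. rewrite U1, U2, DU1, DU2 in B2. rewrite DU1, DU2 in B3.
  rewrite U2 in C1. rewrite U2, DU2 in C2. rewrite DU2 in C3.
  destruct (sym_square_trivial (entry M 0 0) (entry M 0 1) (entry M 1 0) (entry M 1 1)
    (u1 z0) (u2 z0) (du1 z0) (du2 z0)) as [e [He [X1 [X2 [X3 X4]]]]]; auto.
  - match type of A2 with ?L = ?R => transitivity (L / 2); [field|rewrite A2; field] end.
  - match type of B2 with ?L = ?R => transitivity L; [ring|rewrite B2; ring] end.
  - match type of C2 with ?L = ?R => transitivity (L / 2); [field|rewrite C2; field] end.
  - exists e. split; auto. apply mat2_scalar; auto.
Qed.

End TrivialEquation.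

(** * The characterization of the trivial equation *)

Theorem theorem1p1 :
  forall (tau : C), (0 < Im tau)%R ->
  forall (p : params), AP tau p ->
  forall (z0 : C), regular_base_point tau z0 ->
  forall (y1 y2 : C -> C), local_basis tau p z0 y1 y2 ->
  forall (M1 M2 : @matrix C 2 2),
    is_monodromy tau p z0 1 y1 y2 M1 ->
    is_monodromy tau p z0 tau y1 y2 M2 ->
    (p = params0 <->
     exists e1 e2 : C,
       (e1 = 1 \/ e1 = - (1)) /\ (e2 = 1 \/ e2 = - (1)) /\
       M1 = scalar_mat2 e1 /\ M2 = scalar_mat2 e2).
Proof.
  intros tau Htau p HAP z0 Hz0 y1 y2 HB M1 M2 HM1 HM2. split.
  - intros ->.
    destruct (trivial_monodromy tau Htau z0 y1 y2 Hz0 HB 1 M1) as [e1 [H1 E1]]; auto.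
    destruct (trivial_monodromy tau Htau z0 y1 y2 Hz0 HB tau M2) as [e2 [H2 E2]]; auto.
    exists e1, e2. auto.
  - intros [e1 [e2 [H1 [H2 [-> ->]]]]].
    apply (scalar_monodromy_trivial tau p z0 y1 y2 e1 e2); auto.
    + destruct H1 as [-> | ->]; ring.
    + destruct H2 as [-> | ->]; ring.
Qed.
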